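(* Let $\mathcal{G}$ be a negative definite weighted graph. If the automorphism group of $\mathcal{G}$ acts transitively (on its vertices), then the adjacency graph of $\mathcal{G}$ contains only trivial arrows. In other words, the Nash mapping is bijective for singularities having this kind of resolution graph.
   Context: A weighted graph is a finite connected graph whose vertices carry a genus weight and a self-intersection weight; automorphisms preserve both weights. It is negative definite if its incidence matrix (self-intersection weights on the diagonal, numbers of edges between distinct vertices off the diagonal) is negative definite; these are exactly the dual graphs of good resolutions of normal surface singularities (vertices = irreducible components $E_i$ of the exceptional divisor, weighted by genus and self-intersection; edges = intersection points). Let $(X,O)$ be a normal surface singularity over an algebraically closed field $\mathbb{K}$ of characteristic $0$ with a good resolution $\pi:\tilde X\to X$ with dual graph $\mathcal{G}$. $\mathcal{X}_\infty$ is the affine $\mathbb{K}$-scheme representing the functor sending $\operatorname{Spec}A$ to the set of morphisms $\operatorname{Spec}A[[t]]\to X$ sending $V(t)$ to $O$. $N_{E_u}$ is the set of arcs whose lifting to $\tilde X$ sends the closed point into $E_u$. The adjacency graph of $\mathcal{G}$ is the directed graph on the vertices of $\mathcal{G}$ with an arrow from $u$ to $v$ ($u\neq v$) iff $N_{E_v}$ is contained in the Zariski closure of $N_{E_u}$ in $\mathcal{X}_\infty$; it depends only on $\mathcal{G}$ and not on the choice of $(X,O)$. An arrow from $u$ to $v$ is trivial if a sequence of contractions of rational curves with self-intersection $-1$ collapses $E_v$ into $E_u$. A component is essential if for every other resolution its birational transform is an irreducible component of the exceptional divisor. The Nash mapping sends each irreducible component of $\mathcal{X}_\infty$ to the unique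 essential component met by the lifting of a generic arc of that component. *)

(* Defs.v *)
From mathcomp Require Export all_boot all_order all_fingroup all_algebra.
From mathcomp Require Export mpoly.

Set Implicit Arguments.
Unset Strict Implicit.
Unset Printing Implicit Defensive.

Import Order.TTheory GRing.Theory Num.Theory.
Local Open Scope ring_scope.

(* Multiple edges are allowed; loops are not, since the vertices of a dual graph
   of a good resolution are smooth curves. *)
Record weighted_graph := WeightedGraph {
  vertex :> finType;
  genus : vertex -> nat;
  selfint : vertex -> int;
  edges : vertex -> vertex -> nat;
  edges_sym : forall u v, edges u v = edges v u;
  edges_loopless : forall u, edges u u = 0%N;
  vertex_nonempty : (0 < #|vertex|)%N;
  vertex_connected : forall u v, connect [rel x y | (0 < edges x y)%N] u v
}.

Definition incidence (G : weighted_graph) (u v : G) : int :=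
  if u == v then selfint u else (edges u v)%:Z.

(* For an integral symmetric form, definiteness over the rationals and over the
   reals agree. *)
Definition negative_definite (G : weighted_graph) : Prop :=
  forall x : {ffun G -> rat}, x != 0 ->
    \sum_(u : G) \sum_(v : G) x u * (incidence u v)%:~R * x v < 0.

Definition graph_aut (G : weighted_graph) : {set {perm G}} :=
  [set s : {perm G} |
     [forall u, (genus (s u) == genus u) && (selfint (s u) == selfint u)]
     && [forall u, forall v, edges (s u) (s v) == edges u v]].

Lemma graph_aut_group_set (G : weighted_graph) : group_set (graph_aut G).
Proof.
apply/group_setP; split.
  rewrite inE; apply/andP; split; apply/forallP=> u; first by rewrite !perm1 !eqxx.
  by apply/forallP=> v; rewrite !perm1.
move=> s t; rewrite !inE => /andP[/forallP s1 /forallP s2].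
move=> /andP[/forallP t1 /forallP t2]; apply/andP; split; apply/forallP=> u.
  rewrite !permM; case/andP: (t1 (s u)) => /eqP-> /eqP->; exact: s1.
apply/forallP=> v; rewrite !permM.
by rewrite (eqP (forallP (t2 (s u)) (s v))); exact: (forallP (s2 u) v).
Qed.

Canonical graph_aut_group (G : weighted_graph) := Group (graph_aut_group_set G).

(* [contraction G C M p]: successively contracting the curves of C, each of them
   smooth rational with self-intersection -1 at the moment it is contracted,
   leads to a smooth surface on which the images of the remaining curves have
   intersection matrix M and arithmetic genera p.  If pi contracts E_w and m_x = E_x.E_w,
   then pi^* (pi E_x) = E_x + m_x E_w, and the point pi(E_w) has multiplicity m_x
   on pi(E_x); this gives the update formulas. An irreducible curve of
   arithmetic genus 0 is a smooth rational curve. *)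
Inductive contraction (G : weighted_graph) :
    {set G} -> (G -> G -> int) -> (G -> nat) -> Prop :=
| contraction_none : contraction set0 (@incidence G) (@genus G)
| contraction_step C M p w :
    contraction C M p -> w \notin C -> p w = 0%N -> M w w = -1 ->
    contraction (w |: C) (fun x y => M x y + M x w * M y w)
                (fun x => (p x + 'C(`|M x w|, 2))%N).

(* E_v is collapsed to a point, and this point lies on the image of the curve E_u:
   the connected component of E_v in the union of the contracted curves meets E_u. *)
Definition trivial_arrow (G : weighted_graph) (u v : G) : Prop :=
  exists C M p, @contraction G C M p /\ u \notin C /\ v \in C /\
    exists2 w, w \in C & (0 < edges u w)%N /\
      connect [rel x y | [&& x \in C, y \in C & (0 < edges x y)%N]] v w.

Definition psub (T : Type) (A B : T -> Prop) : Prop := forall x, A x -> B x.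
Definition peq (T : Type) (A B : T -> Prop) : Prop := forall x, A x <-> B x.

Definition closed_for (T : Type) (cl : (T -> Prop) -> T -> Prop) (Z : T -> Prop) :=
  peq (cl Z) Z.

Definition irreducible_for (T : Type) (cl : (T -> Prop) -> T -> Prop)
    (Z : T -> Prop) : Prop :=
  (exists x, Z x) /\
  forall A B, closed_for cl A -> closed_for cl B ->
    (forall x, Z x -> A x \/ B x) -> psub Z A \/ psub Z B.

Definition component_of (T : Type) (cl : (T -> Prop) -> T -> Prop)
    (S Z : T -> Prop) : Prop :=
  [/\ closed_for cl Z, irreducible_for cl Z, psub Z S
    & forall Z', closed_for cl Z' -> irreducible_for cl Z' ->
        psub Z' S -> psub Z Z' -> psub Z' Z].

(* Affine varieties over an algebraically closed K are given by their K-points. *)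
Definition evalp (K : fieldType) (N : nat) (f : {mpoly K[N]}) (p : 'rV[K]_N) : K :=
  f.@[fun i => p 0 i].

Definition vanishes (K : fieldType) (N : nat) (f : {mpoly K[N]})
    (Z : 'rV[K]_N -> Prop) : Prop :=
  forall p, Z p -> evalp f p = 0.

Definition aff_closure (K : fieldType) (N : nat) (Z : 'rV[K]_N -> Prop)
    (p : 'rV[K]_N) : Prop :=
  forall f, vanishes f Z -> evalp f p = 0.

Definition jacobian (K : fieldType) (N r : nat) (f : 'I_r -> {mpoly K[N]})
    (p : 'rV[K]_N) : 'M[K]_(r, N) :=
  \matrix_(i < r, j < N) evalp (f i)^`M(j) p.

(* Near p, Z is cut out by N - e equations with independent differentials. *)
Definition smooth_at (K : fieldType) (N : nat) (Z : 'rV[K]_N -> Prop) (e : nat)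
    (p : 'rV[K]_N) : Prop :=
  exists r, (r + e)%N = N /\ exists (f : 'I_r -> {mpoly K[N]}) (g : {mpoly K[N]}),
    [/\ forall i, vanishes (f i) Z, \rank (jacobian f p) = r, evalp g p != 0
      & forall q, evalp g q != 0 -> (forall i, evalp (f i) q = 0) -> Z q].

(* The coordinate ring of X is integrally closed: a fraction f/g satisfying
   a monic equation of degree k is regular. *)
Definition normal_variety (K : fieldType) (N : nat) (X : 'rV[K]_N -> Prop) : Prop :=
  forall f g : {mpoly K[N]}, ~ vanishes g X ->
    (exists (k : nat) (a : 'I_k -> {mpoly K[N]}),
       vanishes (f ^+ k + \sum_(i < k) a i * f ^+ i * g ^+ (k - i)) X) ->
    exists h, vanishes (f - g * h) X.

(* X is an affine representative on which O is the only possibly singular point. *)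
Record normal_surface_singularity (K : fieldType) (n : nat) (X : 'rV[K]_n -> Prop)
    (O : 'rV[K]_n) : Prop := NormalSurfaceSingularity {
  nss_closed : closed_for (@aff_closure K n) X;
  nss_irreducible : irreducible_for (@aff_closure K n) X;
  nss_point : X O;
  nss_nontrivial : exists2 p, X p & p <> O;
  nss_smooth : forall p, X p -> p <> O -> smooth_at X 2 p;
  nss_normal : normal_variety X
}.

(* A subset of A^n x P^m is given by the set of all (x, y), y <> 0, such that (x, [y])
   belongs to it; here d is the degree in the last m + 1 variables. *)
Definition yhomog (K : fieldType) (n m d : nat) (f : {mpoly K[n + m.+1]}) : bool :=
  all (fun mu : 'X_{1.. n + m.+1} => \sum_(j < m.+1) mu (rshift n j) == d)%N (msupp f).

Definition proj_closure (K : fieldType) (n m : nat)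
    (Z : 'rV[K]_(n + m.+1) -> Prop) (z : 'rV[K]_(n + m.+1)) : Prop :=
  rsubmx z != 0 /\ forall d f, yhomog d f -> vanishes f Z -> evalp f z = 0.

Definition chart (K : fieldType) (n m : nat) (Y : 'rV[K]_(n + m.+1) -> Prop)
    (j : 'I_m.+1) (z : 'rV[K]_(n + m.+1)) : Prop :=
  Y z /\ rsubmx z 0 j = 1.

Definition smooth_of_dim (K : fieldType) (n m e : nat)
    (Y : 'rV[K]_(n + m.+1) -> Prop) : Prop :=
  forall j z, chart Y j z -> smooth_at (chart Y j) e z.

Definition same_point (K : fieldType) (n m : nat) (z w : 'rV[K]_(n + m.+1)) : Prop :=
  lsubmx z = lsubmx w /\ exists2 c : K, c != 0 & rsubmx z = c *: rsubmx w.

Definition eval_tuple (K : fieldType) (N m : nat) (F : 'I_m.+1 -> {mpoly K[N]})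
    (p : 'rV[K]_N) : 'rV[K]_m.+1 :=
  \row_j evalp (F j) p.

(* Projective morphism Y -> X, the restriction of the first projection, with Y a
   smooth surface; away from O it has locally a regular inverse x |-> (x, [F x]). *)
Record resolution (K : fieldType) (n m : nat) (X : 'rV[K]_n -> Prop) (O : 'rV[K]_n)
    (Y : 'rV[K]_(n + m.+1) -> Prop) : Prop := Resolution {
  res_closed : closed_for (@proj_closure K n m) Y;
  res_irreducible : irreducible_for (@proj_closure K n m) Y;
  res_over : forall z, Y z -> X (lsubmx z);
  res_smooth : smooth_of_dim 2 Y;
  res_iso : forall x, X x -> x <> O ->
    exists2 F : 'I_m.+1 -> {mpoly K[n]}, eval_tuple F x != 0 &
      forall x', X x' -> x' <> O -> eval_tuple F x' != 0 ->
        forall y, Y (row_mx x' y) <-> exists2 c : K, c != 0 & y = c *: eval_tuple F x'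
}.

Definition exceptional (K : fieldType) (n m : nat) (O : 'rV[K]_n)
    (Y : 'rV[K]_(n + m.+1) -> Prop) (z : 'rV[K]_(n + m.+1)) : Prop :=
  Y z /\ lsubmx z = O.

(* dim A / B = k, for subspaces A and B of V. *)
Definition quotient_dim (K : fieldType) (V : lmodType K) (A B : V -> Prop)
    (k : nat) : Prop :=
  exists e : 'I_k -> V, (forall i, A (e i)) /\
    forall v, A v -> exists! c : 'rV[K]_k, B (v - \sum_(i < k) c 0 i *: e i).

Definition ideal_deg (K : fieldType) (n m : nat) (Z : 'rV[K]_(n + m.+1) -> Prop)
    (d : nat) (f : {mpoly K[n + m.+1]}) : Prop :=
  yhomog d f /\ vanishes f Z.

(* Degree d part of I(E)^2 + I(Y), i.e. of the square of the ideal of E in the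
   homogeneous coordinate ring of Y. *)
Definition ideal_sq_deg (K : fieldType) (n m : nat)
    (Y E : 'rV[K]_(n + m.+1) -> Prop) (d : nat) (f : {mpoly K[n + m.+1]}) : Prop :=
  yhomog d f /\
  exists (s : seq ({mpoly K[n + m.+1]} * {mpoly K[n + m.+1]})) (h : {mpoly K[n + m.+1]}),
    [/\ forall ab, ab \in s -> vanishes ab.1 E /\ vanishes ab.2 E, vanishes h Y
      & f = \sum_(ab <- s) ab.1 * ab.2 + h].

Definition hilbert_fun (K : fieldType) (n m : nat) (E : 'rV[K]_(n + m.+1) -> Prop)
    (d k : nat) : Prop :=
  quotient_dim (fun f : {mpoly K[n + m.+1]} => yhomog d f) (ideal_deg E d) k.

(* For a projective curve E contained in a fibre, the arithmetic genus is 1 - P(0),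
   where P is its Hilbert polynomial. *)
Definition curve_genus (K : fieldType) (n m : nat) (E : 'rV[K]_(n + m.+1) -> Prop)
    (g : nat) : Prop :=
  exists e d0 : nat, forall d, (d0 <= d)%N ->
    exists2 k : nat, hilbert_fun E d k & (k + g = e * d + 1)%N.

(* E.E is the degree of the normal bundle of E in Y, i.e. minus the degree of the
   conormal bundle I/I^2 = O_E(-E), where I is the ideal sheaf of E in Y.  The degree
   of a line bundle L on E being chi(L) - chi(O_E) = chi(L(d)) - chi(O_E(d)), this is
   - (dim (I/I^2)_d - dim (S/I(E))_d) for d large, with S = K[x, y]. *)
Definition curve_selfint (K : fieldType) (n m : nat)
    (Y E : 'rV[K]_(n + m.+1) -> Prop) (s : int) : Prop :=
  exists d0 : nat, forall d, (d0 <= d)%N -> exists a b : nat,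
    [/\ quotient_dim (ideal_deg E d) (ideal_sq_deg Y E d) a, hilbert_fun E d b
      & s = - (a%:Z - b%:Z)].

(* The differentials at z of functions vanishing on E or on E' span the cotangent
   space: the tangent lines of E and E' at z are distinct. *)
Definition transverse_at (K : fieldType) (n m : nat)
    (E E' : 'rV[K]_(n + m.+1) -> Prop) (j : 'I_m.+1) (z : 'rV[K]_(n + m.+1)) : Prop :=
  exists f : 'I_(n + m.+1) -> {mpoly K[n + m.+1]},
    (forall i, vanishes (f i) (chart E j) \/ vanishes (f i) (chart E' j)) /\
    \rank (jacobian f z) = (n + m.+1)%N.

Record good_resolution_with_graph (G : weighted_graph) (K : fieldType) (n m : nat)
    (X : 'rV[K]_n -> Prop) (O : 'rV[K]_n) (Y : 'rV[K]_(n + m.+1) -> Prop)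
    (E : G -> 'rV[K]_(n + m.+1) -> Prop) : Prop := GoodResolution {
  gr_resolution : resolution X O Y;
  gr_component : forall v, component_of (@proj_closure K n m) (exceptional O Y) (E v);
  gr_all_components : forall Z,
    component_of (@proj_closure K n m) (exceptional O Y) Z -> exists v, peq Z (E v);
  gr_distinct : forall u v, peq (E u) (E v) -> u = v;
  gr_smooth : forall v, smooth_of_dim 1 (E v);
  gr_transverse : forall u v, u != v -> forall j z,
    chart (E u) j z -> chart (E v) j z -> transverse_at (E u) (E v) j z;
  gr_no_triple : forall u v w, u != v -> v != w -> u != w ->
    forall z, ~ [/\ E u z, E v z & E w z];
  gr_genus : forall v, curve_genus (E v) (genus v);
  gr_selfint : forall v, curve_selfint Y (E v) (selfint v);
  gr_edges : forall u v, u != v -> exists q : 'I_(edges u v) -> 'rV[K]_(n + m.+1),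
    (forall i, E u (q i) /\ E v (q i)) /\
    (forall z, E u z -> E v z -> exists! i, same_point z (q i))
}.

(* A field-valued point of the affine space Spec K[a_(i,k) | i < n, k in nat], i.e. an
   n-tuple of power series over an extension L of K.  As usual the points of a scheme
   over K are the classes of its field-valued points; closed subsets below are unions
   of classes. *)
Record arc (K : fieldType) (n : nat) := Arc {
  arc_field : fieldType;
  arc_emb : {rmorphism K -> arc_field};
  arc_coef : 'I_n -> nat -> arc_field
}.

(* Coefficient of t^k in f(a(t)); it only depends on a(t) modulo t^(k+1). *)
Definition subst_coef (K L : fieldType) (iota : {rmorphism K -> L}) (N : nat)
    (f : {mpoly K[N]}) (a : 'I_N -> nat -> L) (k : nat) : L :=
  (mmap (fun c => (iota c)%:P) (fun i => \poly_(l < k.+1) a i l) f)`_k.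

(* Points of X_infinity: arcs Spec L[[t]] -> X mapping V(t) to O. *)
Definition is_arc (K : fieldType) (n : nat) (X : 'rV[K]_n -> Prop) (O : 'rV[K]_n)
    (a : arc K n) : Prop :=
  (forall i, arc_coef a i 0 = arc_emb a (O 0 i)) /\
  forall f, vanishes f X -> forall k, subst_coef (arc_emb a) f (arc_coef a) k = 0.

(* Value at an arc of a polynomial in the coordinates a_(i,k), k < N. *)
Definition eval_arc (K : fieldType) (n N : nat) (P : {mpoly K[n * N]}) (a : arc K n) :
    arc_field a :=
  mmap (arc_emb a) (fun l => mxvec (\matrix_(i < n, k < N) arc_coef a i k) 0 l) P.

Definition arc_closure (K : fieldType) (n : nat) (S : arc K n -> Prop)
    (a : arc K n) : Prop :=
  forall N (P : {mpoly K[n * N]}), (forall b, S b -> eval_arc P b = 0) -> eval_arc P a = 0.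

(* The lifting of the arc to Y is given by power series b = (b_0 : ... : b_m), not
   all divisible by t. Only the constant arc has generic point O; it has no
   well-defined lifting and belongs to no N_E. *)
Definition arcs_through (K : fieldType) (n m : nat) (X : 'rV[K]_n -> Prop)
    (O : 'rV[K]_n) (Y E : 'rV[K]_(n + m.+1) -> Prop) (a : arc K n) : Prop :=
  [/\ is_arc X O a,
      exists i k, (0 < k)%N /\ arc_coef a i k != 0
    & exists b : 'I_(n + m.+1) -> nat -> arc_field a,
      [/\ forall i k, b (lshift m.+1 i) k = arc_coef a i k,
          exists j : 'I_m.+1, b (rshift n j) 0%N != 0,
          forall d f, ideal_deg Y d f -> forall k, subst_coef (arc_emb a) f b k = 0
        & forall d f, ideal_deg E d f -> mmap (arc_emb a) (fun i => b i 0%N) f = 0]].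

Definition adjacency_arrow (G : weighted_graph) (K : fieldType) (n m : nat)
    (X : 'rV[K]_n -> Prop) (O : 'rV[K]_n) (Y : 'rV[K]_(n + m.+1) -> Prop)
    (E : G -> 'rV[K]_(n + m.+1) -> Prop) (u v : G) : Prop :=
  u != v /\
  psub (arcs_through X O Y (E v)) (arc_closure (arcs_through X O Y (E u))).

(* F represents the birational map Y ---> Y' over X, wherever F does not vanish. *)
Definition represents_birational (K : fieldType) (n m m' : nat) (O : 'rV[K]_n)
    (Y : 'rV[K]_(n + m.+1) -> Prop) (Y' : 'rV[K]_(n + m'.+1) -> Prop)
    (F : 'I_m'.+1 -> {mpoly K[n + m.+1]}) : Prop :=
  (exists d, forall j, yhomog d (F j)) /\
  forall z, Y z -> lsubmx z <> O -> eval_tuple F z != 0 ->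
    Y' (row_mx (lsubmx z) (eval_tuple F z)).

Definition birational_transform (K : fieldType) (n m m' : nat) (O : 'rV[K]_n)
    (Y : 'rV[K]_(n + m.+1) -> Prop) (Y' : 'rV[K]_(n + m'.+1) -> Prop)
    (E : 'rV[K]_(n + m.+1) -> Prop) : 'rV[K]_(n + m'.+1) -> Prop :=
  proj_closure (fun w => exists (F : 'I_m'.+1 -> {mpoly K[n + m.+1]}) z,
    [/\ represents_birational O Y Y' F, E z, eval_tuple F z != 0
      & w = row_mx (lsubmx z) (eval_tuple F z)]).

(* The exceptional divisor of Y' is the fibre over O.  If O is a regular point
   and Y' -> X is an isomorphism, this fibre is the point O. *)
Definition essential (K : fieldType) (n m : nat) (X : 'rV[K]_n -> Prop)
    (O : 'rV[K]_n) (Y E : 'rV[K]_(n + m.+1) -> Prop) : Prop :=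
  forall m' (Y' : 'rV[K]_(n + m'.+1) -> Prop), resolution X O Y' ->
    component_of (@proj_closure K n m') (exceptional O Y') (birational_transform O Y Y' E).

Definition arc_component (K : fieldType) (n : nat) (X : 'rV[K]_n -> Prop)
    (O : 'rV[K]_n) : (arc K n -> Prop) -> Prop :=
  component_of (@arc_closure K n) (is_arc X O).

(* The generic point of C. *)
Definition generic_arc (K : fieldType) (n : nat) (C : arc K n -> Prop)
    (a : arc K n) : Prop :=
  C a /\ psub C (arc_closure (fun b => b = a)).

(* The graph of the Nash mapping: it maps the component C to the essential component E_v. *)
Definition nash (G : weighted_graph) (K : fieldType) (n m : nat)
    (X : 'rV[K]_n -> Prop) (O : 'rV[K]_n) (Y : 'rV[K]_(n + m.+1) -> Prop)
    (E : G -> 'rV[K]_(n + m.+1) -> Prop) (C : arc K n -> Prop) (v : G) : Prop :=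
  essential X O Y (E v) /\
  exists2 a, generic_arc C a & arcs_through X O Y (E v) a.

Definition nash_bijective (G : weighted_graph) (K : fieldType) (n m : nat)
    (X : 'rV[K]_n -> Prop) (O : 'rV[K]_n) (Y : 'rV[K]_(n + m.+1) -> Prop)
    (E : G -> 'rV[K]_(n + m.+1) -> Prop) : Prop :=
  (forall C, arc_component X O C -> exists! v, nash X O Y E C v) /\
  (forall v, essential X O Y (E v) ->
     exists C, [/\ arc_component X O C, nash X O Y E C v
       & forall C', arc_component X O C' -> nash X O Y E C' v -> peq C' C]).

(* Main.v *)
(* By transitivity all rows of the intersection matrix have the same sum, so testing negative
   definiteness on (1, ..., 1) gives - E_u^2 > (number of edges at u) for every u.  We show that
   there are then no arrows at all.  If f is a function on X with ord_(E_v) f < ord_(E_u) f, the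
   coefficient of t^(ord_(E_v) f) in f(a(t)) vanishes for all a in N_(E_u) but not for all a in
   N_(E_v), so N_(E_v) is not in the closure of N_(E_u).  To construct f, let Z be the sum of the
   E_w and D = kappa ((delta + 1) Z + E_u) with kappa large: then - D . E_w is large for all w.
   Counting dimensions along the E_w, which replaces the vanishing of H^1, powers of two linear
   forms s0, s1 without common zeros on the exceptional divisor generate the sections vanishing
   along D.  This yields a fraction P / s0^k, regular near the exceptional divisor, whose order is
   exactly D_v along E_v and at least D_u > D_v along E_u; it is integral over the coordinate ring
   of X, hence a regular function since X is normal.

   Without arrows the closures of the N_(E_v) are the irreducible components of X_infinity.
   If an irreducible W in the exceptional divisor of another resolution contains the birational
   transform T of E_v, the arcs through W form an irreducible set S whose closure contains
   N_(E_v); so S lies in the closure of N_(E_v), and comparing the leading coefficients, along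
   arcs, of the coordinates of X --> Y' gives W = T.  Hence every E_v is essential. *)
Require Import Defs.
From HB Require Import structures.
From Stdlib Require Import Classical ClassicalEpsilon.
From Stdlib Require Import FunctionalExtensionality PropExtensionality ProofIrrelevance.
From mathcomp Require classical.boolp classical.classical_sets.
From mathcomp Require Import ring zify.

Set Implicit Arguments.
Unset Strict Implicit.
Unset Printing Implicit Defensive.

Import Order.TTheory GRing.Theory Num.Theory.
Local Open Scope ring_scope.

(** * Ideals and Noetherian rings *)

(** The definitions know a curve only through Hilbert functions: genus and self-intersection are
    dimension counts in large degree. So divisors and cohomology are replaced by graded modules:
    [M D] collects the polynomials vanishing to order at least D_w along every E_w, and M(D)/M(D +
    E_w) stands for O(-D) restricted to E_w. Statements in large degree are obtained from local ones
    by a saturation argument. A section is sought as a fraction P/s0^k = Q/s1^k, because the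
    relation s1^k P = s0^k Q describes it on two open sets covering the exceptional divisor. The
    coefficient delta + 1 of Z absorbs the edges between E_w and E_u, which lower -D.E_w; kappa also
    pays for a bounded number of further copies of the curves, after which an error lies in m_O M(D)
    and Nakayama over O removes it. Arcs have coefficients in arbitrary extensions of K, so
    statements about them are specialized to K-valued arcs, where smoothness lets jets be lifted;
    generic arcs are built in the converse direction, as ultraproducts of K-valued arcs. *)

Definition ideal (R : comNzRingType) (J : R -> Prop) : Prop :=
  [/\ J 0, forall x y, J x -> J y -> J (x + y) & forall a x, J x -> J (a * x)].

(** With [P = full] this is the ideal generated by [s]; with an ideal [P] it is the product of [P]
    with that ideal, the object in Nakayama's lemma. *)
Fixpoint span (R : comNzRingType) (P : R -> Prop) (s : seq R) (x : R) : Prop :=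
  if s is a :: s' then exists c y, [/\ P c, span P s' y & x = c * a + y] else x = 0.

Definition full (R : Type) (x : R) : Prop := True.

Definition noetherian (R : comNzRingType) : Prop :=
  forall J : R -> Prop, ideal J -> exists s : seq R,
    (forall x, x \in s -> J x) /\ forall x, J x -> span (@full R) s x.

Lemma mem_tail (T : eqType) (a x : T) s : x \in s -> x \in a :: s.
Proof. by rewrite inE orbC => ->. Qed.

Section Ideals.
Variable R : comNzRingType.
Implicit Types (J P : R -> Prop) (s : seq R).

Lemma ideal0 J : ideal J -> J 0. Proof. by case. Qed.
Lemma idealD J : ideal J -> forall x y, J x -> J y -> J (x + y). Proof. by case. Qed.
Lemma idealMl J : ideal J -> forall a x, J x -> J (a * x). Proof. by case. Qed.
Lemma idealMr J : ideal J -> forall a x, J x -> J (x * a).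
Proof. by move=> HJ a x Jx; rewrite mulrC; apply: idealMl. Qed.
Lemma idealN J : ideal J -> forall x, J x -> J (- x).
Proof. by move=> HJ x Jx; rewrite -mulN1r; apply: idealMl. Qed.
Lemma idealB J : ideal J -> forall x y, J x -> J y -> J (x - y).
Proof. by move=> HJ x y Jx Jy; apply: idealD => //; apply: idealN. Qed.
Lemma ideal_sum J : ideal J -> forall (I : Type) (r : seq I) (Q : pred I) (F : I -> R),
  (forall i, Q i -> J (F i)) -> J (\sum_(i <- r | Q i) F i).
Proof. by move=> HJ I r Q F H; apply: big_ind => //; [apply: ideal0|apply: idealD]. Qed.

Lemma span_sub P J s : ideal J -> (forall x, x \in s -> J x) -> forall x, span P s x -> J x.
Proof.
move=> HJ; elim: s => [_ x -> /=|a s IH Hs x /= [c [y [_ Hy ->]]]]; first exact: ideal0.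
apply: idealD => //; first by apply: idealMl => //; apply: Hs; rewrite inE eqxx.
by apply: IH Hy => z Hz; apply: Hs; rewrite inE Hz orbT.
Qed.

Lemma span_ideal P s : ideal P -> ideal (span P s).
Proof.
move=> HP; elim: s => [|a s [IH0 IHD IHM]] /=.
  by split=> [|x y -> ->|b x ->] //; rewrite ?addr0 ?mulr0.
split=> [|x y [c [x' [Pc Hx ->]]] [d [y' [Pd Hy ->]]]|b x [c [y [Pc Hy ->]]]].
- by exists 0, 0; rewrite mul0r addr0; split=> //; apply: ideal0.
- exists (c + d), (x' + y'); split; [exact: idealD|exact: IHD|].
  by rewrite mulrDl addrACA.
- exists (b * c), (b * y); split; [exact: idealMl|exact: IHM|].
  by rewrite mulrDr mulrA.
Qed.

Lemma full_ideal : ideal (@full R). Proof. by []. Qed.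

Lemma span_mem s x : x \in s -> span (@full R) s x.
Proof.
elim: s => //= a s IH; rewrite inE => /orP[/eqP->|/IH Hx].
  by exists 1, 0; rewrite mul1r addr0; split=> //; apply: (ideal0 (span_ideal _ full_ideal)).
by exists 0, x; rewrite mul0r add0r.
Qed.

Lemma span_sub_span s t : (forall x, x \in s -> span (@full R) t x) ->
  forall x, span (@full R) s x -> span (@full R) t x.
Proof. by move=> H; apply: span_sub => //; apply: span_ideal. Qed.

Lemma add_ideal J1 J2 : ideal J1 -> ideal J2 ->
  ideal (fun x => exists a b, [/\ J1 a, J2 b & x = a + b]).
Proof.
move=> H1 H2; split=> [|x y [a [b [Ha Hb ->]]] [c [d [Hc Hd ->]]]|r x [a [b [Ha Hb ->]]]].
- by exists 0, 0; rewrite addr0; split=> //; apply: ideal0.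
- by exists (a + c), (b + d); rewrite addrACA; split=> //; apply: idealD.
- by exists (r * a), (r * b); rewrite mulrDr; split=> //; apply: idealMl.
Qed.

(* The generators are eliminated one at a time, which avoids the determinant. *)
Lemma nakayama (U p J : R -> Prop) s :
    U 1 -> (forall a b, U a -> U b -> U (a * b)) -> (forall a q, U a -> p q -> U (a - q)) ->
    ideal p -> ideal J ->
    (forall x, x \in s -> exists a y z, [/\ U a, J y, span p s z & a * x = y + z]) ->
  exists2 b, U b & forall x, x \in s -> J (b * x).
Proof.
move=> U1 UM UB Hp; elim: s J => [|f s IH] J HJ H; first by exists 1.
have [a [y [z [Ua Jy [c [z' [pc Hz' ->]]] Ef]]]] := H f (mem_head _ _).
have Ef' : (a - c) * f = y + z' by rewrite mulrBl Ef; ring.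
have Ua' : U (a - c) by apply: UB.
have [b Ub Hb] : exists2 b, U b & forall x, x \in s -> J (b * x).
  apply: IH => // x xs.
  have [a1 [y1 [z1 [Ua1 Jy1 [c1 [z1' [pc1 Hz1 ->]]] E1]]]] := H x (mem_tail _ xs).
  exists ((a - c) * a1), ((a - c) * y1 + c1 * y), (c1 * z' + (a - c) * z1'); split.
  - exact: UM.
  - by apply: idealD => //; apply: idealMl.
  - by apply: idealD; [exact: span_ideal| |]; apply: idealMl => //; apply: span_ideal.
  - by rewrite -mulrA E1 mulrDr mulrDr (mulrCA _ c1 f) Ef'; ring.
exists (b * (a - c)); first exact: UM.
move=> x; rewrite inE => /orP[/eqP->|/Hb Jx].
  rewrite -mulrA Ef' mulrDr; apply: idealD => //; first exact: idealMl.
  clear -HJ Hz' Hb; elim: s z' Hz' Hb => [|g t IHt] z' Hz' Hb.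
    by move: Hz' => /= ->; rewrite mulr0; apply: ideal0.
  move: Hz' => /= [d [w [_ Hw ->]]]; rewrite mulrDr mulrCA; apply: idealD => //.
    by apply: idealMl => //; apply: Hb; rewrite inE eqxx.
  by apply: IHt => // u ut; apply: Hb; rewrite inE ut orbT.
by rewrite mulrAC; apply: idealMr.
Qed.

End Ideals.

Lemma noetherian_surj (A B : comNzRingType) (f : {rmorphism A -> B}) :
  (forall b, exists a, f a = b) -> noetherian A -> noetherian B.
Proof.
move=> fsurj nA J HJ.
have [s [sJ Js]] : exists s : seq A, (forall x, x \in s -> J (f x)) /\
    forall x, J (f x) -> span (@full A) s x.
  apply: nA; split=> [|x y|a x]; rewrite ?rmorph0 ?rmorphD ?rmorphM.
  - exact: ideal0.
  - exact: idealD.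
  - exact: idealMl.
exists (map f s); split=> [x /mapP[y /sJ ? ->] //|b Jb].
have [a Ea] := fsurj b; subst b; move/Js: Jb => {sJ Js}.
elim: s a => [|g s IH] a /=; first by move=> ->; rewrite rmorph0.
move=> [c [y [_ Hy ->]]]; exists (f c), (f y); rewrite rmorphD rmorphM; split=> //.
exact: IH.
Qed.

Lemma size_XnM_leq (A : comNzRingType) (p : {poly A}) n k :
  (size p <= n.+1)%N -> (size ('X^k * p)%R <= (n + k).+1)%N.
Proof.
move=> sp; apply/leq_sizeP => j nkj; rewrite coefXnM; case: ltnP => // kj.
by apply: (leq_sizeP _ _ sp); lia.
Qed.

(** * Hilbert's basis theorem *)

Section HilbertBasis.
Variable A : comNzRingType.
Hypothesis nA : noetherian A.

(** The coefficient of X^n is a formal leading coefficient of polynomials of size at most n + 1,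
    zero being allowed. Multiplication by X^k lets one list serve every degree n + k. *)
Lemma lead_gens (J : {poly A} -> Prop) (HJ : ideal J) n (s : seq A) :
    (forall a, a \in s -> exists p, [/\ J p, (size p <= n.+1)%N & p`_n = a]) ->
  exists S : seq {poly A}, (forall p, p \in S -> J p) /\
    forall k a, span (@full A) s a -> exists q, [/\ span (@full _) S q,
      (size q <= (n + k).+1)%N & q`_(n + k) = a].
Proof.
elim: s => [|b s IH] H.
  exists [::]; split=> // k a /= ->; exists 0; rewrite /= size_poly0 coef0; split=> //.
have [S [SJ HS]] := IH (fun a Ha => H a (mem_tail _ Ha)).
have [p [Jp sp pn]] := H b (mem_head _ _).
exists (p :: S); split=> [q|k a /= [c [y [_ /(HS k)[q [Hq sq qn]] ->]]]].
  by rewrite inE => /orP[/eqP->|/SJ].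
exists (c%:P * 'X^k * p + q); split.
- by exists (c%:P * 'X^k), q.
- rewrite (leq_trans (size_polyD _ _)) // geq_max sq andbT -mulrA.
  by rewrite mul_polyC (leq_trans (size_scale_leq _ _)) // size_XnM_leq.
- by rewrite coefD qn -mulrA coefCM coefXnM ltnNge leq_addl /= addnK pn.
Qed.

(** The ideals [L n] of formal leading coefficients increase with n; their union is finitely
    generated, hence reached at some d. Generators of [L d] serve all degrees from d on, and each
    smaller degree gets its own list. An element of J is then reduced by cancelling its top
    coefficient. *)
Lemma hilbert_basis : noetherian {poly A}.
Proof.
move=> J HJ.
pose L n a := exists p, [/\ J p, (size p <= n.+1)%N & p`_n = a].
have HL n : ideal (L n).
  split=> [|x y [p [Jp sp px]] [q [Jq sq qy]]|a x [p [Jp sp px]]].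
  - by exists 0; rewrite size_poly0 coef0; split=> //; apply: ideal0.
  - exists (p + q); rewrite coefD px qy; split=> //; first exact: idealD.
    by rewrite (leq_trans (size_polyD _ _)) // geq_max sp.
  - exists (a%:P * p); rewrite coefCM px; split=> //; first exact: idealMl.
    by rewrite mul_polyC (leq_trans (size_scale_leq _ _)).
have Lmono n k a : L n a -> L (n + k)%N a.
  move=> [p [Jp sp pa]]; exists ('X^k * p); split; first exact: idealMl.
    exact: size_XnM_leq.
  by rewrite coefXnM ltnNge leq_addl /= addnK.
have [s [sL Ls]] : exists s : seq A, (forall x, x \in s -> exists n, L n x) /\
    forall x, (exists n, L n x) -> span (@full A) s x.
  apply: nA; split=> [|x y [n Hx] [k Hy]|a x [n Hx]].
  - by exists 0%N; apply: ideal0.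
  - by exists (n + k)%N; apply: idealD => //; [exact: Lmono|rewrite addnC; exact: Lmono].
  - by exists n; apply: idealMl.
have [d Hd] : exists d, forall x, x \in s -> L d x.
  elim: (s) sL => [|a t IH] H; first by exists 0%N.
  have [d Hd] := IH (fun x Hx => H x (mem_tail _ Hx)).
  have [k Hk] := H a (mem_head _ _); exists (d + k)%N => x; rewrite inE => /orP[/eqP->|/Hd].
    by rewrite addnC; apply: Lmono.
  exact: Lmono.
have [S0 [S0J HS0]] := lead_gens HJ Hd.
have [S [SJ HS]] : exists S : seq {poly A}, (forall p, p \in S -> J p) /\
    forall n a, (n < d)%N -> L n a -> exists q, [/\ span (@full _) S q,
      (size q <= n.+1)%N & q`_n = a].
  elim: d {Hd S0 S0J HS0} => [|d [S [SJ HS]]]; first by exists [::].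
  have [t [tL Lt]] := nA (HL d).
  have [S1 [S1J HS1]] := lead_gens HJ tL.
  exists (S1 ++ S); split=> [p|n a]; first by rewrite mem_cat => /orP[/S1J|/SJ].
  have sub S' q : {subset S' <= S1 ++ S} -> span (@full _) S' q -> span (@full _) (S1 ++ S) q.
    by move=> H; apply: span_sub_span => x /H; apply: span_mem.
  rewrite ltnS leq_eqVlt => /orP[/eqP->|nd] La.
    have [q [H1 H2 H3]] := HS1 0%N a (Lt _ La); rewrite addn0 in H2 H3.
    by exists q; split=> //; apply: sub H1 => x Hx; rewrite mem_cat Hx.
  have [q [H1 H2 H3]] := HS _ _ nd La.
  by exists q; split=> //; apply: sub H1 => x Hx; rewrite mem_cat Hx orbT.
have sub S' q : {subset S' <= S0 ++ S} -> span (@full _) S' q -> span (@full _) (S0 ++ S) q.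
  by move=> H; apply: span_sub_span => x /H; apply: span_mem.
exists (S0 ++ S); split=> [p|p]; first by rewrite mem_cat => /orP[/S0J|/SJ].
have [n] := ubnP (size p); elim: n p => // n IH p; rewrite ltnS => sp Jp.
case: n => [|n] in IH sp *.
  have -> : p = 0 by apply/eqP; rewrite -size_poly_leq0.
  by apply: ideal0; apply: span_ideal.
have [q [Hq sq qn]] : exists q, [/\ span (@full _) (S0 ++ S) q,
    (size q <= n.+1)%N & q`_n = p`_n].
  have Lp : L n p`_n by exists p.
  case: (ltnP n d) => nd.
    have [q [H1 H2 H3]] := HS _ _ nd Lp.
    by exists q; split=> //; apply: sub H1 => x Hx; rewrite mem_cat Hx orbT.
  have [q []] := HS0 (n - d)%N p`_n (Ls _ (ex_intro _ n Lp)).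
  rewrite subnKC // => H1 H2 H3.
  by exists q; split=> //; apply: sub H1 => x Hx; rewrite mem_cat Hx.
rewrite -(subrK q p); apply: idealD => //; first exact: span_ideal.
have Jq : J q by apply: span_sub Hq => // x; rewrite mem_cat => /orP[/S0J|/SJ].
apply: IH; last exact: idealB.
apply/leq_sizeP => j; rewrite leq_eqVlt => /orP[/eqP<-|nj]; first by rewrite coefB qn subrr.
by rewrite coefB !nth_default ?subrr // (leq_trans _ nj).
Qed.
End HilbertBasis.

Section MpolyInd.
Variables (K : comNzRingType) (n : nat).
Lemma mpoly_ring_ind (P : {mpoly K[n]} -> Prop) :
  (forall c, P c%:MP) -> (forall i, P 'X_i) -> (forall p q, P p -> P q -> P (p + q)) ->
  (forall p q, P p -> P q -> P (p * q)) -> forall p, P p.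
Proof.
move=> HC HX HD HM p; rewrite (mpolyE p); apply: big_ind => [|u v|m _]; [by rewrite -mpolyC0|exact: HD|].
rewrite -mul_mpolyC; apply: (HM) => //; rewrite mpolyXE_id.
apply: big_ind => [|u v|i _]; [by rewrite -mpolyC1|exact: HM|].
elim: (m i) => [|k IH]; first by rewrite expr0 -mpolyC1.
by rewrite exprS; apply: HM.
Qed.
End MpolyInd.

(** The last variable becomes the variable of a one-variable polynomial ring. Surjectivity is enough
    for both inductions on the number of variables, so no inverse is built. *)
Definition unmuni (K : comNzRingType) n : {rmorphism {poly {mpoly K[n]}} -> {mpoly K[n.+1]}} :=
  horner_morph (fun a : {mpoly K[n]} => mulrC ('X_ord_max : {mpoly K[n.+1]}) (mwiden a)).

Lemma unmuniC (K : comNzRingType) n (a : {mpoly K[n]}) : unmuni K n a%:P = mwiden a.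
Proof. exact: horner_morphC. Qed.
Lemma unmuniX (K : comNzRingType) n : unmuni K n 'X = 'X_ord_max.
Proof. exact: horner_morphX. Qed.

Lemma unmuni_surj (K : comNzRingType) n (p : {mpoly K[n.+1]}) : exists q, unmuni K n q = p.
Proof.
move: p; apply: mpoly_ring_ind => [c|i|p q [p' Ep] [q' Eq]|p q [p' Ep] [q' Eq]].
- by exists (c%:MP)%:P; rewrite unmuniC mwidenC.
- case: (unliftP ord_max i) => [j|] ->; last by exists 'X; rewrite unmuniX.
  exists ('X_j)%:P; rewrite unmuniC mwidenX mnmwiden1; congr 'X_[U_(_)].
  by apply: val_inj; rewrite /= /bump leqNgt ltn_ord.
- by exists (p' + q'); rewrite rmorphD Ep Eq.
- by exists (p' * q'); rewrite rmorphM Ep Eq.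
Qed.

Lemma noetherian_field (K : fieldType) : noetherian K.
Proof.
move=> J HJ; case: (classic (exists2 x, J x & x != 0)) => [[x Jx x0]|H].
  exists [:: x]; split=> [y|y Jy]; first by rewrite inE => /eqP->.
  by exists (y / x), 0; rewrite addr0 divfK.
exists [::]; split=> // x Jx /=; apply: NNPP => /eqP x0; apply: H; by exists x.
Qed.

Lemma noetherian_mpoly (K : fieldType) n : noetherian {mpoly K[n]}.
Proof.
elim: n => [|n IH].
  apply: (@noetherian_surj K _ (@mpolyC 0 K)); last exact: noetherian_field.
  move=> b; exists b@_0%MM; rewrite [RHS]mpolyE; apply/mpolyP => m.
  rewrite -mpolyE mcoeffC; have -> : m = 0%MM by apply/mnmP; case.
  by rewrite eqxx mulr1.
by apply: (@noetherian_surj _ _ (unmuni K n)); [exact: unmuni_surj|exact: hilbert_basis].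
Qed.

(** * The Nullstellensatz *)

Definition prime_ideal (R : comNzRingType) (P : R -> Prop) : Prop :=
  [/\ ideal P, ~ P 1 & forall a b, P (a * b) -> P a \/ P b].

Lemma ex_min_nat (T : nat -> Prop) :
  (exists n, T n) -> exists n, T n /\ forall m, T m -> (n <= m)%N.
Proof.
move=> [n Tn]; apply: NNPP => H.
suff: forall m k, (k < m)%N -> ~ T k by move/(_ n.+1 n (ltnSn n)).
elim=> // m IH k; rewrite ltnS leq_eqVlt => /orP[/eqP->|/IH //] Tm.
apply: H; exists m; split=> // l Tl; rewrite leqNgt; apply/negP => /IH; exact.
Qed.

Lemma ex_min_size (T : Type) (sz : T -> nat) (Q : T -> Prop) :
  (exists f, Q f) -> exists f, Q f /\ forall f', Q f' -> (sz f <= sz f')%N.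
Proof.
move=> [f Qf].
have [n [[g [Qg sg]] H]] := @ex_min_nat (fun n => exists g, Q g /\ sz g = n)
  (ex_intro _ _ (ex_intro _ f (conj Qf erefl))).
by exists g; split=> // f' Qf'; rewrite sg; apply: H; exists f'.
Qed.

Lemma primeX (R : comNzRingType) (P : R -> Prop) a k : prime_ideal P -> P (a ^+ k) -> P a.
Proof.
move=> [_ P1 PM]; elim: k => [|k IH]; first by rewrite expr0 => /P1.
by rewrite exprS => /PM[|/IH].
Qed.

Lemma primeMn (R : comNzRingType) (P : R -> Prop) a b :
  prime_ideal P -> ~ P a -> ~ P b -> ~ P (a * b).
Proof. by move=> [_ _ PM] Ha Hb /PM[]. Qed.

(** Instead of counting elements of [K]: a root of h - 1 is a point where h takes the value 1. *)
Lemma ex_nonroot (K : closedFieldType) (h : {poly K}) : h != 0 -> exists t, h.[t] != 0.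
Proof.
move=> h0; case: (eqVneq (size (h - 1)) 1%N) => [/eqP/size_poly1P[c c0 Ec]|/closed_rootP[t]].
  exists 0; have Eh : h = (c + 1)%:P by rewrite polyCD -Ec subrK.
  by rewrite Eh hornerC; apply: contraNneq h0 => Ec1; rewrite Eh Ec1.
rewrite rootE hornerD hornerN hornerC subr_eq0 => /eqP Et.
by exists t; rewrite Et oner_neq0.
Qed.

Section OneStep.
Variables (K : closedFieldType) (A : idomainType) (Q : {poly A} -> Prop).
Hypothesis HQ : prime_ideal Q.
Let iQ : ideal Q. Proof. by case: HQ. Qed.

Lemma poly_coefs_ideal (I : {poly A} -> Prop) (p : {poly A}) :
  ideal I -> (forall i, I (p`_i)%:P) -> I p.
Proof.
move=> HI H; rewrite -[p]coefK poly_def; apply: ideal_sum => // i _.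
by rewrite -mul_polyC; apply: idealMr.
Qed.

(** Leading terms with coefficient in Q are dropped until the leading coefficient lies outside Q.
    Hence, below the least size of an element of I with good leading coefficient, all coefficients
    are in Q. *)
Lemma truncate_bad (I : {poly A} -> Prop) (f : {poly A}) : ideal I -> (forall p, Q p -> I p) -> I f ->
  ~ (forall i, Q (f`_i)%:P) ->
  exists f', [/\ I f', ~ Q (lead_coef f')%:P & (size f' <= size f)%N].
Proof.
move=> HI QI; have [n] := ubnP (size f); elim: n f => // n IH f sf If bad.
case: (classic (Q (lead_coef f)%:P)) => Hl; last by exists f.
pose g := f - (lead_coef f)%:P * 'X^((size f).-1).
have f0 : f != 0.
  apply/negP => /eqP f0; apply: bad => i; rewrite f0 coef0 polyC0; exact: ideal0.
have sg : (size g < size f)%N.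
  have sf0 : (0 < size f)%N by rewrite lt0n size_poly_eq0.
  rewrite -(ltn_predK sf0) ltnS; apply/leq_sizeP => j.
  rewrite leq_eqVlt coefB coefCM coefXn => /orP[/eqP<-|lj].
    by rewrite eqxx mulr1 lead_coefE subrr.
  rewrite (gtn_eqF lj) mulr0 subr0 nth_default //; by rewrite -(prednK sf0).
have [|||f' [H1 H2 H3]] := IH g.
- lia.
- by apply: idealB => //; apply: QI; apply: idealMr.
- move=> H; apply: bad => i; rewrite -(subrK ((lead_coef f)%:P * 'X^((size f).-1)) f) -/g.
  rewrite coefD polyCD; apply: idealD => //; rewrite coefCM coefXn polyCM.
  exact: idealMr.
by exists f'; split=> //; lia.
Qed.

(** Elimination of one variable: b collects the coefficients that must survive a specialization of A
    for the fibre of Q to contain a point where g is nonzero. *)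
Lemma prime_specialize (g : {poly A}) : ~ Q g ->
  exists2 b : A, ~ Q b%:P & forall e : {rmorphism A -> K},
    (forall a, Q a%:P -> e a = 0) -> e b != 0 ->
    exists t : K, (forall p, Q p -> (map_poly e p).[t] = 0) /\ (map_poly e g).[t] != 0.
Proof.
move=> gQ.
(* If all elements of Q have their coefficients in Q, the fibre is the whole line and any t off the
   roots of the specialized g will do. *)
case: (classic (exists2 p : {poly A}, Q p & ~ (forall i, Q (p`_i)%:P))) => [[p0 Qp0 bad0]|nobad]; last first.
  have [i gi] : exists i, ~ Q (g`_i)%:P.
    by apply: NNPP => H; apply: gQ; apply: poly_coefs_ideal => // i; apply: NNPP => Hi; apply: H; exists i.
  exists g`_i => // e eQ eg.
  have [t gt] : exists t, (map_poly e g).[t] != 0.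
    apply: ex_nonroot; apply: contraNneq eg => E; by rewrite -coef_map E coef0.
  exists t; split=> // p Qp.
  suff -> : map_poly e p = 0 by rewrite horner0.
  apply/polyP => j; rewrite coef_map coef0; apply: eQ; apply: NNPP => Hj.
  by apply: nobad; exists p => // H; apply: Hj.
have [p1 [Qp1 lp1 _]] := truncate_bad iQ (fun p H => H) Qp0 bad0.
have [p [[Qp lp] minp]] := @ex_min_size _ (fun p : {poly A} => size p)
  (fun p => Q p /\ ~ Q (lead_coef p)%:P) (ex_intro _ p1 (conj Qp1 lp1)).
have p_neq0 : p != 0 by apply/negP => /eqP E; apply: lp; rewrite E lead_coef0 polyC0; exact: ideal0.
pose I (f : {poly A}) := exists u q v : {poly A}, Q q /\ f = u * p + q + v * g.
have II : ideal I.
  split=> [|x y [u [q [v [Hq ->]]]] [u' [q' [v' [Hq' ->]]]]|a x [u [q [v [Hq ->]]]]].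
  - by exists 0, 0, 0; rewrite !mul0r !addr0; split=> //; apply: ideal0.
  - by exists (u + u'), (q + q'), (v + v'); split; [exact: idealD|ring].
  - by exists (a * u), (a * q), (a * v); split; [exact: idealMl|ring].
have QI q : Q q -> I q by move=> Hq; exists 0, q, 0; rewrite !mul0r addr0 add0r.
have Ig : I g by exists 0, 0, 1; rewrite mul0r add0r add0r mul1r; split=> //; apply: ideal0.
have [d [[Id ld] mind]] := @ex_min_size _ (fun p : {poly A} => size p)
  (fun p => I p /\ ~ Q (lead_coef p)%:P) (ex_intro _ p (conj (QI _ Qp) lp)).
have d_neq0 : d != 0 by apply/negP => /eqP E; apply: ld; rewrite E lead_coef0 polyC0; exact: ideal0.
have modI (J : {poly A} -> Prop) (HJ : ideal J) (QJ : forall p, Q p -> J p) (f h : {poly A}) :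
    h != 0 -> J h -> (forall h', J h' /\ ~ Q (lead_coef h')%:P -> (size h <= size h')%N) ->
    J f -> exists k u r, [/\ Q r, (size r < size h)%N & (lead_coef h)%:P ^+ k * f = u * h + r].
  move=> h0 Jh minh Jf; exists (scalp f h), (f %/ h), (f %% h).
  have E : (lead_coef h)%:P ^+ scalp f h * f = f %/ h * h + f %% h.
    by rewrite -rmorphXn /= mul_polyC; exact: Pdiv.Idomain.divp_eq.
  have sr : (size (f %% h)%R < size h)%N by rewrite Pdiv.Idomain.ltn_modp.
  split=> //; apply: poly_coefs_ideal => //; apply: NNPP => bad.
  have Jr : J (f %% h).
    have -> : f %% h = (lead_coef h)%:P ^+ scalp f h * f - f %/ h * h by rewrite E; ring.
    by apply: idealB => //; apply: idealMl.
  have [f' [J' l' s']] := truncate_bad HJ QJ Jr bad.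
  by have := minh _ (conj J' l'); rewrite leqNgt (leq_ltn_trans s' sr).
case: (HQ) => _ Q1 HM.
have dQ : ~ Q d.
  move=> Qd; have [k [u [r [Qr _ E]]]] := modI I II QI g d d_neq0 Id mind Ig.
  have : Q ((lead_coef d)%:P ^+ k * g) by rewrite E; apply: idealD => //; apply: idealMl.
  by case/HM => [H|//]; apply: ld; apply: primeX H.
have sd1 : size d = 1%N.
  apply/eqP; rewrite eqn_leq andbC lt0n size_poly_eq0 d_neq0 /= leqNgt; apply/negP => sd.
  have [k [u [r [Qr sr E]]]] := modI I II QI p d d_neq0 Id mind (QI _ Qp).
  have sdp : (size d <= size p)%N by apply: mind; split=> //; apply: QI.
  have Qud : Q (u * d).
    by rewrite -(addrK r (u * d)) -E; apply: idealB => //; apply: idealMl.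
  case: (HM _ _ Qud) => // Qu.
  have ud : u * d = (lead_coef d ^+ k)%:P * p - r by rewrite rmorphXn /= E addrK.
  have lk : lead_coef d ^+ k != 0 by rewrite expf_neq0 // lead_coef_eq0.
  have sp : size ((lead_coef d ^+ k)%:P * p) = size p by rewrite mul_polyC size_scale.
  have sud : size (u * d) = size p.
    by rewrite ud size_polyDl ?sp // size_polyN (leq_trans sr sdp).
  have u0 : u != 0.
    apply/eqP => u0; move: sud sdp; rewrite u0 mul0r size_poly0 => <-.
    by rewrite leqn0 => /eqP sd0; rewrite sd0 in sd.
  have lud : lead_coef u * lead_coef d = lead_coef d ^+ k * lead_coef p.
    rewrite -lead_coefM ud lead_coefDl ?lead_coefM ?lead_coefC //.
    by rewrite sp size_polyN (leq_trans sr sdp).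
  have lu : ~ Q (lead_coef u)%:P.
    move=> Hu; have : Q (lead_coef d ^+ k * lead_coef p)%:P.
      by rewrite -lud polyCM; apply: idealMr.
    by rewrite polyCM => /HM[|//]; rewrite rmorphXn /= => /(primeX HQ).
  have aux (i j l : nat) : (1 < j -> (i + j).-1 = l -> l <= i -> False)%N by lia.
  by apply: aux sd _ (minp _ (conj Qu lu)); rewrite -size_mul.
have [b Eb] : exists b, d = b%:P by exists d`_0; apply: size1_polyC; rewrite sd1.
have bQ : ~ Q b%:P by rewrite -Eb.
case: Id => u [q [v [Hq Ed]]].
exists (lead_coef p * b); first by rewrite polyCM; apply: primeMn.
move=> e eQ; rewrite rmorphM mulf_eq0 negb_or => /andP[el eb].
have sep : size (map_poly e p) = size p by apply: size_map_poly_id0.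
have root_Q t : (map_poly e p).[t] = 0 -> forall f, Q f -> (map_poly e f).[t] = 0.
  move=> Et f Qf.
  have [k [w [r [Qr sr E]]]] := modI Q iQ (fun _ H => H) f p p_neq0 Qp minp Qf.
  have Er : map_poly e r = 0.
    apply/polyP => j; rewrite coef_map coef0; apply: eQ; apply: NNPP => Hj.
    have [r' [Qr' lr' sr']] := truncate_bad iQ (fun _ H => H) Qr (fun H => Hj (H j)).
    by have := minp _ (conj Qr' lr'); rewrite leqNgt (leq_ltn_trans sr' sr).
  have := congr1 (fun f => (map_poly e f).[t]) E.
  rewrite /= -rmorphXn /= !rmorphM rmorphD rmorphM /= Er addr0 map_polyC /= !hornerM hornerC Et mulr0.
  by move/eqP; rewrite mulf_eq0 rmorphXn expf_eq0 (negPf el) andbF /= => /eqP.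
(* A root of the specialized p is a zero of all of Q, by pseudo-division by p. The expression of the
   constant d in terms of p, Q and g then shows that g is nonzero there. *)
have /closed_rootP[t] : size (map_poly e p) != 1%N.
  rewrite sep; apply/negP => /size_poly1P[c c0 Ec].
  by apply: lp; rewrite Ec lead_coefC -Ec.
rewrite rootE => /eqP Et; exists t; split; first exact: root_Q.
have := congr1 (fun f => (map_poly e f).[t]) Ed; rewrite /= Eb map_polyC /= hornerC.
rewrite !rmorphD !rmorphM /= !hornerD !hornerM Et mulr0 add0r (root_Q t Et q Hq) add0r => E.
by apply: contraNneq eb => E0; rewrite E E0 mulr0.
Qed.
End OneStep.

Lemma meval_mwiden (K : comNzRingType) n (v : 'I_n.+1 -> K) (p : {mpoly K[n]}) :
  (mwiden p).@[v] = p.@[fun i => v (widen_ord (leqnSn n) i)].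
Proof.
elim/mpoly_ring_ind: p => [c|i|p q IHp IHq|p q IHp IHq].
- by rewrite mwidenC !mevalC.
- by rewrite mwidenX mnmwiden1 !mevalXU; congr v; apply: val_inj.
- by rewrite mwidenD !mevalD IHp IHq.
- by rewrite mwidenM !mevalM IHp IHq.
Qed.

(** Induction on the number of variables: the element b of [prime_specialize] is handed to the
    induction hypothesis as the one to be kept nonzero. *)
Lemma nullstellensatz_prime (K : closedFieldType) n (P : {mpoly K[n]} -> Prop) g :
  prime_ideal P -> ~ P g ->
  exists v : 'I_n -> K, (forall f, P f -> f.@[v] = 0) /\ g.@[v] != 0.
Proof.
elim: n P g => [|n IH] P g HP gP.
  exists (fun _ => 0).
  have Ec (f : {mpoly K[0]}) : f = (f@_0%MM)%:MP.
    rewrite [LHS]mpolyE; apply/mpolyP => m.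
    rewrite -mpolyE mcoeffC; have -> : m = 0%MM by apply/mnmP; case.
    by rewrite eqxx mulr1.
  case: HP => iP P1 PM; split=> [f|]; last first.
    rewrite (Ec g) mevalC; apply/negP => /eqP E; apply: gP.
    by rewrite (Ec g) E mpolyC0; apply: ideal0.
  rewrite (Ec f) mevalC => Pf; apply/eqP; apply/negPn/negP => f0; apply: P1.
  have -> : 1 = (f@_0%MM)^-1%:MP * (f@_0%MM)%:MP :> {mpoly K[0]} by rewrite -mpolyCM mulVf.
  exact: idealMl.
pose Q p := P (unmuni K n p).
have HQ : prime_ideal Q.
  case: HP => iP P1 PM; split=> [||a b]; rewrite /Q ?rmorph1 ?rmorphM //; last exact: PM.
  split=> [|x y|a x]; rewrite /Q ?rmorph0 ?rmorphD ?rmorphM.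
  - exact: ideal0.
  - exact: idealD.
  - exact: idealMl.
have [g' Eg] := unmuni_surj g; subst g.
have [b bQ Hb] := prime_specialize K HQ gP.
have HP0 : prime_ideal (fun a => Q a%:P).
  case: HQ => iQ Q1 QM; split=> [|//|x y]; last by rewrite polyCM; apply: QM.
  split=> [|x y|a x]; rewrite ?polyC0 ?polyCD ?polyCM.
  - exact: ideal0.
  - exact: idealD.
  - exact: idealMl.
have [v [v0 vb]] := IH _ _ HP0 bQ.
have [t [Ht gt]] := Hb (meval v) v0 vb.
pose w (i : 'I_n.+1) := if unlift ord_max i is Some j then v j else t.
have Ew p : (unmuni K n p).@[w] = (map_poly (meval v) p).[t].
  rewrite -[p]coefK poly_def !rmorph_sum horner_sum /=; apply: eq_bigr => i _.
  rewrite -mul_polyC !rmorphM !rmorphXn /= unmuniC unmuniX map_polyC map_polyX.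
  rewrite !hornerM hornerC hornerXn meval_mwiden mevalXU /w unlift_none.
  congr (_ * _); apply: meval_eq => j.
  suff -> : widen_ord (leqnSn n) j = lift ord_max j by rewrite liftK.
  by apply: val_inj; rewrite /= /bump leqNgt ltn_ord.
exists w; split=> [f Pf|]; last by rewrite Ew.
by have [f' Ef] := unmuni_surj f; subst f; rewrite Ew; apply: Ht.
Qed.

Lemma pred_ext (T : Type) (A B : T -> Prop) : peq A B -> A = B.
Proof. by move=> H; apply: functional_extensionality => x; apply: propositional_extensionality. Qed.

(** [Zorn_bigcup] also considers the empty chain. It is therefore applied to the sets A0 union X, so
    that P has to be stable only under unions of nonempty chains. *)
Lemma zorn_pred (T : Type) (P : (T -> Prop) -> Prop) :
  (forall F : (T -> Prop) -> Prop, (forall A, F A -> P A) ->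
     (forall A B, F A -> F B -> psub A B \/ psub B A) -> (exists A, F A) ->
     P (fun x => exists2 A, F A & A x)) ->
  forall A0, P A0 ->
  exists A, [/\ P A, psub A0 A & forall B, P B -> psub A B -> psub B A].
Proof.
move=> HP A0 PA0.
have Pe A B : P A -> peq A B -> P B by move=> PA /pred_ext <-.
have [F FP totF|A [PA maxA]] := @classical_sets.Zorn_bigcup T (fun X => P (fun x => A0 x \/ X x)).
  case: (classic (exists X, F X)) => [[X0 FX0]|noF]; last first.
    apply: Pe PA0 _ => x; split; first by left.
    by case=> // -[X FX]; case: noF; exists X.
  apply: (Pe (fun x => exists2 B, (exists2 X, F X & B = fun x => A0 x \/ X x) & B x)).
    apply: HP => [B [X FX ->]|B C [X FX ->] [Y FY ->]|]; first exact: FP.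
      by case: (totF _ _ FX FY) => XY; [left|right] => x [?|/XY ?]; [left|right|left|right].
    by exists (fun x => A0 x \/ X0 x), X0.
  move=> x; split=> [[B [X FX ->] [A0x|Xx]]|[A0x|[X FX Xx]]].
  - by left.
  - by right; exists X.
  - by exists (fun x => A0 x \/ X0 x); [exists X0|left].
  - by exists (fun x => A0 x \/ X x); [exists X|right].
exists (fun x => A0 x \/ A x); split=> // [x|B PB AB x Bx]; first by left.
apply: NNPP => nx; apply: (maxA B); last first.
  by apply: Pe PB _ => y; split=> [By|[A0y|//]]; [right|apply: AB; left].
split=> [y Ay|BA]; first by apply: AB; right.
by apply: nx; right; apply: BA.
Qed.

(** An ideal P maximal among those avoiding the powers of f is prime: if a and b lie outside, powers
    of f lie in P + (a) and in P + (b), hence their product in P + (ab). *)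
Lemma prime_avoiding_powers (R : comNzRingType) (J : R -> Prop) f :
  ideal J -> (forall k, ~ J (f ^+ k)) -> exists P, [/\ prime_ideal P, psub J P & ~ P f].
Proof.
move=> HJ Jf.
have [|P [[iP Pf] JP maxP]] := @zorn_pred R (fun P => ideal P /\ forall k, ~ P (f ^+ k)) _ J (conj HJ Jf).
  move=> F FP totF [A0 FA0]; split=> [|k [A /FP[_ Af] /Af //]]; split.
  - by exists A0 => //; have [] := FP _ FA0 => /ideal0.
  - move=> x y [A FA Ax] [B FB By].
    case: (totF _ _ FA FB) => H.
      by exists B => //; apply: idealD (H _ Ax) By; have [] := FP _ FB.
    by exists A => //; apply: idealD Ax (H _ By); have [] := FP _ FA.
  - by move=> a x [A FA Ax]; exists A => //; apply: idealMl Ax; have [] := FP _ FA.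
exists P; split=> //; last by move: (Pf 1%N); rewrite expr1.
have Pa a : ~ P a -> exists k x, P (f ^+ k - x * a).
  move=> Pa; apply: NNPP => H; apply: Pa.
  pose P' y := exists x, P (y - x * a).
  have iP' : ideal P'.
    split=> [|y z [x Hx] [x' Hx']|b y [x Hx]].
    - by exists 0; rewrite mul0r subrr; apply: ideal0.
    - by exists (x + x'); rewrite mulrDl opprD addrACA; apply: idealD.
    - by exists (b * x); rewrite -mulrA -mulrBr; apply: idealMl.
  apply: (maxP P'); first by split=> // k [x Hx]; apply: H; exists k, x.
    by move=> y Py; exists 0; rewrite mul0r subr0.
  by exists 1; rewrite mul1r subrr; apply: ideal0.
split=> // [|a b Pab]; first by move: (Pf 0%N); rewrite expr0.
apply: NNPP => /not_or_and[/Pa[k [x Hx]] /Pa[l [y Hy]]].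
apply: (Pf (k + l)%N); rewrite exprD.
have -> : f ^+ k * f ^+ l = (f ^+ k - x * a) * f ^+ l + x * a * (f ^+ l - y * b) + x * y * (a * b).
  by ring.
by apply: idealD => //; [apply: idealD => //|apply: idealMl] => //; [apply: idealMr|apply: idealMl].
Qed.

Lemma nullstellensatz (K : closedFieldType) n (J : {mpoly K[n]} -> Prop) f :
  ideal J -> (forall v : 'I_n -> K, (forall g, J g -> g.@[v] = 0) -> f.@[v] = 0) ->
  exists k, J (f ^+ k).
Proof.
move=> HJ H; apply: NNPP => Jf.
have [P [HP JP Pf]] := prime_avoiding_powers HJ (fun k Hk => Jf (ex_intro _ k Hk)).
have [v [Hv /eqP]] := nullstellensatz_prime HP Pf; apply; apply: H => g /JP; exact: Hv.
Qed.

(** * Dimensions of subquotients *)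

Section Dimension.
Variables (K : fieldType) (M : lmodType K).
Implicit Types U V W : M -> Prop.

Definition subspace U : Prop :=
  [/\ U 0, forall x y, U x -> U y -> U (x + y) & forall c x, U x -> U (c *: x)].

(* [dim_le U V d] and [dim_ge U V d] bound the dimension of the image of U modulo V. *)
Definition dim_le U V d : Prop :=
  forall e : 'I_d.+1 -> M, (forall i, U (e i)) ->
    exists2 c : 'I_d.+1 -> K, (exists i, c i != 0) & V (\sum_i c i *: e i).

Definition dim_ge U V d : Prop :=
  exists2 e : 'I_d -> M, (forall i, U (e i)) &
    forall c : 'I_d -> K, V (\sum_i c i *: e i) -> forall i, c i = 0.

Lemma subspace_sum U (I : Type) (r : seq I) (Q : pred I) (F : I -> M) :
  subspace U -> (forall i, Q i -> U (F i)) -> U (\sum_(i <- r | Q i) F i).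
Proof. by case=> U0 UD _ H; apply: big_ind. Qed.

Lemma subspaceZ U c x : subspace U -> U x -> U (c *: x). Proof. by case=> _ _; apply. Qed.
Lemma subspaceD U x y : subspace U -> U x -> U y -> U (x + y). Proof. by case=> _ + _; apply. Qed.
Lemma subspaceN U x : subspace U -> U x -> U (- x).
Proof. by move=> HU Ux; rewrite -scaleN1r; apply: subspaceZ. Qed.
Lemma subspaceB U x y : subspace U -> U x -> U y -> U (x - y).
Proof. by move=> HU Ux Uy; apply: subspaceD => //; apply: subspaceN. Qed.
Lemma subspace_comb U (I : Type) (r : seq I) (c : I -> K) (F : I -> M) :
  subspace U -> (forall i, U (F i)) -> U (\sum_(i <- r) c i *: F i).
Proof. by move=> HU H; apply: subspace_sum => // i _; apply: subspaceZ. Qed.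

Lemma dim_le_spanned U V r (e : 'I_r -> M) : subspace V ->
  (forall u, U u -> exists c : 'I_r -> K, V (u - \sum_i c i *: e i)) -> dim_le U V r.
Proof.
move=> HV H u Uu.
have [c Hc] : exists c : 'I_r.+1 -> 'I_r -> K, forall k, V (u k - \sum_i c k i *: e i).
  exact: (choice (fun k (ck : 'I_r -> K) => V (u k - \sum_i ck i *: e i)) (fun k => H _ (Uu k))).
pose A := \matrix_(k < r.+1, i < r) c k i.
have /rowV0Pn[v /sub_kermxP vA v0] : kermx A != 0.
  rewrite -mxrank_eq0 mxrank_ker; have := rank_leq_col A; lia.
exists (fun k => v 0 k).
  by move/rV0Pn: v0 => [i vi]; exists i.
have -> : \sum_i v 0 i *: u i = \sum_k v 0 k *: (u k - \sum_i c k i *: e i).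
  under [RHS]eq_bigr do rewrite scalerBr; rewrite sumrB -[LHS]subr0; congr (_ - _).
  under eq_bigr do rewrite scaler_sumr; rewrite exchange_big big1 // => i _.
  under eq_bigr do rewrite scalerA; rewrite -scaler_suml.
  have := congr1 (fun B : 'rV_r => B 0 i) vA; rewrite !mxE => E.
  by under eq_bigr do rewrite -(mxE matrix_key (fun k i => c k i)); rewrite E scale0r.
by apply: subspace_sum => // k _; apply: subspaceZ.
Qed.

Lemma dim_le_dep U V d n (e : 'I_n -> M) : dim_le U V d -> (d < n)%N -> (forall i, U (e i)) ->
  exists2 c : 'I_n -> K, (exists i, c i != 0) & V (\sum_i c i *: e i).
Proof.
move=> H dn Ue; have E : n = (d.+1 + (n - d.+1))%N by lia.
move: (n - d.+1)%N E => m E; subst n.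
have [c [i ci] Hc] := H (fun i => e (lshift m i)) (fun i => Ue _).
exists (fun k => match split k with inl j => c j | inr _ => 0 end).
  by exists (lshift m i); rewrite (unsplitK (inl i : 'I_(d.+1) + 'I_m)).
rewrite big_split_ord /= [X in _ + X]big1 ?addr0 => [|j _]; last first.
  by rewrite (unsplitK (inr j : 'I_(d.+1) + 'I_m)) scale0r.
by under eq_bigr => j _ do rewrite (unsplitK (inl j : 'I_(d.+1) + 'I_m)).
Qed.

Lemma dim_ge_mono U V d d' : dim_ge U V d -> (d' <= d)%N -> dim_ge U V d'.
Proof.
move=> [e Ue He] dd; have E : d = (d' + (d - d'))%N by lia.
move: (d - d')%N E => m E; subst d.
exists (fun i => e (lshift m i)) => // c Hc i.
have := He (fun k => match split k with inl j => c j | inr _ => 0 end) _ (lshift m i).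
rewrite (unsplitK (inl i : 'I_d' + 'I_m)); apply.
rewrite big_split_ord /= [X in _ + X]big1 ?addr0 => [|j _]; last first.
  by rewrite (unsplitK (inr j : 'I_d' + 'I_m)) scale0r.
by under eq_bigr => j _ do rewrite (unsplitK (inl j : 'I_d' + 'I_m)).
Qed.

Lemma dim_ge_le U V d d' : dim_ge U V d -> dim_le U V d' -> (d <= d')%N.
Proof.
move=> [e Ue He] H; rewrite leqNgt; apply/negP => dd.
have [c [i /eqP ci] Hc] := dim_le_dep H dd Ue; exact/ci/He.
Qed.

Lemma dim_le_mono U V d d' : dim_le U V d -> (d <= d')%N -> dim_le U V d'.
Proof. by move=> H dd e Ue; apply: dim_le_dep H _ Ue. Qed.

Lemma dim_not_ge U V d : ~ dim_ge U V d.+1 -> dim_le U V d.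
Proof.
move=> H e Ue; apply: NNPP => H'; apply: H; exists e => // c Hc i.
by apply/eqP; apply/negPn/negP => ci; apply: H'; exists c => //; exists i.
Qed.

Lemma dim_exact U V d : dim_le U V d -> exists d', [/\ (d' <= d)%N, dim_ge U V d' & dim_le U V d'].
Proof.
elim: d => [|d IH] H.
  by exists 0%N; split=> //; exists (fun _ => 0) => [[]|c _ []].
case: (classic (dim_ge U V d.+1)) => [|/dim_not_ge/IH[d' [? ? ?]]]; first by exists d.+1.
by exists d'; split=> //; apply: ltnW.
Qed.

Lemma dim_basis U V d : subspace V -> dim_le U V d ->
  exists d', (d' <= d)%N /\ exists e : 'I_d' -> M, (forall i, U (e i)) /\
    forall u, U u -> exists c : 'I_d' -> K, V (u - \sum_i c i *: e i).
Proof.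
move=> HV /dim_exact[d' [dd [e Ue He] H]]; exists d'; split=> //; exists e; split=> // u Uu.
pose f (i : 'I_d'.+1) := if unlift ord0 i is Some j then e j else u.
have [|c [i ci] Hc] := H f; first by move=> i; rewrite /f; case: unlift.
move: Hc; rewrite big_ord_recl /f unlift_none.
under eq_bigr => j _ do rewrite liftK.
move=> Hc; have c0 : c ord0 != 0.
  apply/negP => /eqP c0; move: Hc; rewrite c0 scale0r add0r => /He cl.
  by move: ci; case: (unliftP ord0 i) => [j|] ->; rewrite ?cl ?c0 eqxx.
exists (fun j => - (c ord0)^-1 * c (lift ord0 j)).
under eq_bigr do rewrite -scalerA; rewrite -scaler_sumr scaleNr opprK.
rewrite -[X in X + _](scalerK c0) -scalerDr; exact: subspaceZ.
Qed.

(** This lemma and the next three are one-sided forms of dim U/V = dim U/W + dim W/V; the later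
    counts mostly bound each dimension from one side only. *)
Lemma dim_le_add U V W a b : subspace V -> subspace W -> dim_le U W a -> dim_le W V b ->
  dim_le U V (a + b).
Proof.
move=> HV HW /(dim_basis HW)[a' [aa [e [Ue He]]]] /(dim_basis HV)[b' [bb [f [Wf Hf]]]].
apply: (@dim_le_mono U V (a' + b')); last exact: leq_add.
apply: (@dim_le_spanned _ _ _ (fun i => match split i with inl j => e j | inr j => f j end)) => //.
move=> u /He[c /Hf[c' Hc]].
exists (fun i => match split i with inl j => c j | inr j => c' j end).
rewrite big_split_ord /=.
under eq_bigr => j _ do rewrite (unsplitK (inl j : 'I_a' + 'I_b')).
under [X in _ - (_ + X)]eq_bigr => j _ do rewrite (unsplitK (inr j : 'I_a' + 'I_b')).
by rewrite opprD addrA.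
Qed.

Lemma dim_ge_sub U V W a b : subspace V -> subspace W ->
  dim_ge U V (a + b) -> dim_le W V b -> dim_ge U W a.
Proof.
move=> HV HW Hge Hle; case: a => [|a] in Hge *; first by exists (fun _ => 0) => [[]|c _ []].
apply: NNPP => /dim_not_ge H.
by have := dim_ge_le Hge (dim_le_add HV HW H Hle); rewrite addSn ltnn.
Qed.

Lemma dim_le_sub U V W a b : (forall x, W x -> U x) -> subspace W -> (forall x, V x -> W x) ->
  dim_le U V (a + b) -> dim_ge W V b -> dim_le U W a.
Proof.
move=> WU HW VW H [f Wf Hf] e Ue.
have [|c ci Hc] := @dim_le_dep U V (a + b)%N (a.+1 + b)%N
  (fun i => match split i with inl j => e j | inr j => f j end) H (leqnn _).
  by move=> i; case: split => j //; apply: WU.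
move: Hc; rewrite big_split_ord /=.
under eq_bigr => j _ do rewrite (unsplitK (inl j : 'I_a.+1 + 'I_b)).
under [X in _ + X]eq_bigr => j _ do rewrite (unsplitK (inr j : 'I_a.+1 + 'I_b)).
move=> Hc; exists (fun i => c (lshift b i)); last first.
  rewrite -(addrK (\sum_i c (rshift a.+1 i) *: f i) (\sum_i _)).
  by apply: subspaceB => //; [apply: VW|apply: subspace_comb].
apply: NNPP => H0.
have c0 i : c (lshift b i) = 0 by apply/eqP; apply/negPn/negP => ?; apply: H0; exists i.
move: Hc; rewrite big1 ?add0r => [/Hf c1|i _]; last by rewrite c0 scale0r.
case: ci => i; rewrite -[i]splitK; case: split => j /=; rewrite ?c0 ?c1 eqxx //.
Qed.

Lemma dim_ge_add U V W a b : (forall x, W x -> U x) -> (forall x, V x -> W x) -> subspace W ->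
  dim_ge U W a -> dim_ge W V b -> dim_ge U V (a + b).
Proof.
move=> WU VW HW [e Ue He] [f Wf Hf].
exists (fun i => match split i with inl j => e j | inr j => f j end).
  by move=> i; case: split => j //; apply: WU.
move=> c; rewrite big_split_ord /=.
under eq_bigr => j _ do rewrite (unsplitK (inl j : 'I_a + 'I_b)).
under [X in _ + X]eq_bigr => j _ do rewrite (unsplitK (inr j : 'I_a + 'I_b)).
move=> Hc.
have c0 : forall i, c (lshift b i) = 0.
  apply: He; rewrite -(addrK (\sum_i c (rshift a i) *: f i) (\sum_i _)).
  by apply: subspaceB => //; [apply: VW|apply: subspace_comb].
move: Hc; rewrite big1 ?add0r => [/Hf c1|i _]; last by rewrite c0 scale0r.
by move=> i; rewrite -[i]splitK; case: split => j /=.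
Qed.

Lemma dim_ge_incl U U' V V' d : (forall x, U x -> U' x) -> (forall x, V' x -> V x) ->
  dim_ge U V d -> dim_ge U' V' d.
Proof. by move=> UU VV [e Ue H]; exists e => [i|c Hc]; auto. Qed.

End Dimension.

Section DimensionMap.
Variables (K : fieldType) (M M' : lmodType K).

(* [rel x y] is the graph of a linear correspondence. *)
Lemma dim_ge_rel (U V : M -> Prop) (U' V' : M' -> Prop) (rel : M -> M' -> Prop) d :
    (forall I (r : seq I) (c : I -> K) f g, (forall i, rel (f i) (g i)) ->
       rel (\sum_(i <- r) c i *: f i) (\sum_(i <- r) c i *: g i)) ->
    (forall x, U x -> exists2 y, U' y & rel x y) ->
    (forall x y, rel x y -> V' y -> V x) ->
  dim_ge U V d -> dim_ge U' V' d.
Proof.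
move=> Hlin Hrel HV [e Ue He].
have [f Hf] := choice (fun i y => U' y /\ rel (e i) y)
  (fun i => let: ex_intro2 y a b := Hrel _ (Ue i) in ex_intro _ y (conj a b)).
exists f => [i|c Hc]; first by have [] := Hf i.
by apply: He; apply: HV Hc; apply: Hlin => i; have [] := Hf i.
Qed.

Lemma dim_le_rel (U V : M -> Prop) (U' V' : M' -> Prop) (rel : M -> M' -> Prop) d :
    (forall I (r : seq I) (c : I -> K) f g, (forall i, rel (f i) (g i)) ->
       rel (\sum_(i <- r) c i *: f i) (\sum_(i <- r) c i *: g i)) ->
    (forall x, U x -> exists2 y, U' y & rel x y) ->
    (forall x y, rel x y -> V' y -> V x) ->
  dim_le U' V' d -> dim_le U V d.
Proof.
move=> Hlin Hrel HV H e Ue.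
have [f Hf] := choice (fun i y => U' y /\ rel (e i) y)
  (fun i => let: ex_intro2 y a b := Hrel _ (Ue i) in ex_intro _ y (conj a b)).
have [|c ci Hc] := H f; first by move=> i; have [] := Hf i.
by exists c => //; apply: HV Hc; apply: Hlin => i; have [] := Hf i.
Qed.
End DimensionMap.

(** * Sections on a curve generated by a pencil *)

Section Pencil.
Variables (K : fieldType) (R : comAlgType K).
Implicit Types (U V W : nat -> R -> Prop).

Definition graded U : Prop := forall j, subspace (U j).

Section PencilModule.
Variables (U V : nat -> R -> Prop) (s0 s1 : R) (j2 : nat).
Hypotheses (gU : graded U) (gV : graded V).
Hypothesis (s0U : forall j x, U j x -> U j.+1 (s0 * x)).
Hypothesis (s1U : forall j x, U j x -> U j.+1 (s1 * x)).
Hypothesis (s0V : forall j x, V j x -> V j.+1 (s0 * x)).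
Hypothesis (s1V : forall j x, V j x -> V j.+1 (s1 * x)).
Hypothesis genU : forall j u, (j2 <= j)%N -> U j.+1 u ->
  exists a b, [/\ U j a, U j b & V j.+1 (u - (s0 * a + s1 * b))].

Lemma pencilX (W : nat -> R -> Prop) s n j x : (forall j x, W j x -> W j.+1 (s * x)) ->
  W j x -> W (n + j)%N (s ^+ n * x).
Proof.
move=> H; elim: n => [|n IH] Wx; first by rewrite expr0 mul1r.
by rewrite exprS -mulrA addSn; apply/H/IH.
Qed.

(** View U/V as a graded module over K[s0, s1]: a monomial of degree i + n in s0 and s1 is divisible
    by s0^i or by s1^n. *)
Lemma pencil_split l i n u : (j2 <= l)%N -> U (l + i + n)%N u ->
  exists a b, [/\ U (l + n)%N a, U (l + i)%N b & V (l + i + n)%N (u - (s0 ^+ i * a + s1 ^+ n * b))].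
Proof.
move=> jl; have [m] := ubnP (i + n)%N; elim: m i n u => // m IH i n u.
case: i => [|i].
  move=> _; rewrite addn0 => Uu; exists u, 0; rewrite expr0 mul1r mulr0 addr0 subrr.
  by split=> //; have [] := gU l; have [] := gV (l + n).
case: n => [|n].
  move=> _; rewrite addn0 => Uu; exists 0, u; rewrite expr0 mul1r mulr0 add0r subrr.
  by split=> //; have [] := gU (l + 0); have [] := gV (l + i.+1).
rewrite !addnS !addSn => lt Uu.
have [|u' [u'' [Uu' Uu'' Vu]]] := genU _ Uu; first by lia.
have [||a [b [Ua Ub Vab]]] := IH i n.+1 u'; [by lia|by rewrite addnS|].
have [||a' [b' [Ua' Ub' Vab']]] := IH i.+1 n u''; [by lia|by rewrite addnS addSn|].
rewrite ?addnS ?addSn in Ua Ub Vab Ua' Ub' Vab'.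
exists (a + s1 * a'), (s0 * b + b'); split.
- by apply: subspaceD => //; apply: s1U.
- by apply: subspaceD => //; apply: s0U.
have -> : u - (s0 ^+ i.+1 * (a + s1 * a') + s1 ^+ n.+1 * (s0 * b + b')) =
   (u - (s0 * u' + s1 * u'')) + s0 * (u' - (s0 ^+ i * a + s1 ^+ n.+1 * b))
     + s1 * (u'' - (s0 ^+ i.+1 * a' + s1 ^+ n * b')) by rewrite !exprS; ring.
by apply: subspaceD => //; [apply: subspaceD => //; apply: s0V|apply: s1V].
Qed.

Variable dmax : nat.
Hypothesis dimU : forall j, (j2 <= j)%N -> dim_le (U j) (V j) dmax.

(** In bounded dimension, multiplication by s0 eventually becomes onto up to s0-torsion. This raises
    the exponent of s0 in [pencil_split] from a fixed i to an arbitrary n without raising the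
    level. *)
Lemma pencil_bounded : exists j3, forall j n u, (j3 <= j)%N -> U (j + n)%N u ->
  exists a b, [/\ U j a, U j b & V (j + n)%N (u - (s0 ^+ n * a + s1 ^+ n * b))].
Proof.
(* [E i l]: s0 U_l fills U_(l+1) after multiplication by s0^i. If it failed for every i up to dmax
   at l = J - i - 1, the counterexamples would give dmax + 1 independent vectors s0^i a_i of U_J /
   V_J: solve a dependence for its term of least index. *)
pose E i l := forall a, U l.+1 a -> exists2 b, U l b & V (l.+1 + i)%N (s0 ^+ i * a - s0 ^+ i.+1 * b).
have [i [l [jl Eil]]] : exists i l, (j2 <= l)%N /\ E i l.
  apply: NNPP => H; pose J := (j2 + dmax.+1)%N.
  have Ha : forall i : 'I_dmax.+1, exists a, U (J - i)%N a /\
      ~ exists2 b, U (J - i.+1)%N b & V J (s0 ^+ i * a - s0 ^+ i.+1 * b).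
    move=> i; apply: NNPP => Hi; apply: H; exists (i : nat), (J - i.+1)%N.
    have iJ : (i.+1 + j2 <= J)%N by have := ltn_ord i; rewrite /J; lia.
    split=> [|a]; first by lia.
    have -> : (J - i.+1).+1 = (J - i)%N by lia.
    have -> : (J - i + i)%N = J by lia.
    by move=> Ua; apply: NNPP => Hb; apply: Hi; exists a.
  have {Ha} [a Ha] := choice _ Ha.
  have jJ : (j2 <= J)%N by rewrite /J; lia.
  have [i|c ci Hc] := @dimU J jJ (fun i : 'I_dmax.+1 => s0 ^+ i * a i).
    have [Ua _] := Ha i; have := pencilX i s0U Ua.
    by congr (U _ _); have := ltn_ord i; rewrite /J; lia.
  have [i0 [ci0 mini]] := @ex_min_size _ (fun i : 'I_dmax.+1 => i : nat) (fun i => c i != 0) ci.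
  have [_] := Ha i0; apply.
  exists (- ((c i0)^-1 *: (\sum_(i < dmax.+1 | (i0 < i)%N) c i *: (s0 ^+ (i - i0.+1) * a i)))).
    apply: subspaceN => //; apply: subspaceZ => //; apply: subspace_sum => // i lti.
    apply: subspaceZ => //; have [Ua _] := Ha i; have := pencilX (i - i0.+1) s0U Ua.
    by congr (U _ _); have := ltn_ord i; rewrite /J; lia.
  rewrite mulrN opprK -[X in X + _](scalerK ci0) -scalerAr -scalerDr; apply: subspaceZ => //.
  move: Hc; rewrite (bigID (fun i : 'I_dmax.+1 => (i0 < i)%N)) /= addrC (bigD1 i0) ?ltnn //=.
  rewrite [X in _ + X + _]big1 ?addr0 => [|i /andP[lei nei]]; last first.
    rewrite -leqNgt in lei; case: (eqVneq (c i) 0) => [->|/mini i0i]; first by rewrite scale0r.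
    by case/negP: nei; apply/eqP/val_inj/eqP; rewrite eqn_leq lei.
  congr (V _ (_ + _)); rewrite mulr_sumr; apply: eq_bigr => i lti.
  by rewrite -scalerAr mulrA -exprD; congr (_ *: (_ ^+ _ * _)); lia.
have El k : E i (l + k)%N.
  elim: k => [|k IH]; first by rewrite addn0.
  rewrite addnS => a /genU[|a1 [a2 [Ua1 Ua2 Va]]]; first by lia.
  have [b Ub Vb] := IH _ Ua2.
  exists (a1 + s1 * b); first by apply: subspaceD => //; apply: s1U.
  have -> : s0 ^+ i * a - s0 ^+ i.+1 * (a1 + s1 * b) =
     s0 ^+ i * (a - (s0 * a1 + s1 * a2)) + s1 * (s0 ^+ i * a2 - s0 ^+ i.+1 * b).
    by rewrite !exprS; ring.
  apply: subspaceD => //; last by rewrite addSn; apply: s1V.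
  by have := pencilX i s0V Va; congr (V _ _); lia.
have Eln k n a : U (l + k + n)%N a ->
    exists2 b, U (l + k)%N b & V (l + k + n + i)%N (s0 ^+ i * a - s0 ^+ (i + n) * b).
  elim: n a => [|n IH] a; first by rewrite !addn0 => Ua; exists a; rewrite // subrr; have [] := gV (l + k + i).
  rewrite addnS => Ua; have [b Ub Vb] : exists2 b, U (l + k + n)%N b &
      V (l + k + n).+1%N (0 : R) /\ V ((l + k + n).+1 + i)%N (s0 ^+ i * a - s0 ^+ i.+1 * b).
    have [b Ub Vb] := El (k + n)%N a (eq_ind _ (fun j => U j a) Ua _ (congr1 S (esym (addnA l k n)))).
    by rewrite addnA in Ub Vb; exists b => //; split=> //; have [] := gV (l + k + n).+1.
  case: Vb => _ Vb; have [b' Ub' Vb'] := IH b Ub; exists b' => //.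
  have -> : s0 ^+ i * a - s0 ^+ (i + n.+1) * b' =
    (s0 ^+ i * a - s0 ^+ i.+1 * b) + s0 * (s0 ^+ i * b - s0 ^+ (i + n) * b').
    by rewrite addnS !exprS; ring.
  by apply: subspaceD => //; rewrite addSn; apply: s0V.
exists (l + i)%N => j n u lj Uu; have Ej : j = (l + (j - l - i) + i)%N by lia.
move: (j - l - i)%N Ej => k Ej; subst j.
case: (leqP i n) => ni; last first.
  have [||a [b [Ua Ub Vab]]] := @pencil_split (l + k + i - n) n n u; [by lia| |].
    by move: Uu; congr (U _ _); lia.
  have E1 : (l + k + i - n + n = l + k + i)%N by lia.
  by rewrite !E1 in Ua Ub Vab; exists a, b.
have [|a [b [Ua Ub Vab]]] := @pencil_split (l + k) i n u _ Uu; first by lia.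
have En : n = (i + (n - i))%N by lia.
have Ua' : U (l + (k + i) + (n - i))%N a by move: Ua; congr (U _ _); lia.
have [a' Ua'' Vaa'] := Eln _ _ _ Ua'; rewrite -En in Vaa'.
exists a', b; split=> //; first by rewrite -addnA.
have -> : u - (s0 ^+ n * a' + s1 ^+ n * b) =
  (u - (s0 ^+ i * a + s1 ^+ n * b)) + (s0 ^+ i * a - s0 ^+ n * a') by ring.
by apply: subspaceD => //; move: Vaa'; congr (V _ _); lia.
Qed.
End PencilModule.

(** * Existence of sections and vanishing of H^1 on one curve, by dimension counts *)

Section CurveVanishing.
Variables (O p U V : nat -> R -> Prop) (s0 s1 : R) (j1 jU h g cU B : nat).
Hypotheses (gO : graded O) (gp : graded p) (gU : graded U) (gV : graded V).
Hypotheses (Os0 : O 1%N s0) (Os1 : O 1%N s1) (ps0 : ~ p 1%N s0) (ps1 : ~ p 1%N s1).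
Hypothesis mulO : forall i j x y, O i x -> O j y -> O (i + j)%N (x * y).
Hypothesis mulp : forall i j x y, O i x -> p j y -> p (i + j)%N (x * y).
Hypothesis mulU : forall i j x y, O i x -> U j y -> U (i + j)%N (x * y).
Hypothesis mulV : forall i j x y, O i x -> V j y -> V (i + j)%N (x * y).
Hypothesis mulpU : forall i j x y, p i x -> U j y -> V (i + j)%N (x * y).
Hypothesis VU : forall j x, V j x -> U j x.
Hypothesis pO : forall j x, p j x -> O j x.
Hypothesis primeV : forall i j x y, O i x -> U j y -> V (i + j)%N (x * y) -> p i x \/ V j y.
Hypothesis genO : forall j u, (j1 <= j)%N -> O j.+1 u ->
  exists a b, [/\ O j a, O j b & p j.+1 (u - (s0 * a + s1 * b))].
Hypothesis genU : forall j u, (jU <= j)%N -> U j.+1 u ->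
  exists a b, [/\ U j a, U j b & V j.+1 (u - (s0 * a + s1 * b))].
Hypothesis dimO : forall j, (jU <= j)%N ->
  exists2 k, dim_ge (O j) (p j) k & (k + g = h * j + 1)%N.
Hypothesis dimU : forall j, (jU <= j)%N -> dim_le (U j) (V j) (h * j + cU).
Hypothesis dimU' : forall j, (jU <= j)%N -> dim_ge (U j) (V j) (h * j + B).

Let s0V j x : V j x -> V j.+1 (s0 * x). Proof. exact: (mulV Os0). Qed.
Let s1V j x : V j x -> V j.+1 (s1 * x). Proof. exact: (mulV Os1). Qed.
Let s0U j x : U j x -> U j.+1 (s0 * x). Proof. exact: (mulU Os0). Qed.
Let s1U j x : U j x -> U j.+1 (s1 * x). Proof. exact: (mulU Os1). Qed.

Lemma cancelV s n j x : O 1%N s -> ~ p 1%N s -> U j x -> V (n + j)%N (s ^+ n * x) -> V j x.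
Proof.
move=> Os ps; elim: n j x => [|n IH] j x Ux; first by rewrite expr0 mul1r.
rewrite exprS -mulrA addSn => /(primeV Os)[|//|Vx].
  exact: (pencilX n (fun i y => @mulU 1 i s y Os) Ux).
exact: IH.
Qed.

(** Dictionary: O/p is the homogeneous coordinate ring of a curve of degree h and genus g, and U/V
    behaves like a line bundle on it whose dimension in degree j is at least h j + B. If the
    dimension at least doubled at each passage from k to 2k + j0, its excess over h k + B would grow
    without bound because h j0 < B, against [dimU]. *)
Lemma pencil_dim j0 k0 : (h * j0 < B)%N -> exists k d, [/\ (k0 <= k)%N, dim_ge (U k) (V k) d
  & dim_le (U (k + (k + j0))%N) (V (k + (k + j0))%N) (d + d).-1 /\ (0 < d)%N].
Proof.
move=> hB; apply: NNPP => H.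
suff: forall e k, (jU <= k)%N -> (k0 <= k)%N -> exists2 k', (k <= k')%N & dim_ge (U k') (V k') (h * k' + B + e).
  move/(_ (cU + 1)%N (maxn jU k0) (leq_maxl _ _) (leq_maxr _ _)) => [k' kk' Hge].
  have jk : (jU <= k')%N by lia.
  by have := dim_ge_le Hge (dimU jk); lia.
elim=> [|e IH] k jk kk; first by exists k => //; rewrite addn0; apply: dimU'.
have [k' kk' Hk'] := IH k jk kk; exists (k' + (k' + j0))%N; first by lia.
have jk2 : (jU <= k' + (k' + j0))%N by lia.
have [d [_ Hge Hle]] := dim_exact (dimU jk2).
apply: dim_ge_mono Hge _; rewrite leqNgt; apply/negP => Hd.
apply: H; exists k', (h * k' + B + e)%N; split=> //; first by lia.
split; last by lia.
apply: dim_le_mono Hle _; move: Hd; rewrite !mulnDr; lia.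
Qed.

(** For n = k + j0, the spaces s1^n U_k and s0^n U_k are too large to be independent in degree 2k +
    j0. A dependence is a nonzero section a / s0^n = b / s1^n of U twisted by -j0. *)
Lemma pencil_pair j0 k0 : (h * j0 < B)%N -> exists k a b, [/\ (k0 <= k)%N, U k a, U k b,
  ~ V k a & V (k + (k + j0))%N (s1 ^+ (k + j0) * a - s0 ^+ (k + j0) * b)].
Proof.
move=> hB; have [k [d [kk [e Ue He] [Hle d0]]]] := pencil_dim k0 hB; set n := (k + j0)%N in Hle *.
have kn : (k + n = n + k)%N by rewrite addnC.
have [||c ci Hc] := @dim_le_dep _ _ _ _ _ (d + d)%N (fun i => match split i with
   inl j => s1 ^+ n * e j | inr j => s0 ^+ n * e j end) Hle.
- by lia.
- by move=> i; rewrite kn; case: split => j; apply: pencilX.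
move: Hc; rewrite big_split_ord /=.
under eq_bigr => j _ do rewrite (unsplitK (inl j : 'I_d + 'I_d)) scalerAr.
under [X in _ + X]eq_bigr => j _ do rewrite (unsplitK (inr j : 'I_d + 'I_d)) scalerAr.
rewrite -!mulr_sumr; set a := \sum_i _; set b := \sum_i _ => Hab.
have Ua : U k a by apply: subspace_comb.
have Ub : U k b by apply: subspace_comb.
exists k, a, (- b); split=> //; [exact: subspaceN| |by rewrite mulrN opprK].
move=> Va.
have Vb : V k b.
  apply: (@cancelV s0 n) => //; rewrite -kn.
  rewrite -(addrK (s1 ^+ n * a) (_ * b)) [_ * b + _]addrC; apply: subspaceB => //.
  by rewrite kn; apply: pencilX.
have c1 := He _ Va; have c2 := He _ Vb.
by case: ci => i; rewrite -[i]splitK; case: split => j /=; rewrite ?c1 ?c2 eqxx.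
Qed.

(** A section a / s0^n of U twisted by -j1 embeds O/p, twisted by j1, into U/V with cokernel of
    bounded dimension. The cokernel is split by [pencil_bounded]; the remaining error comes from O/p
    in degree 2k + j1, where the pencil generates enough to split it. *)
Lemma curve_vanishing : (h * j1 < B)%N -> exists k0, forall k u, (k0 <= k)%N -> U (k + k)%N u ->
  exists a b, [/\ U k a, U k b & V (k + k)%N (u - (s0 ^+ k * a + s1 ^+ k * b))].
Proof.
move=> hB; have [k [a [b [_ Ua Ub Va Vab]]]] := pencil_pair 0 hB; set n := (k + j1)%N in Vab *.
have osplit := @pencil_split O p s0 s1 j1 gO gp (fun i y => @mulO 1 i s0 y Os0)
  (fun i y => @mulO 1 i s1 y Os1) (fun i y => @mulp 1 i s0 y Os0)
  (fun i y => @mulp 1 i s1 y Os1) genO.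
(* [W] is the image of x |-> a x / s0^n, enlarged by V. *)
pose W j u := U j u /\ exists2 x, O (j + j1)%N x & V (n + j)%N (s0 ^+ n * u - a * x).
(* If x = s0^n x0 + s1^n x1, then x0 a + x1 b plays the role of a x / s0^n, because s1^n a = s0^n b
   modulo V. *)
have lift_x j x : (n + n <= j)%N -> O (j + j1)%N x -> exists2 u, U j u & V (n + j)%N (s0 ^+ n * u - a * x).
  move=> nj Ox; have Ex : (j + j1 = (j + j1 - n - n) + n + n)%N by lia.
  have [||x0 [x1 [Ox0 Ox1 px]]] := osplit (j + j1 - n - n)%N n n x.
  - by rewrite /n; lia.
  - by rewrite -Ex.
  have E2 : (j + j1 - n - n + n + k = j)%N by rewrite /n; lia.
  exists (x0 * a + x1 * b).
    by rewrite -E2; apply: subspaceD => //; apply: mulU.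
  have -> : s0 ^+ n * (x0 * a + x1 * b) - a * x =
     - (x1 * (s1 ^+ n * a - s0 ^+ n * b)) - (x - (s0 ^+ n * x0 + s1 ^+ n * x1)) * a by ring.
  apply: subspaceB => //; first apply: subspaceN => //.
    by have := mulV Ox1 Vab; congr (V _ _); rewrite /n; lia.
  by have := mulpU px Ua; congr (V _ _); rewrite /n; lia.
have gW : graded W.
  move=> j; split=> [|x y [Ux [x' Ox' Vx]] [Uy [y' Oy' Vy]]|c x [Ux [x' Ox' Vx]]].
  - split; first by have [] := gU j.
    exists 0; first by have [] := gO (j + j1).
    by rewrite !mulr0 subrr; have [] := gV (n + j).
  - split; first exact: subspaceD.
    exists (x' + y'); first exact: subspaceD.
    by rewrite !mulrDr opprD addrACA; apply: subspaceD.
  - split; first exact: subspaceZ.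
    exists (c *: x'); first exact: subspaceZ.
    by rewrite -!scalerAr -scalerBr; apply: subspaceZ.
have VW j x : V j x -> W j x.
  move=> Vx; split; first exact: VU.
  by exists 0; [have [] := gO (j + j1)|rewrite mulr0 subr0; apply: pencilX].
have sW s j x : O 1%N s -> W j x -> W j.+1 (s * x).
  move=> Os [Ux [x' Ox' Vx]]; split; first exact: (mulU Os Ux).
  exists (s * x'); first exact: (mulO Os Ox').
  rewrite addnS (mulrCA _ s) (mulrCA a) -mulrBr; exact: (mulV Os Vx).
pose jm := maxn jU (n + n).
(* U/W has bounded dimension: the upper bound for U/V and the lower bound for W/V have the same
   slope h, and their difference is at most cU + g. *)
have [j3 Hj3] : exists j3, forall j m u, (j3 <= j)%N -> U (j + m)%N u ->
  exists a b, [/\ U j a, U j b & W (j + m)%N (u - (s0 ^+ m * a + s1 ^+ m * b))].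
  apply: (@pencil_bounded U W s0 s1 jm gU gW s0U s1U (fun j x => @sW s0 j x Os0)
    (fun j x => @sW s1 j x Os1) _ (cU + g)) => //.
  - move=> j u jj Uu; have [|a' [b' [Ua' Ub' Vu]]] := @genU j u _ Uu; first by lia.
    by exists a', b'; split=> //; apply: VW.
  - move=> j jj; have jj1 : (jU <= j + j1)%N by lia.
    have [d Hd Ed] := dimO jj1.
    apply: (@dim_le_sub _ _ _ _ _ _ d _ _ (@VW j)) => //; first by move=> x [].
      apply: (@dim_le_mono _ _ _ _ (h * j + cU)); first by apply: dimU; lia.
      by move: Ed; rewrite mulnDr; lia.
    apply: (dim_ge_rel (rel := fun x u => O (j + j1)%N x /\ V (n + j)%N (s0 ^+ n * u - a * x))) Hd.
    - move=> I r c f f' Hf; split; first by apply: subspace_comb => // i; have [] := Hf i.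
      rewrite !mulr_sumr -sumrB; apply: subspace_sum => // i _.
      by rewrite -!scalerAr -scalerBr; apply: subspaceZ => //; have [] := Hf i.
    - move=> x Ox; have [|u Uu Vu] := lift_x j x _ Ox; first by lia.
      by exists u => //; split=> //; exists x.
    - move=> x u [Ox Vux] Vu.
      have Vax : V ((j + j1) + k)%N (x * a).
        have -> : x * a = s0 ^+ n * u - (s0 ^+ n * u - a * x) by ring.
        have -> : (j + j1 + k = n + j)%N by rewrite /n; lia.
        by apply: subspaceB => //; apply: pencilX.
      by have [] := primeV Ox Ua Vax.
exists (j3 + n + n)%N => k' u kk Uu.
have [|a' [b' [Ua' Ub' [_ [x Ox Vx]]]]] := Hj3 k' k' u _ Uu; first by lia.
have [||x0 [x1 [Ox0 Ox1 px]]] := osplit j1 k' k' x.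
- by [].
- by move: Ox; congr (O _ _); lia.
rewrite (addnC j1) in Ox0 Ox1.
have [|u0 Uu0 Vu0] := lift_x k' x0 _ Ox0; first by lia.
have [|u1 Uu1 Vu1] := lift_x k' x1 _ Ox1; first by lia.
exists (a' + u0), (b' + u1); split; try exact: subspaceD.
set w := u - (s0 ^+ k' * a' + s1 ^+ k' * b') in Vx.
have -> : u - (s0 ^+ k' * (a' + u0) + s1 ^+ k' * (b' + u1)) = w - (s0 ^+ k' * u0 + s1 ^+ k' * u1).
  by rewrite /w; ring.
apply: (@cancelV s0 n) => //.
  apply: subspaceB => //; last by apply: subspaceD => //; apply: pencilX.
  by apply: subspaceB => //; apply: subspaceD => //; apply: pencilX.
have -> : s0 ^+ n * (w - (s0 ^+ k' * u0 + s1 ^+ k' * u1)) = (s0 ^+ n * w - a * x)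
  - (s0 ^+ k' * (s0 ^+ n * u0 - a * x0) + s1 ^+ k' * (s0 ^+ n * u1 - a * x1))
  + (x - (s0 ^+ k' * x0 + s1 ^+ k' * x1)) * a by ring.
apply: subspaceD => //; first apply: subspaceB => //.
  by apply: subspaceD => //; [have := pencilX k' s0V Vu0|have := pencilX k' s1V Vu1];
    congr (V _ _); lia.
by have := mulpU px Ua; congr (V _ _); rewrite /n; lia.
Qed.
End CurveVanishing.
End Pencil.

(** * Bihomogeneous polynomials *)

Section Evaluation.
Variables (K : fieldType) (N : nat).
Implicit Types (f g : {mpoly K[N]}) (z : 'rV[K]_N) (Z : 'rV[K]_N -> Prop).

Lemma evalp0 z : evalp 0 z = 0. Proof. exact: meval0. Qed.
Lemma evalp1 z : evalp 1 z = 1. Proof. exact: meval1. Qed.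
Lemma evalpD f g z : evalp (f + g) z = evalp f z + evalp g z. Proof. exact: mevalD. Qed.
Lemma evalpN f z : evalp (- f) z = - evalp f z. Proof. exact: mevalN. Qed.
Lemma evalpB f g z : evalp (f - g) z = evalp f z - evalp g z. Proof. exact: mevalB. Qed.
Lemma evalpM f g z : evalp (f * g) z = evalp f z * evalp g z. Proof. exact: mevalM. Qed.
Lemma evalpC c z : evalp c%:MP z = c. Proof. exact: mevalC. Qed.
Lemma evalpZ c f z : evalp (c *: f) z = c * evalp f z. Proof. exact: mevalZ. Qed.
Lemma evalpXU i z : evalp 'X_i z = z 0 i. Proof. exact: mevalXU. Qed.
Lemma evalpX f k z : evalp (f ^+ k) z = evalp f z ^+ k. Proof. exact: rmorphXn. Qed.
Lemma evalp_sum (I : Type) (r : seq I) (P : pred I) (F : I -> {mpoly K[N]}) z :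
  evalp (\sum_(i <- r | P i) F i) z = \sum_(i <- r | P i) evalp (F i) z.
Proof. exact: raddf_sum. Qed.

Definition evalpE := (evalp0, evalp1, evalpD, evalpN, evalpB, evalpM, evalpC, evalpZ, evalpXU, evalpX).

Lemma vanishes_ideal Z : ideal (fun f => vanishes f Z).
Proof.
split=> [z _|f g Hf Hg z Zz|a f Hf z Zz]; rewrite !evalpE ?Hf ?Hg ?addr0 ?mulr0 //.
Qed.

Lemma not_vanishes f Z : ~ vanishes f Z -> exists2 z, Z z & evalp f z != 0.
Proof.
move=> H; apply: NNPP => H'; apply: H => z Zz.
by apply/eqP; apply/negPn/negP => fz; apply: H'; exists z.
Qed.

Lemma evalp_neq0_vanishes f Z z : Z z -> evalp f z != 0 -> ~ vanishes f Z.
Proof. by move=> Zz /eqP fz /(_ _ Zz). Qed.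

Lemma point_ideal z : ideal (fun f => evalp f z = 0).
Proof.
split=> [|f g Hf Hg|a f Hf]; rewrite !evalpE ?Hf ?Hg ?addr0 ?mulr0 //.
Qed.

Lemma subspace_ideal (J : {mpoly K[N]} -> Prop) : ideal J -> subspace J.
Proof. by move=> [J0 JD JM]; split=> // c x Jx; rewrite -mul_mpolyC; apply: JM. Qed.

Lemma subspace_cap (M : lmodType K) (U V : M -> Prop) :
  subspace U -> subspace V -> subspace (fun x => U x /\ V x).
Proof.
move=> [U0 UD UZ] [V0 VD VZ]; split=> [//|x y [? ?] [? ?]|c x [? ?]]; split; auto.
Qed.

End Evaluation.

Definition ydeg n m (mu : 'X_{1.. n + m.+1}) : nat := (\sum_(j < m.+1) mu (rshift n j))%N.

Lemma ydeg0 n m : @ydeg n m 0%MM = 0%N.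
Proof. by rewrite /ydeg big1 // => j _; rewrite mnm0E. Qed.
Lemma ydegD n m : {morph @ydeg n m : m1 m2 / (m1 + m2)%MM >-> (m1 + m2)%N}.
Proof. by move=> a b; rewrite /ydeg -big_split; apply: eq_bigr => j _; rewrite mnmDE. Qed.
HB.instance Definition _ n m := isMeasure.Build (n + m.+1) (@ydeg n m) (@ydeg0 n m) (@ydegD n m).

Section Grading.
Variables (K : fieldType) (n m : nat).
Local Notation N := (n + m.+1)%N.
Local Notation R := {mpoly K[N]}.
Implicit Types (f g : R) (z : 'rV[K]_N) (Z : 'rV[K]_N -> Prop).

Lemma yhomogE d f : yhomog d f = (f \is d.-homog for @ydeg n m).
Proof. by []. Qed.

Definition hcomp d f : R := pihomog (@ydeg n m) d f.

Lemma yhomog0 d : yhomog d (0 : R). Proof. by rewrite yhomogE dhomog0. Qed.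
Lemma yhomogD d f g : yhomog d f -> yhomog d g -> yhomog d (f + g).
Proof. by rewrite !yhomogE; apply: dhomogD. Qed.
Lemma yhomogZ d c f : yhomog d f -> yhomog d (c *: f).
Proof. by rewrite !yhomogE; apply: dhomogZ. Qed.
Lemma yhomogM d e f g : yhomog d f -> yhomog e g -> yhomog (d + e) (f * g).
Proof. by rewrite !yhomogE; apply: dhomogM. Qed.
Lemma yhomogMn d k f : yhomog d f -> yhomog (k * d) (f ^+ k).
Proof. by rewrite mulnC !yhomogE; apply: dhomogMn. Qed.
Lemma yhomogC c : yhomog 0 (c%:MP : R).
Proof.
rewrite -[c%:MP]mulr1 mul_mpolyC; by apply: yhomogZ; rewrite yhomogE dhomog1.
Qed.
Lemma yhomogx i : yhomog 0 ('X_(lshift m.+1 i) : R).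
Proof.
rewrite yhomogE dhomogX /= /ydeg big1 // => j _; rewrite mnm1E.
by rewrite eq_lrshift.
Qed.
Lemma yhomogy j : yhomog 1 ('X_(rshift n j) : R).
Proof.
rewrite yhomogE dhomogX /= /ydeg (bigD1 j) //= mnm1E eqxx big1 // => i /negPf ij.
by rewrite mnm1E (inj_eq (@rshift_inj _ _)) eq_sym ij.
Qed.
Lemma yhomog_subspace d : subspace (fun f : R => yhomog d f).
Proof.
split=> [|x y|c x]; [exact: yhomog0|exact: yhomogD|exact: yhomogZ].
Qed.

Lemma hcompP d f : yhomog d (hcomp d f). Proof. by rewrite yhomogE; apply: pihomogP. Qed.
Lemma hcomp_id d f : yhomog d f -> hcomp d f = f. Proof. by rewrite yhomogE; apply: pihomog_dE. Qed.
Lemma hcomp_ne d e f : yhomog d f -> d != e -> hcomp e f = 0.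
Proof. by rewrite yhomogE => Hf de; apply: pihomog_ne0 de Hf. Qed.
Lemma hcompD d f g : hcomp d (f + g) = hcomp d f + hcomp d g. Proof. exact: pihomogD. Qed.
Lemma hcompB d f g : hcomp d (f - g) = hcomp d f - hcomp d g. Proof. exact: pihomogB. Qed.
Lemma hcomp_sum0 d (I : Type) (r : seq I) (P : pred I) (F : I -> R) :
  hcomp d (\sum_(i <- r | P i) F i) = \sum_(i <- r | P i) hcomp d (F i).
Proof. exact: raddf_sum. Qed.

Lemma hcomp_partition f : exists k0, forall k, (k0 <= k)%N -> f = \sum_(d < k) hcomp d f.
Proof. by exists (mmeasure (@ydeg n m) f) => k; apply: pihomog_partitionE. Qed.

Lemma hcompM d e f g : yhomog d g -> hcomp (d + e) (g * f) = g * hcomp e f.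
Proof.
move=> Hg; have [k0 Hk] := hcomp_partition f.
have {1}-> := Hk (maxn k0 e.+1) (leq_maxl _ _).
rewrite mulr_sumr hcomp_sum0.
have he : (e < maxn k0 e.+1)%N by rewrite leq_max leqnn orbT.
rewrite (bigD1 (Ordinal he)) //= hcomp_id ?big1 ?addr0 => [//|i ie|].
  apply: (@hcomp_ne (d + i)); first by apply: yhomogM => //; apply: hcompP.
  by rewrite eqn_add2l.
by apply: yhomogM => //; apply: hcompP.
Qed.

Lemma hcompM_lt d e f g : yhomog d g -> (e < d)%N -> hcomp e (g * f) = 0.
Proof.
move=> Hg ed; have [k0 Hk] := hcomp_partition f.
rewrite (Hk k0 (leqnn _)) mulr_sumr hcomp_sum0 big1 // => i _.
apply: (@hcomp_ne (d + i)); first by apply: yhomogM => //; apply: hcompP.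
by rewrite neq_ltn orbC (leq_trans ed) // leq_addr.
Qed.

Definition yscale (c : K) z : 'rV[K]_N := row_mx (lsubmx z) (c *: rsubmx z).

Lemma yscale_l c z i : yscale c z 0 (lshift m.+1 i) = z 0 (lshift m.+1 i).
Proof. by rewrite row_mxEl mxE. Qed.
Lemma yscale_r c z j : yscale c z 0 (rshift n j) = c * z 0 (rshift n j).
Proof. by rewrite row_mxEr !mxE. Qed.
Lemma yscaleA c c' z : yscale c (yscale c' z) = yscale (c * c') z.
Proof. by rewrite /yscale row_mxKl row_mxKr scalerA. Qed.
Lemma yscale1 z : yscale 1 z = z.
Proof. by rewrite /yscale scale1r hsubmxK. Qed.
Lemma rsub_yscale c z : rsubmx (yscale c z) = c *: rsubmx z. Proof. exact: row_mxKr. Qed.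

Lemma evalp_yscale d f c z : yhomog d f -> evalp f (yscale c z) = c ^+ d * evalp f z.
Proof.
rewrite yhomogE => /dhomogP Hf; rewrite /evalp !mevalE mulr_sumr; apply: eq_big_seq => mu /Hf Hmu.
rewrite mulrCA; congr (_ * _); rewrite !big_split_ord /=.
rewrite mulrCA; congr (_ * _); first by apply: eq_bigr => i _; rewrite yscale_l.
rewrite -Hmu /= /ydeg -prodrXr -big_split; apply: eq_bigr => j _.
by rewrite yscale_r exprMn.
Qed.

Definition cone Z : Prop := forall z c, Z z -> c != 0 -> Z (yscale c z).

End Grading.

(** * Closed subsets of A^n x P^m and their ideals *)

Section ProjectiveSets.
Variables (K : closedFieldType) (n m : nat).
Local Notation N := (n + m.+1)%N.
Local Notation R := {mpoly K[N]}.
Implicit Types (f g : R) (z : 'rV[K]_N) (Z : 'rV[K]_N -> Prop).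

(** Along the punctured line through z, f is a polynomial in c whose coefficients are the values of
    its components; an extra factor X covers c = 0. *)
Lemma hcomp_vanish_line f z : (forall c : K, c != 0 -> evalp f (yscale c z) = 0) ->
  forall d, evalp (hcomp d f) z = 0.
Proof.
move=> H d; have [k0 Hk] := hcomp_partition f.
pose k := maxn k0 d.+1; have Ef := Hk k (leq_maxl _ _).
pose q := \poly_(e < k) evalp (hcomp e f) z.
have qc (c : K) : q.[c] = evalp f (yscale c z).
  rewrite horner_poly [in RHS]Ef evalp_sum; apply: eq_bigr => e _.
  by rewrite (evalp_yscale _ _ (hcompP _ _)) mulrC.
have q0 : q = 0.
  have /eqP : q * 'X = 0.
    apply/eqP/negPn/negP => /ex_nonroot[t]; rewrite hornerM hornerX.
    by case: (eqVneq t 0) => [->|t0]; rewrite ?mulr0 ?eqxx // qc H // mul0r eqxx.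
  by rewrite mulf_eq0 polyX_eq0 orbF => /eqP.
have : q`_d = 0 by rewrite q0 coef0.
by rewrite coef_poly /k leq_max leqnn orbT.
Qed.

Lemma vanishes_hcomp Z d f : cone Z -> vanishes f Z -> vanishes (hcomp d f) Z.
Proof. by move=> HZ Hf z Zz; apply: hcomp_vanish_line => c c0; apply/Hf/HZ. Qed.

Lemma vanishes_hcomps Z f : (forall d, vanishes (hcomp d f) Z) -> vanishes f Z.
Proof.
move=> H z Zz; have [k0 Hk] := hcomp_partition f.
by rewrite (Hk k0 (leqnn _)) evalp_sum big1 // => d _; apply: H.
Qed.

Lemma proj_closedP Z : closed_for (@proj_closure K n m) Z ->
  forall z, rsubmx z != 0 -> (forall d f, yhomog d f -> vanishes f Z -> evalp f z = 0) -> Z z.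
Proof. by move=> HZ z z0 H; apply/HZ. Qed.

Lemma proj_closed_neq0 Z z : closed_for (@proj_closure K n m) Z -> Z z -> rsubmx z != 0.
Proof. by move=> HZ /HZ[]. Qed.

Lemma proj_closed_cone Z : closed_for (@proj_closure K n m) Z -> cone Z.
Proof.
move=> HZ z c Zz c0; apply: (proj_closedP HZ).
  rewrite rsub_yscale scaler_eq0 (negPf c0) /=; exact: (proj_closed_neq0 HZ Zz).
by move=> d f Hf Zf; rewrite (evalp_yscale _ _ Hf) Zf // mulr0.
Qed.

Lemma proj_closure_closed Z : closed_for (@proj_closure K n m) (@proj_closure K n m Z).
Proof.
move=> z; split=> [[z0 H]|H]; last by split=> [|d f Hf Hf']; [case: H|apply: Hf'].
by split=> [//|d f Hf Zf]; apply: H (Hf) _ => w [_ Hw]; exact: Hw Hf Zf.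
Qed.

Lemma sub_proj_closure Z z : Z z -> rsubmx z != 0 -> proj_closure Z z.
Proof. by move=> Zz z0; split=> // d f _; apply. Qed.

Lemma proj_closed_zeros Z (F : nat -> R -> Prop) : closed_for (@proj_closure K n m) Z ->
  (forall d f, F d f -> yhomog d f) ->
  closed_for (@proj_closure K n m) (fun z => Z z /\ forall d f, F d f -> evalp f z = 0).
Proof.
move=> HZ HF z; split=> [[z0 H]|[Zz H]]; last first.
  by apply: sub_proj_closure; [|exact: (proj_closed_neq0 HZ Zz)].
split=> [|d f Ff]; last by apply: (H d f (HF _ _ Ff)) => w [_ Hw]; exact: Hw Ff.
by apply: (proj_closedP HZ) => // d f Hf Zf; apply: H Hf _ => w [Zw _]; apply: Zf.
Qed.

(** Closed sets are cut out by homogeneous polynomials, yet primeness is obtained for all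
    polynomials: on each line of the cone a product of two one-variable polynomials vanishes, so all
    components of f or all components of g vanish there. *)
Lemma irreducible_prime Z : closed_for (@proj_closure K n m) Z ->
  irreducible_for (@proj_closure K n m) Z -> prime_ideal (fun f => vanishes f Z).
Proof.
move=> HZ [[z0 Zz0] irr]; split; first exact: vanishes_ideal.
  by move/(_ _ Zz0)/eqP; rewrite evalp1 oner_eq0.
move=> f g Hfg; pose Zf h z := Z z /\ forall d e, (exists2 d', d = d' & e = hcomp d' h) -> evalp e z = 0.
have cl h : closed_for (@proj_closure K n m) (Zf h).
  by apply: proj_closed_zeros => // d e [d' -> ->]; apply: hcompP.
have sub h : psub Z (Zf h) -> vanishes h Z.
  move=> H; apply: vanishes_hcomps => d z /H[_ Hz].
  by apply: (Hz d (hcomp d h)); exists d.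
have Hline z : Z z -> (forall d, evalp (hcomp d f) z = 0) \/ (forall d, evalp (hcomp d g) z = 0).
  move=> Zz.
  have [k1 Hk1] := hcomp_partition f; have [k2 Hk2] := hcomp_partition g.
  pose k := maxn k1 k2.
  pose q h := \poly_(e < k) evalp (hcomp e h) z.
  have qc h (c : K) : h = \sum_(d < k) hcomp d h -> (q h).[c] = evalp h (yscale c z).
    move=> Eh; rewrite horner_poly [in RHS]Eh evalp_sum; apply: eq_bigr => e _.
    by rewrite (evalp_yscale _ _ (hcompP _ _)) mulrC.
  have /eqP : q f * q g * 'X = 0.
    apply/eqP/negPn/negP => /ex_nonroot[t]; rewrite !hornerM hornerX.
    case: (eqVneq t 0) => [->|t0]; first by rewrite mulr0 eqxx.
    rewrite !qc -?evalpM ?Hfg ?mul0r ?eqxx //; first exact: proj_closed_cone.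
      by apply: Hk2; apply: leq_maxr.
    by apply: Hk1; apply: leq_maxl.
  rewrite mulf_eq0 polyX_eq0 orbF mulf_eq0 => /orP[]/eqP q0; [left|right] => d.
    apply: hcomp_vanish_line => c _; rewrite -qc ?q0 ?horner0 //.
    by apply: Hk1; apply: leq_maxl.
  apply: hcomp_vanish_line => c _; rewrite -qc ?q0 ?horner0 //.
  by apply: Hk2; apply: leq_maxr.
have [|/sub|/sub] := irr (Zf f) (Zf g) (cl f) (cl g); [|by left|by right].
move=> z Zz; case: (Hline z Zz) => H; [left|right]; split=> // d e [d' _ ->]; exact: H.
Qed.

Lemma prime_irreducible Z : (exists z, Z z) -> prime_ideal (fun f => vanishes f Z) ->
  irreducible_for (@proj_closure K n m) Z.
Proof.
move=> Zne [_ _ PM]; split=> // A B cA cB H; apply: NNPP => /not_or_and[nA nB].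
have sep (C : 'rV[K]_N -> Prop) : closed_for (@proj_closure K n m) C -> ~ psub Z C ->
    (forall z, Z z -> rsubmx z != 0) -> exists2 f, vanishes f C & ~ vanishes f Z.
  move=> cC nC Zn; apply: NNPP => H'; apply: nC => z Zz; apply: (proj_closedP cC); first exact: Zn.
  move=> d f Hf Cf; apply: NNPP => fz; apply: H'; exists f => // /(_ _ Zz).
  exact: fz.
have Zn z : Z z -> rsubmx z != 0 by case/H; apply: proj_closed_neq0.
have [f Af Zf] := sep A cA nA Zn; have [g Bg Zg] := sep B cB nB Zn.
case: (PM f g) => // z /H[/Af|/Bg]; rewrite evalpM => ->; rewrite ?mul0r ?mulr0 //.
Qed.

Lemma proj_nullstellensatz (J : R -> Prop) : ideal J ->
  (forall z, (forall f, J f -> evalp f z = 0) -> rsubmx z = 0) ->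
  exists k, forall j, J ('X_(rshift n j) ^+ k).
Proof.
move=> HJ H.
have Hj (j : 'I_m.+1) : exists k, J ('X_(rshift n j) ^+ k).
  apply: nullstellensatz => // v Hv; rewrite mevalXU.
  have := H (\row_i v i) _; rewrite /evalp => /(_ _)/matrixP/(_ 0 j); rewrite !mxE; apply.
  by move=> f /Hv <-; apply: meval_eq => i; rewrite mxE.
have [k Hk] := choice _ Hj; exists (\sum_j k j)%N => j.
by rewrite (bigD1 j) //= exprD; apply: idealMr.
Qed.

End ProjectiveSets.

(** * Power series solutions *)

Lemma mmap_mul (K L : comNzRingType) (iota : {rmorphism K -> L}) N (h : 'I_N -> L) (f g : {mpoly K[N]}) :
  mmap iota h (f * g) = mmap iota h f * mmap iota h g.
Proof. exact: (rmorphM (mmap iota h)). Qed.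

Lemma mmap_sum (K L : comNzRingType) (iota : {rmorphism K -> L}) N (h : 'I_N -> L)
    (I : Type) (r : seq I) (P : pred I) (F : I -> {mpoly K[N]}) :
  mmap iota h (\sum_(i <- r | P i) F i) = \sum_(i <- r | P i) mmap iota h (F i).
Proof. exact: raddf_sum. Qed.

Section Substitution.
Variables (K L : fieldType) (iota : {rmorphism K -> L}) (N : nat).
Implicit Types (f g : {mpoly K[N]}) (b : 'I_N -> nat -> L).
Local Notation sc := (subst_coef iota).
Local Notation trunc b M f := (mmap (polyC \o iota) (fun i => \poly_(l < M) b i l) f).

Lemma scE f b k : sc f b k = (trunc b k.+1 f)`_k. Proof. by []. Qed.

Lemma trunc_eq b M M' f k : (k < M)%N -> (k < M')%N -> (trunc b M f)`_k = (trunc b M' f)`_k.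
Proof.
move: f k; apply: mpoly_ring_ind => [c|i|f g IHf IHg|f g IHf IHg] k kM kM'.
- by rewrite !mmapC.
- by rewrite !mmapX !mmap1U !coef_poly kM kM'.
- by rewrite !mmapD !coefD IHf ?IHg.
- rewrite !rmorphM /= !coefM; apply: eq_bigr => j _.
  have jk : (j <= k)%N by rewrite -ltnS.
  rewrite IHf ?IHg //; lia.
Qed.

Lemma scC c b k : sc c%:MP b k = if k == 0%N then iota c else 0.
Proof. by rewrite scE mmapC /= coefC. Qed.
Lemma scX i b k : sc 'X_i b k = b i k.
Proof. by rewrite scE mmapX mmap1U coef_poly ltnSn. Qed.
Lemma scD f g b k : sc (f + g) b k = sc f b k + sc g b k.
Proof. by rewrite !scE mmapD coefD. Qed.
Lemma scN f b k : sc (- f) b k = - sc f b k.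
Proof. by rewrite !scE mmapN coefN. Qed.
Lemma scB f g b k : sc (f - g) b k = sc f b k - sc g b k.
Proof. by rewrite scD scN. Qed.
Lemma scM f g b k : sc (f * g) b k = \sum_(j < k.+1) sc f b j * sc g b (k - j)%N.
Proof.
rewrite scE rmorphM /= coefM; apply: eq_bigr => j _; have jk : (j <= k)%N by rewrite -ltnS.
by congr (_ * _); rewrite scE; apply: trunc_eq; lia.
Qed.

Lemma sc_mmap f b : sc f b 0%N = mmap iota (fun i => b i 0%N) f.
Proof.
move: f; apply: mpoly_ring_ind => [c|i|f g IHf IHg|f g IHf IHg].
- by rewrite scC mmapC.
- by rewrite scX mmapX mmap1U.
- by rewrite scD IHf IHg mmapD.
- by rewrite scM big_ord1 subn0 IHf IHg mmap_mul.
Qed.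

Lemma scM_low f g b p q : (forall k, (k < p)%N -> sc f b k = 0) ->
  (forall k, (k < q)%N -> sc g b k = 0) -> forall k, (k < p + q)%N -> sc (f * g) b k = 0.
Proof.
move=> Hf Hg k kpq; rewrite scM big1 // => j _.
case: (ltnP j p) => jp; first by rewrite Hf ?mul0r.
by rewrite Hg ?mulr0 //; have := ltn_ord j; lia.
Qed.

Lemma scM_lead f g b p q : (forall k, (k < p)%N -> sc f b k = 0) ->
  (forall k, (k < q)%N -> sc g b k = 0) -> sc (f * g) b (p + q)%N = sc f b p * sc g b q.
Proof.
move=> Hf Hg; have hp : (p < (p + q).+1)%N by lia.
rewrite scM (bigD1 (Ordinal hp)) //= addKn big1 ?addr0 // => j jp.
case: (ltnP j p) => jlp; first by rewrite Hf ?mul0r.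
have {}jp : (p < j)%N by rewrite ltn_neqAle jlp andbT; apply: contraNneq jp => E; apply/eqP/val_inj.
by rewrite Hg ?mulr0 //; have := ltn_ord j; lia.
Qed.

Lemma sc_min f b : ~ (forall k, sc f b k = 0) ->
  exists2 p, sc f b p != 0 & forall k, (k < p)%N -> sc f b k = 0.
Proof.
move=> H; have [|p [Hp minp]] := @ex_min_nat (fun k => sc f b k != 0).
  by apply: NNPP => H'; apply: H => k; apply/eqP; apply/negPn/negP => ?; apply: H'; exists k.
exists p => // k kp; apply/eqP; apply/negPn/negP => /minp; lia.
Qed.

Lemma sc_prime f g b : (forall k, sc (f * g) b k = 0) ->
  (forall k, sc f b k = 0) \/ (forall k, sc g b k = 0).
Proof.
move=> H; apply: NNPP => /not_or_and[/sc_min[p fp Hp] /sc_min[q gq Hq]].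
by have := H (p + q)%N; rewrite (scM_lead Hp Hq) => /eqP; rewrite mulf_eq0 (negPf fp) (negPf gq).
Qed.

Lemma sc_ideal b : prime_ideal (fun f => forall k, sc f b k = 0).
Proof.
split=> [|/(_ 0%N)|f g]; last exact: sc_prime; last first.
  by move/eqP; rewrite -mpolyC1 scC eqxx rmorph1 oner_eq0.
split=> [k|f g Hf Hg k|a f Hf k].
- by rewrite -mpolyC0 scC rmorph0 if_same.
- by rewrite scD Hf Hg addr0.
- by rewrite scM big1 // => j _; rewrite Hf mulr0.
Qed.

Lemma sc_agree f b b' k : (forall i l, (l <= k)%N -> b i l = b' i l) -> sc f b k = sc f b' k.
Proof.
move: f k; apply: mpoly_ring_ind => [c|i|f g IHf IHg|f g IHf IHg] k H.
- by rewrite !scC.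
- by rewrite !scX H.
- by rewrite !scD IHf ?IHg.
- rewrite !scM; apply: eq_bigr => j _; have jk : (j <= k)%N by rewrite -ltnS.
  by rewrite IHf ?IHg // => i l lj; apply: H; lia.
Qed.

Definition jet b M : 'I_(N * M) -> L :=
  fun l => mxvec (\matrix_(i < N, k < M) b i k) 0 l.

Lemma jetE b M (i : 'I_N) (k : 'I_M) : jet b (mxvec_index i k) = b i k.
Proof. by rewrite /jet mxvecE mxE. Qed.

Lemma jet_agree b b' M (P : {mpoly K[N * M]}) : (forall i l, (l < M)%N -> b i l = b' i l) ->
  mmap iota (jet b (M := M)) P = mmap iota (jet b' (M := M)) P.
Proof.
move=> H; rewrite /mmap; apply: eq_bigr => mu _; congr (_ * _); rewrite /mmap1.
by apply: eq_bigr => l _; case/mxvec_indexP: l => i k; rewrite !jetE H.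
Qed.

End Substitution.

(** The coefficient is one polynomial over K in the jet, the same for all extensions L. This makes
    conditions on coefficients of f(a(t)) closed conditions on arcs. *)
Lemma coef_poly_universal (K : fieldType) N (f : {mpoly K[N]}) M k : (k < M)%N ->
  exists C : {mpoly K[N * M]}, forall (L : fieldType) (iota : {rmorphism K -> L}) b,
    mmap iota (jet b (M := M)) C = subst_coef iota f b k.
Proof.
move: f k; apply: mpoly_ring_ind => [c|i|f g IHf IHg|f g IHf IHg] k kM.
- exists (if k == 0%N then c%:MP else 0) => L iota b; rewrite scC.
  by case: eqP => _; [rewrite mmapC|rewrite raddf0].
- exists 'X_(mxvec_index i (Ordinal kM)) => L iota b.
  by rewrite mmapX mmap1U jetE scX.
- have [C HC] := IHf _ kM; have [D HD] := IHg _ kM.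
  by exists (C + D) => L iota b; rewrite mmapD HC HD scD.
- have HC (j : 'I_k.+1) : exists CD : {mpoly K[N * M]} * {mpoly K[N * M]},
     forall (L : fieldType) (iota : {rmorphism K -> L}) b,
       mmap iota (jet b (M := M)) CD.1 = subst_coef iota f b j /\
       mmap iota (jet b (M := M)) CD.2 = subst_coef iota g b (k - j).
    have [|C HC] := IHf j; first by have := ltn_ord j; lia.
    have [|D HD] := IHg (k - j)%N; first by lia.
    by exists (C, D) => L iota b; split; [exact: HC|exact: HD].
  have [CD HCD] := choice _ HC.
  exists (\sum_(j < k.+1) (CD j).1 * (CD j).2) => L iota b.
  rewrite scM mmap_sum; apply: eq_bigr => j _.
  by have [E1 E2] := HCD j L iota b; rewrite mmap_mul E1 E2.
Qed.

Lemma jet_widen (K : fieldType) N M M' (P : {mpoly K[N * M]}) : (M <= M')%N ->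
  exists P' : {mpoly K[N * M']}, forall (L : fieldType) (iota : {rmorphism K -> L}) b,
    mmap iota (jet b (M := M')) P' = mmap iota (jet b (M := M)) P.
Proof.
move=> MM; move: P; apply: mpoly_ring_ind => [c|l|f g [f' Hf] [g' Hg]|f g [f' Hf] [g' Hg]].
- by exists c%:MP => L iota b; rewrite !mmapC.
- case/mxvec_indexP: l => i k; exists 'X_(mxvec_index i (widen_ord MM k)) => L iota b.
  by rewrite !mmapX !mmap1U !jetE.
- by exists (f' + g') => L iota b; rewrite !mmapD Hf Hg.
- by exists (f' * g') => L iota b; rewrite !mmap_mul Hf Hg.
Qed.

(** * Taylor expansion and Newton iteration *)

Section Taylor.
Variables (K : fieldType) (N : nat).
Implicit Types (f : {mpoly K[N]}) (z : 'rV[K]_N).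
Definition idK : {rmorphism K -> K} := idfun.
Local Notation sc := (subst_coef idK).

Lemma sc_eval f (b : 'I_N -> nat -> K) : sc f b 0%N = evalp f (\row_i b i 0%N).
Proof.
rewrite sc_mmap /evalp /meval /mmap; apply: eq_bigr => mu _; congr (_ * _).
by apply: eq_bigr => i _; rewrite mxE.
Qed.

Lemma mderivXU (i j : 'I_N) : ('X_i : {mpoly K[N]})^`M(j) = (i == j)%:R.
Proof.
rewrite mderivX mnm1E; case: eqP => [->|_]; last by rewrite scale0r.
have -> : (U_(j) - U_(j) = 0 :> 'X_{1..N})%MM by apply/mnmP => l; rewrite mnmBE mnm0E subnn.
by rewrite scale1r mpolyX0.
Qed.

(** Polynomial cofactors h_j take the place of higher derivatives, so the expansion can be used as
    an identity between elements of ideals. *)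
Lemma taylor f z : exists h : 'I_N -> {mpoly K[N]},
  f = (evalp f z)%:MP + \sum_j h j * ('X_j - (z 0 j)%:MP) /\
  forall j, evalp (h j) z = evalp f^`M(j) z.
Proof.
move: f; apply: mpoly_ring_ind => [c|i|f g [h [Ef Hh]] [h' [Eg Hh']]|f g [h [Ef Hh]] [h' [Eg Hh']]].
- exists (fun _ => 0); rewrite evalpC big1 ?addr0 => [|j _]; last by rewrite mul0r.
  by split=> // j; rewrite mderivC.
- exists (fun j => (i == j)%:R); rewrite evalpXU (bigD1 i) //= eqxx big1 => [|j /negPf ij].
    split=> [|j]; first by rewrite mul1r addr0 addrC subrK.
    by rewrite mderivXU.
  by rewrite eq_sym ij mul0r.
- exists (fun j => h j + h' j); rewrite evalpD mpolyCD; split=> [|j].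
    by under eq_bigr do rewrite mulrDl; rewrite big_split /= addrACA -Ef -Eg.
  by rewrite mderivD !evalpD Hh Hh'.
- exists (fun j => h j * g + (evalp f z)%:MP * h' j); rewrite evalpM mpolyCM; split=> [|j].
    under eq_bigr => j _ do rewrite mulrDl (mulrAC (h j)) -(mulrA _ (h' j)).
    rewrite big_split /= -mulr_suml -mulr_sumr.
    set S := \sum_j h j * _ in Ef *; set S' := \sum_j h' j * _ in Eg *.
    transitivity ((evalp f z)%:MP * ((evalp g z)%:MP + S') + S * g); last by ring.
    by rewrite -Eg -mulrDl -Ef.
  by rewrite mderivM !evalpE Hh Hh' addrC [X in X + _]mulrC addrC mulrC.
Qed.

(** A change of the series in degree k affects degree k of f(b) only through the linear term: a
    product of two changes has degree at least 2k > k. *)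
Lemma sc_taylor f (b b' : 'I_N -> nat -> K) k : (0 < k)%N ->
  (forall i l, (l < k)%N -> b i l = b' i l) ->
  sc f b k - sc f b' k = \sum_j evalp f^`M(j) (\row_i b i 0%N) * (b j k - b' j k).
Proof.
move=> k0 H; have ag h l : (l < k)%N -> sc h b l = sc h b' l.
  by move=> lk; apply: sc_agree => i l' ll; apply: H; lia.
move: f; apply: mpoly_ring_ind => [c|i|f g IHf IHg|f g IHf IHg].
- rewrite !scC gtn_eqF // subr0 big1 // => j _; by rewrite mderivC evalp0 mul0r.
- rewrite !scX (bigD1 i) //= big1 ?addr0 => [|j /negPf ij].
    by rewrite mderivXU eqxx evalp1 mul1r.
  by rewrite mderivXU eq_sym ij evalp0 mul0r.
- rewrite !scD opprD addrACA IHf IHg -big_split; apply: eq_bigr => j _.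
  by rewrite mderivD evalpD mulrDl.
- rewrite !scM -sumrB; case: k k0 H ag IHf IHg => // k _ H ag IHf IHg.
  rewrite big_ord_recl big_ord_recr /= subn0 /bump leq0n add1n subnn big1 => [|j _]; last first.
    rewrite /bump leq0n add1n; have := ltn_ord j => jk.
    by rewrite !ag ?subrr //; lia.
  rewrite !(ag _ 0%N) // -mulrBr -mulrBl IHf IHg add0r mulr_sumr mulr_suml -big_split /=.
  apply: eq_bigr => j _; rewrite mderivM evalpD !evalpM.
  have E h : sc h b' 0%N = evalp h (\row_i b i 0%N) by rewrite -ag // sc_eval.
  by rewrite !E; ring.
Qed.
End Taylor.

Section FormalInverse.
Variables (K : fieldType) (N : nat) (u : 'I_N -> {mpoly K[N]}).
Implicit Types (z : 'rV[K]_N) (v b : 'I_N -> nat -> K).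
Local Notation sc := (subst_coef (@idK K)).

(* Newton iteration for the series b with b(0) = z and u(b) = v. *)
Fixpoint approx z v k : 'I_N -> nat -> K :=
  if k is k'.+1 then
    let b := approx z v k' in
    fun i l => if l == k then (invmx (jacobian u z) *m \col_j (v j k - sc (u j) b k)) i 0 else b i l
  else fun i l => if l == 0%N then z 0 i else 0.

(** The diagonal is legitimate: the coefficient of degree l is fixed at step l of the iteration. *)
Definition sol z v : 'I_N -> nat -> K := fun i l => approx z v l i l.

Lemma approx_sol z v k i l : (l <= k)%N -> approx z v k i l = sol z v i l.
Proof.
elim: k => [|k IH]; first by rewrite leqn0 => /eqP->.
by rewrite leq_eqVlt => /orP[/eqP->//|lk]; rewrite /= ltn_eqF //; apply: IH.
Qed.

Lemma approx_beyond z v k i l : (k < l)%N -> approx z v k i l = 0.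
Proof.
elim: k => [|k IH] kl /=; first by rewrite gtn_eqF.
by rewrite gtn_eqF // IH //; apply: ltnW.
Qed.

Lemma sol0 z v : \row_i sol z v i 0%N = z.
Proof. by apply/rowP => i; rewrite mxE /sol /=. Qed.

Lemma jac_mulE z (w : 'cV[K]_N) i :
  \sum_j evalp (u i)^`M(j) z * w j 0 = (jacobian u z *m w) i 0.
Proof. by rewrite mxE; apply: eq_bigr => j _; rewrite mxE. Qed.

Lemma newton_solP z v : jacobian u z \in unitmx -> (forall i, v i 0%N = evalp (u i) z) ->
  forall i k, sc (u i) (sol z v) k = v i k.
Proof.
move=> uJ v0 i [|k]; first by rewrite sc_eval sol0 v0.
rewrite -(@sc_agree _ _ _ _ _ (approx z v k.+1)) => [|j l lk]; last exact: approx_sol.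
rewrite -[LHS](subrK (sc (u i) (approx z v k) k.+1)).
rewrite (@sc_taylor _ _ _ _ (approx z v k)) // => [|j l lk]; last by rewrite /= ltn_eqF.
have -> : \row_i approx z v k.+1 i 0%N = z.
  by apply/rowP => j; rewrite mxE approx_sol.
under eq_bigr => j _ do rewrite /= eqxx approx_beyond // subr0.
by rewrite jac_mulE mulKVmx // mxE subrK.
Qed.

Lemma sol_unique z v b M : jacobian u z \in unitmx -> \row_i b i 0%N = z ->
  (forall i k, (k < M)%N -> sc (u i) b k = v i k) -> (forall i, v i 0%N = evalp (u i) z) ->
  forall i k, (k < M)%N -> b i k = sol z v i k.
Proof.
move=> uJ b0 Hb v0 i k; have [l] := ubnP k; elim: l k i => // l IH k i kl kM.
case: k => [|k] in kl kM *.
  by have := congr1 (fun w : 'rV_N => w 0 i) b0; rewrite mxE /sol /= => ->.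
have agr j l' : (l' < k.+1)%N -> b j l' = sol z v j l' by move=> lk; apply: IH; lia.
pose w := \col_j (b j k.+1 - sol z v j k.+1).
have : jacobian u z *m w = 0.
  apply/colP => j; rewrite [RHS]mxE -jac_mulE.
  under eq_bigr => j' _ do rewrite mxE.
  have := @sc_taylor _ _ (u j) b (sol z v) k.+1 isT agr; rewrite b0 => <-.
  by rewrite Hb // newton_solP // subrr.
move/(congr1 (mulmx (invmx (jacobian u z)))); rewrite mulKmx // mulmx0 => /colP/(_ i).
by rewrite !mxE => /eqP; rewrite subr_eq0 => /eqP.
Qed.
End FormalInverse.

Section Regular.
Variables (K : fieldType) (N P : nat) (D : {mpoly K[N]}).
Implicit Types (phi psi : 'rV[K]_(N + P) -> K).

(** Functions of a start point and P further parameters that are polynomial up to a power of D. With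
    D the Jacobian determinant, Newton's solution is of this kind, so a nonvanishing condition on it
    is open in the parameters. *)
Definition regular phi : Prop := exists e (G : {mpoly K[N + P]}), forall x,
  evalp D (lsubmx x) != 0 -> evalp D (lsubmx x) ^+ e * phi x = evalp G x.

Lemma embed_left (f : {mpoly K[N]}) : exists F : {mpoly K[N + P]},
  forall x, evalp F x = evalp f (lsubmx x).
Proof.
move: f; apply: mpoly_ring_ind => [c|i|f g [f' Hf] [g' Hg]|f g [f' Hf] [g' Hg]].
- by exists c%:MP => x; rewrite !evalpC.
- by exists 'X_(lshift P i) => x; rewrite !evalpXU mxE.
- by exists (f' + g') => x; rewrite !evalpD Hf Hg.
- by exists (f' * g') => x; rewrite !evalpM Hf Hg.
Qed.

Lemma regular_poly (f : {mpoly K[N]}) : regular (fun x => evalp f (lsubmx x)).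
Proof.
by have [F HF] := embed_left f; exists 0%N, F => x _; rewrite expr0 mul1r HF.
Qed.
Lemma regular_cst c : regular (fun _ => c).
Proof. by exists 0%N, c%:MP => x _; rewrite evalpC expr0 mul1r. Qed.
Lemma regular_coord i : regular (fun x => x 0 i).
Proof. by exists 0%N, 'X_i => x _; rewrite evalpXU expr0 mul1r. Qed.
Lemma regularM phi psi : regular phi -> regular psi -> regular (fun x => phi x * psi x).
Proof.
move=> [e [F HF]] [e' [G HG]]; exists (e + e')%N, (F * G) => x Dx.
by rewrite exprD mulrACA HF // HG // evalpM.
Qed.
Lemma regularD phi psi : regular phi -> regular psi -> regular (fun x => phi x + psi x).
Proof.
move=> [e [F HF]] [e' [G HG]]; have [D' HD] := embed_left D.
exists (e + e')%N, (D' ^+ e' * F + D' ^+ e * G) => x Dx.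
rewrite !evalpE HD -HF // -HG // exprD; ring.
Qed.
Lemma regularN phi : regular phi -> regular (fun x => - phi x).
Proof. by move=> [e [F HF]]; exists e, (- F) => x Dx; rewrite evalpN mulrN HF. Qed.
Lemma regular_sum (I : Type) (r : seq I) (phi : I -> 'rV[K]_(N + P) -> K) :
  (forall i, regular (phi i)) -> regular (fun x => \sum_(i <- r) phi i x).
Proof.
move=> H; elim: r => [|i r IH].
  by have [e [F HF]] := regular_cst 0; exists e, F => x Dx; rewrite big_nil; apply: HF.
have [e [F HF]] := regularD (H i) IH.
by exists e, F => x Dx; rewrite big_cons; apply: HF.
Qed.
Lemma regular_inv : regular (fun x => (evalp D (lsubmx x))^-1).
Proof. by exists 1%N, 1 => x Dx; rewrite expr1 mulfV // evalp1. Qed.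
Lemma regular_ext phi psi : (forall x, evalp D (lsubmx x) != 0 -> phi x = psi x) ->
  regular phi -> regular psi.
Proof. by move=> H [e [F HF]]; exists e, F => x Dx; rewrite -H ?HF. Qed.

Lemma regular_sc (b : 'rV[K]_(N + P) -> 'I_N -> nat -> K) (f : {mpoly K[N]}) k :
  (forall i l, (l <= k)%N -> regular (fun x => b x i l)) ->
  regular (fun x => subst_coef (@idK K) f (b x) k).
Proof.
move: f k; apply: mpoly_ring_ind => [c|i|f g IHf IHg|f g IHf IHg] k H.
- by apply: (regular_ext (phi := fun _ => if k == 0%N then c else 0)) => [x _|];
    [rewrite scC|apply: regular_cst].
- by apply: regular_ext (H i k (leqnn _)) => x _; rewrite scX.
- by apply: regular_ext (regularD (IHf _ H) (IHg _ H)) => x _; rewrite scD.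
- apply: (regular_ext (phi := fun x => \sum_(j < k.+1) subst_coef (@idK K) f (b x) j *
     subst_coef (@idK K) g (b x) (k - j)%N)) => [x _|]; first by rewrite scM.
  apply: regular_sum => j; have := ltn_ord j => jk.
  by apply: regularM; [apply: IHf|apply: IHg] => i l lj; apply: H; lia.
Qed.

Lemma regular_jet (b : 'rV[K]_(N + P) -> 'I_N -> nat -> K) M (Q : {mpoly K[N * M]}) :
  (forall i l, regular (fun x => b x i l)) ->
  regular (fun x => mmap (@idK K) (jet (b x) (M := M)) Q).
Proof.
move=> H; move: Q; apply: mpoly_ring_ind => [c|l|f g IHf IHg|f g IHf IHg].
- by apply: regular_ext (regular_cst c) => x _; rewrite mmapC.
- case/mxvec_indexP: l => i k.
  by apply: regular_ext (H i k) => x _; rewrite mmapX mmap1U jetE.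
- by apply: regular_ext (regularD IHf IHg) => x _; rewrite mmapD.
- by apply: regular_ext (regularM IHf IHg) => x _; rewrite mmap_mul.
Qed.
End Regular.

Section RegularSolution.
Variables (K : fieldType) (N P : nat) (u : 'I_N -> {mpoly K[N]}).

Definition jacdet : {mpoly K[N]} := \det (\matrix_(i, j) (u i)^`M(j)).

Lemma jacobian_map z : jacobian u z = map_mx (meval (fun i => z 0 i)) (\matrix_(i, j) (u i)^`M(j)).
Proof. by apply/matrixP => i j; rewrite !mxE. Qed.

Lemma evalp_jacdet z : evalp jacdet z = \det (jacobian u z).
Proof. by rewrite jacobian_map det_map_mx. Qed.

Lemma jacdet_unit z : (jacobian u z \in unitmx) = (evalp jacdet z != 0).
Proof. by rewrite evalp_jacdet unitmxE unitfE. Qed.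

Lemma regular_sol (v : 'rV[K]_(N + P) -> 'I_N -> nat -> K) :
  (forall i k, regular jacdet (fun x => v x i k)) ->
  forall i l, regular jacdet (fun x => sol u (lsubmx x) (v x) i l).
Proof.
move=> Hv i l; rewrite /sol.
suff H k : forall l i, regular jacdet (fun x => approx u (lsubmx x) (v x) k i l) by exact: H.
elim: k => [|k IH] {}l {}i /=.
  case: eqP => _; last exact: regular_cst.
  by apply: regular_ext (regular_poly _ _ 'X_i) => x _; rewrite evalpXU.
case: eqP => _; last exact: IH.
pose A := \matrix_(i < N, j < N) (u i)^`M(j).
apply: (regular_ext (phi := fun x => \sum_j (evalp jacdet (lsubmx x))^-1 * evalp ((\adj A) i j) (lsubmx x)
  * (v x j k.+1 - subst_coef (@idK K) (u j) (approx u (lsubmx x) (v x) k) k.+1))) => [x Dx|].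
  rewrite [RHS]mxE; apply: eq_bigr => j _.
  rewrite [(\col_j _) j 0]mxE; congr (_ * _).
  rewrite /invmx jacdet_unit Dx evalp_jacdet [RHS]mxE; congr (_ * _).
  by rewrite jacobian_map -map_mx_adj [RHS]mxE.
apply: regular_sum => j; apply: regularM; first apply: regularM.
- exact: regular_inv.
- exact: regular_poly.
- apply: regularD => //; apply: regularN; apply: regular_sc => i' l' _; exact: IH.
Qed.
End RegularSolution.

(** Linear forms supply the missing differentials; [row_ebase] provides rows completing those of the
    Jacobian of f to a basis. *)
Lemma complete_jacobian (K : fieldType) N r e (f : 'I_r -> {mpoly K[N]}) z : (r + e = N)%N ->
  \rank (jacobian f z) = r ->
  exists2 u : 'I_N -> {mpoly K[N]}, (forall (i : 'I_N) (ir : (i < r)%N), u i = f (Ordinal ir))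
    & jacobian u z \in unitmx.
Proof.
move=> rN; subst N => rkf; pose A := jacobian f z.
pose u (i : 'I_(r + e)) := match split i with
  | inl j => f j | inr j => \sum_k (dsubmx (row_ebase A)) j k *: 'X_k end.
exists u => [i ir|].
  rewrite /u; have {1}-> : i = lshift e (Ordinal ir) by apply: val_inj.
  by rewrite (unsplitK (inl _ : 'I_r + 'I_e)).
have -> : jacobian u z = block_mx (col_ebase A) 0 0 1%:M *m row_ebase A.
  rewrite -[row_ebase A in RHS]vsubmxK mul_block_col !mul0mx addr0 add0r mul1mx.
  have EA : col_ebase A *m usubmx (row_ebase A) = A.
    rewrite -[RHS]mulmx_ebase /A rkf pid_mx_row -[row_ebase _ in RHS]vsubmxK.
    by rewrite -mulmxA mul_row_col mul1mx mul0mx addr0.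
  rewrite EA; apply/matrixP => i j; rewrite !mxE /u.
  case: (split i) => k; first by rewrite /A mxE.
  rewrite [in LHS](bigD1 j) //= mderivD evalpD mderivZ evalpZ mderivXU eqxx evalp1 mulr1.
  rewrite raddf_sum /= evalp_sum big1 ?addr0 // => l /negPf lj.
  by rewrite mderivZ evalpZ mderivXU lj evalp0 mulr0.
rewrite unitmx_mul row_ebase_unit andbT unitmxE det_ublock det1 mulr1 -unitmxE.
exact: col_ebase_unit.
Qed.

(** * Arcs on a smooth affine variety *)

Section ArcsIn.
Variables (K : closedFieldType) (N : nat).
Implicit Types (Z W : 'rV[K]_N -> Prop) (b : 'I_N -> nat -> K).
Local Notation sc := (subst_coef (@idK K)).

Definition arc_in Z b : Prop := forall f, vanishes f Z -> forall k, sc f b k = 0.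
Definition start b : 'rV[K]_N := \row_i b i 0%N.

Record smooth_chart Z (r : nat) (u : 'I_N -> {mpoly K[N]}) (g : {mpoly K[N]}) : Prop := SmoothChart {
  sch_van : forall i : 'I_N, (i < r)%N -> vanishes (u i) Z;
  sch_cut : forall q, evalp g q != 0 -> (forall i : 'I_N, (i < r)%N -> evalp (u i) q = 0) -> Z q
}.

Lemma smooth_chart_of Z r e (f : 'I_r -> {mpoly K[N]}) g z : (r + e = N)%N ->
  (forall i, vanishes (f i) Z) -> \rank (jacobian f z) = r ->
  (forall q, evalp g q != 0 -> (forall i, evalp (f i) q = 0) -> Z q) ->
  exists u : 'I_N -> {mpoly K[N]}, [/\ forall (i : 'I_N) (ir : (i < r)%N), u i = f (Ordinal ir),
    smooth_chart Z r u g & evalp (jacdet u) z != 0].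
Proof.
move=> rN fZ rkf cut; have [u uf uJ] := complete_jacobian rN rkf.
exists u; split=> //; last by rewrite -jacdet_unit.
split=> [i ir|q gq H]; first by rewrite (uf i ir).
have rN' : (r <= N)%N by rewrite -rN leq_addr.
apply: cut => // i; have := H (widen_ord rN' i) (ltn_ord i).
by rewrite (uf (widen_ord rN' i) (ltn_ord i)); congr (evalp (f _) q = 0); apply: val_inj.
Qed.

Lemma smooth_chartP Z e z : smooth_at Z e z -> exists r u g,
  [/\ (r + e = N)%N, smooth_chart Z r u g, evalp (jacdet u) z != 0 & evalp g z != 0].
Proof.
move=> [r [rN [f [g [fZ rkf gz cut]]]]].
by have [u [_ ch Dz]] := smooth_chart_of rN fZ rkf cut; exists r, u, g.
Qed.

(** The r equations cut out Z only as a set, where g is nonzero. By the Nullstellensatz a power of g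
    h lies in their ideal, and the polynomials killed by an arc form a prime ideal, which does not
    contain g. *)
Lemma chart_arc Z r u g b : smooth_chart Z r u g ->
  (forall i : 'I_N, (i < r)%N -> forall k, sc (u i) b k = 0) -> evalp g (start b) != 0 -> arc_in Z b.
Proof.
move=> [van cut] Hb gb h hZ.
pose s := map u (filter (fun i : 'I_N => (i < r)%N) (enum 'I_N)).
have HJ : ideal (span (@full _) s) by apply: span_ideal.
have [k Jk] : exists k, span (@full _) s ((g * h) ^+ k).
  apply: nullstellensatz => // v Hv; pose q := \row_i v i.
  have Eq p : p.@[v] = evalp p q by rewrite /evalp; apply: meval_eq => i; rewrite mxE.
  rewrite Eq evalpM; case: (eqVneq (evalp g q) 0) => [->|gq]; first by rewrite mul0r.
  rewrite hZ ?mulr0 //; apply: cut => // i ir; rewrite -Eq; apply: Hv; apply: span_mem.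
  by apply/mapP; exists i; rewrite // mem_filter ir mem_enum.
have Hsc : forall l, sc ((g * h) ^+ k) b l = 0.
  have [iS _ _] := sc_ideal (@idK K) b.
  apply: (span_sub iS) Jk => x /mapP[i]; rewrite mem_filter => /andP[ir _] ->.
  exact: Hb.
have := primeX (sc_ideal (@idK K) b) Hsc => /sc_prime[/(_ 0%N)|//].
by rewrite sc_eval => g0; rewrite g0 eqxx in gb.
Qed.

Lemma not_vanishes3 W (f g h : {mpoly K[N]}) : prime_ideal (fun f => vanishes f W) ->
  ~ vanishes f W -> ~ vanishes g W -> ~ vanishes h W ->
  exists z, [/\ W z, evalp f z != 0, evalp g z != 0 & evalp h z != 0].
Proof.
move=> pW nf ng nh; have := primeMn pW (primeMn pW nf ng) nh.
move=> /not_vanishes[z Wz]; rewrite !evalpM !mulf_eq0 !negb_or => /andP[/andP[? ?] ?].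
by exists z.
Qed.

Section Family.
Variables (Z W : 'rV[K]_N -> Prop) (r M : nat) (u : 'I_N -> {mpoly K[N]}) (g : {mpoly K[N]}).
Hypotheses (WZ : psub W Z) (Hch : smooth_chart Z r u g).

(** Prescribed values of the coordinates u along an arc. All start at u(z); in positive degrees the
    first r are zero, so that the arc stays in Z, and the others have free coefficients in degrees 1
    to M - 1, read from x, and zero beyond. *)
Definition target (x : 'rV[K]_(N + N * M)) (i : 'I_N) (k : nat) : K :=
  if k is 0 then evalp (u i) (lsubmx x)
  else if (i < r)%N then 0 else if insub k is Some k' then x 0 (rshift N (mxvec_index i k')) else 0.

Definition family x := sol u (lsubmx x) (target x).

Lemma family_start x : start (family x) = lsubmx x. Proof. exact: sol0. Qed.

Lemma family_arc x : W (lsubmx x) -> evalp (jacdet u) (lsubmx x) != 0 ->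
  evalp g (lsubmx x) != 0 -> arc_in Z (family x).
Proof.
move=> Wx Dx gx; apply: (chart_arc Hch); last by rewrite family_start.
move=> i ir k; rewrite newton_solP ?jacdet_unit //; case: k => [|k] /=.
  by apply: (sch_van Hch) => //; apply: WZ.
by rewrite ir.
Qed.

Lemma regular_family i l : regular (jacdet u) (fun x => family x i l).
Proof.
apply: regular_sol => {l}i [|k] /=; first exact: regular_poly.
case: (i < r)%N; first exact: regular_cst.
by case: (insub k.+1) => [k'|]; [apply: regular_coord|apply: regular_cst].
Qed.

Lemma family_approx b : (forall i : 'I_N, (i < r)%N -> forall k, (k < M)%N -> sc (u i) b k = 0) ->
  evalp (jacdet u) (start b) != 0 ->
  exists2 w, lsubmx w = start b & forall i k, (k < M)%N -> b i k = family w i k.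
Proof.
move=> Hb Db.
pose w : 'rV[K]_(N + N * M) := row_mx (start b) (mxvec (\matrix_(i < N, k < M) sc (u i) b k)).
have lw : lsubmx w = start b by rewrite row_mxKl.
exists w => // i k kM; rewrite /family lw; apply: (@sol_unique _ _ _ _ _ _ M) => //.
- by rewrite jacdet_unit.
- move=> j [|l] lM; first by rewrite /= lw sc_eval.
  rewrite /=; case: ifP => jr; first exact: Hb.
  by rewrite insubT /= row_mxEr mxvecE mxE.
- by move=> j; rewrite /= lw.
Qed.

Lemma family_poly (P : {mpoly K[N * M]}) : exists e (G : {mpoly K[N + N * M]}), forall x,
  evalp (jacdet u) (lsubmx x) != 0 ->
  evalp (jacdet u) (lsubmx x) ^+ e * mmap (@idK K) (jet (family x) (M := M)) P = evalp G x.
Proof. by apply: regular_jet => i l; apply: regular_family. Qed.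
End Family.

Lemma partial_eval P (G : {mpoly K[N + P]}) (w : 'rV[K]_P) :
  exists G1 : {mpoly K[N]}, forall z, evalp G1 z = evalp G (row_mx z w).
Proof.
move: G; apply: mpoly_ring_ind => [c|i|f g [f' Hf] [g' Hg]|f g [f' Hf] [g' Hg]].
- by exists c%:MP => x; rewrite !evalpC.
- rewrite -(splitK i); case: split => j /=.
    by exists 'X_j => x; rewrite !evalpXU row_mxEl.
  by exists (w 0 j)%:MP => x; rewrite evalpXU evalpC row_mxEr.
- by exists (f' + g') => x; rewrite !evalpD Hf Hg.
- by exists (f' * g') => x; rewrite !evalpM Hf Hg.
Qed.

Lemma line_eval P (G : {mpoly K[P]}) (w w' : 'rV[K]_P) :
  exists q : {poly K}, forall s, q.[s] = evalp G (w + s *: (w' - w)).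
Proof.
move: G; apply: mpoly_ring_ind => [c|i|f g [f' Hf] [g' Hg]|f g [f' Hf] [g' Hg]].
- by exists c%:P => x; rewrite evalpC hornerC.
- exists ((w 0 i)%:P + 'X * (w' 0 i - w 0 i)%:P) => s.
  by rewrite evalpXU hornerD hornerM hornerX !hornerC !mxE.
- by exists (f' + g') => s; rewrite evalpD hornerD Hf Hg.
- by exists (f' * g') => s; rewrite evalpM hornerM Hf Hg.
Qed.

Lemma two_nonzero P (G G' : {mpoly K[P]}) (w w' : 'rV[K]_P) : evalp G w != 0 -> evalp G' w' != 0 ->
  exists2 s, evalp G (w + s *: (w' - w)) != 0 & evalp G' (w + s *: (w' - w)) != 0.
Proof.
have [q Hq] := line_eval G w w'; have [q' Hq'] := line_eval G' w w' => Gw Gw'.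
have q0 : q != 0.
  apply: contraNneq Gw => q0; have := Hq 0; by rewrite q0 horner0 scale0r addr0 => <-.
have q0' : q' != 0.
  apply: contraNneq Gw' => q0'; have := Hq' 1; by rewrite q0' horner0 scale1r addrCA subrr addr0 => <-.
have /ex_nonroot[s] : q * q' != 0 by rewrite mulf_neq0.
by rewrite hornerM mulf_eq0 negb_or Hq Hq' => /andP[? ?]; exists s.
Qed.

(** With the free coefficients of the arc fixed, the value of P becomes a rational function of the
    start point. It is nonzero at one point of W, hence on a dense open subset. *)
Lemma arc_move Z W e M (P : {mpoly K[N * M]}) (h : {mpoly K[N]}) b :
    prime_ideal (fun f => vanishes f W) -> psub W Z -> (forall p, W p -> smooth_at Z e p) ->
    arc_in Z b -> W (start b) -> mmap (@idK K) (jet b (M := M)) P != 0 -> ~ vanishes h W ->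
  exists b', [/\ arc_in Z b', W (start b'), mmap (@idK K) (jet b' (M := M)) P != 0
    & evalp h (start b') != 0].
Proof.
move=> pW WZ smW Zb Wb Pb hW.
have [r [u [g [_ ch Db gb]]]] := smooth_chartP (smW _ Wb).
have [|w lw Hw] := @family_approx r M u b _ Db.
  by move=> i ir k _; apply: Zb; apply: (sch_van ch).
have [d [G HG]] := family_poly r u P.
have [G1 HG1] := partial_eval G (rsubmx w).
have G1W : ~ vanishes (G1 * g) W.
  apply: (evalp_neq0_vanishes Wb); rewrite evalpM mulf_neq0 //.
  rewrite HG1 -lw hsubmxK -HG lw // mulf_neq0 ?expf_neq0 //.
  by rewrite -(jet_agree (@idK K) P Hw).
have [z [Wz]] := not_vanishes3 pW G1W hW (evalp_neq0_vanishes Wb Db).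
rewrite evalpM mulf_eq0 negb_or HG1 => /andP[G1z gz] hz Dz.
exists (family r u (row_mx z (rsubmx w))).
have Ez : lsubmx (row_mx z (rsubmx w)) = z by rewrite row_mxKl.
split; rewrite ?family_start ?Ez //; first by apply: (family_arc WZ ch); rewrite Ez.
by apply: contraNneq G1z => E; rewrite -HG ?Ez // E mulr0.
Qed.

(* Two arcs are joined by moving the starting point in W, and then the free coordinates
   of the arc along a line. *)
Lemma arcs_irreducible Z W e M (P Q : {mpoly K[N * M]}) b1 b2 :
    prime_ideal (fun f => vanishes f W) -> psub W Z -> (forall p, W p -> smooth_at Z e p) ->
    arc_in Z b1 -> W (start b1) -> mmap (@idK K) (jet b1 (M := M)) P != 0 ->
    arc_in Z b2 -> W (start b2) -> mmap (@idK K) (jet b2 (M := M)) Q != 0 ->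
  exists b, [/\ arc_in Z b, W (start b), mmap (@idK K) (jet b (M := M)) P != 0
    & mmap (@idK K) (jet b (M := M)) Q != 0].
Proof.
move=> pW WZ smW Zb1 Wb1 Pb1 Zb2 Wb2 Qb2.
have [r [u [g [_ ch Db2 gb2]]]] := smooth_chartP (smW _ Wb2).
have DW : ~ vanishes (jacdet u) W := evalp_neq0_vanishes Wb2 Db2.
have gW : ~ vanishes g W := evalp_neq0_vanishes Wb2 gb2.
have [b [Zb Wb Pb Db]] := arc_move pW WZ smW Zb1 Wb1 Pb1 DW.
have [|w lw Hw] := @family_approx r M u b _ Db.
  by move=> i ir k _; apply: Zb; apply: (sch_van ch).
have [|w2 lw2 Hw2] := @family_approx r M u b2 _ Db2.
  by move=> i ir k _; apply: Zb2; apply: (sch_van ch).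
have [d [G HG]] := family_poly r u P.
have [d' [G' HG']] := family_poly r u Q.
have [G1 HG1] := partial_eval G (rsubmx w).
have [G1' HG1'] := partial_eval G' (rsubmx w2).
have nG1 : ~ vanishes G1 W.
  apply: (evalp_neq0_vanishes Wb); rewrite HG1 -lw hsubmxK -HG lw // mulf_neq0 ?expf_neq0 //.
  by rewrite -(jet_agree (@idK K) P Hw).
have nG1' : ~ vanishes G1' W.
  apply: (evalp_neq0_vanishes Wb2); rewrite HG1' -lw2 hsubmxK -HG' lw2 // mulf_neq0 ?expf_neq0 //.
  by rewrite -(jet_agree (@idK K) Q Hw2).
have [z [Wz G1z G1z']] := not_vanishes3 pW nG1 nG1' (primeMn pW DW gW).
rewrite evalpM mulf_eq0 negb_or => /andP[Dz gz].
rewrite HG1 in G1z; rewrite HG1' in G1z'.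
have [s Gs Gs'] := two_nonzero G1z G1z'.
set x := row_mx z _ + _ in Gs Gs'.
have lx : lsubmx x = z by rewrite /x linearD linearZ linearB /= !row_mxKl subrr scaler0 addr0.
exists (family r u x); split; rewrite ?family_start ?lx //.
- by apply: (family_arc WZ ch); rewrite lx.
- by apply: contraNneq Gs => E; rewrite -HG ?lx // E mulr0.
- by apply: contraNneq Gs' => E; rewrite -HG' ?lx // E mulr0.
Qed.

(* The jet of an arc over an extension of K is specialized to a jet over K, which lifts to an arc
   because Z is smooth. *)
Lemma arc_descent Z W e M (P : {mpoly K[N * M.+1]}) (L : fieldType) (iota : {rmorphism K -> L})
    (b : 'I_N -> nat -> L) :
    (forall z, (forall f, vanishes f W -> evalp f z = 0) -> W z) ->
    psub W Z -> (forall p, W p -> smooth_at Z e p) ->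
    (forall f, vanishes f Z -> forall k, subst_coef iota f b k = 0) ->
    (forall f, vanishes f W -> subst_coef iota f b 0%N = 0) ->
    mmap iota (jet b (M := M.+1)) P != 0 ->
  exists b', [/\ arc_in Z b', W (start b') & mmap (@idK K) (jet b' (M := M.+1)) P != 0].
Proof.
move=> cW WZ smW Zb Wb Pb.
pose p Q := mmap iota (jet b (M := M.+1)) Q = 0.
have pp : prime_ideal p.
  split=> [||f g]; rewrite /p.
  - split=> [|f g Hf Hg|f g Hg].
    + by rewrite raddf0.
    + by rewrite mmapD Hf Hg addr0.
    + by rewrite mmap_mul Hg mulr0.
  - by apply/eqP; rewrite (rmorph1 (mmap iota _)) oner_eq0.
  - by rewrite mmap_mul => /eqP; rewrite mulf_eq0 => /orP[]/eqP; [left|right].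
have [v [Hv Pv]] := nullstellensatz_prime pp (fun H : p P => negP Pb (introT eqP H)).
pose b0 (i : 'I_N) (k : nat) : K := if insub k is Some k' then v (mxvec_index i k') else 0.
have Eb0 Q : mmap (@idK K) (jet b0 (M := M.+1)) Q = Q.@[v].
  rewrite /meval /mmap; apply: eq_bigr => mu _; congr (_ * _); apply: eq_bigr => l _.
  by case/mxvec_indexP: l => i k; rewrite jetE /b0 valK.
have Z0 f : vanishes f Z -> forall k, (k < M.+1)%N -> sc f b0 k = 0.
  move=> fZ k kM; have [C HC] := coef_poly_universal f kM.
  by rewrite -HC Eb0; apply: Hv; rewrite /p HC Zb.
have W0 : W (start b0).
  apply: cW => f fW; have [C HC] := @coef_poly_universal _ _ f M.+1 0%N isT.
  by rewrite -sc_eval -HC Eb0; apply: Hv; rewrite /p HC Wb.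
have [r [u [g [_ ch Db gb]]]] := smooth_chartP (smW _ W0).
have [|w lw Hw] := @family_approx r M.+1 u b0 _ Db.
  by move=> i ir k kM; apply: Z0 => //; apply: (sch_van ch).
exists (family r u w); split; rewrite ?family_start ?lw //.
  by apply: (family_arc WZ ch); rewrite lw.
by rewrite -(jet_agree (@idK K) P Hw) Eb0.
Qed.

End ArcsIn.

(** * Local equations of curves on a smooth surface *)

Lemma span_mull (R : comNzRingType) (P : R -> Prop) (s : seq R) t x : ideal P ->
  P t -> span (@full R) s x -> span P s (t * x).
Proof.
move=> iP Pt; elim: s x => [|a s IH] x /=; first by move=> ->; rewrite mulr0.
move=> [c [y [_ Hy ->]]]; exists (t * c), (t * y); split; last by ring.
  exact: idealMr.
exact: IH.
Qed.

Section LocalAffine.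
Variables (K : closedFieldType) (N : nat).
Implicit Types (Z : 'rV[K]_N -> Prop) (b : 'I_N -> nat -> K) (f : {mpoly K[N]}).
Local Notation R := {mpoly K[N]}.
Local Notation sc := (subst_coef (@idK K)).

Lemma sc_const f b k : (forall i l, (0 < l)%N -> b i l = 0) -> (0 < k)%N -> sc f b k = 0.
Proof.
move=> Hb; move: f k; apply: mpoly_ring_ind => [c|i|f g IHf IHg|f g IHf IHg] k k0.
- by rewrite scC gtn_eqF.
- by rewrite scX Hb.
- by rewrite scD IHf ?IHg ?addr0.
- rewrite scM big1 // => j _; case: (posnP j) => [->|j0]; last by rewrite IHf ?mul0r.
  by rewrite subn0 IHg ?mulr0.
Qed.

Lemma sc1 f b : sc f b 1%N = \sum_j evalp f^`M(j) (start b) * b j 1%N.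
Proof.
pose b' i l := if l is 0 then b i 0%N else 0.
rewrite -[LHS]subr0 -[X in _ - X](@sc_const f b' 1) // => [|i [] //].
rewrite (@sc_taylor _ _ f b b') // => [|i [] //].
by apply: eq_bigr => j _; rewrite subr0.
Qed.

Lemma arc_tangent Z r e (f : 'I_r -> R) g z (t : 'cV[K]_N) : (r + e = N)%N ->
  (forall i, vanishes (f i) Z) -> \rank (jacobian f z) = r -> evalp g z != 0 ->
  (forall q, evalp g q != 0 -> (forall i, evalp (f i) q = 0) -> Z q) ->
  Z z -> jacobian f z *m t = 0 ->
  exists b, [/\ arc_in Z b, start b = z & forall j, b j 1%N = t j 0].
Proof.
move=> rN fZ rkf gz cut Zz Ht; have [u [uf ch Dz]] := smooth_chart_of rN fZ rkf cut.
have uJ : jacobian u z \in unitmx by rewrite jacdet_unit.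
pose v i k := if k is 0 then evalp (u i) z else if k is 1 then (jacobian u z *m t) i 0 else 0.
have Hs := newton_solP (v := v) uJ (fun i => erefl).
have Es : start (sol u z v) = z := sol0 _ _ _.
exists (sol u z v); split=> //.
  apply: (chart_arc ch); last by rewrite Es.
  move=> i ir k; rewrite Hs; case: k => [|[|k]] //=; first exact: (sch_van ch).
  have /colP/(_ (Ordinal ir)) := Ht; rewrite [RHS]mxE => <-.
  by rewrite mxE [RHS]mxE; apply: eq_bigr => j _; rewrite !mxE (uf i ir).
move=> j; suff /colP/(_ j) : \col_j sol u z v j 1%N = t by rewrite mxE.
rewrite -[LHS](mulKmx uJ) -[RHS](mulKmx uJ); congr (_ *m _).
apply/colP => i; rewrite -jac_mulE.
have := Hs i 1%N; rewrite sc1 Es => E; rewrite -[RHS]/(v i 1%N) -E.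
by apply: eq_bigr => l _; rewrite mxE.
Qed.

(** With B a left inverse of the Jacobian, the combinations B f have the differentials of the
    coordinates, so B f = A (X - z) with A(z) = 1. Multiplying by the adjugate shows that f
    generates the ideal of z once det A is inverted. *)
Lemma local_gen k (f : 'I_k -> R) z : (forall i, evalp (f i) z = 0) -> row_full (jacobian f z) ->
  exists2 a, evalp a z != 0 & forall x, evalp x z = 0 -> exists c : 'I_k -> R, a * x = \sum_i c i * f i.
Proof.
move=> f0 fullJ; pose B := pinvmx (jacobian f z).
pose f' (i : 'I_N) := \sum_j (B i j)%:MP * f j.
have H i : exists h : 'I_N -> R, f' i = \sum_j h j * ('X_j - (z 0 j)%:MP) /\
    forall j, evalp (h j) z = (i == j)%:R.
  have [h [E Hh]] := taylor (f' i) z; exists h; split.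
    rewrite [LHS]E evalp_sum big1 ?mpolyC0 ?add0r // => j _.
    by rewrite evalpM f0 mulr0.
  move=> j; rewrite Hh; have /matrixP/(_ i j) := mulVpmx fullJ; rewrite !mxE => <-.
  rewrite /f' raddf_sum /= evalp_sum; apply: eq_bigr => l _.
  by rewrite mderiv_mulC evalpM evalpC [jacobian _ _ _ _]mxE.
have [h Hh] := choice _ H.
pose A : 'M[R]_N := \matrix_(i, j) h i j.
exists (\det A).
  rewrite /evalp -det_map_mx; have -> : map_mx (meval (fun i => z 0 i)) A = 1%:M.
    by apply/matrixP => i j; rewrite !mxE; have [_ E] := Hh i; exact: E.
  by rewrite det1 oner_eq0.
move=> x x0; have [g [Ex _]] := taylor x z; rewrite x0 mpolyC0 add0r in Ex.
pose xi : 'cV[R]_N := \col_j ('X_j - (z 0 j)%:MP).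
have EA : A *m xi = \col_i f' i.
  apply/colP => i; rewrite !mxE; have [-> _] := Hh i.
  by apply: eq_bigr => j _; rewrite !mxE.
have Exi : \det A *: xi = \adj A *m \col_i f' i.
  by rewrite -EA mulmxA mul_adj_mx mul_scalar_mx.
exists (fun l => \sum_j g j * \sum_i (\adj A) j i * (B i l)%:MP).
rewrite {1}Ex mulr_sumr.
transitivity (\sum_j g j * (\adj A *m \col_i f' i) j 0).
  by apply: eq_bigr => j _; rewrite -Exi !mxE mulrCA.
under [RHS]eq_bigr do rewrite mulr_suml; rewrite [RHS]exchange_big; apply: eq_bigr => j _ /=.
under [RHS]eq_bigr do rewrite -mulrA mulr_suml; rewrite -mulr_sumr; congr (_ * _).
rewrite [RHS]exchange_big mxE; apply: eq_bigr => i _ /=.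
rewrite [(\col_i f' i) i 0]mxE /f' mulr_sumr; apply: eq_bigr => l _; by rewrite mulrA.
Qed.

(** Near z the ideal of z is generated by the equations g of Y, an equation tau of E independent of
    them, and a further coordinate t. Since t does not vanish on E, the t-part of an element of I(E)
    has its cofactor again in I(E), and Nakayama removes it. *)
Lemma local_principal_aff Y E z : smooth_at Y 2 z -> smooth_at E 1 z -> psub E Y -> E z ->
  prime_ideal (fun f => vanishes f E) ->
  exists tau, [/\ vanishes tau E,
    exists b, [/\ arc_in Y b, start b = z & sc tau b 1%N != 0]
    & forall f, vanishes f E -> exists a c i, [/\ evalp a z != 0, vanishes i Y & a * f = c * tau + i]].
Proof.
move=> smY smE EY Ez pE.
have [rY [rYN [g [gg [gvan rkg ggz gcut]]]]] := smY.
have [rE [rEN [f [ff [fvan rkf ffz fcut]]]]] := smE.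
(* At z the Jacobian for E has rank one more than the Jacobian for Y, so some equation of E has a
   differential outside the span of those of Y. *)
have [i0 Hi0] : exists i, ~~ (row i (jacobian f z) <= jacobian g z)%MS.
  apply/existsP; rewrite -negb_forall; apply/negP => /forallP H.
  have /mxrankS : (jacobian f z <= jacobian g z)%MS by apply/row_subP.
  by rewrite rkf rkg; lia.
pose tau := f i0; pose J1 := col_mx (jacobian g z) (row i0 (jacobian f z)).
have rk1 : \rank J1 = (rY + 1)%N.
  have lt : (jacobian g z < J1)%MS.
    by rewrite ltmxE col_mx_sub submx_refl /= Hi0 andbT; apply: submx_trans (addsmxSl _ (row i0 (jacobian f z))) _; rewrite addsmxE.
  have := rank_ltmx lt; have := rank_leq_row J1; rewrite rkg; lia.
have [l0 Hl0] : exists l, ~~ (row l (1%:M : 'M[K]_N) <= J1)%MS.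
  apply/existsP; rewrite -negb_forall; apply/negP => /forallP H.
  have /mxrankS : (1%:M <= J1)%MS by apply/row_subP.
  by rewrite rk1 mxrank1; lia.
pose t : R := 'X_l0 - (z 0 l0)%:MP.
pose F (i : 'I_(rY + 1 + 1)) : R := match split i with
  | inl i' => match split i' with inl k => g k | inr _ => tau end | inr _ => t end.
have EJ : jacobian F z = col_mx J1 (row l0 1%:M).
  apply/matrixP => i j; rewrite mxE /F [RHS]mxE.
  case: (split i) => [i'|i'].
    rewrite [RHS]mxE; case: (split i') => [k|k]; rewrite !mxE //.
  rewrite !mxE mderivB mderivC subr0 mderivXU.
  by case: eqP; rewrite ?evalp1 ?evalp0.
have F0 i : evalp (F i) z = 0.
  rewrite /F; case: (split i) => [i'|_]; last by rewrite /t !evalpE subrr.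
  by case: (split i') => [k|_]; [apply: gvan; apply: EY|apply: fvan].
have fullF : row_full (jacobian F z).
  rewrite /row_full eqn_leq rank_leq_col /= EJ.
  have lt : (J1 < col_mx J1 (row l0 1%:M))%MS.
    by rewrite ltmxE col_mx_sub submx_refl /= Hl0 andbT; apply: submx_trans (addsmxSl _ (row l0 1%:M)) _; rewrite addsmxE.
  have := rank_ltmx lt; rewrite rk1; lia.
have [a az Ha] := local_gen F0 fullF.
(* If t vanished on E, so would the whole ideal of z, and E would be the single point z; but E
   carries an arc with nonzero velocity. *)
have nt : ~ vanishes t E.
  move=> tE.
  have FE i : vanishes (F i) E.
    rewrite /F; case: (split i) => [i'|_] //.
    by case: (split i') => [k|_] p Ep; [apply: gvan; apply: EY|apply: fvan].
  have mE x : evalp x z = 0 -> vanishes x E.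
    move=> x0; have [c Ec] := Ha x x0.
    have : vanishes (a * x) E.
      by rewrite Ec; apply: (ideal_sum (vanishes_ideal E)) => i _; apply: (idealMl (vanishes_ideal E)).
    by case: pE => _ _ PM /PM[/(_ z Ez)/eqP|//]; rewrite (negPf az).
  have [v v0 Hv] : exists2 v : 'cV[K]_N, v != 0 & jacobian f z *m v = 0.
    have : cokermx (jacobian f z) != 0.
      by rewrite -mxrank_eq0 mxrank_coker rkf; lia.
    case/matrix0Pn => i [j ij]; exists (col j (cokermx (jacobian f z))).
      by apply/cV0Pn; exists i; rewrite mxE.
    by rewrite colE mulmxA mulmx_coker mul0mx.
  have [b [Eb sb b1]] := arc_tangent rEN fvan rkf ffz fcut Ez Hv.
  case/cV0Pn: v0 => i /eqP; apply; rewrite -b1.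
  have := Eb ('X_i - (z 0 i)%:MP) _ 1%N; rewrite scB scX scC /= subr0; apply.
  by apply: mE; rewrite !evalpE subrr.
(* A tangent vector of Y transverse to E. An arc with this velocity witnesses that tau vanishes to
   order exactly one. *)
have [y [dtau Hy]] : exists y : 'cV[K]_N, row i0 (jacobian f z) *m y != 0 /\ jacobian g z *m y = 0.
  have : row i0 (jacobian f z) *m cokermx (jacobian g z) != 0 by rewrite -submxE.
  case/rV0Pn => j ij; exists (col j (cokermx (jacobian g z))); split.
    rewrite colE mulmxA; move: ij; set w := row i0 _ *m _; clearbody w => wj; apply: contraNneq wj => w0.
    by have := congr1 (fun A : 'M_1 => A 0 0) w0; rewrite -colE !mxE => ->.
  by rewrite colE mulmxA mulmx_coker mul0mx.
exists tau; split; first exact: fvan.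
  have [b [Yb sb b1]] := arc_tangent rYN gvan rkg ggz gcut (EY _ Ez) Hy.
  exists b; split=> //; rewrite sc1 sb; case/rV0Pn: dtau => j; rewrite (ord1 j) mxE.
  by congr (_ != 0); apply: eq_bigr => l _; rewrite b1 !mxE.
move=> h hE; have [s [sE Es]] := @noetherian_mpoly K N (fun f => vanishes f E) (vanishes_ideal E).
pose U (a : R) := evalp a z != 0.
pose J x := exists u w, [/\ exists c, u = c * tau, vanishes w Y & x = u + w].
have iJ : ideal J.
  apply: add_ideal; last exact: vanishes_ideal.
  split=> [|x' y' [c ->] [d ->]|c x' [d ->]]; first by exists 0; rewrite mul0r.
    by exists (c + d); rewrite mulrDl.
  by exists (c * d); rewrite mulrA.
have ip := point_ideal z.
have [b Ub Hb] : exists2 b, U b & forall x, x \in s -> J (b * x).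
  apply: (nakayama _ _ _ ip iJ); rewrite /U.
  - by rewrite evalp1 oner_neq0.
  - by move=> a' b' Ua Ub; rewrite evalpM mulf_neq0.
  - by move=> a' q Ua Eq; rewrite evalpB Eq subr0.
  move=> x xs; have [c Ec] := Ha x (sE x xs z Ez).
  move: Ec; rewrite !big_split_ord !big_ord1 /=.
  rewrite /F (unsplitK (inr _ : 'I_(rY + 1) + 'I_1)).
  rewrite (unsplitK (inl _ : 'I_(rY + 1) + 'I_1)) (unsplitK (inr _ : 'I_rY + 'I_1)).
  under eq_bigr => i _ do rewrite (unsplitK (inl _ : 'I_(rY + 1) + 'I_1)) (unsplitK (inl _ : 'I_rY + 'I_1)).
  set w := \sum_i _; set ct := c _; set c' := c _ => Ec.
  have wY : vanishes w Y.
    by apply: (ideal_sum (vanishes_ideal Y)) => i _; apply: (idealMl (vanishes_ideal Y)).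
  have c'E : vanishes c' E.
    have : vanishes (t * c') E.
      have -> : t * c' = a * x - (w + ct * tau) by rewrite Ec; ring.
      apply: (idealB (vanishes_ideal E)); first by apply: (idealMl (vanishes_ideal E)); apply: sE.
      apply: (idealD (vanishes_ideal E)); first by move=> p /EY; apply: wY.
      by apply: (idealMl (vanishes_ideal E)); apply: fvan.
    by case: pE => _ _ PM /PM[].
  exists a, (w + ct * tau), (t * c'); split=> //.
  - by exists (ct * tau), w; split=> //; [exists ct|ring].
  - by apply: span_mull => //; [rewrite /t !evalpE subrr|apply: Es].
  - by rewrite Ec; ring.
have : J (b * h).
  have iJb : ideal (fun x => J (b * x)).
    split=> [|x' y' ? ?|c x' ?]; rewrite ?mulr0 ?mulrDr 1?mulrCA.
    - exact: ideal0.
    - exact: idealD.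
    - exact: idealMl.
  exact: (span_sub iJb Hb (Es h hE)).
by move=> [_ [w [[c ->] wY Ebh]]]; exists b, c, w.
Qed.
End LocalAffine.

(** * From affine charts to bihomogeneous polynomials *)

Section Homogenization.
Variables (K : closedFieldType) (n m : nat).
Local Notation N := (n + m.+1)%N.
Local Notation R := {mpoly K[N]}.
Implicit Types (f g : R) (z : 'rV[K]_N) (Y E Z : 'rV[K]_N -> Prop) (j : 'I_m.+1).
Local Notation sc := (subst_coef (@idK K)).
Local Notation closedp := (closed_for (@proj_closure K n m)).

Definition ycoord j z : K := z 0 (rshift n j).
Definition normalize j z : 'rV[K]_N := yscale (ycoord j z)^-1 z.

Lemma ycoord_rsub j z : rsubmx z 0 j = ycoord j z. Proof. by rewrite mxE. Qed.
Lemma evalp_yvar j z : evalp ('X_(rshift n j)) z = ycoord j z. Proof. exact: evalpXU. Qed.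
Lemma ycoord_yscale j c z : ycoord j (yscale c z) = c * ycoord j z. Proof. exact: yscale_r. Qed.
Lemma normalize1 j z : ycoord j z = 1 -> normalize j z = z.
Proof. by move=> zj; rewrite /normalize zj invr1 yscale1. Qed.

Lemma ex_ycoord z : rsubmx z != 0 -> exists j, ycoord j z != 0.
Proof. by case/rV0Pn => j; rewrite ycoord_rsub; exists j. Qed.

Lemma chart_normalize j Z z : cone Z -> Z z -> ycoord j z != 0 -> chart Z j (normalize j z).
Proof.
move=> cZ Zz zj; split; first by apply: cZ => //; rewrite invr_neq0.
by rewrite ycoord_rsub ycoord_yscale mulVf.
Qed.

(** All large degrees are offered, so that several polynomials can be brought to matching
    degrees. *)
Lemma homogenize j f : exists d0, forall d, (d0 <= d)%N -> exists2 F : R, yhomog d F &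
  forall z, ycoord j z != 0 -> evalp F z = ycoord j z ^+ d * evalp f (normalize j z).
Proof.
have yX d : yhomog d ('X_(rshift n j) ^+ d : R).
  by have := yhomogMn d (yhomogy K n j); rewrite muln1.
move: f; apply: mpoly_ring_ind => [c|i|f g [d1 H1] [d2 H2]|f g [d1 H1] [d2 H2]].
- exists 0%N => d _; exists (c *: 'X_(rshift n j) ^+ d); first exact: yhomogZ.
  by move=> z _; rewrite evalpZ evalpX evalp_yvar evalpC mulrC.
- exists 1%N => -[//|d] _; rewrite -(splitK i); case: split => l /=.
    exists ('X_(lshift m.+1 l) * 'X_(rshift n j) ^+ d.+1).
      by rewrite -[d.+1]add0n; apply: yhomogM => //; apply: yhomogx.
    by move=> z _; rewrite evalpM evalpX evalp_yvar !evalpXU /normalize yscale_l mulrC.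
  exists ('X_(rshift n l) * 'X_(rshift n j) ^+ d).
    by rewrite -[d.+1]add1n; apply: yhomogM => //; apply: yhomogy.
  move=> z zj; rewrite evalpM evalpX !evalpXU /normalize yscale_r exprS.
  by rewrite /ycoord in zj *; field.
- exists (maxn d1 d2) => d; rewrite geq_max => /andP[/H1[F HF EF] /H2[G HG EG]].
  exists (F + G); first exact: yhomogD.
  by move=> z zj; rewrite !evalpD EF // EG // mulrDr.
- exists (d1 + d2)%N => d dd; have [F HF EF] := H1 d1 (leqnn _).
  have [|G HG EG] := H2 (d - d1)%N; first by lia.
  have Ed : (d1 + (d - d1) = d)%N by lia.
  exists (F * G); first by rewrite -Ed; apply: yhomogM.
  by move=> z zj; rewrite !evalpM EF // EG // -[in RHS]Ed exprD mulrACA.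
Qed.

(** Homogenized identities are controlled only where y_j is nonzero; the factor y_j extends them to
    the rest of Z. *)
Lemma vanishes_off j Z f : (forall z, Z z -> ycoord j z != 0 -> evalp f z = 0) ->
  vanishes ('X_(rshift n j) * f) Z.
Proof.
move=> H z Zz; rewrite evalpM evalp_yvar.
by case: (eqVneq (ycoord j z) 0) => [->|zj]; rewrite ?mul0r // H ?mulr0.
Qed.

Lemma vanishes_chart j Z f : vanishes f Z -> vanishes f (chart Z j).
Proof. by move=> H z [Zz _]; apply: H. Qed.

Lemma chart_prime j Z z : cone Z -> prime_ideal (fun f => vanishes f Z) ->
  chart Z j z -> prime_ideal (fun f => vanishes f (chart Z j)).
Proof.
move=> cZ [_ _ PM] [Zz zj]; split; first exact: vanishes_ideal.
  by move/(_ z (conj Zz zj))/eqP; rewrite evalp1 oner_eq0.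
have zj0 : ycoord j z != 0 by rewrite -ycoord_rsub zj oner_neq0.
move=> f g Hfg; have [d1 /(_ d1 (leqnn _))[F HF EF]] := homogenize j f.
have [d2 /(_ d2 (leqnn _))[G HG EG]] := homogenize j g.
have back (h H : R) d : (forall z, ycoord j z != 0 -> evalp H z = ycoord j z ^+ d * evalp h (normalize j z)) ->
    vanishes H Z -> vanishes h (chart Z j).
  move=> EH HZ w [Zw wj]; have wj' : ycoord j w = 1 by rewrite -ycoord_rsub.
  by have := EH w; rewrite wj' expr1n mul1r normalize1 // => <-; rewrite ?oner_neq0 // HZ.
have : vanishes ('X_(rshift n j) * (F * G)) Z.
  apply: vanishes_off => w Zw wj; rewrite evalpM EF // EG // mulrACA -evalpM.
  by rewrite Hfg ?mulr0 //; apply: chart_normalize.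
case/PM => [|/PM[HF0|HG0]]; last 2 first.
- by left; apply: (back f F d1 EF).
- by right; apply: (back g G d2 EG).
by move/(_ z Zz)/eqP; rewrite evalp_yvar (negPf zj0).
Qed.

Lemma local_principal Y E z : closedp Y -> closedp E -> psub E Y -> smooth_of_dim 2 Y ->
  smooth_of_dim 1 E -> prime_ideal (fun f => vanishes f E) -> E z ->
  exists d tau, [/\ yhomog d tau, vanishes tau E,
    exists j b, [/\ arc_in (chart Y j) b, chart E j (start b), start b = normalize j z & sc tau b 1%N != 0]
    & forall e f, yhomog e f -> vanishes f E -> exists k a c i, [/\ yhomog k a, evalp a z != 0,
        vanishes i Y & a * f = c * tau + i]].
Proof.
move=> cY cE EY sY sE pE Ez.
have coY := proj_closed_cone cY; have coE := proj_closed_cone cE.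
have [j zj] := ex_ycoord (proj_closed_neq0 cE Ez).
set z' := normalize j z; have cEz : chart E j z' by apply: chart_normalize.
have pE' := chart_prime coE pE cEz.
have EYj : psub (chart E j) (chart Y j) by move=> w [/EY Yw wj].
have [tau [tauE [b [Yb sb tb]] Htau]] :=
  local_principal_aff (sY _ _ (EYj _ cEz)) (sE _ _ cEz) EYj cEz pE'.
have [d0 /(_ d0 (leqnn _))[T0 HT ET]] := homogenize j tau.
pose y : R := 'X_(rshift n j); have Hy : yhomog 1 y by apply: yhomogy.
exists (1 + d0)%N, (y * T0); split.
- exact: yhomogM.
- by apply: vanishes_off => w Ew wj; rewrite ET // tauE ?mulr0 //; apply: chart_normalize.
- exists j, b; split=> //; first by rewrite sb.
  suff : sc (y * T0 - tau) b 1%N = 0 by rewrite scB => /eqP; rewrite subr_eq0 => /eqP->.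
  apply: Yb => w [Yw wj]; have wj' : ycoord j w = 1 by rewrite -ycoord_rsub.
  rewrite evalpB evalpM evalp_yvar ET wj' ?oner_neq0 // expr1n !mul1r normalize1 //.
  by rewrite subrr.
move=> e f Hf fE.
have [a [c [i [az iY Eaf]]]] := Htau f (vanishes_chart (j := j) fE).
have [da HA] := homogenize j a; have [dc HC] := homogenize j c.
have [A A1 EA] := HA (da + dc + d0)%N ltac:(lia).
have [C C1 EC] := HC (da + dc + e)%N ltac:(lia).
exists (1 + (da + dc + d0))%N, (y * A), C, (y * (A * f - C * T0)); split.
- exact: yhomogM.
- by rewrite evalpM evalp_yvar EA // !mulf_neq0 // expf_neq0.
- apply: vanishes_off => w Yw wj; rewrite evalpB !evalpM EA // EC // ET //.
  have := congr1 (fun h => evalp h (normalize j w)) Eaf.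
  rewrite evalpM evalpD evalpM (iY (normalize j w)) ?addr0 => [Ew|]; last exact: chart_normalize.
  rewrite /normalize (evalp_yscale _ _ Hf) -/(normalize j w) in Ew.
  have Ef : evalp f w = ycoord j w ^+ e * ((ycoord j w)^-1 ^+ e * evalp f w).
    by rewrite mulrA -exprMn mulfV // expr1n mul1r.
  rewrite Ef mulrACA -exprD Ew mulrACA -exprD; apply/eqP; rewrite subr_eq0; apply/eqP.
  by congr (_ ^+ _ * _); lia.
- by rewrite /y; ring.
Qed.

(** Distinct tangent lines make I(E) + I(E') the full ideal of z near z, by [local_gen]. *)
Lemma transverse_local E E' z j : cone E -> cone E' ->
  E z -> E' z -> ycoord j z != 0 -> transverse_at E E' j (normalize j z) ->
  forall e f, yhomog e f -> evalp f z = 0 -> exists k a u v, [/\ yhomog k a, evalp a z != 0,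
    vanishes u E, vanishes v E' & a * f = u + v].
Proof.
move=> coE coE' Ez E'z zj [F [HF rkF]] e f Hf fz; set z' := normalize j z in rkF *.
have cE : chart E j z' by apply: chart_normalize.
have cE' : chart E' j z' by apply: chart_normalize.
have F0 i : evalp (F i) z' = 0 by case: (HF i) => H; apply: H.
have fullF : row_full (jacobian F z') by rewrite /row_full rkF.
have [a az Ha] := local_gen F0 fullF.
have fz' : evalp f z' = 0 by rewrite (evalp_yscale _ _ Hf) fz mulr0.
have [c Ec] := Ha f fz'.
have [u [v [uE vE' Euv]]] : exists u v, [/\ vanishes u (chart E j), vanishes v (chart E' j) & a * f = u + v].
  have [iA iB] := (vanishes_ideal (chart E j), vanishes_ideal (chart E' j)).
  suff : forall s : seq 'I_N, exists u v, [/\ vanishes u (chart E j), vanishes v (chart E' j)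
      & \sum_(i <- s) c i * F i = u + v] by move/(_ (index_enum _)); rewrite -Ec.
  elim=> [|i s [u [v [Hu Hv Es]]]].
    by exists 0, 0; rewrite big_nil addr0; split=> //; [exact: (ideal0 iA)|exact: (ideal0 iB)].
  case: (HF i) => Hi.
    exists (c i * F i + u), v; rewrite big_cons Es addrA; split=> //.
    by apply: (idealD iA) => //; apply: (idealMl iA).
  exists u, (c i * F i + v); rewrite big_cons Es addrCA; split=> //.
  by apply: (idealD iB) => //; apply: (idealMl iB).
have [da HA] := homogenize j a; have [du HU] := homogenize j u; have [dv HV] := homogenize j v.
have [A A1 EA] := HA (da + du + dv)%N ltac:(lia).
have [U U1 EU] := HU (da + du + dv + e)%N ltac:(lia).
have [V V1 EV] := HV (da + du + dv + e)%N ltac:(lia).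
pose y : R := 'X_(rshift n j); have Hy : yhomog 1 y by apply: yhomogy.
exists (1 + (da + du + dv))%N, (y * A), (y * (A * f - V)), (y * V); split.
- exact: yhomogM.
- by rewrite evalpM evalp_yvar EA // !mulf_neq0 // expf_neq0.
- apply: vanishes_off => w Ew wj; have cw : chart E j (normalize j w) by apply: chart_normalize.
  have := congr1 (fun h => evalp h (normalize j w)) Euv.
  rewrite evalpM evalpD (uE _ cw) add0r => Ew'.
  rewrite evalpB evalpM EA // EV // -Ew' [evalp f (normalize _ _)](evalp_yscale _ _ Hf).
  have Ef : evalp f w = ycoord j w ^+ e * ((ycoord j w)^-1 ^+ e * evalp f w).
    by rewrite mulrA -exprMn mulfV // expr1n mul1r.
  by rewrite {1}Ef mulrACA -exprD subrr.
- by apply: vanishes_off => w Ew wj; rewrite EV // vE' ?mulr0 //; apply: chart_normalize.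
- by ring.
Qed.
End Homogenization.

(** * Orders of vanishing along the exceptional curves *)

Section Components.
Variables (K : closedFieldType) (n m : nat).
Local Notation N := (n + m.+1)%N.
Local Notation R := {mpoly K[N]}.
Local Notation closedp := (closed_for (@proj_closure K n m)).
Local Notation irrp := (irreducible_for (@proj_closure K n m)).

Lemma exceptional_closed (O : 'rV[K]_n) (Y : 'rV[K]_N -> Prop) : closedp Y ->
  closedp (exceptional O Y).
Proof.
move=> cY.
pose F d (f : R) := d = 0%N /\ exists i, f = 'X_(lshift m.+1 i) - (O 0 i)%:MP.
have HF d f : F d f -> yhomog d f.
  move=> [-> [i ->]]; apply: (subspaceB (yhomog_subspace _ _ _ 0)); first exact: yhomogx.
  exact: yhomogC.
have -> : exceptional O Y = fun z => Y z /\ forall d f, F d f -> evalp f z = 0.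
  apply: pred_ext => z; split=> [[Yz Oz]|[Yz H]]; split=> //.
    by move=> d f [_ [i ->]]; rewrite !evalpE -Oz mxE subrr.
  apply/rowP => i; have := H 0%N _ (conj erefl (ex_intro _ i erefl)).
  by rewrite !evalpE mxE => /eqP; rewrite subr_eq0 => /eqP.
exact: proj_closed_zeros.
Qed.

(** Zorn's lemma on cones with prime ideal, starting from the punctured line through z. Primeness
    survives unions of chains, since two nonvanishing conditions have witnesses in a common
    member. *)
Lemma in_component (S : 'rV[K]_N -> Prop) z : closedp S -> S z ->
  exists2 Z, component_of (@proj_closure K n m) S Z & Z z.
Proof.
move=> cS Sz; have coS := proj_closed_cone cS.
pose P A := [/\ prime_ideal (fun f : R => vanishes f A), cone A, psub A S & exists z, A z].
pose A0 w := exists2 c : K, c != 0 & w = yscale c z.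
have PA0 : P A0.
  split.
  - split=> [||f g Hfg]; first exact: vanishes_ideal.
      by move/(_ z); rewrite evalp1 => H; have := oner_neq0 K; rewrite H ?eqxx //;
        exists 1; rewrite ?oner_neq0 ?yscale1.
    have H0 h : (forall c : K, c != 0 -> evalp h (yscale c z) = 0) -> vanishes h A0.
      by move=> H w [c c0 ->]; apply: H.
    have [k1 Hk1] := hcomp_partition f; have [k2 Hk2] := hcomp_partition g.
    pose k := maxn k1 k2.
    pose q (h : R) := \poly_(e < k) evalp (hcomp e h) z.
    have qc h (c : K) : h = \sum_(d < k) hcomp d h -> (q h).[c] = evalp h (yscale c z).
      move=> Eh; rewrite horner_poly [in RHS]Eh evalp_sum; apply: eq_bigr => e _.
      by rewrite (evalp_yscale _ _ (hcompP _ _)) mulrC.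
    have Ef : f = \sum_(d < k) hcomp d f by apply: Hk1; apply: leq_maxl.
    have Eg : g = \sum_(d < k) hcomp d g by apply: Hk2; apply: leq_maxr.
    have /eqP : q f * q g * 'X = 0.
      apply/eqP/negPn/negP => /ex_nonroot[t]; rewrite !hornerM hornerX.
      case: (eqVneq t 0) => [->|t0]; first by rewrite mulr0 eqxx.
      by rewrite !qc // -evalpM Hfg ?mul0r ?eqxx //; exists t.
    rewrite mulf_eq0 polyX_eq0 orbF mulf_eq0 => /orP[]/eqP q0; [left|right]; apply: H0 => c _.
      by rewrite -qc // q0 horner0.
    by rewrite -qc // q0 horner0.
  - by move=> w c [c' c0' ->] c0; exists (c * c'); rewrite ?mulf_neq0 // yscaleA.
  - by move=> w [c c0 ->]; apply: coS.
  - by exists z, 1; rewrite ?oner_neq0 ?yscale1.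
have [|Z [[pZ coZ ZS [w Zw]] A0Z maxZ]] := @zorn_pred _ P _ A0 PA0.
  move=> F FP totF [A1 FA1]; split.
  - split=> [||f g Hfg]; first exact: vanishes_ideal.
      by have [[_ A11 _] _ _ _] := FP _ FA1 => H; apply: A11 => w A1w; apply: H; exists A1.
    apply: NNPP => /not_or_and[/not_vanishes[w1 [B1 FB1 Bw1] fw] /not_vanishes[w2 [B2 FB2 Bw2] gw]].
    have [B [FB Bw1' Bw2']] : exists B, [/\ F B, B w1 & B w2].
      by case: (totF _ _ FB1 FB2) => H; [exists B2|exists B1]; split=> //; apply: H.
    have [[_ _ PM] _ _ _] := FP _ FB.
    case: (PM f g) => [u Bu|/(_ _ Bw1')/eqP|/(_ _ Bw2')/eqP]; first by apply: Hfg; exists B.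
      by rewrite (negPf fw).
    by rewrite (negPf gw).
  - by move=> u c [B FB Bu] c0; exists B => //; have [_ coB _ _] := FP _ FB; apply: coB.
  - by move=> u [B FB Bu]; have [_ _ BS _] := FP _ FB; apply: BS.
  - by have [_ _ _ [u Bu]] := FP _ FA1; exists u, A1.
have Zz : Z z by apply: A0Z; exists 1; rewrite ?oner_neq0 ?yscale1.
have Zn u : Z u -> rsubmx u != 0 by move=> Zu; apply: (proj_closed_neq0 cS); apply: ZS.
have cZ : closedp Z.
  move=> u; split=> [|Zu]; last by apply: sub_proj_closure => //; apply: Zn.
  apply: maxZ; last by move=> v Zv; apply: sub_proj_closure => //; apply: Zn.
  have EI : (fun f : R => vanishes f (@proj_closure K n m Z)) = (fun f => vanishes f Z).
    apply: pred_ext => f; split=> H v.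
      by move=> Zv; apply: H; apply: sub_proj_closure => //; apply: Zn.
    move=> [v0 Hv]; have [k Hk] := hcomp_partition f.
    rewrite (Hk k (leqnn _)) evalp_sum big1 // => d _; apply: (Hv d); first exact: hcompP.
    exact: vanishes_hcomp.
  split; first by rewrite EI.
  - exact: (proj_closed_cone (proj_closure_closed _)).
  - move=> v [v0 Hv]; apply: (proj_closedP cS v0) => d f Hf Sf.
    by apply: (Hv d) => // t /ZS; apply: Sf.
  - by exists w; apply: sub_proj_closure => //; apply: Zn.
exists Z => //; split=> //; first by apply: prime_irreducible; [exists w|].
move=> Z' cZ' iZ' Z'S ZZ'; apply: maxZ => //.
split=> //; [exact: irreducible_prime|exact: proj_closed_cone|].
by exists w; apply: ZZ'.
Qed.

Lemma proj_separate (Z : 'rV[K]_N -> Prop) z : closedp Z -> rsubmx z != 0 -> ~ Z z ->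
  exists d (f : R), [/\ yhomog d f, vanishes f Z & evalp f z != 0].
Proof.
move=> cZ z0 nZ; apply: NNPP => H; apply: nZ; apply: (proj_closedP cZ z0) => d f Hf fZ.
by apply/eqP/negPn/negP => fz; apply: H; exists d, f.
Qed.
End Components.

Section Setup.
Variables (G : weighted_graph) (K : closedFieldType) (n m : nat) (X : 'rV[K]_n -> Prop)
  (O : 'rV[K]_n) (Y : 'rV[K]_(n + m.+1) -> Prop) (E : G -> 'rV[K]_(n + m.+1) -> Prop).
Hypotheses (nss : normal_surface_singularity X O) (gr : good_resolution_with_graph X O Y E).
Local Notation N := (n + m.+1)%N.
Local Notation R := {mpoly K[N]}.
Local Notation closedp := (closed_for (@proj_closure K n m)).
Local Notation sc := (subst_coef (@idK K)).
Implicit Types (f g a c : R) (u v w : G) (z : 'rV[K]_N).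

Lemma clY : closedp Y. Proof. exact: res_closed (gr_resolution gr). Qed.
Lemma coneY : cone Y. Proof. exact: proj_closed_cone clY. Qed.
Lemma primeY : prime_ideal (fun f : R => vanishes f Y).
Proof. exact: irreducible_prime clY (res_irreducible (gr_resolution gr)). Qed.
Lemma idealY : ideal (fun f : R => vanishes f Y). Proof. exact: vanishes_ideal. Qed.
Lemma clE w : closedp (E w). Proof. by have [] := gr_component gr w. Qed.
Lemma coneE w : cone (E w). Proof. exact: proj_closed_cone (clE w). Qed.
Lemma primeE w : prime_ideal (fun f : R => vanishes f (E w)).
Proof. by have [c i _ _] := gr_component gr w; apply: irreducible_prime. Qed.
Lemma idealE w : ideal (fun f : R => vanishes f (E w)). Proof. exact: vanishes_ideal. Qed.
Lemma E_exc w : psub (E w) (exceptional O Y). Proof. by have [] := gr_component gr w. Qed.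
Lemma E_Y w : psub (E w) Y. Proof. by move=> z /E_exc[]. Qed.
Lemma E_O w z : E w z -> lsubmx z = O. Proof. by move=> /E_exc[]. Qed.
Lemma E_neq0 w z : E w z -> rsubmx z != 0. Proof. exact: proj_closed_neq0 (clE w). Qed.
Lemma E_nonempty w : exists z, E w z.
Proof. by have [_ [] ] := gr_component gr w. Qed.
Lemma E_cover z : exceptional O Y z -> exists w, E w z.
Proof.
move=> /(in_component (exceptional_closed O clY))[Z cZ Zz].
by have [w EZ] := gr_all_components gr cZ; exists w; apply/EZ.
Qed.
Lemma E_incl u v : psub (E u) (E v) -> u = v.
Proof.
move=> uv; have [_ _ _ maxu] := gr_component gr u; have [cv iv sv _] := gr_component gr v.
by apply: (gr_distinct gr) => z; split; [apply: uv|apply: maxu].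
Qed.
Lemma E_separate u v : u != v -> exists d f, [/\ yhomog d f, vanishes f (E v) & ~ vanishes f (E u)].
Proof.
move=> uv; apply: NNPP => H; case/negP: uv; apply/eqP/E_incl => z Ez.
apply: NNPP => nz; have [d [f [Hf fv fz]]] := proj_separate (clE v) (E_neq0 Ez) nz.
by apply: H; exists d, f; split=> //; apply: (evalp_neq0_vanishes Ez).
Qed.

Lemma vanY_E w f : vanishes f Y -> vanishes f (E w). Proof. by move=> H z /E_Y; apply: H. Qed.

Definition xdiff i : R := 'X_(lshift m.+1 i) - (O 0 i)%:MP.
Lemma xdiff_hom i : yhomog 0 (xdiff i).
Proof.
apply: (subspaceB (yhomog_subspace _ _ _ 0)); first exact: yhomogx.
exact: yhomogC.
Qed.
Lemma xdiff_E i w : vanishes (xdiff i) (E w).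
Proof. by move=> z /E_O Oz; rewrite /xdiff !evalpE -Oz mxE subrr. Qed.

Lemma Y_generic : exists z, Y z /\ lsubmx z <> O.
Proof.
have [x Xx xO] := nss_nontrivial nss.
have [F Fx H] := res_iso (gr_resolution gr) Xx xO.
exists (row_mx x (eval_tuple F x)); rewrite row_mxKl; split=> //.
by apply/(H x Xx xO Fx); exists 1; rewrite ?oner_neq0 ?scale1r.
Qed.

Lemma xdiff_notY : exists i, ~ vanishes (xdiff i) Y.
Proof.
have [z [Yz zO]] := Y_generic; apply: NNPP => H; apply: zO; apply/rowP => i.
apply: NNPP => zi; apply: H; exists i => /(_ z Yz).
by rewrite /xdiff !evalpE => /eqP; rewrite subr_eq0 => /eqP E0; apply: zi; rewrite mxE.
Qed.

Definition hom f : Prop := exists d, yhomog d f.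

Lemma hom_hcomp d f : hom (hcomp d f). Proof. by exists d; apply: hcompP. Qed.
Lemma homM f g : hom f -> hom g -> hom (f * g).
Proof. by move=> [d Hd] [e He]; exists (d + e)%N; apply: yhomogM. Qed.
Lemma homX f k : hom f -> hom (f ^+ k).
Proof. by move=> [d Hd]; exists (k * d)%N; apply: yhomogMn. Qed.
Lemma hom1 : hom 1. Proof. by exists 0%N; rewrite -mpolyC1; apply: yhomogC. Qed.
Lemma hom0 : hom 0. Proof. by exists 0%N; apply: yhomog0. Qed.
Lemma hom_prod (I : Type) (r : seq I) (P : pred I) (F : I -> R) :
  (forall i, P i -> hom (F i)) -> hom (\prod_(i <- r | P i) F i).
Proof. by move=> H; apply: big_ind; [exact: hom1|exact: homM|]. Qed.

Lemma hom_quot b t c : hom b -> hom t -> vanishes (b - c * t) Y ->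
  exists2 c', hom c' & vanishes (b - c' * t) Y.
Proof.
move=> [d Hb] [e Ht] H.
have Hd : vanishes (hcomp d (b - c * t)) Y by apply: vanishes_hcomp => //; exact: coneY.
case: (leqP e d) => ed.
  exists (hcomp (d - e) c); first exact: hom_hcomp.
  move: Hd; rewrite hcompB hcomp_id // mulrC -{1}(subnKC ed) hcompM //.
  by rewrite mulrC.
exists 0; first exact: hom0.
by move: Hd; rewrite hcompB hcomp_id // mulrC (hcompM_lt _ Ht) // mul0r.
Qed.

Record local_eq w z t : Prop := LocalEq {
  leq_hom : hom t;
  leq_van : vanishes t (E w);
  leq_arc : exists j b, [/\ arc_in (chart Y j) b, chart (E w) j (start b), start b = normalize j z
    & sc t b 1%N != 0];
  leq_gen : forall f, hom f -> vanishes f (E w) ->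
    exists a c, [/\ hom a, hom c, evalp a z != 0 & vanishes (a * f - c * t) Y]
}.

Lemma ex_local_eq w z : E w z -> exists t, local_eq w z t.
Proof.
move=> Ez; have sY := res_smooth (gr_resolution gr).
have [d [t [Ht tE Hb Hg]]] := local_principal clY (clE w) (@E_Y w) sY (gr_smooth gr (v := w)) (primeE w) Ez.
exists t; split=> //; first by exists d.
move=> f [e Hf] fE; have [k [a [c [i [Ha az iY Eaf]]]]] := Hg e f Hf fE.
have [|||c' Hc' Ec'] := @hom_quot (a * f) t c.
- by apply: homM; [exists k|exists e].
- by exists d.
- by rewrite Eaf addrAC subrr add0r.
by exists a, c'; split=> //; exists k.
Qed.

Lemma tau_ex w : exists t, exists2 z, E w z & local_eq w z t.
Proof. by have [z Ez] := E_nonempty w; have [t Ht] := ex_local_eq Ez; exists t, z. Qed.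
(** A local equation at one arbitrary point of E_w is enough: it generates the ideal at the generic
    point of E_w, where orders are measured. *)
Definition tau w : R := proj1_sig (constructive_indefinite_description _ (tau_ex w)).
Lemma tauP w : exists2 z, E w z & local_eq w z (tau w).
Proof. by rewrite /tau; case: constructive_indefinite_description. Qed.
Lemma tau_hom w : hom (tau w). Proof. by have [z _ []] := tauP w. Qed.
Lemma tau_E w : vanishes (tau w) (E w). Proof. by have [z _ []] := tauP w. Qed.

(* The symbolic powers of the ideal of E_w: f vanishes to order at least k along E_w. *)
Definition og w k f : Prop := exists a c, ~ vanishes a (E w) /\ vanishes (a * f - c * tau w ^+ k) Y.

Lemma notE1 w : ~ vanishes 1 (E w). Proof. by have [_ ] := primeE w. Qed.
Lemma notEM w a b : ~ vanishes a (E w) -> ~ vanishes b (E w) -> ~ vanishes (a * b) (E w).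
Proof. exact: primeMn (primeE w). Qed.

Lemma og_vanY w k f : vanishes f Y -> og w k f.
Proof. by move=> fY; exists 1, 0; rewrite mul1r mul0r subr0; split=> //; apply: notE1. Qed.

Lemma og_ideal w k : ideal (og w k).
Proof.
split=> [|f g [a [c [na Ha]]] [b [d [nb Hb]]]|r f [a [c [na Ha]]]].
- by apply: og_vanY; apply: (ideal0 idealY).
- exists (a * b), (b * c + a * d); split; first exact: notEM.
  have -> : a * b * (f + g) - (b * c + a * d) * tau w ^+ k =
    b * (a * f - c * tau w ^+ k) + a * (b * g - d * tau w ^+ k) by ring.
  by apply: (idealD idealY); apply: (idealMl idealY).
- exists a, (r * c); split=> //.
  have -> : a * (r * f) - r * c * tau w ^+ k = r * (a * f - c * tau w ^+ k) by ring.
  exact: (idealMl idealY).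
Qed.

Lemma og0 w f : og w 0 f.
Proof.
by exists 1, f; split; [exact: notE1|rewrite expr0 mulr1 mul1r subrr; apply: (ideal0 idealY)].
Qed.

Lemma og_mono w k l f : og w (k + l)%N f -> og w k f.
Proof.
move=> [a [c [na Ha]]]; exists a, (c * tau w ^+ l); split=> //.
by rewrite -mulrA -exprD (addnC l k).
Qed.

Lemma og_le w k l f : (k <= l)%N -> og w l f -> og w k f.
Proof. by move=> /subnKC <-; apply: og_mono. Qed.

Lemma og_cancel w k x f : ~ vanishes x (E w) -> og w k (x * f) -> og w k f.
Proof.
by move=> nx [a [c [na Ha]]]; exists (a * x), c; rewrite -mulrA; split=> //; apply: notEM.
Qed.

Lemma ogM w k l f g : og w k f -> og w l g -> og w (k + l)%N (f * g).
Proof.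
move=> [a [c [na Ha]]] [b [d [nb Hb]]]; exists (a * b), (c * d); split; first exact: notEM.
have -> : a * b * (f * g) - c * d * tau w ^+ (k + l) =
   (a * f - c * tau w ^+ k) * (b * g) + c * tau w ^+ k * (b * g - d * tau w ^+ l).
  by rewrite exprD; ring.
by apply: (idealD idealY); [apply: (idealMr idealY)|apply: (idealMl idealY)].
Qed.

(** Take a homogeneous component of a outside P and the matching component of c. P will be the ideal
    of a curve or of a point. *)
Lemma hom_cofactor f c t (P : R -> Prop) a : ideal P -> hom f -> hom t -> ~ P a ->
  vanishes (a * f - c * t) Y ->
  exists a' c', [/\ hom a', hom c', ~ P a' & vanishes (a' * f - c' * t) Y].
Proof.
move=> iP [d Hf] Ht na H.
have [i ni] : exists i, ~ P (hcomp i a).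
  apply: NNPP => Hn; apply: na; have [k Hk] := hcomp_partition a; rewrite (Hk k (leqnn _)).
  by apply: (ideal_sum iP) => j _; apply: NNPP => nj; apply: Hn; exists j.
have : vanishes (hcomp (d + i)%N (f * a - t * c)) Y.
  by apply: vanishes_hcomp; [exact: coneY|rewrite mulrC [t * c]mulrC].
rewrite hcompB (hcompM _ _ Hf) => H2; have [e He] := Ht.
case: (leqP e (d + i)) => ed.
  exists (hcomp i a), (hcomp (d + i - e) c); split=> //; [exact: hom_hcomp|exact: hom_hcomp|].
  by move: H2; rewrite -{1}(subnKC ed) (hcompM _ _ He) ![hcomp _ _ * _]mulrC.
exists (hcomp i a), 0; split=> //; [exact: hom_hcomp|exact: hom0|].
by move: H2; rewrite (hcompM_lt _ He) // mul0r !subr0 mulrC.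
Qed.

Lemma og1P w f : og w 1 f <-> vanishes f (E w).
Proof.
split=> [[a [c [na Ha]]]|fE].
  have [iE _ pE] := primeE w.
  have : vanishes (a * f) (E w).
    have -> : a * f = (a * f - c * tau w ^+ 1) + c * tau w by rewrite expr1 subrK.
    by apply: (idealD iE); [apply: vanY_E|apply: (idealMl iE); apply: tau_E].
  by case/pE.
have [k Hk] := hcomp_partition f; rewrite (Hk k (leqnn _)).
apply: (ideal_sum (og_ideal w 1)) => d _.
have [z Ez Hz] := tauP w.
have [a [c [_ _ az H]]] := leq_gen Hz (hom_hcomp d f) (vanishes_hcomp d (@coneE w) fE).
by exists a, c; split; [apply: (evalp_neq0_vanishes Ez)|rewrite expr1].
Qed.

Lemma ogX w k l f : og w k f -> og w (l * k)%N (f ^+ l).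
Proof.
move=> Hf; elim: l => [|l IH]; first by rewrite mul0n; apply: og0.
by rewrite exprS mulSn; apply: ogM.
Qed.

Lemma og_vanX w f k : vanishes f (E w) -> og w k (f ^+ k).
Proof. by move=> /og1P /(@ogX w 1 k); rewrite muln1. Qed.

Lemma og_Y_congr w k f g : vanishes (f - g) Y -> og w k f -> og w k g.
Proof.
move=> fg Hf; have -> : g = f - (f - g) by rewrite subKr.
by apply: (idealB (og_ideal w k)) => //; apply: og_vanY.
Qed.

Lemma tau_notY w : ~ vanishes (tau w) Y.
Proof.
move=> tY; have [i ni] := xdiff_notY; have [z Ez Hz] := tauP w.
have [a [c [_ _ az H]]] := leq_gen Hz (ex_intro _ 0%N (xdiff_hom i)) (@xdiff_E i w).
have [iY _ pY] := primeY.
have : vanishes (a * xdiff i) Y.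
  rewrite -[_ * _](subrK (c * tau w)).
  by apply: (idealD iY) => //; apply: (idealMl iY).
by case/pY => // /(_ _ (E_Y Ez)) az0; rewrite az0 eqxx in az.
Qed.

Lemma og_tau w k l g : og w (k + l)%N (tau w ^+ k * g) -> og w l g.
Proof.
move=> [a [c [na H]]]; exists a, c; split=> //.
have [_ _ pY] := primeY.
case: (pY (tau w ^+ k) (a * g - c * tau w ^+ l)) => // [|tk].
  suff -> : tau w ^+ k * (a * g - c * tau w ^+ l) =
    a * (tau w ^+ k * g) - c * tau w ^+ (k + l) by [].
  by rewrite exprD; ring.
by case: (tau_notY (primeX primeY tk)).
Qed.

(** Additivity of the valuation: the cofactor c of f is a unit at the generic point of E_w, since
    otherwise f would have order k + 1. *)
Lemma og_exact w k l f g : og w k f -> ~ og w k.+1 f -> og w (k + l)%N (f * g) -> og w l g.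
Proof.
move=> [a [c [na Ha]]] nf Hfg.
have nc : ~ vanishes c (E w).
  move=> cE; apply: nf; apply: (og_cancel na).
  apply: (@og_Y_congr _ _ (c * tau w ^+ k)).
    by rewrite -opprB; apply: (idealN idealY).
  rewrite -add1n; apply: ogM; first exact/og1P.
  exact: og_vanX (@tau_E w).
apply: (og_cancel nc); apply: (@og_tau _ k).
apply: (@og_Y_congr _ _ (a * (f * g))); last exact: (idealMl (og_ideal w _)).
have -> : a * (f * g) - tau w ^+ k * (c * g) = g * (a * f - c * tau w ^+ k) by ring.
exact: (idealMl idealY).
Qed.

Lemma exactM w k l f g : og w k f -> ~ og w k.+1 f -> ~ og w l.+1 g -> ~ og w (k + l).+1 (f * g).
Proof. by move=> Hf nf ng; rewrite -addnS => /(og_exact Hf nf). Qed.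

Lemma exactX w f l : ~ og w 2 f -> vanishes f (E w) -> ~ og w l.+1 (f ^+ l).
Proof.
move=> nf /og1P Hf; elim: l => [|l IH]; first by rewrite expr0 => /og1P /notE1.
by rewrite exprS; apply: (@exactM w 1).
Qed.

Lemma local_eq_exact w z t : E w z -> local_eq w z t -> ~ og w 2 t.
Proof.
move=> Ez Ht H2; have [a [c [_ _ az H]]] := leq_gen Ht (tau_hom w) (@tau_E w).
have : og w (1 + 1)%N (tau w ^+ 1 * 1).
  rewrite expr1 mulr1.
  apply: (og_cancel (evalp_neq0_vanishes Ez az)); apply: (@og_Y_congr _ _ (c * t)).
    by rewrite -opprB; apply: (idealN idealY).
  exact: (idealMl (og_ideal w _)).
by move/og_tau/og1P/notE1.
Qed.

(** Symbolic and ordinary powers agree at z because the ideal of E_w is principal there; each step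
    of the induction divides by one more t. *)
Lemma local_gen_og w z t k f : E w z -> local_eq w z t -> hom f -> og w k f ->
  exists a c, [/\ hom a, hom c, evalp a z != 0 & vanishes (a * f - c * t ^+ k) Y].
Proof.
move=> Ez Ht Hf; elim: k => [_|k IH Hk].
  exists 1, f; split=> //; [exact: hom1|by rewrite evalp1 oner_neq0|].
  by rewrite mul1r expr0 mulr1 subrr; apply: (ideal0 idealY).
have [a [c [Ha Hc az H]]] := IH (og_le (leqnSn k) Hk).
have cE : vanishes c (E w).
  apply/og1P; apply: (@og_exact w k 1 (t ^+ k)).
  - exact: og_vanX (leq_van Ht).
  - by apply: exactX; [exact: local_eq_exact Ht|exact: leq_van Ht].
  rewrite addn1; apply: (@og_Y_congr _ _ (a * f)); first by rewrite [t ^+ k * c]mulrC.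
  exact: (idealMl (og_ideal w _)).
have [a' [c' [Ha' Hc' az' H']]] := leq_gen Ht Hc cE.
exists (a' * a), c'; split=> //; [exact: homM|by rewrite evalpM mulf_neq0|].
have -> : a' * a * f - c' * t ^+ k.+1 =
   a' * (a * f - c * t ^+ k) + t ^+ k * (a' * c - c' * t) by rewrite exprS; ring.
by apply: (idealD idealY); apply: (idealMl idealY).
Qed.

(** Krull's intersection theorem: at the generic point of E_w the intersection J satisfies J = tau
    J, so by Nakayama a multiplier not vanishing on E_w kills J on Y. *)
Lemma og_cap w f : (forall k, og w k f) -> vanishes f Y.
Proof.
pose J f := forall k, og w k f; move=> Jf.
have iJ : ideal J.
  split=> [k|x y Jx Jy k|a x Jx k]; first exact: (ideal0 (og_ideal w k)).
    by apply: (idealD (og_ideal w k)).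
  by apply: (idealMl (og_ideal w k)).
have [s [sJ Js]] := @noetherian_mpoly K N J iJ.
have [||||||b nb Hb] := @nakayama _ (fun a => ~ vanishes a (E w)) (fun a => vanishes a (E w))
    (fun f => vanishes f Y) s.
- exact: notE1.
- by move=> a b; apply: notEM.
- by move=> a q na qE H; apply: na; rewrite -[a](subrK q); apply: (idealD (idealE w)).
- exact: idealE.
- exact: idealY.
- move=> x /sJ Jx; have [a [c [na H]]] := Jx 1%N.
  exists a, (a * x - c * tau w), (tau w * c); split=> //.
  + apply: span_mull; [exact: idealE|exact: tau_E|]; apply: Js => k.
    apply: (@og_tau _ 1); rewrite expr1; apply: (@og_Y_congr _ _ (a * x)); first by rewrite [tau w * c]mulrC.
    exact: (idealMl (og_ideal w _)).
  + by rewrite [tau w * c]mulrC subrK.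
have : vanishes (b * f) Y.
  have [iY _ _] := primeY.
  have iB : ideal (fun g => vanishes (b * g) Y).
    split=> [|g h Hg Hh|r g Hg]; first by rewrite mulr0; apply: (ideal0 iY).
      by rewrite mulrDr; apply: (idealD iY).
    by rewrite mulrCA; apply: (idealMl iY).
  exact: (span_sub iB Hb (Js f Jf)).
have [_ _ pY] := primeY; case/pY => // bY.
by case: nb; apply: vanY_E.
Qed.

Lemma exact_order w f : ~ vanishes f Y -> exists2 k, og w k f & ~ og w k.+1 f.
Proof.
move=> nf; have [|k [nk mk]] := @ex_min_nat (fun k => ~ og w k f).
  by apply: NNPP => H; apply: nf; apply: (@og_cap w) => k; apply: NNPP => nk; apply: H; exists k.
case: k nk mk => [|k] nk mk; first by case: nk; apply: og0.
by exists k => //; apply: NNPP => H; have := mk k H; rewrite ltnn.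
Qed.

Lemma hcomp_ideal (J : R -> Prop) : ideal J -> ideal (fun f => forall d, J (hcomp d f)).
Proof.
move=> iJ; split=> [d|f g Hf Hg d|r f Hf d].
- by rewrite (hcomp_ne (yhomog0 _ _ _ d.+1)) ?gtn_eqF //; apply: (ideal0 iJ).
- by rewrite hcompD; apply: (idealD iJ).
have [k Hk] := hcomp_partition r; rewrite (Hk k (leqnn _)) mulr_suml hcomp_sum0.
apply: (ideal_sum iJ) => e _; case: (leqP e d) => [/subnKC <-|de].
  by rewrite (hcompM _ _ (hcompP e r)); apply: (idealMl iJ).
by rewrite (hcompM_lt _ (hcompP e r)) //; apply: (ideal0 iJ).
Qed.

Lemma hcomp_in (J : R -> Prop) f : ideal J -> hom f -> J f -> forall d, J (hcomp d f).
Proof.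
move=> iJ [e He] Jf d; case: (eqVneq e d) => [<-|ed]; first by rewrite hcomp_id.
by rewrite (hcomp_ne He ed); apply: (ideal0 iJ).
Qed.

Lemma hcomp_out (J : R -> Prop) f : ideal J -> (forall d, J (hcomp d f)) -> J f.
Proof.
move=> iJ H; have [k Hk] := hcomp_partition f; rewrite (Hk k (leqnn _)).
exact: (ideal_sum iJ).
Qed.

(* Stated on homogeneous components, so that M D is visibly a homogeneous ideal. *)
Definition M (D : G -> nat) f : Prop := forall d w, og w (D w) (hcomp d f).

Lemma M_ideal D : ideal (M D).
Proof.
have iJ : ideal (fun f => forall w, og w (D w) f).
  split=> [w|f g Hf Hg w|r f Hf w]; first exact: (ideal0 (og_ideal w _)).
    exact: (idealD (og_ideal w _)).
  exact: (idealMl (og_ideal w _)).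
exact: (hcomp_ideal iJ).
Qed.

Lemma M_og D f w : M D f -> og w (D w) f.
Proof. by move=> H; apply: (hcomp_out (og_ideal w _)) => d; apply: H. Qed.

Lemma M_hom D f : hom f -> (forall w, og w (D w) f) -> M D f.
Proof. by move=> Hf H d w; apply: (hcomp_in (og_ideal w _)). Qed.

Lemma M_hcomp D f d : M D f -> M D (hcomp d f).
Proof. by move=> H; apply: M_hom; [exact: hom_hcomp|move=> w; apply: H]. Qed.

Lemma M_le D D' f : (forall w, (D w <= D' w)%N) -> M D' f -> M D f.
Proof. by move=> H Mf d w; apply: og_le (Mf d w). Qed.

Lemma M_Y D f : vanishes f Y -> M D f.
Proof. by move=> fY d w; apply: og_vanY; apply: vanishes_hcomp => //; exact: coneY. Qed.

Lemma MM D D' D2 f g : (forall w, D2 w = D w + D' w)%N -> hom f -> hom g -> M D f -> M D' g -> M D2 (f * g).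
Proof.
move=> E2 hf hg Hf Hg; apply: M_hom; first exact: homM.
by move=> w; rewrite E2; apply: ogM; apply: M_og.
Qed.

Lemma local_eq_other w w' z t : E w z -> E w' z -> local_eq w z t -> w != w' -> ~ vanishes t (E w').
Proof.
move=> Ez Ez' Ht ww' tE; rewrite eq_sym in ww'.
have [d [f [Hf fw nf]]] := E_separate ww'.
have [a [c [_ _ az H]]] := leq_gen Ht (ex_intro _ d Hf) fw.
have [iE _ pE] := primeE w'.
have : vanishes (a * f) (E w').
  by rewrite -[_ * _](subrK (c * t)); apply: (idealD iE); [apply: vanY_E|apply: (idealMl iE)].
by case/pE => // /(_ _ Ez') az0; rewrite az0 eqxx in az.
Qed.

(** The generator is the product of the t_w^(D_w) over the curves through z. A curve missing z
    contributes a factor that vanishes on it but not at z, so that the product belongs to [M D]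
    globally. *)
Lemma M_local D z : rsubmx z != 0 -> exists th, [/\ hom th, M D th,
    forall w, E w z -> ~ og w (D w).+1 th
  & forall f, hom f -> (forall w, E w z -> og w (D w) f) ->
    exists a c, [/\ hom a, hom c, evalp a z != 0 & vanishes (a * f - c * th) Y]].
Proof.
move=> z0.
(* Curves are added one by one; along a curve through z that is not yet treated, th has order 0,
   whence the bound 1. *)
suff [th [H1 H2 H3 H4]] : exists th, [/\ hom th, forall w, w \in enum G -> og w (D w) th,
    forall w, E w z -> ~ og w (if w \in enum G then (D w).+1 else 1%N) th
  & forall f, hom f -> (forall w, w \in enum G -> E w z -> og w (D w) f) ->
    exists a c, [/\ hom a, hom c, evalp a z != 0 & vanishes (a * f - c * th) Y]].
  exists th; split=> // [|w Ez|f Hf Mf].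
  - by apply: M_hom => // w; apply: H2; rewrite mem_enum.
  - by have := H3 w Ez; rewrite mem_enum.
  - by apply: H4 => // w _; apply: Mf.
elim: (enum G) (enum_uniq G) => [_|w r IH /=/andP[wr /IH[th [H1 H2 H3 H4]]]].
  exists 1; split=> //; first exact: hom1.
    by move=> w _ /og1P /notE1.
  move=> f Hf _; exists 1, f; split=> //; [exact: hom1|by rewrite evalp1 oner_neq0|].
  by rewrite mulr1 mul1r subrr; apply: (ideal0 idealY).
case: (classic (E w z)) => [Ez|nEz].
  have [t Ht] := ex_local_eq Ez; exists (th * t ^+ D w).
  have nth1 : ~ og w 1 th by have := H3 w Ez; rewrite (negPf wr).
  split.
  - by apply: homM => //; apply: homX; apply: leq_hom Ht.
  - move=> w'; rewrite inE => /orP[/eqP ->|w'r].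
      by apply: (idealMl (og_ideal w _)); apply: og_vanX; apply: leq_van Ht.
    by apply: (idealMr (og_ideal w' _)); apply: H2.
  - move=> w' Ez'; case: (eqVneq w' w) => [->|w'w].
      rewrite mem_head; apply: (@exactM w 0) => //; first exact: og0.
      by apply: exactX; [exact: local_eq_exact Ht|exact: leq_van Ht].
    rewrite inE (negPf w'w) /= mulrC => /og_cancel H; apply: (H3 w' Ez'); apply: H.
    by move=> /(primeX (primeE w')); apply: local_eq_other Ht _ => //; rewrite eq_sym.
  - move=> f Hf Mf; have [|a [c [Ha Hc az H]]] := H4 f Hf.
      by move=> w' w'r; apply: Mf; apply: mem_tail.
    have cD : og w (D w) c.
      apply: (@og_exact w 0 (D w) th) => //; first exact: og0.
      apply: (@og_Y_congr _ _ (a * f)); first by rewrite [th * c]mulrC.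
      by apply: (idealMl (og_ideal w _)); apply: Mf => //; apply: mem_head.
    have [a' [c' [Ha' Hc' az' H']]] := local_gen_og Ez Ht Hc cD.
    exists (a' * a), c'; split=> //; [exact: homM|by rewrite evalpM mulf_neq0|].
    have -> : a' * a * f - c' * (th * t ^+ D w) =
      a' * (a * f - c * th) + th * (a' * c - c' * t ^+ D w) by ring.
    by apply: (idealD idealY); apply: (idealMl idealY).
have [d [eta [He etaE etaz]]] := proj_separate (clE w) z0 nEz.
exists (th * eta ^+ D w).
have He' : hom (eta ^+ D w) by apply: homX; exists d.
split.
- exact: homM.
- move=> w'; rewrite inE => /orP[/eqP ->|w'r].
    by apply: (idealMl (og_ideal w _)); apply: og_vanX.
  by apply: (idealMr (og_ideal w' _)); apply: H2.
- move=> w' Ez'; rewrite inE; case: eqP => [Ew|_]; first by case: nEz; rewrite -Ew.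
  rewrite /= mulrC => /og_cancel H; apply: (H3 w' Ez'); apply: H.
  by move=> /(primeX (primeE w')) /(_ _ Ez') e0; rewrite e0 eqxx in etaz.
- move=> f Hf Mf; have [|a [c [Ha Hc az H]]] := H4 f Hf.
    by move=> w' w'r; apply: Mf; apply: mem_tail.
  exists (a * eta ^+ D w), c; split=> //; first exact: homM.
    by rewrite evalpM mulf_neq0 // evalpX expf_neq0.
  have -> : a * eta ^+ D w * f - c * (th * eta ^+ D w) = eta ^+ D w * (a * f - c * th) by ring.
  exact: (idealMl idealY).
Qed.
End Setup.

(** * Graded torsion and Hilbert functions *)

Section Graded.
Variables (K : closedFieldType) (n m : nat).
Local Notation N := (n + m.+1)%N.
Local Notation R := {mpoly K[N]}.
Implicit Types (f g r : R) (z : 'rV[K]_N).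

Lemma yhomog_power (J : R -> Prop) k i r : ideal J -> (forall l, J ('X_(rshift n l) ^+ k)) ->
  (m.+1 * k <= i)%N -> yhomog i r -> J r.
Proof.
move=> iJ Jk ki /allP Hr; rewrite (mpolyE r); apply: (big_ind J).
- exact: (ideal0 iJ).
- exact: (idealD iJ).
move=> mu _; case: (boolP (mu \in msupp r)) => [/Hr /eqP Emu|/memN_msupp_eq0 ->]; last first.
  by rewrite scale0r; apply: (ideal0 iJ).
rewrite -mul_mpolyC; apply: (idealMl iJ).
have [l kl] : exists l : 'I_m.+1, (k <= mu (rshift n l))%N.
  case: (posnP k) => [->|k0]; first by exists ord0.
  apply: NNPP => H; have : (\sum_(j < m.+1) mu (rshift n j) <= \sum_(j < m.+1) k.-1)%N.
    apply: leq_sum => j _; rewrite -ltnS prednK // ltnNge; apply/negP => kj; apply: H.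
    by exists j.
  by rewrite Emu sum_nat_const card_ord; nia.
have le : (U_(rshift n l) *+ k <= mu)%MM.
  apply/mnm_lepP => t; rewrite mulmnE mnm1E; case: eqP => [<-|_]; last by rewrite mul0n.
  by rewrite mul1n.
by rewrite -(submK le) mpolyXD -mpolyXn; apply: (idealMl iJ).
Qed.

Lemma graded_eventually (B J : R -> Prop) : ideal B -> ideal J ->
  (forall x, B x -> exists k, forall j r, (k <= j)%N -> J (hcomp j (r * x))) ->
  exists k, forall j f, (k <= j)%N -> B f -> J (hcomp j f).
Proof.
move=> iB iJ H; have [s [sB Bs]] := @noetherian_mpoly K N B iB.
suff [k Hk] : exists k, forall j f, (k <= j)%N -> span (@full _) s f -> J (hcomp j f).
  by exists k => j f kj /Bs; apply: Hk.
elim: s sB {Bs} => [_|x s IH sB].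
  exists 0%N => j f _ ->; rewrite (hcomp_ne (yhomog0 _ _ _ j.+1)) ?gtn_eqF //.
  exact: (ideal0 iJ).
have [|k1 Hk1] := IH; first by move=> y ys; apply: sB; apply: mem_tail.
have [k2 Hk2] := H x (sB x (mem_head _ _)).
exists (maxn k1 k2) => j f; rewrite geq_max => /andP[j1 j2] [c [z [_ Hz ->]]].
by rewrite hcompD; apply: (idealD iJ); [apply: Hk2|apply: Hk1].
Qed.

Lemma hcomp_mul_eventually (J : R -> Prop) x : ideal J ->
  (forall e, exists k, forall i r, (k <= i)%N -> yhomog i r -> J (r * hcomp e x)) ->
  exists k, forall j r, (k <= j)%N -> J (hcomp j (r * x)).
Proof.
move=> iJ Hc; have [k0 Hk0] := hcomp_partition x; have [kk Hkk] := choice _ Hc.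
exists (\sum_(e < k0) kk e + k0)%N => j r kj.
rewrite (Hk0 k0 (leqnn _)) mulr_sumr hcomp_sum0; apply: (ideal_sum iJ) => e _.
have je : (e <= j)%N by have := ltn_ord e; lia.
rewrite mulrC -{1}(subnKC je) (hcompM _ _ (hcompP e x)) mulrC; apply: Hkk (hcompP _ _).
have : (kk e <= \sum_(e < k0) kk e)%N by rewrite (bigD1 e) //= leq_addr.
by have := ltn_ord e; lia.
Qed.

(** The local-to-global principle of the proof. The elements lying in J locally at all points with y
    nonzero form the saturation of J; its homogeneous part is finitely generated, and all forms of
    large degree carry each generator into J. *)
Lemma torsion_uniform (J : R -> Prop) : ideal J -> exists j0, forall j f, (j0 <= j)%N -> yhomog j f ->
  (forall z, rsubmx z != 0 -> exists2 c, evalp c z != 0 & J (c * f)) -> J f.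
Proof.
move=> iJ; pose B0 f := forall z, rsubmx z != 0 -> exists2 c, evalp c z != 0 & J (c * f).
have iB0 : ideal B0.
  split=> [z _|f g Hf Hg z z0|r f Hf z z0].
  - by exists 1; rewrite ?evalp1 ?oner_neq0 // mulr0; apply: (ideal0 iJ).
  - have [a az Ja] := Hf z z0; have [b bz Jb] := Hg z z0; exists (a * b).
      by rewrite evalpM mulf_neq0.
    have -> : a * b * (f + g) = b * (a * f) + a * (b * g) by ring.
    by apply: (idealD iJ); apply: (idealMl iJ).
  - by have [a az Ja] := Hf z z0; exists a => //; rewrite mulrCA; apply: (idealMl iJ).
have iB := hcomp_ideal iB0.
have stepA a : B0 a -> exists k, forall i r, (k <= i)%N -> yhomog i r -> J (r * a).
  move=> Ba; have iC : ideal (fun c => J (c * a)).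
    split=> [|x y Hx Hy|x y Hy]; first by rewrite mul0r; apply: (ideal0 iJ).
      by rewrite mulrDl; apply: (idealD iJ).
    by rewrite -mulrA; apply: (idealMl iJ).
  have [|k Hk] := proj_nullstellensatz iC.
    move=> z Hz; apply/eqP/negPn/negP => z0; have [c cz Jc] := Ba z z0.
    by rewrite Hz ?eqxx in cz.
  by exists (m.+1 * k)%N => i r ki Hr; apply: (yhomog_power iC Hk ki Hr).
have [|k Hk] := graded_eventually iB iJ; last first.
  exists k => j f kj Hf Bf; rewrite -(hcomp_id Hf); apply: Hk => //.
  by apply: (hcomp_in iB0) => //; exists j.
by move=> x Bx; apply: hcomp_mul_eventually => // e; apply: stepA; apply: Bx.
Qed.

(* The coefficients are the powers of a generic t. *)
Lemma linear_nonzero (s : seq 'rV[K]_N) : (forall z, z \in s -> rsubmx z != 0) ->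
  exists2 l, yhomog 1 l & forall z, z \in s -> evalp l z != 0.
Proof.
move=> Hs; pose q (z : 'rV[K]_N) : {poly K} := \poly_(i < m.+1) ycoord (inord i) z.
have q0 z : z \in s -> q z != 0.
  move=> /Hs/ex_ycoord[j yj]; apply/eqP => /(congr1 (fun p : {poly K} => p`_j)).
  by rewrite coef_poly ltn_ord inord_val coef0; apply/eqP.
have /ex_nonroot[t Ht] : \prod_(z <- s) q z != 0.
  by rewrite prodf_seq_neq0; apply/allP => z zs; apply/implyP => _; apply: q0.
exists (\sum_(j < m.+1) t ^+ j *: 'X_(rshift n j)).
  by apply: (subspace_comb _ _ (yhomog_subspace _ _ _ 1)) => j; apply: yhomogy.
move=> z zs; move: Ht; rewrite horner_prod prodf_seq_neq0 => /allP/(_ z zs)/=.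
rewrite horner_poly evalp_sum; congr (_ != 0); apply: eq_bigr => j _.
by rewrite evalpZ evalp_yvar inord_val mulrC.
Qed.

Lemma linear_separate z z' : rsubmx z != 0 -> rsubmx z' != 0 -> lsubmx z = lsubmx z' -> ~ same_point z' z ->
  exists l, [/\ yhomog 1 l, evalp l z = 0 & evalp l z' != 0].
Proof.
move=> z0 z'0 Ez H; apply: NNPP => Hl; apply: H; split=> //.
have [j zj] := ex_ycoord z0.
have L i : ycoord j z * ycoord i z' = ycoord i z * ycoord j z'.
  apply/eqP; rewrite -subr_eq0; apply/negPn/negP => D; apply: Hl.
  exists (ycoord j z *: 'X_(rshift n i) - ycoord i z *: 'X_(rshift n j)).
  rewrite !evalpB !evalpZ !evalp_yvar; split=> //; last by rewrite mulrC subrr.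
  apply: (subspaceB (yhomog_subspace _ _ _ 1)); exact: yhomogZ (yhomogy _ _ _).
exists (ycoord j z' / ycoord j z).
  rewrite mulf_neq0 ?invr_neq0 //; apply/eqP => z'j; case/negP: z'0; apply/eqP/rowP => i.
  have := L i; rewrite z'j mulr0 => /eqP; rewrite mulf_eq0 (negPf zj) /= => /eqP.
  by move=> yi; rewrite ycoord_rsub yi mxE.
apply/rowP => i; rewrite !mxE -/(ycoord i z') -/(ycoord i z); apply: (mulfI zj); rewrite L; field.
exact: zj.
Qed.

Lemma interpolate (s : seq 'rV[K]_N) z' : rsubmx z' != 0 ->
  (forall z, z \in s -> [/\ rsubmx z != 0, lsubmx z = lsubmx z' & ~ same_point z' z]) ->
  exists l, [/\ hom l, forall z, z \in s -> evalp l z = 0 & evalp l z' != 0].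
Proof.
move=> z'0; elim: s => [|z s IH] Hs.
  by exists 1; split=> //; [apply: hom1|rewrite evalp1 oner_neq0].
have [|l [hl l0 lz']] := IH; first by move=> y ys; apply: Hs; apply: mem_tail.
have [z0 Ez Hz] := Hs z (mem_head _ _); have [l1 [h1 l1z l1z']] := linear_separate z0 z'0 Ez Hz.
exists (l1 * l); split; first by apply: homM => //; exists 1%N.
  by move=> y; rewrite inE evalpM => /orP[/eqP -> |/l0 ->]; rewrite ?l1z ?mul0r ?mulr0.
by rewrite evalpM mulf_neq0.
Qed.
End Graded.

Section Dimension.
Variables (K : fieldType) (V : lmodType K).
Lemma quotient_dim_exact (A B : V -> Prop) k : subspace B -> quotient_dim A B k ->
  dim_ge A B k /\ dim_le A B k.
Proof.
move=> sB [e [Ae He]]; split; last first.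
  apply: (@dim_le_spanned _ _ _ _ _ e) => // u /He[c [Hc _]].
  by exists (fun i => c 0 i).
have B0 : B 0 by case: sB.
case: (posnP k) => k0; first by subst k; exists e => // c _ [].
exists e => // c Hc i; have A0 : A (e i) by [].
have [d [Hd Ud]] := He _ A0.
have E1 : d = d + \row_i c i.
  apply: Ud; have -> : e i - \sum_(i < k) (d + \row_i c i) 0 i *: e i =
    (e i - \sum_(i < k) d 0 i *: e i) - \sum_(i < k) c i *: e i.
    rewrite -addrA -opprD -big_split; congr (_ - _); apply: eq_bigr => j _.
    by rewrite !mxE scalerDl.
  by apply: subspaceB.
have /rowP/(_ i) : \row_i c i = 0 by apply: (addrI d); rewrite addr0 -E1.
by rewrite !mxE.
Qed.
End Dimension.

Section Setup.
Variables (G : weighted_graph) (K : closedFieldType) (n m : nat) (X : 'rV[K]_n -> Prop)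
  (O : 'rV[K]_n) (Y : 'rV[K]_(n + m.+1) -> Prop) (E : G -> 'rV[K]_(n + m.+1) -> Prop).
Hypotheses (nss : normal_surface_singularity X O) (gr : good_resolution_with_graph X O Y E).
Local Notation N := (n + m.+1)%N.
Local Notation R := {mpoly K[N]}.
Local Notation og := (og gr).
Local Notation M := (M gr).
Local Notation H j := (fun f : R => is_true (yhomog j f)).
Implicit Types (f g a c : R) (u v w : G) (z : 'rV[K]_N).

Lemma ideal_deg_subspace (Z : 'rV[K]_N -> Prop) j : subspace (ideal_deg Z j).
Proof.
apply: subspace_cap; first exact: yhomog_subspace.
by apply: subspace_ideal; apply: vanishes_ideal.
Qed.

Lemma hilbert_exists w : exists h d0, forall d, (d0 <= d)%N -> exists k,
  [/\ hilbert_fun (E w) d k, dim_ge (H d) (ideal_deg (E w) d) k, dim_le (H d) (ideal_deg (E w) d) k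
    & (k + genus w = h * d + 1)%N].
Proof.
have [h [d0 Hd]] := gr_genus gr w; exists h, d0 => d /Hd[k Hk Ek]; exists k.
by have [] := quotient_dim_exact (@ideal_deg_subspace _ _) Hk; split.
Qed.

(** Bezout by Hilbert functions: r distinct zeros of b impose r independent conditions in large
    degree, while multiplication by b, of degree c, embeds a space smaller by only h c into the
    forms vanishing at them. Hence r is at most h c. *)
Lemma finite_zeros w b : hom b -> ~ vanishes b (E w) ->
  exists s : seq 'rV[K]_N, (forall z, z \in s -> E w z /\ evalp b z = 0) /\
    forall z, E w z -> evalp b z = 0 -> exists2 z', z' \in s & same_point z z'.
Proof.
move=> [c Hb] nb; apply: NNPP => Hn.
have Hr r : exists q : 'I_r -> 'rV[K]_N, [/\ forall i, E w (q i), forall i, evalp b (q i) = 0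
   & forall i j, i != j -> ~ same_point (q i) (q j)].
  elim: r => [|r [q [qE qb qq]]]; first by exists (fun _ => 0); split=> -[].
  have [z [Ez bz Hz]] : exists z, [/\ E w z, evalp b z = 0 & forall i, ~ same_point z (q i)].
    apply: NNPP => Hz; apply: Hn; exists (codom q); split=> [z /codomP[i ->] //|z Ez bz].
    apply: NNPP => Hz'; apply: Hz; exists z; split=> // i Hi; apply: Hz'; exists (q i) => //.
    exact: codom_f.
  exists (fun i => if unlift ord0 i is Some j then q j else z); split=> [i|i|i j].
  - by case: unliftP.
  - by case: unliftP.
  case: unliftP => [i' ->|->]; case: unliftP => [j' ->|->] //; rewrite ?eqxx //.
    by rewrite (inj_eq lift_inj); apply: qq.
  move=> _ [Hl [a a0 Ha]]; apply: (Hz i'); split=> //; exists a^-1; first by rewrite invr_eq0.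
  by rewrite Ha scalerA mulVf // scale1r.
have [h [d0 Hd]] := hilbert_exists w.
pose r := (h * c).+1; have [q [qE qb qq]] := Hr r.
have Hl (i : 'I_r) : exists l, [/\ hom l, forall j, j != i -> evalp l (q j) = 0 & evalp l (q i) != 0].
  have [||l [hl l0 li]] := @interpolate K n m [seq q j | j <- enum 'I_r & j != i] (q i).
  - exact: (E_neq0 gr (qE i)).
  - move=> z /mapP[j]; rewrite mem_filter => /andP[ji _] ->; split.
    + exact: (E_neq0 gr (qE j)).
    + by rewrite !(E_O gr (qE _)).
    + by apply: qq; rewrite eq_sym.
  exists l; split=> // j ji; apply: l0; apply/mapP; exists j => //.
  by rewrite mem_filter ji mem_enum.
have [l Hl'] := choice _ Hl.
have [e He] : exists e : 'I_r -> nat, forall i, yhomog (e i) (l i).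
  by apply: (choice (fun i e => yhomog e (l i))) => i; have [] := Hl' i.
have [L HL Lq] : exists2 L : R, yhomog 1 L & forall i, evalp L (q i) != 0.
  have [z|L HL Lq] := @linear_nonzero K n m (codom q).
    by move=> /codomP[i ->]; exact: (E_neq0 gr (qE i)).
  by exists L => // i; apply: Lq; apply: codom_f.
pose d := (d0 + \sum_i e i)%N.
have de i : (e i <= d + c)%N by rewrite /d (bigD1 i) //=; lia.
have [|k1 [_ ge1 le1 E1]] := Hd d; first exact: leq_addr.
have [|k2 [_ ge2 le2 E2]] := Hd (d + c)%N; first by rewrite /d; lia.
pose W f := yhomog (d + c)%N f /\ forall i, evalp f (q i) = 0.
have sW : subspace W.
  apply: subspace_cap; first exact: yhomog_subspace.
  split=> [i|x y Hx Hy i|t x Hx i]; first by rewrite evalp0.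
    by rewrite evalpD Hx Hy addr0.
  by rewrite evalpZ Hx mulr0.
have geW : dim_ge (H (d + c)%N) W r.
  exists (fun i => l i * L ^+ (d + c - e i)) => [i|t [_ Ht] i].
    rewrite -(subnKC (de i)); apply: yhomogM => //; first by rewrite addKn -[X in yhomog X]muln1; apply: yhomogMn.
  have := Ht i; rewrite evalp_sum (bigD1 i) //= big1 => [|j ji]; last first.
    by have [_ lj _] := Hl' j; rewrite evalpZ evalpM (lj i) ?mul0r ?mulr0 // eq_sym.
  have [_ _ li] := Hl' i.
  rewrite addr0 evalpZ evalpM evalpX => /eqP; rewrite !mulf_eq0 (negPf li) expf_eq0 (negPf (Lq i)) andbF !orbF.
  by move/eqP.
have pW x : ideal_deg (E w) (d + c)%N x -> W x by move=> [Hx xE]; split=> // i; apply: xE.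
have gepW : dim_ge W (ideal_deg (E w) (d + c)%N) k1.
  apply: (@dim_ge_rel _ _ _ (H d) (ideal_deg (E w) d) _ _ (fun x y => yhomog d x /\ y = b * x)) ge1.
  - move=> I s t f g Hfg; split.
      by apply: (subspace_comb _ _ (yhomog_subspace _ _ _ d)) => i; have [] := Hfg i.
    by rewrite mulr_sumr; apply: eq_bigr => i _; have [_ ->] := Hfg i; rewrite -scalerAr.
  - move=> x Hx; exists (b * x) => //; split; first by rewrite addnC; apply: yhomogM.
    by move=> i; rewrite evalpM qb mul0r.
  - move=> x y [Hx ->] [_ bx]; split=> //; have [_ _ pE] := primeE gr w.
    by case/pE: bx.
have := dim_ge_le (dim_ge_add _ pW sW geW gepW) le2.
move=> /(_ (fun x Wx => proj1 Wx)); rewrite /r; nia.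
Qed.
End Setup.

Lemma same_yscale (K : fieldType) n m (z z' : 'rV[K]_(n + m.+1)) : same_point z z' ->
  exists2 c : K, c != 0 & z = yscale c z'.
Proof.
by move=> [Hl [c c0 Hr]]; exists c => //; rewrite /yscale -Hl -Hr hsubmxK.
Qed.

Lemma evalp_same (K : closedFieldType) n m (z z' : 'rV[K]_(n + m.+1)) (f : {mpoly K[n + m.+1]}) :
  hom f -> same_point z z' -> (evalp f z != 0) = (evalp f z' != 0).
Proof.
move=> [d Hf] /same_yscale[c c0 ->]; rewrite (evalp_yscale _ _ Hf) mulf_eq0 negb_or.
by rewrite expf_neq0.
Qed.

Section Setup.
Variables (G : weighted_graph) (K : closedFieldType) (n m : nat) (X : 'rV[K]_n -> Prop)
  (O : 'rV[K]_n) (Y : 'rV[K]_(n + m.+1) -> Prop) (E : G -> 'rV[K]_(n + m.+1) -> Prop).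
Hypotheses (nss : normal_surface_singularity X O) (gr : good_resolution_with_graph X O Y E).
Local Notation N := (n + m.+1)%N.
Local Notation R := {mpoly K[N]}.
Local Notation og := (og gr).
Local Notation M := (M gr).
Local Notation H j := (fun f : R => is_true (yhomog j f)).
Local Notation xdiff := (@xdiff K n m O).
Implicit Types (f g a b c : R) (u v w : G) (z : 'rV[K]_N) (D : G -> nat).

Lemma ex_pencil : exists s0 s1 : R, [/\ yhomog 1 s0, yhomog 1 s1,
  forall w, ~ vanishes s0 (E w), forall w, ~ vanishes s1 (E w)
  & forall w z, E w z -> evalp s0 z = 0 -> evalp s1 z != 0].
Proof.
have [p Hp] := choice _ (E_nonempty gr).
have p0 z : z \in codom p -> rsubmx z != 0 by move=> /codomP[w ->]; apply: (E_neq0 gr (Hp w)).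
have [s0 h0 Hs0] := linear_nonzero p0.
have ns0 w : ~ vanishes s0 (E w).
  by move=> /(_ _ (Hp w)) /eqP; apply/negP/Hs0/codom_f.
have [q Hq] := choice _ (fun w => finite_zeros gr (ex_intro _ 1%N h0) (ns0 w)).
have [z|s1 h1 Hs1] := @linear_nonzero K n m (codom p ++ flatten [seq q w | w <- enum G]).
  rewrite mem_cat => /orP[/p0 //|/flattenP[_ /mapP[w _ ->] qz]].
  by have [/(_ z qz)[/(E_neq0 gr)]] := Hq w.
exists s0, s1; split=> // [w|w z Ez sz].
  by move=> /(_ _ (Hp w)) /eqP; apply/negP/Hs1; rewrite mem_cat codom_f.
have [_ /(_ z Ez sz)[z' qz' Hz]] := Hq w.
rewrite (evalp_same (ex_intro _ 1%N h1) Hz); apply: Hs1; rewrite mem_cat; apply/orP; right.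
by apply/flattenP; exists (q w) => //; apply/mapP; exists w; rewrite ?mem_enum.
Qed.

(** m_O M(D) + I(Y), with m_O the ideal of O in K[x]. Equalities modulo [midM D] are those that
    Nakayama over the local ring of O turns into equalities on Y. *)
Definition midM D f : Prop := exists F : 'I_n -> R, (forall i, M D (F i)) /\
  vanishes (f - \sum_i F i * xdiff i) Y.

Lemma midM_Y D f : vanishes f Y -> midM D f.
Proof.
move=> fY; exists (fun _ => 0); split=> [i|]; first exact: (ideal0 (M_ideal gr D)).
by rewrite big1 ?subr0 // => i _; rewrite mul0r.
Qed.

Lemma midM_ideal D : ideal (midM D).
Proof.
split=> [|f g [F [HF Hf]] [F' [HF' Hg]]|r f [F [HF Hf]]].
- by apply: midM_Y; apply: (ideal0 (idealY Y)).
- exists (fun i => F i + F' i); split=> [i|]; first exact: (idealD (M_ideal gr D)).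
  have -> : f + g - \sum_i (F i + F' i) * xdiff i =
    (f - \sum_i F i * xdiff i) + (g - \sum_i F' i * xdiff i).
    by rewrite (eq_bigr _ (fun i _ => mulrDl _ _ _)) big_split /=; ring.
  exact: (idealD (idealY Y)).
- exists (fun i => r * F i); split=> [i|]; first exact: (idealMl (M_ideal gr D)).
  have -> : r * f - \sum_i r * F i * xdiff i = r * (f - \sum_i F i * xdiff i).
    by rewrite mulrBr mulr_sumr; congr (_ - _); apply: eq_bigr => i _; rewrite mulrA.
  exact: (idealMl (idealY Y)).
Qed.

Lemma midM_xdiff D i f : M D f -> midM D (xdiff i * f).
Proof.
move=> Mf; exists (fun j => if j == i then f else 0); split=> [j|].
  by case: eqP => // _; apply: (ideal0 (M_ideal gr D)).
rewrite (bigD1 i) //= eqxx big1 => [|j /negPf ->]; last by rewrite mul0r.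
by rewrite addr0 mulrC subrr; apply: (ideal0 (idealY Y)).
Qed.

Lemma midM_hcomp D f d : midM D f -> midM D (hcomp d f).
Proof.
move=> [F [HF Hf]]; exists (fun i => hcomp d (F i)); split=> [i|]; first exact: M_hcomp.
have -> : hcomp d f - \sum_i hcomp d (F i) * xdiff i = hcomp d (f - \sum_i F i * xdiff i).
  rewrite hcompB hcomp_sum0; congr (_ - _); apply: eq_bigr => i _.
  by rewrite [in RHS]mulrC -[in RHS](add0n d) (hcompM _ _ (xdiff_hom _ _ i)) mulrC.
exact: vanishes_hcomp (coneY gr) Hf.
Qed.

Lemma midM_M D D' f : (forall w, D' w <= (D w).+1)%N -> midM D f -> M D' f.
Proof.
move=> HD [F [HF Hf]]; rewrite -[f](subrK (\sum_i F i * xdiff i)).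
apply: (idealD (M_ideal gr D')); first exact: M_Y.
apply: (ideal_sum (M_ideal gr D')) => i _ d w; apply: (og_le (HD w)).
rewrite mulrC -[d]add0n (hcompM _ _ (xdiff_hom _ _ i)) -add1n; apply: ogM; last exact: HF.
by apply/og1P; apply: (xdiff_E gr).
Qed.

Lemma midM_mul D a f : midM (fun=> 0%N) a -> M D f -> midM D (a * f).
Proof.
move=> [F [_ Ha]] Mf; exists (fun i => F i * f); split=> [i|]; first exact: (idealMl (M_ideal gr D)).
have -> : a * f - \sum_i F i * f * xdiff i = f * (a - \sum_i F i * xdiff i).
  by rewrite mulrBr mulr_sumr mulrC; congr (_ - _); apply: eq_bigr => i _; ring.
exact: (idealMl (idealY Y)).
Qed.

Lemma M0 f : M (fun=> 0%N) f. Proof. by move=> d w; apply: og0. Qed.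

Lemma mid_zero z : rsubmx z != 0 -> (forall f, midM (fun=> 0%N) f -> evalp f z = 0) ->
  exists w, E w z.
Proof.
move=> z0 Hz; have Yz : Y z.
  apply: (proj_closedP (clY gr) z0) => d f _ fY; apply: Hz; exact: midM_Y.
apply: (E_cover gr); split=> //; apply/rowP => i.
have := Hz _ (midM_xdiff i (M0 1)); rewrite mulr1 /xdiff !evalpE => /eqP.
by rewrite subr_eq0 mxE => /eqP.
Qed.

Section Pencil.
Variables s0 s1 : R.
Hypotheses (h0 : yhomog 1 s0) (h1 : yhomog 1 s1).
Hypothesis s01 : forall w z, E w z -> evalp s0 z = 0 -> evalp s1 z != 0.

Definition genJ D f : Prop := exists a b, [/\ M D a, M D b & midM D (f - (s0 * a + s1 * b))].

Lemma genJ_ideal D : ideal (genJ D).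
Proof.
split=> [|f g [a [b [Ha Hb Hf]]] [a' [b' [Ha' Hb' Hg]]]|r f [a [b [Ha Hb Hf]]]].
- exists 0, 0; split; try exact: (ideal0 (M_ideal gr D)).
  by rewrite !mulr0 addr0 subr0; apply: (ideal0 (midM_ideal D)).
- exists (a + a'), (b + b'); split; try exact: (idealD (M_ideal gr D)).
  have -> : f + g - (s0 * (a + a') + s1 * (b + b')) =
    (f - (s0 * a + s1 * b)) + (g - (s0 * a' + s1 * b')) by ring.
  exact: (idealD (midM_ideal D)).
- exists (r * a), (r * b); split; try exact: (idealMl (M_ideal gr D)).
  have -> : r * f - (s0 * (r * a) + s1 * (r * b)) = r * (f - (s0 * a + s1 * b)) by ring.
  exact: (idealMl (midM_ideal D)).
Qed.

(** s0 and s1 have no common zero on the fibre over O, so by the projective Nullstellensatz they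
    generate, modulo m_O, all forms of large degree. *)
Lemma genJ_H : exists j1, forall i f, (j1 <= i)%N -> yhomog i f -> genJ (fun=> 0%N) f.
Proof.
have iJ := genJ_ideal (fun=> 0%N).
have [|k Hk] := proj_nullstellensatz iJ; last first.
  by exists (m.+1 * k)%N => i f; apply: yhomog_power.
move=> z Hz; apply/eqP/negPn/negP => z0.
have [|w Ez] := mid_zero z0.
  move=> f fm; apply: Hz; exists 0, 0; split; try exact: M0.
  by rewrite !mulr0 addr0 subr0.
have Js a b : genJ (fun=> 0%N) (s0 * a + s1 * b).
  by exists a, b; split; try exact: M0; rewrite subrr; apply: (ideal0 (midM_ideal _)).
have sz0 : evalp s0 z = 0 by apply: Hz; have := Js 1 0; rewrite mulr1 mulr0 addr0.
have sz1 : evalp s1 z = 0 by apply: Hz; have := Js 0 1; rewrite mulr1 mulr0 add0r.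
by have := s01 Ez sz0; rewrite sz1 eqxx.
Qed.

Lemma genJ_split D j f : yhomog j.+1 f -> genJ D f -> exists a b,
  [/\ yhomog j a /\ M D a, yhomog j b /\ M D b & midM D (f - (s0 * a + s1 * b))].
Proof.
move=> Hf [a [b [Ha Hb Hab]]]; exists (hcomp j a), (hcomp j b).
split; try by split; [exact: hcompP|exact: M_hcomp].
have := midM_hcomp j.+1 Hab; rewrite hcompB hcomp_id // hcompD.
by rewrite -[j.+1]add1n (hcompM _ _ h0) (hcompM _ _ h1).
Qed.

Lemma genH : exists j1, forall j f, (j1 <= j)%N -> yhomog j.+1 f -> exists a b,
  [/\ yhomog j a, yhomog j b & midM (fun=> 0%N) (f - (s0 * a + s1 * b))].
Proof.
have [j1 Hj1] := genJ_H; exists j1 => j f jj Hf.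
have [|a [b [[Ha _] [Hb _] Hab]]] := genJ_split Hf (Hj1 _ _ _ Hf); first exact: leqW.
by exists a, b.
Qed.

Lemma genM D : exists jU, forall j f, (jU <= j)%N -> yhomog j.+1 f -> M D f -> exists a b,
  [/\ yhomog j a /\ M D a, yhomog j b /\ M D b & midM D (f - (s0 * a + s1 * b))].
Proof.
have [j1 Hj1] := genJ_H.
have [|k Hk] := graded_eventually (M_ideal gr D) (genJ_ideal D); last first.
  exists k => j f kj Hf Mf; apply: genJ_split => //.
  by rewrite -(hcomp_id Hf); apply: Hk => //; apply: leqW.
move=> x Mx; apply: (hcomp_mul_eventually (genJ_ideal D)) => e; exists j1 => i r ji Hr.
have [a [b [_ _ Hab]]] := Hj1 _ _ ji Hr; have Me := M_hcomp e Mx.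
exists (a * hcomp e x), (b * hcomp e x); split; try exact: (idealMl (M_ideal gr D)).
have -> : r * hcomp e x - (s0 * (a * hcomp e x) + s1 * (b * hcomp e x)) =
  (r - (s0 * a + s1 * b)) * hcomp e x by ring.
exact: midM_mul.
Qed.
End Pencil.
End Setup.

(** * The modules M(D): common denominators and generators of stalks *)

Section Setup.
Variables (G : weighted_graph) (K : closedFieldType) (n m : nat) (X : 'rV[K]_n -> Prop)
  (O : 'rV[K]_n) (Y : 'rV[K]_(n + m.+1) -> Prop) (E : G -> 'rV[K]_(n + m.+1) -> Prop).
Hypotheses (nss : normal_surface_singularity X O) (gr : good_resolution_with_graph X O Y E).
Local Notation N := (n + m.+1)%N.
Local Notation R := {mpoly K[N]}.
Local Notation og := (og gr).
Local Notation M := (M gr).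
Local Notation H j := (fun f : R => is_true (yhomog j f)).
Local Notation tau := (tau gr).
Implicit Types (f g a b c : R) (u v w : G) (z : 'rV[K]_N) (D : G -> nat).

Definition MH D j f : Prop := yhomog j f /\ M D f.
Definition addE D w : G -> nat := fun w' => (D w' + (w' == w))%N.

Lemma MH_subspace D j : subspace (MH D j).
Proof.
apply: subspace_cap; first exact: yhomog_subspace.
by apply: subspace_ideal; apply: M_ideal.
Qed.

Lemma M_addE D w f : hom f -> M D f -> og w (D w).+1 f -> M (addE D w) f.
Proof.
move=> hf Mf Hf; apply: M_hom => // w'; rewrite /addE; case: eqP => [->|_]; first by rewrite addn1.
by rewrite addn0; apply: M_og.
Qed.

Lemma addE_M D w f : M (addE D w) f -> M D f.
Proof. by apply: M_le => w'; apply: leq_addr. Qed.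

Lemma addE_og D w f : M (addE D w) f -> og w (D w).+1 f.
Proof. by move=> /(M_og w); rewrite /addE eqxx addn1. Qed.

Lemma M_mulE D w a f : vanishes a (E w) -> M D f -> M (addE D w) (a * f).
Proof.
move=> aE Mf; have iM := M_ideal gr (addE D w).
have [k Hk] := hcomp_partition a; have [l Hl] := hcomp_partition f.
rewrite (Hk k (leqnn _)) (Hl l (leqnn _)) mulr_suml; apply: (ideal_sum iM) => d _.
rewrite mulr_sumr; apply: (ideal_sum iM) => e _.
apply: (@MM _ _ _ _ _ _ _ _ _ (fun w' => (w' == w) : nat) D) => [w'|||d' w'|].
- by rewrite /addE addnC.
- exact: hom_hcomp.
- exact: hom_hcomp.
- case: eqP => [->|_]; last exact: og0.
  apply/og1P; apply: (vanishes_hcomp _ (coneE gr (w := w))).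
  exact: (vanishes_hcomp _ (coneE gr (w := w))).
- exact: M_hcomp.
Qed.

(** The homogeneous part of B has finitely many generators, each with finitely many components: the
    product of their denominators serves all of B. *)
Lemma uniform_den w (B J : R -> Prop) : ideal B -> ideal J ->
  (forall x, hom x -> B x -> exists a, [/\ hom a, ~ vanishes a (E w) & J (a * x)]) ->
  exists a, [/\ hom a, ~ vanishes a (E w) & forall x, hom x -> B x -> J (a * x)].
Proof.
move=> iB iJ HB; have iB' := hcomp_ideal iB.
have ext a b x : J (a * x) -> J (b * a * x) by rewrite -mulrA; apply: (idealMl iJ).
have Hx x : (forall d, B (hcomp d x)) ->
    exists a, [/\ hom a, ~ vanishes a (E w) & forall d, J (a * hcomp d x)].
  move=> Bx; have [k Hk] := hcomp_partition x.
  have Hl l : exists a, [/\ hom a, ~ vanishes a (E w) & forall d, (d < l)%N -> J (a * hcomp d x)].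
    elim: l => [|l [a [ha na Ha]]]; first by exists 1; split=> //; [exact: hom1|exact: (@notE1 _ _ _ _ _ _ _ _ gr)].
    have [b [hb nb Hb]] := HB _ (hom_hcomp l x) (Bx l).
    exists (b * a); split; [exact: homM|exact: (notEM gr)|].
    move=> d; rewrite ltnS leq_eqVlt => /orP[/eqP ->|dl]; last by apply: ext; apply: Ha.
    by rewrite [b * a]mulrC; apply: ext.
  have [a [ha na Ha]] := Hl k; exists a; split=> // d; case: (ltnP d k) => [|kd]; first exact: Ha.
  rewrite (Hk k (leqnn _)) hcomp_sum0 big1 ?mulr0; first exact: (ideal0 iJ).
  by move=> i _; apply: (hcomp_ne (hcompP _ _)); rewrite neq_ltn (leq_trans (ltn_ord i) kd).
have [s [sB Bs]] := @noetherian_mpoly K N _ iB'.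
have [a [ha na Ha]] : exists a, [/\ hom a, ~ vanishes a (E w) &
    forall x, x \in s -> forall d, J (a * hcomp d x)].
  elim: s sB {Bs} => [_|x s IH sB].
    by exists 1; split=> //; [exact: hom1|exact: (@notE1 _ _ _ _ _ _ _ _ gr)].
  have [|a [ha na Ha]] := IH; first by move=> y ys; apply: sB; apply: mem_tail.
  have [b [hb nb Hb]] := Hx x (sB x (mem_head _ _)).
  exists (b * a); split; [exact: homM|exact: (notEM gr)|].
  move=> y; rewrite inE => /orP[/eqP ->|ys] d; last by apply: ext; apply: Ha.
  by rewrite [b * a]mulrC; apply: ext.
exists a; split=> // x hx Bx.
have iC : ideal (fun f => J (a * f)).
  split=> [|f g Hf Hg|r f Hf]; first by rewrite mulr0; apply: (ideal0 iJ).
    by rewrite mulrDr; apply: (idealD iJ).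
  by rewrite mulrCA; apply: (idealMl iJ).
apply: (hcomp_out iC); apply: (span_sub (hcomp_ideal iC) Ha).
by apply: Bs; apply: hcomp_in.
Qed.

Lemma multiples_ideal th : ideal (fun f => exists g, vanishes (f - g * th) Y).
Proof.
split=> [|f g [c Hc] [d Hd]|r f [c Hc]].
- by exists 0; rewrite mul0r subr0; apply: (ideal0 (idealY Y)).
- exists (c + d); have -> : f + g - (c + d) * th = (f - c * th) + (g - d * th) by ring.
  exact: (idealD (idealY Y)).
- exists (r * c); have -> : r * f - r * c * th = r * (f - c * th) by ring.
  exact: (idealMl (idealY Y)).
Qed.

(* [gen_at D z T]: T generates the stalk of M D at z. *)
Definition gen_at D z T : Prop := forall f, hom f -> M D f ->
  exists a c, [/\ hom a, hom c, evalp a z != 0 & vanishes (a * f - c * T) Y].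

Lemma ex_gen_at D z : rsubmx z != 0 -> exists T, [/\ hom T, M D T & gen_at D z T].
Proof.
move=> /(M_local nss gr D)[T [hT MT _ HT]]; exists T; split=> // f hf Mf.
by apply: HT => // w _; apply: M_og.
Qed.

Lemma gen_at_exact D w z T : E w z -> gen_at D z T -> ~ og w (D w).+1 T.
Proof.
move=> Ez HT OT; have [th [hth Mth nth _]] := M_local nss gr D (E_neq0 gr Ez).
apply: (nth w Ez); have [a [c [_ _ az Hac]]] := HT th hth Mth.
apply: (og_cancel (evalp_neq0_vanishes Ez az)); apply: (@og_Y_congr _ _ _ _ _ _ _ _ gr _ _ (c * T)).
  by rewrite -opprB; apply: (idealN (idealY Y)).
exact: (idealMl (og_ideal gr w _)).
Qed.

Lemma gen_at_transfer D z T T' (a u : R) : gen_at D z T -> hom T' -> evalp u z != 0 ->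
  vanishes (a * T' - u * T) Y -> gen_at D z T'.
Proof.
move=> HT hT' uz HT' f hf Mf; have [b [c [hb hc bz Hbc]]] := HT f hf Mf.
have [||b' [c' [hb' hc' /eqP bz' Hbc']]] :=
    @hom_cofactor _ _ _ _ _ _ _ _ gr f (c * a) T' (fun g => evalp g z = 0) (u * b) (point_ideal z) hf hT'.
- by apply/eqP; rewrite evalpM mulf_neq0.
- have -> : u * b * f - c * a * T' = u * (b * f - c * T) - c * (a * T' - u * T) by ring.
  by apply: (idealB (idealY Y)); apply: (idealMl (idealY Y)).
by exists b', c'.
Qed.

(** A general combination of a generator for the earlier points and one for the new point generates
    everywhere: each point excludes at most one value of t. Powers of a linear form l, a unit at all
    the points, equalize the degrees. *)
Lemma gen_at_list D (s : seq 'rV[K]_N) : (forall z, z \in s -> rsubmx z != 0) ->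
  exists T, [/\ hom T, M D T & forall z, z \in s -> gen_at D z T].
Proof.
elim: s => [_|z s IH Hs].
  by exists 0; split=> //; [exact: hom0|exact: (ideal0 (M_ideal gr D))].
have [|T [[d hT] MT HT]] := IH; first by move=> y ys; apply: Hs; apply: mem_tail.
have [th [[e hth] Mth Hth]] := ex_gen_at D (Hs z (mem_head _ _)).
have [l hl Hl] := linear_nonzero Hs.
have HX k x : yhomog k (l ^+ k) /\ (x \in z :: s -> evalp (l ^+ k) x != 0).
  split; first by rewrite -[X in yhomog X]muln1; apply: yhomogMn.
  by move=> /Hl lx; rewrite evalpX expf_neq0.
pose T' (t : K) := l ^+ e * T + t *: (l ^+ d * th).
have hT' t : yhomog (e + d) (T' t).
  apply: yhomogD; first by apply: yhomogM => //; have [] := HX e 0.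
  by apply: yhomogZ; rewrite addnC; apply: yhomogM => //; have [] := HX d 0.
have Hgen x : x \in z :: s -> exists q : {poly K}, q != 0 /\ forall t, q.[t] != 0 -> gen_at D x (T' t).
  move=> xs; have [hle /(_ xs) le0] := HX e x; have [hld /(_ xs) ld0] := HX d x.
  have lin (A B : K) : (A != 0) || (B != 0) -> A%:P + B *: 'X != 0.
    apply: contraL => /eqP Q0; have := congr1 (fun p : {poly K} => (p`_0, p`_1)) Q0.
    rewrite /= !coefD !coefC !coefZ !coefX ?coef0 /= mulr0 mulr1 addr0 add0r => -[-> ->].
    by rewrite eqxx.
  case: (boolP (x == z)) xs => [/eqP ->|xz] xs.
    have [a [c [_ _ az Hac]]] := Hth T (ex_intro _ d hT) MT.
    exists ((evalp (c * l ^+ e) z)%:P + evalp (a * l ^+ d) z *: 'X); split.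
      by apply: lin; rewrite orbC [evalp (a * _) z]evalpM mulf_neq0 //; have [_] := HX d z; apply; apply: mem_head.
    move=> t Ht; apply: (@gen_at_transfer D z th _ a (c * l ^+ e + t *: (a * l ^+ d)) Hth).
    - by exists (e + d)%N.
    - by rewrite evalpD evalpZ; move: Ht; rewrite !hornerE [_ * t]mulrC.
    have -> : a * T' t - (c * l ^+ e + t *: (a * l ^+ d)) * th = l ^+ e * (a * T - c * th).
      by rewrite /T' -!mul_mpolyC; ring.
    exact: (idealMl (idealY Y)).
  have xs' : x \in s by move: xs; rewrite inE (negPf xz).
  have [a [c [_ _ ax Hac]]] := HT x xs' th (ex_intro _ e hth) Mth.
  exists ((evalp (a * l ^+ e) x)%:P + evalp (c * l ^+ d) x *: 'X); split.
    by apply: lin; rewrite evalpM mulf_neq0.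
  move=> t Ht; apply: (@gen_at_transfer D x T _ a (a * l ^+ e + t *: (c * l ^+ d)) (HT x xs')).
  - by exists (e + d)%N.
  - by rewrite evalpD evalpZ; move: Ht; rewrite !hornerE [_ * t]mulrC.
  have -> : a * T' t - (a * l ^+ e + t *: (c * l ^+ d)) * T = t *: (l ^+ d * (a * th - c * T)).
    by rewrite /T' -!mul_mpolyC; ring.
  by rewrite -mul_mpolyC; do 2 apply: (idealMl (idealY Y)).
have [q Hq] := choice (fun x q => x \in z :: s -> q != 0 /\ forall t, q.[t] != 0 -> gen_at D x (T' t))
  (fun x => match boolP (x \in z :: s) with AltTrue h => let: ex_intro q P := Hgen x h in ex_intro _ q (fun _ => P)
     | AltFalse h => ex_intro _ 0 (fun h' => False_ind _ (elimN idP h h')) end).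
have /ex_nonroot[t Ht] : \prod_(x <- z :: s) q x != 0.
  by rewrite prodf_seq_neq0; apply/allP => x xs; apply/implyP => _; have [] := Hq x xs.
exists (T' t); split; first by exists (e + d)%N.
  have iM := M_ideal gr D.
  rewrite /T' -mul_mpolyC; apply: (idealD iM); first exact: (idealMl iM).
  by do 2 apply: (idealMl iM).
move=> x xs; have [_] := Hq x xs; apply.
by move: Ht; rewrite horner_prod prodf_seq_neq0 => /allP/(_ x xs).
Qed.
End Setup.

(** * Intersection numbers *)

Section Setup.
Variables (G : weighted_graph) (K : closedFieldType) (n m : nat) (X : 'rV[K]_n -> Prop)
  (O : 'rV[K]_n) (Y : 'rV[K]_(n + m.+1) -> Prop) (E : G -> 'rV[K]_(n + m.+1) -> Prop).
Hypotheses (nss : normal_surface_singularity X O) (gr : good_resolution_with_graph X O Y E).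
Local Notation N := (n + m.+1)%N.
Local Notation R := {mpoly K[N]}.
Local Notation og := (og gr).
Local Notation M := (M gr).
Local Notation MH := (MH gr).
Local Notation H j := (fun f : R => is_true (yhomog j f)).
Local Notation tau := (tau gr).
Implicit Types (f g a b c : R) (u v w : G) (z : 'rV[K]_N) (D : G -> nat).

Lemma notE_sep w z : rsubmx z != 0 -> ~ E w z -> exists2 c, vanishes c (E w) & evalp c z != 0.
Proof. by move=> z0 nz; have [d [f [_ fE fz]]] := proj_separate (clE gr w) z0 nz; exists f. Qed.

(* The value at z of the fraction x / th. *)
Definition has_value (z : 'rV[K]_N) (th x : R) (y : K) : Prop :=
  exists a c, [/\ evalp a z != 0, vanishes (a * x - c * th) Y & evalp c z = y * evalp a z].

Lemma has_valueD z th x x' y y' : has_value z th x y -> has_value z th x' y' ->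
  has_value z th (x + x') (y + y').
Proof.
move=> [a [c [az H Ec]]] [a' [c' [az' H' Ec']]]; exists (a * a'), (a' * c + a * c'); split.
- by rewrite evalpM mulf_neq0.
- have -> : a * a' * (x + x') - (a' * c + a * c') * th =
     a' * (a * x - c * th) + a * (a' * x' - c' * th) by ring.
  by apply: (idealD (idealY Y)); apply: (idealMl (idealY Y)).
- by rewrite evalpD !evalpM Ec Ec'; ring.
Qed.

Lemma has_valueZ z th x y t : has_value z th x y -> has_value z th (t *: x) (t * y).
Proof.
move=> [a [c [az H Ec]]]; exists a, (t *: c); split=> //; last by rewrite evalpZ Ec mulrA.
have -> : a * (t *: x) - t *: c * th = t%:MP * (a * x - c * th) by rewrite -!mul_mpolyC; ring.
exact: (idealMl (idealY Y)).
Qed.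

Lemma has_value0 z th : has_value z th 0 0.
Proof.
exists 1, 0; rewrite evalp1 oner_neq0 evalp0 mul0r mulr0 mul0r subr0; split=> //.
exact: (ideal0 (idealY Y)).
Qed.

(** O(-D) restricted to E_w loses degree E_w.E_w' when E_w' is added to D. For J = M(D + E_w) + M(D
    + E_w'), the quotient M(D)/J lives at the intersection points, and J/M(D + E_w) is bounded by
    M(D + E_w')/M(D + E_w + E_w'). *)
Lemma cross_lower w w' D : w != w' -> exists j0, forall j r, (j0 <= j)%N ->
  dim_ge (MH D j) (MH (addE D w) j) (r + edges w w') ->
  dim_ge (MH (addE D w') j) (MH (addE (addE D w') w) j) r.
Proof.
move=> ww'; have [q [qE Hq]] := gr_edges gr ww'; set s := edges w w' in q qE Hq *.
have q0 i : rsubmx (q i) != 0 by have [/(E_neq0 gr)] := qE i.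
have [th Hth] := choice _ (fun i => M_local nss gr D (q0 i)).
pose J f := exists a b, [/\ M (addE D w) a, M (addE D w') b & f = a + b].
have iJ : ideal J.
  split=> [|x y [a [b [Ha Hb ->]]] [a' [b' [Ha' Hb' ->]]]|r x [a [b [Ha Hb ->]]]].
  - by exists 0, 0; split; [exact: (ideal0 (M_ideal gr _))..|rewrite addr0].
  - by exists (a + a'), (b + b'); split; [exact: (idealD (M_ideal gr _))..|ring].
  - by exists (r * a), (r * b); split; [exact: (idealMl (M_ideal gr _))..|ring].
have [j0 Hj0] := torsion_uniform iJ; exists j0 => j r j0j Hge.
have sJ : subspace (fun f => yhomog j f /\ J f).
  by apply: subspace_cap; [exact: yhomog_subspace|exact: subspace_ideal].
(* Each intersection point imposes one condition: the value there of x / th, where th generates the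
   stalk of M(D). *)
have le1 : dim_le (MH D j) (fun f => yhomog j f /\ J f) s.
  apply: (@dim_le_rel _ _ 'rV[K]_s _ _ (fun _ => True) (fun y => y = 0)
    (fun x y => MH D j x /\ forall i, has_value (q i) (th i) x (y 0 i))).
  - move=> I rr c f g Hfg; split.
      by apply: (subspace_comb _ _ (MH_subspace gr D j)) => i; have [] := Hfg i.
    move=> i; elim: rr => [|x rr IH]; first by rewrite !big_nil mxE; apply: has_value0.
    rewrite !big_cons mxE; apply: has_valueD => //; rewrite mxE; apply: has_valueZ.
    by have [_] := Hfg x; apply.
  - move=> x [hx Mx]; have Hv i : exists y, has_value (q i) (th i) x y.
      have [_ _ _ /(_ x (ex_intro _ j hx))[|a [c [_ _ az Hac]]]] := Hth i.
        by move=> v _; apply: M_og.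
      by exists (evalp c (q i) / evalp a (q i)), a, c; split=> //; rewrite divfK.
    have [y Hy] := choice _ Hv; exists (\row_i y i) => //; split=> // i.
    by rewrite mxE; apply: Hy.
  - move=> x y [[hx Mx] Hxy] y0; split=> //; apply: (Hj0 j) => // z z0.
    case: (classic (E w z)) => [Ez|/(notE_sep z0)[c cE cz]]; last first.
      exists c => //; exists (c * x), 0; split; [exact: M_mulE|exact: (ideal0 (M_ideal gr _))|].
      by rewrite addr0.
    case: (classic (E w' z)) => [Ez'|/(notE_sep z0)[c cE cz]]; last first.
      exists c => //; exists 0, (c * x); split; [exact: (ideal0 (M_ideal gr _))|exact: M_mulE|].
      by rewrite add0r.
    have [i [Hi _]] := Hq z Ez Ez'; have [hth Mth nth _] := Hth i; have [Eqi Eqi'] := qE i.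
    have := Hxy i; rewrite y0 mxE => -[a [c [az Hac]]]; rewrite mul0r => c0.
    have [||a' [c' [ha' hc' /eqP az' Hac']]] := @hom_cofactor _ _ _ _ _ _ _ _ gr x c (th i)
      (fun g => evalp g (q i) = 0) a (point_ideal (q i)) (ex_intro _ j hx) hth.
    + by apply/eqP.
    + exact: Hac.
    have c'0 : evalp c' (q i) = 0.
      have : vanishes ((a' * c - a * c') * th i) Y.
        have -> : (a' * c - a * c') * th i = a * (a' * x - c' * th i) - a' * (a * x - c * th i) by ring.
        by apply: (idealB (idealY Y)); apply: (idealMl (idealY Y)).
      have [_ _ pY] := primeY gr; case/pY => [|thY]; last by case: (nth w Eqi); apply: og_vanY.
      move=> /(_ (q i) (E_Y gr Eqi)); rewrite evalpB !evalpM c0 mulr0 sub0r => /eqP.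
      by rewrite oppr_eq0 mulf_eq0 (negPf az) /= => /eqP.
    have [l ql] := ex_ycoord (q0 i).
    have ce := chart_normalize (coneE gr (w := w)) Eqi ql.
    have ce' := chart_normalize (coneE gr (w := w')) Eqi' ql.
    have [dc hdc] := hc'.
    (* When the value is zero, transversality writes the cofactor of th as a sum of an element of
       I(E_w) and one of I(E_w'), so x lies in J near the point. *)
    have [k [b [uu [vv [hb bz uE vE Eb]]]]] := transverse_local (coneE gr (w := w)) (coneE gr (w := w'))
      Eqi Eqi' ql (gr_transverse gr ww' ce ce') hdc c'0.
    exists (b * a').
      rewrite evalpM mulf_neq0 //; first by rewrite (evalp_same (ex_intro _ k hb) Hi).
      by rewrite (evalp_same ha' Hi).
    have -> : b * a' * x = (b * (a' * x - c' * th i) + uu * th i) + vv * th i.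
      by rewrite mulrBr [b * (c' * _)]mulrA Eb; ring.
    exists (b * (a' * x - c' * th i) + uu * th i), (vv * th i); split=> //; last exact: M_mulE.
    apply: (idealD (M_ideal gr _)); last exact: M_mulE.
    by apply: M_Y; apply: (idealMl (idealY Y)).
  apply: (@dim_le_spanned _ _ _ _ _ (fun i => delta_mx 0 i)) => [|u _]; last first.
    by exists (fun i => u 0 i); rewrite -row_sum_delta subrr.
  by split=> [//|a b -> ->|t a ->]; rewrite ?addr0 ?scaler0.
case: r Hge => [|r] Hge; first by exists (fun _ => 0) => [[]|c _ []].
apply: NNPP => /dim_not_ge Hle.
suff le2 : dim_le (fun f => yhomog j f /\ J f) (MH (addE D w) j) r.
  have := dim_ge_le Hge (dim_le_add (MH_subspace gr _ j) sJ le1 le2); lia.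
apply: (@dim_le_rel _ _ _ _ _ (MH (addE D w') j) (MH (addE (addE D w') w) j)
  (fun x y => MH (addE D w) j (x - y))) Hle.
- move=> I rr c f g Hfg; rewrite -sumrB.
  rewrite (eq_bigr (fun i => c i *: (f i - g i))) => [|i _]; last by rewrite scalerBr.
  exact: (subspace_comb _ _ (MH_subspace gr _ j)).
- move=> x [hx [a [b [Ma Mb Ex]]]]; exists (hcomp j b); first by split; [exact: hcompP|exact: M_hcomp].
  have -> : x - hcomp j b = hcomp j a by rewrite -{1}(hcomp_id hx) Ex hcompD addrK.
  by split; [exact: hcompP|exact: M_hcomp].
- move=> x y Hxy [hy My]; rewrite -[x](subrK y); apply: (subspaceD (MH_subspace gr _ j)) => //.
  split=> //; apply: M_le My => v; rewrite /addE; lia.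
Qed.
End Setup.

Section Setup.
Variables (G : weighted_graph) (K : closedFieldType) (n m : nat) (X : 'rV[K]_n -> Prop)
  (O : 'rV[K]_n) (Y : 'rV[K]_(n + m.+1) -> Prop) (E : G -> 'rV[K]_(n + m.+1) -> Prop).
Hypotheses (nss : normal_surface_singularity X O) (gr : good_resolution_with_graph X O Y E).
Local Notation N := (n + m.+1)%N.
Local Notation R := {mpoly K[N]}.
Local Notation og := (og gr).
Local Notation M := (M gr).
Local Notation MH := (MH gr).
Local Notation H j := (fun f : R => is_true (yhomog j f)).
Local Notation tau := (tau gr).
Implicit Types (f g a b c : R) (u v w : G) (z : 'rV[K]_N) (D : G -> nat).

Lemma subspace0 (F : fieldType) (A : lmodType F) (U : A -> Prop) : subspace U -> U 0. Proof. by case. Qed.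

Definition sq w f : Prop := exists (s : seq (R * R)) (h : R),
  [/\ forall ab, ab \in s -> vanishes ab.1 (E w) /\ vanishes ab.2 (E w), vanishes h Y
    & f = \sum_(ab <- s) ab.1 * ab.2 + h].

Lemma sq_ideal w : ideal (sq w).
Proof.
split=> [|x y [s [h [Hs hY ->]]] [s' [h' [Hs' hY' ->]]]|r x [s [h [Hs hY ->]]]].
- by exists [::], 0; split=> //; [exact: (ideal0 (idealY Y))|rewrite big_nil addr0].
- exists (s ++ s'), (h + h'); split; [|exact: (idealD (idealY Y))|by rewrite big_cat /=; ring].
  by move=> ab; rewrite mem_cat => /orP[/Hs|/Hs'].
- exists [seq (r * ab.1, ab.2) | ab <- s], (r * h); split; last first.
  + rewrite big_map mulrDr mulr_sumr; congr (_ + _); apply: eq_bigr => ab _; exact: mulrA.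
  + exact: (idealMl (idealY Y)).
  move=> _ /mapP[ab /Hs[H1 H2] ->] /=; split=> //; exact: (idealMl (vanishes_ideal (E w))).
Qed.

Lemma sq_mul w a b : vanishes a (E w) -> vanishes b (E w) -> sq w (a * b).
Proof.
move=> aE bE; exists [:: (a, b)], 0; split; last by rewrite big_seq1 addr0.
  by move=> ab; rewrite inE => /eqP ->.
exact: (ideal0 (idealY Y)).
Qed.

Lemma sqY w f : vanishes f Y -> sq w f.
Proof. by move=> fY; exists [::], f; split=> //; rewrite big_nil add0r. Qed.

(** The definition of the self-intersection uses I(E_w)^2 + I(Y). The symbolic square is contained
    in it locally, since E_w is locally principal, hence in large degree. *)
Lemma og2_sq w : exists j0, forall j f, (j0 <= j)%N -> yhomog j f -> og w 2 f -> sq w f.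
Proof.
have [j0 Hj0] := torsion_uniform (sq_ideal w); exists j0 => j f jj hf Of; apply: (Hj0 j) => // z z0.
have fE : vanishes f (E w) by apply/(og1P gr); apply: og_le Of.
case: (classic (E w z)) => [Ez|/(notE_sep gr z0)[c cE cz]]; last by exists c => //; apply: sq_mul.
have [t Ht] := ex_local_eq gr Ez.
have [a [c [_ _ az Hac]]] := local_gen_og nss Ez Ht (ex_intro _ j hf) Of.
exists a => //; rewrite -[a * f](subrK (c * t ^+ 2)); apply: (idealD (sq_ideal w)); first exact: sqY.
by apply: (idealMl (sq_ideal w)); rewrite expr2; apply: sq_mul; apply: leq_van Ht.
Qed.

Lemma conormal_dim w (e : nat) : selfint w = - e%:Z -> exists j0, forall j, (j0 <= j)%N ->
  exists k, [/\ hilbert_fun (E w) j k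
    & dim_ge (ideal_deg (E w) j) (fun f => yhomog j f /\ og w 2 f) (k + e)].
Proof.
move=> He; have [d0 Hd0] := gr_selfint gr w; have [j0 Hj0] := og2_sq w.
exists (maxn d0 j0) => j; rewrite geq_max => /andP[/Hd0[a [b [qa hb Eab]]] jj]; exists b; split=> //.
have [ge _] := quotient_dim_exact (subspace_cap (@yhomog_subspace _ _ _ j) (subspace_ideal (sq_ideal w))) qa.
apply: dim_ge_mono (dim_ge_incl _ _ ge) _ => // [x [hx Ox]|]; last lia.
by split; [|apply: (Hj0 _ _ _ hx Ox)].
Qed.

(** Adding E_w to D raises the degree of O(-D) on E_w by e. Multiplication by tau, of degree c,
    embeds M(D)/M(D + E_w) into the next quotient, which gives r. The cokernel is bounded below
    through x |-> T x on I(E_w), with T a generator of M(D) at suitable points: in one degree, I/I^2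
    has dimension at least k + e, and the multiples of tau account for at most k - h c. *)
Lemma self_lower w (e h d0 : nat) : selfint w = - e%:Z ->
  (forall d, (d0 <= d)%N -> exists k,
    [/\ hilbert_fun (E w) d k, dim_ge (H d) (ideal_deg (E w) d) k, dim_le (H d) (ideal_deg (E w) d) k
    & (k + genus w = h * d + 1)%N]) ->
  exists c : nat, forall D, exists j0, forall j r, (j0 <= j)%N -> dim_ge (MH D j) (MH (addE D w) j) r ->
  dim_ge (MH (addE D w) (j + c)) (MH (addE (addE D w) w) (j + c)) (r + (h * c + e)).
Proof.
move=> He Hd; have [c htau] := tau_hom gr w; exists c => D.
have [z0 Ez0 Hz0] := tauP gr w.
(* tau generates I(E_w) wherever b is nonzero. At the finitely many zeros of b it may fail to, so T
   is chosen to generate the stalks of M(D) there; the extra point z0 makes the order of T along E_w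
   exactly D_w. *)
have [b [hb nb Hb]] : exists b, [/\ hom b, ~ vanishes b (E w)
    & forall x, hom x -> vanishes x (E w) -> exists g, vanishes (b * x - g * tau w) Y].
  apply: (uniform_den gr (vanishes_ideal (E w)) (multiples_ideal Y (tau w))) => x hx xE.
  have [a [c' [ha _ az Hac]]] := leq_gen Hz0 hx xE.
  by exists a; split=> //; [exact: (evalp_neq0_vanishes Ez0)|exists c'].
have [s [sE Hs]] := finite_zeros gr hb nb.
have [|T [[r hT] MT HT]] := @gen_at_list _ _ _ _ _ _ _ _ nss gr D (z0 :: s).
  by move=> z; rewrite inE => /orP[/eqP ->|/sE[Ez _]]; apply: (E_neq0 gr (w := w)).
have nT : ~ og w (D w).+1 T := gen_at_exact nss Ez0 (HT z0 (mem_head _ _)).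
have OT : og w (D w) T := M_og w MT.
pose O2 f := forall d, og w 2 (hcomp d f).
have iO : ideal O2 := hcomp_ideal (og_ideal gr w 2).
have O2og x : O2 x -> og w 2 x by apply: hcomp_out; apply: og_ideal.
have ogO2 x : hom x -> og w 2 x -> O2 x by move=> hx Ox; apply: (hcomp_in (og_ideal gr w 2)).
pose J f := exists g, O2 (f - g * tau w).
have iJ : ideal J.
  split=> [|x y [g Hg] [g' Hg']|y x [g Hg]].
  - by exists 0; rewrite mul0r subr0; apply: (ideal0 iO).
  - exists (g + g'); have -> : x + y - (g + g') * tau w = (x - g * tau w) + (y - g' * tau w) by ring.
    exact: (idealD iO).
  - exists (y * g); have -> : y * x - y * g * tau w = y * (x - g * tau w) by ring.
    exact: (idealMl iO).
have [j1 Hj1] := torsion_uniform iJ; have [j2 Hj2] := conormal_dim He.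
exists (r + c + d0 + j1 + j2)%N => j k jj Hge.
pose V := MH (addE (addE D w) w) (j + c); pose U := MH (addE D w) (j + c).
pose W f := U f /\ exists (g v : R), [/\ MH D j g, V v & f = tau w * g + v].
have sV : subspace V := MH_subspace gr _ _.
have sW : subspace W.
  apply: subspace_cap; first exact: (MH_subspace gr).
  split=> [|x y [g [v [Hg Hv ->]]] [g' [v' [Hg' Hv' ->]]]|t x [g [v [Hg Hv ->]]]].
  - by exists 0, 0; split; [apply: (subspace0 (MH_subspace gr _ _))|apply: (subspace0 sV)|rewrite mulr0 addr0].
  - exists (g + g'), (v + v'); split; [exact: (subspaceD (MH_subspace gr _ _))|exact: (subspaceD sV)|ring].
  - exists (t *: g), (t *: v); split; [exact: (subspaceZ _ (MH_subspace gr _ _))|exact: (subspaceZ _ sV)|].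
    by rewrite scalerDr scalerAr.
have VU x : V x -> U x by move=> [hx Mx]; split=> //; apply: addE_M Mx.
have VW x : V x -> W x.
  move=> Vx; split; [exact: VU|exists 0, x; split=> //; last by rewrite mulr0 add0r].
  exact: (subspace0 (MH_subspace gr _ _)).
have tau2 x : hom x -> M D x -> M (addE (addE D w) w) (tau w * x) -> M (addE D w) x.
  move=> hx Mx /(@addE_og _ _ _ _ _ _ _ _ gr) Ox; apply: M_addE => //.
  by apply: (og_tau nss (k := 1)); rewrite expr1; move: Ox; rewrite /addE eqxx !addn1 add1n.
have geWV : dim_ge W V k.
  apply: (@dim_ge_rel _ _ _ _ _ _ _ (fun x y => MH D j x /\ y = tau w * x)) Hge.
  - move=> I rr t f g Hfg; split.
      by apply: (subspace_comb _ _ (MH_subspace gr D j)) => i; have [] := Hfg i.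
    by rewrite mulr_sumr; apply: eq_bigr => i _; have [_ ->] := Hfg i; rewrite -scalerAr.
  - move=> x [hx Mx]; exists (tau w * x) => //; split.
      split; first by rewrite addnC; apply: yhomogM.
      by apply: M_mulE => //; apply: tau_E.
    by exists x, 0; split; [|exact: (subspace0 sV)|rewrite addr0].
  - by move=> x y [[hx Mx] ->] [_ Mt]; split=> //; apply: tau2 => //; exists j.
rewrite (addnC k); apply: (dim_ge_add _ VW sW _ geWV) => [x [] //|].
pose d := (j + c - r)%N; have dE : (d + r = j + c)%N by rewrite /d; lia.
have [|kd [hkd gekd]] := Hj2 d; first by rewrite /d; lia.
have [|k1 [hk1 _ lek1 E1]] := Hd (d - c)%N; first by rewrite /d; lia.
have [|k2 [hk2 ge2 _ E2]] := Hd d; first by rewrite /d; lia.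
have Ek : kd = k2.
  have [g1 l1] := quotient_dim_exact (@ideal_deg_subspace _ _ _ _ _) hkd.
  have [g2 l2] := quotient_dim_exact (@ideal_deg_subspace _ _ _ _ _) hk2.
  by apply/eqP; rewrite eqn_leq (dim_ge_le g1 l2) (dim_ge_le g2 l1).
have sO : subspace (fun f => yhomog d f /\ og w 2 f).
  by apply: subspace_cap; [exact: yhomog_subspace|apply: subspace_ideal; apply: og_ideal].
have sJ : subspace (fun f => yhomog d f /\ J f).
  by apply: subspace_cap; [exact: yhomog_subspace|exact: subspace_ideal].
have geJ : dim_ge (ideal_deg (E w) d) (fun f => yhomog d f /\ J f) (h * c + e).
  apply: (@dim_ge_sub _ _ _ (fun f => yhomog d f /\ og w 2 f) _ _ k1) => //.
    by apply: dim_ge_mono gekd _; rewrite Ek; have : (c <= d)%N; [rewrite /d; lia|nia].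
  apply: (@dim_le_rel _ _ _ _ _ (H (d - c)%N) (ideal_deg (E w) (d - c)%N)
    (fun x y => yhomog d x /\ og w 2 (x - y * tau w))) lek1.
  - move=> I rr t f g Hfg; split.
      by apply: (subspace_comb _ _ (yhomog_subspace _ _ _ d)) => i; have [] := Hfg i.
    rewrite mulr_suml -sumrB (eq_bigr (fun i => t i *: (f i - g i * tau w))) => [|i _].
      by apply: (subspace_comb _ _ (subspace_ideal (og_ideal gr w 2))) => i; have [] := Hfg i.
    by rewrite scalerBr scalerAl.
  - move=> x [hx [g Og]]; exists (hcomp (d - c) g); first exact: hcompP.
    split=> //; have cd : (c <= d)%N by rewrite /d; lia.
    have -> : x - hcomp (d - c) g * tau w = hcomp d (x - g * tau w); last exact: Og.
    by rewrite hcompB (hcomp_id hx) [g * _]mulrC -[X in hcomp X (tau w * g)](subnKC cd) (hcompM _ _ htau) mulrC.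
  - move=> x y [hx Oxy] [hy yE]; split=> //; rewrite -[x](subrK (y * tau w)).
    apply: (idealD (og_ideal gr w 2)) => //; apply: (@ogM _ _ _ _ _ _ _ _ gr w 1 1); last exact/og1P/tau_E.
    exact/og1P.
apply: (@dim_ge_rel _ _ _ _ _ _ _ (fun x y => ideal_deg (E w) d x /\ y = T * x)) geJ.
- move=> I rr t f g Hfg; split.
    by apply: (subspace_comb _ _ (@ideal_deg_subspace _ _ _ _ _)) => i; have [] := Hfg i.
  by rewrite mulr_sumr; apply: eq_bigr => i _; have [_ ->] := Hfg i; rewrite -scalerAr.
- move=> x [hx xE]; exists (T * x) => //; split; first by rewrite -dE addnC; apply: yhomogM.
  by rewrite mulrC; apply: M_mulE.
move=> x _ [[hx xE] ->] [_ [g [v [[hg Mg] [hv Mv] Egv]]]]; split=> //.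
apply: (Hj1 d) => [||z zn0]; [by rewrite /d; lia|by []|].
case: (classic (E w z)) => [Ez|/(proj_separate (clE gr w) zn0)[da [a [ha aE az]]]]; last first.
  exists a => //; exists 0; rewrite mul0r subr0; apply: ogO2.
    by apply: homM; [exists da|exists d].
  by apply: (@ogM _ _ _ _ _ _ _ _ gr w 1 1); exact/og1P.
(* Off the zeros of b, x is a multiple of tau up to a unit. At a zero, g is a multiple of T up to a
   unit, and dividing T x = tau g + v by T leaves a multiple of tau and a term of order two. *)
case: (boolP (evalp b z == 0)) => [/eqP bz|bz]; last first.
  have [a Ha] := Hb x (ex_intro _ d hx) xE.
  exists b => //; exists a; move=> i; apply: og_vanY; exact: (vanishes_hcomp _ (coneY gr)).
have [z' zs' Hz'] := Hs z Ez bz.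
have [a [a' [ha ha' az Haa]]] := HT z' (mem_tail _ zs') g (ex_intro _ j hg) Mg.
exists a; first by rewrite (evalp_same ha Hz').
exists a' => i; apply: (og_exact nss OT nT); rewrite -(hcompM i _ hT).
have -> : T * (a * x - a' * tau w) = tau w * (a * g - a' * T) + a * v.
  by rewrite mulrBr mulrCA Egv; ring.
rewrite hcompD; apply: (idealD (og_ideal gr w _)).
  apply: og_vanY; apply: (vanishes_hcomp _ (coneY gr)).
  exact: (idealMl (idealY Y)).
have := idealMl (M_ideal gr _) a Mv; move/(_ (r + i)%N w).
by rewrite {1}/addE eqxx /addE eqxx -addnA.
Qed.
End Setup.

Section Setup.
Variables (G : weighted_graph) (K : closedFieldType) (n m : nat) (X : 'rV[K]_n -> Prop)
  (O : 'rV[K]_n) (Y : 'rV[K]_(n + m.+1) -> Prop) (E : G -> 'rV[K]_(n + m.+1) -> Prop).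
Hypotheses (nss : normal_surface_singularity X O) (gr : good_resolution_with_graph X O Y E).
Local Notation N := (n + m.+1)%N.
Local Notation R := {mpoly K[N]}.
Local Notation og := (og gr).
Local Notation M := (M gr).
Local Notation MH := (MH gr).
Local Notation H j := (fun f : R => is_true (yhomog j f)).
Local Notation tau := (tau gr).
Implicit Types (f g a b c : R) (u v w : G) (z : 'rV[K]_N) (D : G -> nat).

Section Vertex.
Variables (w : G) (e h d0 : nat).
Hypothesis He : selfint w = - e%:Z.
Hypothesis Hd : forall d, (d0 <= d)%N -> exists k,
    [/\ hilbert_fun (E w) d k, dim_ge (H d) (ideal_deg (E w) d) k, dim_le (H d) (ideal_deg (E w) d) k
    & (k + genus w = h * d + 1)%N].

(** Riemann's inequality for O(-D) on E_w, twisted by j. Induction on the total weight of D, one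
    curve at a time; removing E_w itself costs the degree shift c of [self_lower], which its term h
    c compensates. *)
Lemma quotient_lower D : exists j0, forall j, (j0 <= j)%N -> exists2 k,
  dim_ge (MH D j) (MH (addE D w) j) k &
  (h * j + 1 + e * D w <= k + genus w + \sum_(v : G) D v * edges w v)%N.
Proof.
have [c Hc] := self_lower nss gr He Hd.
have [l Dl] : exists l, (\sum_(v : G) D v <= l)%N by exists (\sum_(v : G) D v)%N.
elim: l D Dl => [|l IH] D Dl; last first.
  case: (classic (exists u, (0 < D u)%N)) => [[u Du]|]; last first.
    move=> Dn; apply: IH; rewrite big1 // => v _; case: (posnP (D v)) => // v0.
    by case: Dn; exists v.
  pose D' := fun v => (D v - (v == u))%N.
  have ED : addE D' u = D.
    apply: functional_extensionality => v; rewrite /addE /D' subnK //.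
    by case: eqP => [->|].
  have Du' : D u = (D' u).+1 by rewrite /D' eqxx subn1 prednK.
  have Dv v : v != u -> D v = D' v by move=> /negPf vu; rewrite /D' vu subn0.
  have SD (F : G -> nat) : (\sum_(v : G) D v * F v = \sum_(v : G) D' v * F v + F u)%N.
    rewrite (bigD1 u) //= [in RHS](bigD1 u) //= Du'.
    by rewrite (eq_bigr (fun v => D' v * F v)%N) => [|v vu]; [lia|rewrite Dv].
  have [|j0 Hj0] := IH D'.
    move: Dl; rewrite (bigD1 u) //= Du' (eq_bigr D') => [|v /Dv //].
    by rewrite addSn ltnS [in X in (_ <= _)%N -> X](bigD1 u).
  case: (eqVneq u w) => [Euw|uw].
    subst u.
    have [j1 Hj1] := Hc D'; exists (j0 + j1 + c)%N => j jj.
    have jc : (c <= j)%N by lia.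
    have [|k Hk Ek] := Hj0 (j - c)%N; first lia.
    exists (k + (h * c + e))%N.
      have j1c : (j1 <= j - c)%N by lia.
      by have := Hj1 _ _ j1c Hk; rewrite subnK // ED.
    rewrite SD edges_loopless addn0 Du'; have Ej : (j = j - c + c)%N by rewrite subnK.
    by move: Ek; set j' := (j - c)%N in Ej *; rewrite Ej; nia.
  have [j1 Hj1] := cross_lower nss gr D' (w := w) (w' := u) (negbT (introF eqP (fun e => elimN eqP uw (esym e)))).
  exists (j0 + j1)%N => j jj; have [|k Hk Ek] := Hj0 j; first lia.
  have Dw : D w = D' w by apply: Dv; rewrite eq_sym.
  exists (k - edges w u)%N; last by rewrite SD Dw; lia.
  case: (leqP (edges w u) k) => [ke|/ltnW]; last first.
    by rewrite -subn_eq0 => /eqP ->; exists (fun _ => 0) => [[]|? _ []].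
  by apply: dim_ge_incl (Hj1 j (k - edges w u)%N _ _); rewrite ?subnK ?ED //; lia.
have D0 v : D v = 0%N by apply/eqP; rewrite -leqn0 (leq_trans _ Dl) // (bigD1 v) //= leq_addr.
exists d0 => j /Hd[k [_ ge _ Ek]]; exists k; last by rewrite D0 muln0 Ek; lia.
apply: dim_ge_incl ge => x; first by move=> hx; split=> // d v; rewrite D0; apply: og0.
by move=> [hx /addE_og Ox]; split=> //; apply/(og1P gr); rewrite D0 in Ox.
Qed.

(** Up to one denominator a, M(D) consists of multiples of th, so the quotient embeds into the
    coordinate ring of E_w in a shifted degree. The constant is rough; what counts is the slope
    h. *)
Lemma quotient_upper D : exists cU, exists j0, forall j, (j0 <= j)%N ->
  dim_le (MH D j) (MH (addE D w) j) (h * j + cU).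
Proof.
have [z Ez] := E_nonempty gr w.
have [th [[r hth] Mth nth Hth]] := M_local nss gr D (E_neq0 gr Ez).
have [a [[da ha] na Ha]] : exists a, [/\ hom a, ~ vanishes a (E w)
    & forall x, hom x -> M D x -> exists g, vanishes (a * x - g * th) Y].
  apply: (uniform_den gr (M_ideal gr D) (multiples_ideal Y th)) => x hx Mx.
  have [|a [c [ha _ az Hac]]] := Hth x hx; first by move=> v _; apply: M_og.
  by exists a; split=> //; [exact: (evalp_neq0_vanishes Ez)|exists c].
exists (h * da + 1)%N, (r + d0)%N => j jj; pose d := (da + j - r)%N.
have dr : (r + d = da + j)%N by rewrite /d; lia.
have [|k [_ _ le Ek]] := Hd (d := d); first by rewrite /d; lia.
apply: (@dim_le_mono _ _ _ _ k); last by rewrite /d in Ek; nia.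
apply: (@dim_le_rel _ _ _ _ _ _ _ (fun x y => MH D j x /\ vanishes (a * x - y * th) Y)) le.
- move=> I rr t f g Hfg; split.
    by apply: (subspace_comb _ _ (MH_subspace gr D j)) => i; have [] := Hfg i.
  rewrite mulr_sumr mulr_suml -sumrB (eq_bigr (fun i => t i *: (a * f i - g i * th))) => [|i _].
    by apply: (subspace_comb _ _ (subspace_ideal (idealY Y))) => i; have [] := Hfg i.
  by rewrite scalerBr [t i *: (a * _)]scalerAr [t i *: (g i * _)]scalerAl.
- move=> x [hx Mx]; have [g Hg] := Ha x (ex_intro _ j hx) Mx.
  exists (hcomp d g); first exact: hcompP.
  split=> //; have -> : a * x - hcomp d g * th = hcomp (da + j) (a * x - g * th).
    by rewrite hcompB (hcomp_id (yhomogM ha hx)) [g * _]mulrC -dr (hcompM _ _ hth) [th * _]mulrC.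
  exact: (vanishes_hcomp _ (coneY gr)).
- move=> x y [[hx Mx] Hxy] [hy yE]; split=> //; apply: M_addE => //; first by exists j.
  apply: (og_cancel na); apply: (@og_Y_congr _ _ _ _ _ _ _ _ gr _ _ (y * th)).
    by rewrite -opprB; apply: (idealN (idealY Y)).
  rewrite -add1n; apply: ogM; [exact/(og1P gr)|exact: M_og].
Qed.

Variables s0 s1 : R.
Hypotheses (h0 : yhomog 1 s0) (h1 : yhomog 1 s1).
Hypothesis n0 : forall w, ~ vanishes s0 (E w).
Hypothesis s01 : forall w z, E w z -> evalp s0 z = 0 -> evalp s1 z != 0.
Variable j1 : nat.
Hypothesis gen1 : forall j f, (j1 <= j)%N -> yhomog j.+1 f -> exists a b,
  [/\ yhomog j a, yhomog j b & midM gr (fun=> 0%N) (f - (s0 * a + s1 * b))].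

(** The Euler characteristic 1 - genus - D.E_w. Subtraction is truncated, so the lower bound in
    [curve_hyps] is claimed only when [B D] is positive. *)
Let B D := (1 + e * D w - genus w - \sum_(v : G) D v * edges w v)%N.
Lemma curve_hyps D : exists jU, [/\ forall j (u : R), (jU <= j)%N -> MH D j.+1 u ->
     exists a b, [/\ MH D j a, MH D j b & MH (addE D w) j.+1 (u - (s0 * a + s1 * b))],
   forall j, (jU <= j)%N -> exists2 k, dim_ge (H j) (ideal_deg (E w) j) k & (k + genus w = h * j + 1)%N,
   exists cU, forall j, (jU <= j)%N -> dim_le (MH D j) (MH (addE D w) j) (h * j + cU)
  & (0 < B D)%N -> forall j, (jU <= j)%N -> dim_ge (MH D j) (MH (addE D w) j) (h * j + B D)].
Proof.
have [j2 Hj2] := genM gr h0 h1 s01 D; have [cU [j3 Hj3]] := quotient_upper D.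
have [j4 Hj4] := quotient_lower D; exists (d0 + j2 + j3 + j4)%N; split.
- move=> j u jj [hu Mu]; have [|a [b [Ha Hb Hab]]] := Hj2 j u _ hu Mu; first lia.
  exists a, b; split=> //; split.
    apply: (subspaceB (yhomog_subspace _ _ _ j.+1)) => //.
    have [ha _] := Ha; have [hb _] := Hb.
    by rewrite -add1n; apply: yhomogD; apply: yhomogM.
  by apply: midM_M Hab => v; rewrite /addE -addn1 leq_add2l leq_b1.
- by move=> j jj; have [|k [_ ge _ Ek]] := Hd (d := j); [lia|exists k].
- by exists cU => j jj; apply: Hj3; lia.
move=> B0 j jj; have [|k ge Ek] := Hj4 j; first lia.
by apply: dim_ge_mono ge _; move: B0; rewrite /B; lia.
Qed.

Let gH : graded (fun j => H j). Proof. by move=> j; apply: yhomog_subspace. Qed.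
Let gp : graded (fun j => @ideal_deg K n m (E w) j). Proof. by move=> j; apply: ideal_deg_subspace. Qed.
Let gM D : graded (fun j => MH D j). Proof. by move=> j; apply: MH_subspace. Qed.
Let pn0 : ~ ideal_deg (E w) 1 s0. Proof. by move=> [_]; apply: n0. Qed.
Let mulp i j x y : H i x -> ideal_deg (E w) j y -> ideal_deg (E w) (i + j) (x * y).
Proof. by move=> hx [hy yE]; split; [apply: yhomogM|apply: (idealMl (vanishes_ideal (E w)))]. Qed.
Let mulM D i j x y : H i x -> MH D j y -> MH D (i + j) (x * y).
Proof. by move=> hx [hy My]; split; [apply: yhomogM|apply: (idealMl (M_ideal gr D))]. Qed.
Let mulpM D i j x y : ideal_deg (E w) i x -> MH D j y -> MH (addE D w) (i + j) (x * y).
Proof. by move=> [hx xE] [hy My]; split; [apply: yhomogM|apply: M_mulE]. Qed.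
Let addM D j x : MH (addE D w) j x -> MH D j x.
Proof. by move=> [hx Mx]; split=> //; apply: addE_M Mx. Qed.
Let primeM D i j x y : H i x -> MH D j y -> MH (addE D w) (i + j) (x * y) ->
  ideal_deg (E w) i x \/ MH (addE D w) j y.
Proof.
move=> hx [hy My] [_ Mxy]; case: (classic (vanishes x (E w))) => [xE|nx]; first by left.
right; split=> //; apply: M_addE => //; first by exists j.
exact: og_cancel nx (addE_og Mxy).
Qed.
Let genp j (u : R) : (j1 <= j)%N -> H j.+1 u ->
  exists a b, [/\ H j a, H j b & ideal_deg (E w) j.+1 (u - (s0 * a + s1 * b))].
Proof.
move=> jj hu; have [a [b [ha hb Hab]]] := gen1 jj hu; exists a, b; split=> //; split.
  apply: (subspaceB (yhomog_subspace _ _ _ j.+1)) => //.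
  by rewrite -add1n; apply: yhomogD; apply: yhomogM.
apply/(og1P gr); apply: (M_og (D := fun=> 1%N) w); exact: midM_M Hab.
Qed.

Lemma curve_step D : (h * j1 + genus w + \sum_(v : G) D v * edges w v < 1 + e * D w)%N ->
  exists k0, forall k f, (k0 <= k)%N -> MH D (k + k)%N f ->
  exists a b, [/\ MH D k a, MH D k b & MH (addE D w) (k + k)%N (f - (s0 ^+ k * a + s1 ^+ k * b))].
Proof.
move=> HB; have [jU [gU dO [cU dU] dU']] := curve_hyps D.
have hB : (h * j1 < B D)%N by rewrite /B; lia.
have B0 : (0 < B D)%N by apply: leq_ltn_trans hB.
exact: (curve_vanishing gH gp (@gM D) (@gM (addE D w)) h0 h1 pn0
  (fun i j x y hx hy => yhomogM hx hy) mulp (@mulM D) (@mulM (addE D w)) (@mulpM D) (@addM D)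
  (@primeM D) genp gU dO dU (dU' B0) hB).
Qed.

(** [pencil_pair] with j0 = 0: a positive Euler characteristic yields a nonzero section of O(-D) on
    E_w. *)
Lemma curve_pair D k0 : (genus w + \sum_(v : G) D v * edges w v < 1 + e * D w)%N ->
  exists k a b, [/\ (k0 <= k)%N, MH D k a, MH D k b, ~ MH (addE D w) k a
    & MH (addE D w) (k + k)%N (s1 ^+ k * a - s0 ^+ k * b)].
Proof.
move=> HB; have [jU [gU dO [cU dU] dU']] := curve_hyps D.
have B0 : (0 < B D)%N by rewrite /B; lia.
have hB : (h * 0 < B D)%N by rewrite muln0.
have := pencil_pair (@gM D) (@gM (addE D w)) h0 h1 pn0 (@mulM D) (@mulM (addE D w))
  (@primeM D) dU (dU' B0) k0 hB.
by move=> [k [a [b [kk Ua Ub nV]]]]; rewrite (addn0 k) => HV; exists k, a, b.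
Qed.
End Vertex.
End Setup.

(** * Functions with prescribed order *)

Section Setup.
Variables (G : weighted_graph) (K : closedFieldType) (n m : nat) (X : 'rV[K]_n -> Prop)
  (O : 'rV[K]_n) (Y : 'rV[K]_(n + m.+1) -> Prop) (E : G -> 'rV[K]_(n + m.+1) -> Prop).
Hypotheses (nss : normal_surface_singularity X O) (gr : good_resolution_with_graph X O Y E).
Local Notation N := (n + m.+1)%N.
Local Notation R := {mpoly K[N]}.
Local Notation og := (og gr).
Local Notation M := (M gr).
Local Notation MH := (MH gr).
Local Notation H j := (fun f : R => is_true (yhomog j f)).
Local Notation tau := (tau gr).
Implicit Types (f g a b c : R) (u v w : G) (z : 'rV[K]_N) (D : G -> nat).

Lemma idealXD (A : comNzRingType) (J : A -> Prop) (x y : A) i j : ideal J ->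
  J (x ^+ i) -> J (y ^+ j) -> J ((x + y) ^+ (i + j)).
Proof.
move=> iJ Jx Jy; rewrite exprDn; apply: (ideal_sum iJ) => k _.
rewrite -mulr_natr; apply: (idealMr iJ); case: (leqP j k) => [/subnKC <-|kj].
  by rewrite exprD mulrCA; apply: (idealMr iJ).
have -> : (i + j - k = i + (j - k))%N by lia.
by rewrite exprD -mulrA; apply: (idealMr iJ).
Qed.

Lemma uniform_nil (B J : R -> Prop) : ideal B -> ideal J -> (forall x, B x -> exists k, J (x ^+ k)) ->
  exists k, forall x, B x -> J (x ^+ k).
Proof.
move=> iB iJ HB; have [s [sB Bs]] := @noetherian_mpoly K N B iB.
suff [k Hk] : exists k, forall x, span (@full _) s x -> J (x ^+ k) by exists k => x /Bs; apply: Hk.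
elim: s sB {Bs} => [_|x s IH sB].
  by exists 1%N => x ->; rewrite expr1; apply: (ideal0 iJ).
have [|k1 Hk1] := IH; first by move=> y ys; apply: sB; apply: mem_tail.
have [k2 Hk2] := HB x (sB x (mem_head _ _)).
exists (k2 + k1)%N => _ [c [z [_ Hz ->]]]; apply: (idealXD iJ); last exact: Hk1.
by rewrite exprMn; apply: (idealMl iJ).
Qed.

(** High order along the whole exceptional divisor forces membership in m_O M(D). With rho a local
    equation of Z, y_l rho vanishes on the fibre over O, so by the Nullstellensatz its N0-th power
    lies in the ideal of that fibre, with one N0 for all D and z. *)
Lemma mid_of_deep : exists N0, forall D, exists j0, forall j f, (j0 <= j)%N ->
  MH (fun v => D v + N0)%N j f -> midM gr D f.
Proof.
have i0 := midM_ideal gr (fun=> 0%N).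
pose B f := forall z, (forall g, midM gr (fun=> 0%N) g -> evalp g z = 0) -> evalp f z = 0.
have iB : ideal B.
  split=> [z _|f g Hf Hg z Hz|r f Hf z Hz]; first by rewrite evalp0.
    by rewrite evalpD (Hf z Hz) (Hg z Hz) addr0.
  by rewrite evalpM (Hf z Hz) mulr0.
have [f Bf|N0 HN0] := uniform_nil iB i0.
  apply: (nullstellensatz i0) => v Hv.
  have Ev (g : R) : g.@[v] = evalp g (\row_i v i).
    by apply: meval_eq => i; rewrite mxE.
  by rewrite Ev; apply: Bf => g /Hv; rewrite Ev.
exists N0 => D; have [j0 Hj0] := torsion_uniform (midM_ideal gr D); exists j0 => j f jj [hf Mf].
have MDf : M D f by apply: M_le Mf => v; apply: leq_addr.
apply: (Hj0 j) => // z z0.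
(* Away from the fibre over O, some element g of its ideal is a unit at z, and g f is in m_O
   M(D). *)
case: (classic (forall g, midM gr (fun=> 0%N) g -> evalp g z = 0)) => [Vz|/not_all_ex_not[g]]; last first.
  move=> Hg; have [mg /eqP gz] := imply_to_and _ _ Hg.
  by exists g => //; apply: midM_mul.
have [th [[r hth] Mth nth Hth]] := M_local nss gr D z0.
have [rho [hrho Mrho nrho Hrho]] := M_local nss gr (fun=> 1%N) z0.
have loc k c : hom c -> (forall w, E w z -> og w k c) ->
    exists a d, [/\ hom a, hom d, evalp a z != 0 & vanishes (a * c - d * rho ^+ k) Y].
  move=> hc; elim: k => [_|k IH Hk].
    exists 1, c; split=> //; [exact: hom1|by rewrite evalp1 oner_neq0|].
    by rewrite mul1r expr0 mulr1 subrr; apply: (ideal0 (idealY Y)).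
  have [|a [d [ha hd az Had]]] := IH; first by move=> w /Hk; apply: og_le.
  have [|a' [d' [ha' hd' az' Had']]] := Hrho d hd.
    move=> w Ez; apply: (og_exact nss (k := k) (f := rho ^+ k)).
    - by have := @ogX _ _ _ _ _ _ _ _ gr w 1 k rho (M_og w Mrho); rewrite muln1.
    - apply: (exactX nss); first exact: nrho.
      by apply/(og1P gr); apply: (M_og w Mrho).
    rewrite addn1; apply: (@og_Y_congr _ _ _ _ _ _ _ _ gr _ _ (a * c)); first by rewrite [rho ^+ k * d]mulrC.
    by apply: (idealMl (og_ideal gr w _)); apply: Hk.
  exists (a' * a), d'; split=> //; [exact: homM|by rewrite evalpM mulf_neq0|].
  have -> : a' * a * c - d' * rho ^+ k.+1 =
     a' * (a * c - d * rho ^+ k) + rho ^+ k * (a' * d - d' * rho) by rewrite exprS; ring.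
  by apply: (idealD (idealY Y)); apply: (idealMl (idealY Y)).
have [|a [c [ha hc az Hac]]] := Hth f (ex_intro _ j hf); first by move=> w _; apply: M_og.
have [w Ez|a' [d [ha' hd az' Had]]] := loc N0 c hc.
  apply: (og_exact nss (M_og w Mth) (nth w Ez)).
  apply: (@og_Y_congr _ _ _ _ _ _ _ _ gr _ _ (a * f)); first by rewrite [th * c]mulrC.
  by apply: (idealMl (og_ideal gr w _)); apply: (M_og w Mf).
have [l yl] := ex_ycoord z0.
exists ('X_(rshift n l) ^+ N0 * a' * a).
  by rewrite !evalpM !mulf_neq0 // evalpX expf_neq0 // evalp_yvar.
have -> : 'X_(rshift n l) ^+ N0 * a' * a * f =
  'X_(rshift n l) ^+ N0 * (a' * (a * f - c * th) + th * (a' * c - d * rho ^+ N0)) +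
  ('X_(rshift n l) * rho) ^+ N0 * (d * th) by rewrite exprMn; ring.
apply: (idealD (midM_ideal gr D)).
  apply: midM_Y; apply: (idealMl (idealY Y)).
  by apply: (idealD (idealY Y)); apply: (idealMl (idealY Y)).
apply: midM_mul; last exact: (idealMl (M_ideal gr D)).
apply: HN0 => z' Hz'; rewrite evalpM evalp_yvar.
case: (eqVneq (rsubmx z') 0) => [z'0|z'0].
  by rewrite -ycoord_rsub z'0 mxE mul0r.
have [w Ew] := mid_zero z'0 Hz'.
have /(og1P gr) -> // : og w 1 rho by apply: (M_og w Mrho).
by rewrite mulr0.
Qed.

Section Generation.
Variables (e h d0 : G -> nat).
Hypothesis He : forall w, selfint w = - (e w)%:Z.
Hypothesis Hd : forall w d, (d0 w <= d)%N -> exists k,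
    [/\ hilbert_fun (E w) d k, dim_ge (H d) (ideal_deg (E w) d) k, dim_le (H d) (ideal_deg (E w) d) k
    & (k + genus w = h w * d + 1)%N].
Variables s0 s1 : R.
Hypotheses (h0 : yhomog 1 s0) (h1 : yhomog 1 s1).
Hypothesis n0 : forall w, ~ vanishes s0 (E w).
Hypothesis s01 : forall w z, E w z -> evalp s0 z = 0 -> evalp s1 z != 0.
Variable j1 : nat.
Hypothesis gen1 : forall j f, (j1 <= j)%N -> yhomog j.+1 f -> exists a b,
  [/\ yhomog j a, yhomog j b & midM gr (fun=> 0%N) (f - (s0 * a + s1 * b))].
Variable N0 : nat.
Hypothesis HN0 : forall D, exists j0, forall j f, (j0 <= j)%N ->
  MH (fun v => D v + N0)%N j f -> midM gr D f.

(** The error of [curve_step] vanishes to one order more along one curve. Applying it at most N0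
    times to each curve pushes the error from M(D1) into M(D1 + N0 Z), where [mid_of_deep] absorbs
    it; the positivity is required for every D met on the way. *)
Lemma module_generation D1 :
  (forall D, (forall v, D1 v <= D v <= D1 v + N0)%N -> forall w,
     (h w * j1 + genus w + \sum_(v : G) D v * edges w v < 1 + e w * D w)%N) ->
  exists k0, forall k f, (k0 <= k)%N -> MH D1 (k + k)%N f ->
  exists a b, [/\ MH D1 k a, MH D1 k b & midM gr D1 (f - (s0 ^+ k * a + s1 ^+ k * b))].
Proof.
move=> HD1; suff gen S D : (forall v, D1 v <= D v <= D1 v + N0)%N -> (\sum_v (D1 v + N0 - D v) <= S)%N ->
  exists k0, forall k f, (k0 <= k)%N -> MH D (k + k)%N f ->
  exists a b, [/\ MH D1 k a, MH D1 k b & midM gr D1 (f - (s0 ^+ k * a + s1 ^+ k * b))].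
  by apply: (gen (\sum_v (D1 v + N0 - D1 v))%N D1) => // v; lia.
elim: S D => [|S IH] D HD HS.
  have [j0 Hj0] := HN0 D1; exists j0 => k f kj [hf Mf].
  exists 0, 0; rewrite !mulr0 addr0 subr0; split; try exact: (subspace0 (MH_subspace gr D1 k)).
  apply: (Hj0 (k + k)%N); first lia.
  split=> //; apply: M_le Mf => v; have := HD v.
  by move: HS; rewrite (bigD1 v) //=; lia.
case: (classic (exists w, (D w < D1 w + N0)%N)) => [[w Dw]|Hn]; last first.
  apply: IH => //; rewrite big1 // => v _; apply/eqP; rewrite subn_eq0 leqNgt.
  by apply/negP => Hv; apply: Hn; exists v.
have [k1 Hk1] := curve_step nss (He w) (@Hd w) h0 h1 n0 s01 gen1 (HD1 D HD w).
have [||k2 Hk2] := IH (addE D w).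
- by move=> v; have := HD v; rewrite /addE; case: eqP => [->|_]; lia.
- move: HS; rewrite (bigD1 w) //= [in X in _ -> X](bigD1 w) //= {1}/addE eqxx.
  rewrite [in X in _ -> X](eq_bigr (fun v => D1 v + N0 - D v)%N) => [|v /negPf vw]; first lia.
  by rewrite /addE vw addn0.
exists (maxn k1 k2) => k f; rewrite geq_max => /andP[kk1 kk2] Hf.
have [a [b [Ha Hb Hab]]] := Hk1 k f kk1 Hf.
have [a' [b' [Ha' Hb' Hab']]] := Hk2 k _ kk2 Hab.
have MDD x : MH D k x -> MH D1 k x.
  by move=> [hx Mx]; split=> //; apply: M_le Mx => v; have /andP[] := HD v.
exists (a + a'), (b + b'); split; try by apply: (subspaceD (MH_subspace gr D1 k)) => //; apply: MDD.
suff -> : f - (s0 ^+ k * (a + a') + s1 ^+ k * (b + b')) =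
   f - (s0 ^+ k * a + s1 ^+ k * b) - (s0 ^+ k * a' + s1 ^+ k * b') by [].
by ring.
Qed.
End Generation.

(* The homogeneous polynomials of degree 0 in y form the ring K[x]. *)
Section NakayamaO.
Variables (d : nat) (T S : R -> Prop).
Hypotheses (TH : forall f, T f -> yhomog d f) (T0 : T 0)
  (TD : forall f g, T f -> T g -> T (f + g)) (TM : forall a f, yhomog 0 a -> T f -> T (a * f)).
Hypotheses (S0 : S 0) (SD : forall f g, S f -> S g -> S (f + g))
  (SM : forall a f, yhomog 0 a -> S f -> S (a * f)).
Hypothesis gen : forall f, T f -> exists F : 'I_n -> R, (forall i, T (F i)) /\
  S (f - \sum_i F i * xdiff m O i).

(** Encodes a K[x]-module U of forms of degree d as an ideal: components below d vanish and those
    above d are free. Finite generation over K[x] then follows from the Noetherian property of the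
    whole ring. *)
Let modI (U : R -> Prop) f := (forall e, (e < d)%N -> hcomp e f = 0) /\ U (hcomp d f).

Let modI_ideal U : U 0 -> (forall f g, U f -> U g -> U (f + g)) ->
  (forall a f, yhomog 0 a -> U f -> U (a * f)) -> ideal (modI U).
Proof.
move=> U0 UD UM; have h00 e : hcomp e (0 : R) = 0.
  by rewrite (hcomp_ne (yhomog0 _ _ _ e.+1)) // gtn_eqF.
split=> [|f g [f0 Uf] [g0 Ug]|r f [f0 Uf]]; first by split=> [e _|]; rewrite h00.
  by split=> [e ed|]; rewrite hcompD; [rewrite f0 // g0 // addr0|apply: UD].
have [k Hk] := hcomp_partition r.
have Er e : hcomp e (r * f) = \sum_(i < k) hcomp e (hcomp i r * f).
  by rewrite {1}(Hk k (leqnn _)) mulr_suml hcomp_sum0.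
have small (i e : nat) : ((e < d) || (0 < i))%N -> (e <= d)%N -> hcomp e (hcomp i r * f) = 0.
  move=> ied ed; case: (ltnP e i) => [|ie]; first exact: (hcompM_lt _ (hcompP i r)).
  by rewrite -(subnKC ie) (hcompM _ _ (hcompP i r)) f0 ?mulr0 //; lia.
split=> [e ed|]; rewrite Er; first by rewrite big1 // => i _; apply: small; [rewrite ed|apply: ltnW].
case: k {Hk Er} => [|k]; first by rewrite big_ord0.
rewrite big_ord_recl big1 => [|i _]; last by apply: small; rewrite ?orbT.
have E0 : hcomp d (hcomp 0 r * f) = hcomp 0 r * hcomp d f := hcompM d f (hcompP 0 r).
by rewrite addr0 [X in U X]E0; apply: (UM _ _ (hcompP 0 r) Uf).
Qed.

Lemma hcomp0_eval (f : R) z : evalp (hcomp 0 f) z = evalp f (yscale 0 z).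
Proof.
have [k Hk] := hcomp_partition f.
have -> : evalp f (yscale 0 z) = \sum_(d < k.+1) evalp (hcomp d f) (yscale 0 z).
  by rewrite {1}(Hk k.+1) // evalp_sum.
rewrite big_ord_recl big1 => [|i _].
  by rewrite addr0 (evalp_yscale _ _ (hcompP 0 f)) expr0 mul1r.
by rewrite (evalp_yscale _ _ (hcompP _ f)) expr0n mul0r.
Qed.

(** Multiplication by h with h(O) nonzero stands for localization at O. At the auxiliary point z0 =
    (O, 0) a polynomial takes the value at O of its part of degree 0. *)
Lemma nakayama_O : exists h, [/\ yhomog 0 h, forall z, lsubmx z = O -> evalp h z != 0
  & forall f, T f -> S (h * f)].
Proof.
have iT := modI_ideal T0 TD TM; have iS := modI_ideal S0 SD SM.
have [s [sT Ts]] := @noetherian_mpoly K N _ iT.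
pose z0 : 'rV[K]_N := row_mx O 0.
have [||||||b bz Hb] := @nakayama _ (fun a => evalp a z0 != 0) (fun a => evalp a z0 = 0) (modI S) s.
- by rewrite evalp1 oner_neq0.
- by move=> a b az bz; rewrite evalpM mulf_neq0.
- by move=> a q az qz; rewrite evalpB qz subr0.
- exact: point_ideal.
- exact: iS.
- move=> x /sT[x0 Tx]; have [F [TF HF]] := gen Tx.
  have hom_sum : yhomog d (\sum_i F i * xdiff m O i).
    apply: (subspace_sum _ (yhomog_subspace _ _ _ d)) => i _.
    by rewrite mulrC -[d]add0n; apply: yhomogM; [exact: xdiff_hom|exact: TH].
  exists 1, (x - \sum_i F i * xdiff m O i), (\sum_i F i * xdiff m O i).
  split; [by rewrite evalp1 oner_neq0| | |by rewrite mul1r subrK].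
    split=> [e ed|]; rewrite hcompB.
      by rewrite x0 // (hcomp_ne hom_sum) ?subr0 // gtn_eqF.
    by rewrite (hcomp_id hom_sum).
  apply: (ideal_sum (span_ideal s (point_ideal z0))) => i _; rewrite mulrC.
  apply: span_mull; [exact: point_ideal|by rewrite /xdiff !evalpE row_mxEl subrr|].
  apply: Ts; split=> [e ed|]; last by rewrite hcomp_id //; apply: TH.
  by apply: (hcomp_ne (TH (TF i))); rewrite gtn_eqF.
exists (hcomp 0 b); split; [exact: hcompP| |].
  move=> z Oz; rewrite hcomp0_eval.
  suff -> : yscale 0 z = z0 by [].
  by rewrite /yscale Oz scale0r.
move=> f Tf; have iB : ideal (fun g => modI S (b * g)).
  split=> [|x y Hx Hy|r x Hx]; first by rewrite mulr0; apply: (ideal0 iS).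
    by rewrite mulrDr; apply: (idealD iS).
  by rewrite mulrCA; apply: (idealMl iS).
have [|_] := span_sub iB Hb (Ts f _).
  split=> [e ed|]; last by rewrite hcomp_id //; apply: TH.
  by apply: (hcomp_ne (TH Tf)); rewrite gtn_eqF.
by rewrite mulrC -{1}[d]addn0 (hcompM _ _ (TH Tf)) mulrC.
Qed.
End NakayamaO.
End Setup.

Section Setup.
Variables (G : weighted_graph) (K : closedFieldType) (n m : nat) (X : 'rV[K]_n -> Prop)
  (O : 'rV[K]_n) (Y : 'rV[K]_(n + m.+1) -> Prop) (E : G -> 'rV[K]_(n + m.+1) -> Prop).
Hypotheses (nss : normal_surface_singularity X O) (gr : good_resolution_with_graph X O Y E).
Local Notation N := (n + m.+1)%N.
Local Notation R := {mpoly K[N]}.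
Local Notation og := (og gr).
Local Notation M := (M gr).
Local Notation MH := (MH gr).
Local Notation H j := (fun f : R => is_true (yhomog j f)).
Local Notation tau := (tau gr).
Implicit Types (f g a b c : R) (u v w : G) (z : 'rV[K]_N) (D : G -> nat).

Lemma midM_H D i f : yhomog i f -> midM gr D f -> exists F : 'I_n -> R,
  (forall j, MH D i (F j)) /\ vanishes (f - \sum_j F j * xdiff m O j) Y.
Proof.
move=> hf [F [MF HF]]; exists (fun j => hcomp i (F j)); split=> [j|].
  by split; [exact: hcompP|exact: M_hcomp].
have -> : f - \sum_j hcomp i (F j) * xdiff m O j = hcomp i (f - \sum_j F j * xdiff m O j).
  rewrite hcompB (hcomp_id hf) hcomp_sum0; congr (_ - _); apply: eq_bigr => j _.
  have E0 : hcomp i (xdiff m O j * F j) = xdiff m O j * hcomp i (F j) := hcompM i _ (xdiff_hom m O j).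
  by rewrite [F j * _]mulrC E0 mulrC.
exact: (vanishes_hcomp _ (coneY gr)).
Qed.

Definition widen (f : {mpoly K[n]}) : R := mmap (@mpolyC N K) (fun i => 'X_(lshift m.+1 i)) f.

Lemma evalp_widen (f : {mpoly K[n]}) z : evalp (widen f) z = evalp f (lsubmx z).
Proof.
pose Q (f : {mpoly K[n]}) := evalp (widen f) z = evalp f (lsubmx z).
apply: (@mpoly_ring_ind _ _ Q) => [c|i|p q Hp Hq|p q Hp Hq]; rewrite /Q /widen.
- by rewrite mmapC !evalpC.
- by rewrite mmapX mmap1U !evalpXU mxE.
- by rewrite mmapD !evalpD -/(widen p) -/(widen q) Hp Hq.
- by rewrite mmap_mul !evalpM -/(widen p) -/(widen q) Hp Hq.
Qed.

Section Substitution.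
Variable F : 'I_m.+1 -> {mpoly K[n]}.
Definition sub_graph f : {mpoly K[n]} := mmap (@mpolyC n K)
  (fun i => match split i with inl a => 'X_a | inr b => F b end) f.

Lemma evalp_sub_graph f x : evalp (sub_graph f) x = evalp f (row_mx x (eval_tuple F x)).
Proof.
pose Q f := evalp (sub_graph f) x = evalp f (row_mx x (eval_tuple F x)).
apply: (@mpoly_ring_ind _ _ Q) => [c|i|p q Hp Hq|p q Hp Hq]; rewrite /Q /sub_graph.
- by rewrite mmapC !evalpC.
- rewrite mmapX mmap1U evalpXU mxE; case: splitP => j _; first by rewrite evalpXU.
  by rewrite mxE.
- by rewrite mmapD !evalpD -/(sub_graph p) -/(sub_graph q) Hp Hq.
- by rewrite mmap_mul !evalpM -/(sub_graph p) -/(sub_graph q) Hp Hq.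
Qed.
End Substitution.

Lemma span_map (W : nat -> R) L f : span (@full _) [seq W j | j <- iota 0 L] f ->
  exists r : nat -> R, f = \sum_(j < L) r j * W j.
Proof.
have gen i : span (@full _) [seq W j | j <- iota i L] f ->
    exists r : nat -> R, f = \sum_(j < L) r j * W (i + j)%N; last exact: (gen 0%N).
elim: L i f => [|L IH] i f /=; first by move=> ->; exists (fun _ => 0); rewrite big_ord0.
move=> [c [z [_ Hz ->]]]; have [r ->] := IH _ _ Hz.
exists (fun j => if j is j'.+1 then r j' else c); rewrite big_ord_recl addn0; congr (_ + _).
by apply: eq_bigr => j _; rewrite addSnnS.
Qed.

(** The spans of initial segments become stationary. The resulting relation is the source of the
    integral equation in [regular_function]. *)
Lemma noether_sequence (W : nat -> R) : exists L (r : nat -> R), W L = \sum_(j < L) r j * W j.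
Proof.
pose Wl L := [seq W j | j <- iota 0 L]; pose J f := exists L, span (@full _) (Wl L) f.
have mono L L' f : (L <= L')%N -> span (@full _) (Wl L) f -> span (@full _) (Wl L') f.
  move=> LL; apply: span_sub_span => _ /mapP[j jL ->]; apply: span_mem; apply: map_f.
  by move: jL; rewrite !mem_iota; lia.
have iS L : ideal (span (@full _) (Wl L)) by apply: span_ideal; apply: full_ideal.
have iJ : ideal J.
  split=> [|f g [L Hf] [L' Hg]|r f [L Hf]].
  - by exists 0%N.
  - exists (maxn L L'); apply: (idealD (iS _)); [apply: mono Hf|apply: mono Hg].
      exact: leq_maxl.
    exact: leq_maxr.
  - by exists L; apply: (idealMl (iS _)).
have [s [sJ Js]] := @noetherian_mpoly K N J iJ.
have [L HL] : exists L, forall x, x \in s -> span (@full _) (Wl L) x.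
  elim: s sJ {Js} => [_|x s IH sJ]; first by exists 0%N.
  have [|L HL] := IH; first by move=> y ys; apply: sJ; apply: mem_tail.
  have [L' HL'] := sJ x (mem_head _ _); exists (maxn L L') => y.
  by rewrite inE => /orP[/eqP ->|/HL]; [apply: mono HL'; apply: leq_maxr|apply: mono; apply: leq_maxl].
exists L; apply: span_map; apply: (span_sub (iS L) HL); apply: Js; exists L.+1.
by apply: span_mem; apply: map_f; rewrite mem_iota add0n ltnSn.
Qed.

Lemma aff_zeros_closed (F : {mpoly K[n]} -> Prop) :
  closed_for (@aff_closure K n) (fun x => forall f : {mpoly K[n]}, F f -> evalp f x = 0).
Proof.
move=> x; split=> [Hx f Ff|Hx f]; last exact.
by apply: Hx => y; apply.
Qed.

Lemma X_density (f : {mpoly K[n]}) : (forall x, X x -> x <> O -> evalp f x = 0) -> vanishes f X.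
Proof.
move=> Hf; have [p Xp pO] := nss_nontrivial nss; have [_ irrX] := nss_irreducible nss.
pose F1 (g : {mpoly K[n]}) := g = f; pose F2 (g : {mpoly K[n]}) := exists i, g = 'X_i - (O 0 i)%:MP.
case: (irrX _ _ (aff_zeros_closed F1) (aff_zeros_closed F2)) => [x Xx|Xf x Xx|XO].
- case: (classic (x = O)) => [->|xO]; last by left=> g ->; apply: Hf.
  by right=> g [i ->]; rewrite !evalpE subrr.
- by apply: Xf.
case: pO; apply/rowP => i; have := XO p Xp _ (ex_intro _ i erefl).
by rewrite !evalpE => /eqP; rewrite subr_eq0 => /eqP.
Qed.

(** * Integrality of the fraction and normality of X *)

Section Regular.
Variables (s0 s1 P Q : R) (k : nat).
Hypotheses (h0 : yhomog 1 s0) (h1 : yhomog 1 s1) (k0 : (0 < k)%N) (s0Y : ~ vanishes s0 Y).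
Hypothesis s01 : forall w z, E w z -> evalp s0 z = 0 -> evalp s1 z != 0.
Hypotheses (hP : yhomog k P) (hQ : yhomog k Q) (HPQ : vanishes (s1 ^+ k * P - s0 ^+ k * Q) Y).

(* P / s0^k is integral over K[x] near O: multiplied by some h with h(O) <> 0, it maps
   the polynomials of some degree i in y into themselves. *)
Lemma regular_function : exists (h : R) (f : {mpoly K[n]}), [/\ yhomog 0 h,
  forall z, lsubmx z = O -> evalp h z != 0 & vanishes (s0 ^+ k * widen f - h * P) Y].
Proof.
have hk (s : R) : yhomog 1 s -> forall l, yhomog l (s ^+ l).
  by move=> hs l; rewrite -[X in yhomog X]muln1; apply: yhomogMn.
have h0k := hk _ h0 k; have h1k := hk _ h1 k.
have [_ _ pY] := primeY gr.
have [|i0 Hi0] := @genJ_H _ _ _ _ _ _ _ _ gr (s0 ^+ k) (s1 ^+ k).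
  move=> w z Ez; rewrite !evalpX => /eqP; rewrite expf_eq0 k0 /= => /eqP /(s01 Ez).
  by move=> sz; rewrite expf_neq0.
pose i := (i0 + k)%N; have ki : (k <= i)%N by apply: leq_addl.
pose S f := yhomog i f /\ exists a b, [/\ yhomog (i - k) a, yhomog (i - k) b
  & vanishes (f - (s0 ^+ k * a + s1 ^+ k * b)) Y].
have [|||||||f hf|h [hh hO HS]] := @nakayama_O _ _ _ O i (fun f => yhomog i f) S.
- by [].
- exact: yhomog0.
- by move=> f g; apply: yhomogD.
- by move=> a f ha hf; rewrite -[i]add0n; apply: yhomogM.
- split; first exact: yhomog0.
  exists 0, 0; split; [exact: yhomog0|exact: yhomog0|].
  by rewrite !mulr0 addr0 subr0; apply: (ideal0 (idealY Y)).
- move=> f g [hf [a [b [ha hb Hab]]]] [hg [a' [b' [ha' hb' Hab']]]]; split; first exact: yhomogD.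
  exists (a + a'), (b + b'); split; [exact: yhomogD|exact: yhomogD|].
  have -> : f + g - (s0 ^+ k * (a + a') + s1 ^+ k * (b + b')) =
    (f - (s0 ^+ k * a + s1 ^+ k * b)) + (g - (s0 ^+ k * a' + s1 ^+ k * b')) by ring.
  exact: (idealD (idealY Y)).
- move=> r f hr [hf [a [b [ha hb Hab]]]]; have mulr0h j (x : R) : yhomog j x -> yhomog j (r * x).
    by move=> hx; rewrite -[j]add0n; apply: yhomogM.
  split; first exact: mulr0h.
  exists (r * a), (r * b); split; [exact: mulr0h|exact: mulr0h|].
  have -> : r * f - (s0 ^+ k * (r * a) + s1 ^+ k * (r * b)) =
    r * (f - (s0 ^+ k * a + s1 ^+ k * b)) by ring.
  exact: (idealMl (idealY Y)).
- have [a [b [_ _ Hab]]] := Hi0 i f (leq_addr _ _) hf.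
  have := midM_hcomp i Hab; rewrite hcompB (hcomp_id hf) hcompD.
  rewrite -[X in hcomp X (s0 ^+ k * a)](subnKC ki) -[X in hcomp X (s1 ^+ k * b)](subnKC ki).
  rewrite (hcompM _ _ h0k) (hcompM _ _ h1k) => Hab'.
  have hc (s x : R) : yhomog k s -> yhomog i (s * hcomp (i - k) x).
    by move=> hs; rewrite -[X in yhomog X](subnKC ki); apply: yhomogM => //; apply: hcompP.
  have hg : yhomog i (f - (s0 ^+ k * hcomp (i - k) a + s1 ^+ k * hcomp (i - k) b)).
    by apply: (subspaceB (yhomog_subspace _ _ _ i)) => //; apply: yhomogD; apply: hc.
  have [F [HF Fv]] := midM_H hg Hab'; exists F; split=> [j|]; first by have [] := HF j.
  split.
    apply: (subspaceB (yhomog_subspace _ _ _ i)) => //.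
    apply: (subspace_sum _ (yhomog_subspace _ _ _ i)) => j _; have [hF _] := HF j.
    by rewrite mulrC -[i]add0n; apply: yhomogM => //; apply: xdiff_hom.
  exists (hcomp (i - k) a), (hcomp (i - k) b); split; try exact: hcompP.
  by rewrite addrAC.
(* The fraction is A / B. It maps forms w of degree i to such forms modulo I(Y), because h w = s0^k
   u + s1^k v and s1^k P = s0^k Q. *)
pose A := h * P; pose B := s0 ^+ k.
have hA : yhomog k A by rewrite -[k]add0n; apply: yhomogM.
have Hnext (w : R) : exists w' : R, yhomog i w -> yhomog i w' /\ vanishes (A * w - B * w') Y.
  case: (classic (yhomog i w)) => [hw|]; last by move=> nw; exists 0.
  have [hw' [u [v [hu hv Huv]]]] := HS w hw; exists (P * u + Q * v) => _; split.
    by rewrite -(subnKC ki); apply: yhomogD; apply: yhomogM.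
  have -> : A * w - B * (P * u + Q * v) =
    P * (h * w - (s0 ^+ k * u + s1 ^+ k * v)) + v * (s1 ^+ k * P - s0 ^+ k * Q).
    by rewrite /A /B; ring.
  by apply: (idealD (idealY Y)); apply: (idealMl (idealY Y)).
have [next nextP] := choice _ Hnext.
(* [W l] represents (A / B)^l s0^i. A relation among the W l with coefficients of degree 0 in y is
   an integral equation for A / B. *)
pose W l := iter l next (s0 ^+ i).
have hW l : yhomog i (W l).
  by elim: l => [|l IH]; [exact: hk|have [] := nextP _ IH].
have AW l : vanishes (A ^+ l * s0 ^+ i - B ^+ l * W l) Y.
  elim: l => [|l IH]; first by rewrite !expr0 !mul1r subrr; apply: (ideal0 (idealY Y)).
  have [_ Hl] := nextP _ (hW l).
  have -> : A ^+ l.+1 * s0 ^+ i - B ^+ l.+1 * W l.+1 =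
    A * (A ^+ l * s0 ^+ i - B ^+ l * W l) + B ^+ l * (A * W l - B * next (W l)).
    by rewrite !exprS /W /=; ring.
  by apply: (idealD (idealY Y)); apply: (idealMl (idealY Y)).
have [L [r HL]] := noether_sequence W; pose c j := hcomp 0 (r j).
have WL : W L = \sum_(j < L) c j * W j.
  rewrite -[LHS](hcomp_id (hW L)) HL hcomp_sum0; apply: eq_bigr => j _.
  by rewrite mulrC -{1}[i]addn0 (hcompM _ _ (hW j)) mulrC.
have L0 : (0 < L)%N.
  case: (posnP L) => // L0; move: WL; rewrite L0 big_ord0 /W /= => E0.
  by case: s0Y; apply: (primeX (primeY gr) (k := i)); rewrite E0; apply: (ideal0 (idealY Y)).
pose Z := A ^+ L - \sum_(j < L) c j * (A ^+ j * B ^+ (L - j)).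
have ZY : vanishes Z Y.
  suff : vanishes (Z * s0 ^+ i) Y.
    by case/pY => // /(primeX (primeY gr)) s0Y'; case: s0Y.
  have -> : Z * s0 ^+ i = (A ^+ L * s0 ^+ i - B ^+ L * W L) -
      \sum_(j < L) c j * B ^+ (L - j) * (A ^+ j * s0 ^+ i - B ^+ j * W j).
    rewrite /Z mulrBl mulr_suml WL mulr_sumr.
    rewrite [\sum_(j < L) c j * B ^+ (L - j) * _](eq_bigr
      (fun j : 'I_L => c j * (A ^+ j * B ^+ (L - j)) * s0 ^+ i - B ^+ L * (c j * W j))) => [|j _].
      by rewrite sumrB; ring.
    by rewrite -[in B ^+ L](subnK (ltnW (ltn_ord j))) exprD; ring.
  apply: (idealB (idealY Y)) => //; apply: (ideal_sum (idealY Y)) => j _.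
  exact: (idealMl (idealY Y)).
(* Substituting y = F(x), the inverse of Y -> X on an open set, carries the equation from Y to X,
   where normality applies. *)
have [x1 Xx1 x1O] := nss_nontrivial nss.
have [F Fx1 HF] := res_iso (gr_resolution gr) Xx1 x1O.
have onY x : X x -> x <> O -> eval_tuple F x != 0 -> Y (row_mx x (eval_tuple F x)).
  by move=> Xx xO Fx; apply/(HF x Xx xO Fx); exists 1; rewrite ?oner_neq0 ?scale1r.
have dens g : (forall z, Y z -> lsubmx z <> O -> eval_tuple F (lsubmx z) != 0 -> evalp g z = 0) ->
    vanishes g Y.
  move=> Hg; have [t nt] := xdiff_notY nss gr.
  have [j nj] : exists j, evalp (F j) x1 != 0.
    apply: NNPP => Hn; case/negP: Fx1; apply/eqP/rowP => j; rewrite !mxE.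
    by apply/eqP/negPn/negP => nj; apply: Hn; exists j.
  have nF : ~ vanishes (widen (F j)) Y.
    by apply: (evalp_neq0_vanishes (onY _ Xx1 x1O Fx1)); rewrite evalp_widen row_mxKl.
  have : vanishes (xdiff m O t * (widen (F j) * g)) Y.
    move=> z Yz; rewrite !evalpM evalp_widen.
    case: (classic (lsubmx z = O)) => [Oz|zO].
      by rewrite /xdiff !evalpE -Oz mxE subrr mul0r.
    case: (eqVneq (eval_tuple F (lsubmx z)) 0) => [/rowP/(_ j)|Fz]; last by rewrite Hg // !mulr0.
    by rewrite !mxE => ->; rewrite mul0r mulr0.
  by case/pY => // /pY[].
have scal d g z : yhomog d g -> Y z -> lsubmx z <> O -> eval_tuple F (lsubmx z) != 0 ->
    exists2 t : K, t != 0 & forall d g, yhomog d g -> evalp g z = t ^+ d * evalp (sub_graph F g) (lsubmx z).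
  move=> hg Yz zO Fz; have Xz := res_over (gr_resolution gr) Yz.
  have := HF _ Xz zO Fz (rsubmx z); rewrite hsubmxK => -[/(_ Yz)[t t0 Et] _].
  exists t => // e g' hg'; rewrite evalp_sub_graph -(evalp_yscale _ _ hg') /yscale row_mxKl row_mxKr -Et.
  by rewrite hsubmxK.
have nB : ~ vanishes (sub_graph F B) X.
  move=> BX; case: s0Y; apply: (primeX (primeY gr) (k := k)); apply: dens => z Yz zO Fz.
  have [t _ Ht] := scal _ _ _ h0k Yz zO Fz; rewrite (Ht _ _ h0k) BX ?mulr0 //.
  exact: (res_over (gr_resolution gr) Yz).
have [|f Hf] := nss_normal nss (f := sub_graph F A) nB.
  exists L, (fun j => - sub_graph F (c j)); apply: X_density => x Xx xO.
  have EZ : evalp Z (row_mx x (eval_tuple F x)) = 0.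
    (* Where F vanishes, (x, F(x)) is not a point of Y, but A and B have positive degree in y and
       vanish there too. *)
    case: (eqVneq (eval_tuple F x) 0) => [Fx|Fx]; last by apply: ZY; apply: onY.
    have E0 d g : yhomog d g -> (0 < d)%N -> evalp g (row_mx x (eval_tuple F x)) = 0.
      move=> hg d0; have -> : row_mx x (eval_tuple F x) = yscale 0 (row_mx x (eval_tuple F x)).
        by rewrite /yscale row_mxKl row_mxKr Fx scaler0.
      by rewrite (evalp_yscale _ _ hg) expr0n eqn0Ngt d0 mul0r.
    rewrite /Z evalpB evalpX (E0 _ _ hA k0) expr0n eqn0Ngt L0 sub0r evalp_sum big1 ?oppr0 // => j _.
    by rewrite !evalpM (evalpX B) (E0 _ B h0k k0) (expr0n _ (L - j)%N) subn_eq0 leqNgt ltn_ord !mulr0.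
  rewrite -[RHS]EZ /Z evalpD evalpB !evalpX evalp_sub_graph; congr (_ + _).
  rewrite !evalp_sum -sumrN; apply: eq_bigr => j _.
  by rewrite !evalpM evalpN (evalpX A) (evalpX B) (evalpX (sub_graph F A)) (evalpX (sub_graph F B)) !evalp_sub_graph; ring.
exists h, f; split=> //; apply: dens => z Yz zO Fz.
have [t _ Ht] := scal _ _ _ h0k Yz zO Fz.
have := Hf _ (res_over (gr_resolution gr) Yz); rewrite evalpB evalpM => /eqP.
rewrite subr_eq0 => /eqP EA.
rewrite evalpB evalpM (Ht _ _ h0k) (Ht _ _ hA) -/B EA evalp_widen; ring.
Qed.
End Regular.

Section Separating.
Variable e : G -> nat.
Hypothesis He : forall w, selfint w = - (e w)%:Z.
Hypothesis eG : forall w, (\sum_(v : G) edges w v < e w)%N.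

Lemma separating_function u v : u != v -> exists (f : {mpoly K[n]}) (k l : nat),
  [/\ (k < l)%N, og u l (widen f), og v k (widen f) & ~ og v k.+1 (widen f)].
Proof.
move=> uv; have [s0 [s1 [h0 h1 n0 n1 s01]]] := ex_pencil gr.
have [j1 gen1] := genH gr h0 h1 s01; have [N0 HN0] := mid_of_deep nss gr.
have [h Hh] := choice _ (fun w => hilbert_exists gr w); have [d0 Hd] := choice _ Hh.
pose dg w := (\sum_(v : G) edges w v)%N; pose Delta := (\sum_(w : G) dg w)%N.
(* kappa exceeds what [curve_step] and [curve_pair] need at every w, plus the loss caused by the at
   most N0 + 1 extra copies of each curve in the divisors met below. *)
pose kappa := (\sum_(w : G) (h w * j1 + genus w) + N0.+1 * Delta).+1.
pose D w := (kappa * (Delta.+1 + (w == u)))%N.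
have dgD w : (dg w <= Delta)%N by rewrite /Delta (bigD1 w) //= leq_addr.
have edge w : (edges w u <= dg w)%N by rewrite /dg (bigD1 u) //= leq_addr.
have hg w : (h w * j1 + genus w + N0.+1 * Delta < kappa)%N.
  by rewrite /kappa ltnS leq_add2r (bigD1 w) //= leq_addr.
(* -D.E_w is at least kappa: the multiple of Z contributes at least kappa (Delta + 1), because e_w
   exceeds the number of edges at w, and the extra kappa E_u costs at most kappa Delta. *)
have sumD w : (\sum_(x : G) D x * edges w x + kappa <= e w * D w)%N.
  have -> : (\sum_(x : G) D x * edges w x = kappa * (Delta.+1 * dg w + edges w u))%N.
    rewrite /dg mulnDr mulnA big_distrr /= (bigD1 u) //= [in RHS](bigD1 u) //= addnAC.
    rewrite /D eqxx addn1 (eq_bigr (fun x => kappa * Delta.+1 * edges w x)%N) => [|x /negPf xu].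
      by nia.
    by rewrite xu addn0.
  rewrite /D; have := edge w; have := dgD w; have := eG w; rewrite -/(dg w).
  case: (eqVneq w u) => [->|wu] ew dw ed; first by rewrite edges_loopless; nia.
  rewrite addn0; have : (Delta.+1 * dg w + edges w u + 1 <= e w * Delta.+1)%N by nia.
  by move=> HH; rewrite mulnCA; nia.
have bound D' w : (forall x, D x <= D' x <= D x + N0.+1)%N ->
    (h w * j1 + genus w + \sum_(x : G) D' x * edges w x < 1 + e w * D' w)%N.
  move=> HD'; have : (\sum_(x : G) D' x * edges w x <= \sum_(x : G) D x * edges w x + N0.+1 * dg w)%N.
    rewrite /dg big_distrr -big_split leq_sum //= => x _.
    by rewrite -mulnDl leq_mul2r; have /andP[_ ->] := HD' x; rewrite orbT.
  have : (e w * D w <= e w * D' w)%N by rewrite leq_mul2l; have /andP[-> _] := HD' w; rewrite orbT.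
  have : (N0.+1 * dg w <= N0.+1 * Delta)%N by rewrite leq_mul2l dgD.
  by have := sumD w; have := hg w; lia.
(* The relation between a and b will be corrected by elements of M(D + E_v), which leave the order
   D_v along E_v unchanged. *)
pose D1 := addE D v.
have [|k1 Hk1] := @module_generation _ _ _ _ _ _ _ _ nss gr e h d0 He Hd s0 s1 h0 h1 n0 s01 j1 gen1 N0 HN0 D1.
  move=> D' HD' w; apply: bound => x; have := HD' x; rewrite /D1 /addE.
  by case: (x == v); rewrite ?addn0 ?addn1; lia.
have [|k [a [b [kk [ha Ma] [hb Mb] nMa [hab Mab]]]]] :=
    curve_pair nss gr (He v) (@Hd v) h0 h1 n0 s01 (D := D) (maxn k1 1).
  by apply: leq_ltn_trans (bound D v _); [lia|move=> x; lia].
have [k1k k0] : (k1 <= k)%N /\ (0 < k)%N by split; lia.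
pose S f := yhomog (k + k) f /\ exists a b, [/\ MH D1 k a, MH D1 k b
  & vanishes (f - (s0 ^+ k * a + s1 ^+ k * b)) Y].
have mul0M j (r x : R) : yhomog 0 r -> MH D1 j x -> MH D1 j (r * x).
  move=> hr [hx Mx]; split; last exact: (idealMl (M_ideal gr D1)).
  by rewrite -[j]add0n; apply: yhomogM.
have sM j := MH_subspace gr D1 j.
have hX (s : R) : yhomog 1 s -> yhomog k (s ^+ k).
  by move=> hs; rewrite -[X in yhomog X]muln1; apply: yhomogMn.
have [|||||||f Hf|q [hq qO HS]] := @nakayama_O _ _ _ O (k + k) (MH D1 (k + k)) S.
- by move=> f [].
- exact: (subspace0 (sM _)).
- by move=> f g; apply: (subspaceD (sM _)).
- by move=> r f; apply: mul0M.
- split; first exact: yhomog0.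
  exists 0, 0; split; [exact: (subspace0 (sM _))|exact: (subspace0 (sM _))|].
  by rewrite !mulr0 addr0 subr0; apply: (ideal0 (idealY Y)).
- move=> f g [hf [x [y [hx hy Hxy]]]] [hg' [x' [y' [hx' hy' Hxy']]]]; split; first exact: yhomogD.
  exists (x + x'), (y + y'); split; [exact: (subspaceD (sM _))|exact: (subspaceD (sM _))|].
  have -> : f + g - (s0 ^+ k * (x + x') + s1 ^+ k * (y + y')) =
    (f - (s0 ^+ k * x + s1 ^+ k * y)) + (g - (s0 ^+ k * x' + s1 ^+ k * y')) by ring.
  exact: (idealD (idealY Y)).
- move=> r f hr [hf [x [y [hx hy Hxy]]]]; split; first by rewrite -[(k + k)%N]add0n; apply: yhomogM.
  exists (r * x), (r * y); split; [exact: mul0M|exact: mul0M|].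
  have -> : r * f - (s0 ^+ k * (r * x) + s1 ^+ k * (r * y)) =
    r * (f - (s0 ^+ k * x + s1 ^+ k * y)) by ring.
  exact: (idealMl (idealY Y)).
- have [x [y [[hx Mx] [hy My] Hxy]]] := Hk1 k f k1k Hf.
  have hg' : yhomog (k + k) (f - (s0 ^+ k * x + s1 ^+ k * y)).
    apply: (subspaceB (yhomog_subspace _ _ _ (k + k)%N)); first by have [] := Hf.
    by apply: yhomogD; apply: yhomogM => //; apply: hX.
  have [F [HF Fv]] := midM_H hg' Hxy; exists F; split=> //; split.
    apply: (subspaceB (yhomog_subspace _ _ _ (k + k)%N)); first by have [] := Hf.
    apply: (subspace_sum _ (yhomog_subspace _ _ _ (k + k)%N)) => j _; have [hF _] := HF j.
    by rewrite mulrC -[(k + k)%N]add0n; apply: yhomogM => //; apply: xdiff_hom.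
  by exists x, y; split; [split|split|rewrite addrAC].
have [_ [a' [b' [[ha' Ma'] [hb' Mb'] Hab']]]] := HS _ (conj hab Mab).
have hq0 (x : R) j : yhomog j x -> yhomog j (q * x) by move=> hx; rewrite -[j]add0n; apply: yhomogM.
(* After the correction the relation s1^k P = s0^k Q holds on Y itself; the factor q from Nakayama
   is nonzero on the fibre over O. *)
pose P := q * a - b'; pose Q := q * b + a'.
have hP : yhomog k P by apply: (subspaceB (yhomog_subspace _ _ _ k)) => //; apply: hq0.
have hQ : yhomog k Q by apply: yhomogD => //; apply: hq0.
have HPQ : vanishes (s1 ^+ k * P - s0 ^+ k * Q) Y.
  have -> : s1 ^+ k * P - s0 ^+ k * Q =
    q * (s1 ^+ k * a - s0 ^+ k * b) - (s0 ^+ k * a' + s1 ^+ k * b') by rewrite /P /Q; ring.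
  exact: Hab'.
have nE (x : R) w : (forall z, lsubmx z = O -> evalp x z != 0) -> ~ vanishes x (E w).
  move=> Hx xE; have [z Ez] := E_nonempty gr w.
  by have := Hx z (E_O gr Ez); rewrite xE ?eqxx.
have s0Y : ~ vanishes s0 Y by move=> s0Y; apply: (n0 v); apply: (vanY_E gr).
have [r [f [hr rO Hf]]] := regular_function h0 h1 k0 s0Y s01 hP hQ HPQ.
have PD w : og w (D w) P.
  apply: (idealB (og_ideal gr w _)); first by apply: (idealMl (og_ideal gr w _)); apply: M_og.
  by apply: (M_og w); apply: addE_M Mb'.
have nP : ~ og v (D v).+1 P.
  move=> OP; apply: nMa; split=> //; apply: M_addE => //; first by exists k.
  apply: (og_cancel (nE q v qO)); rewrite -[q * a](subrK b').
  by apply: (idealD (og_ideal gr v _)) => //; apply: addE_og Mb'.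
have fP w l : og w l (widen f) <-> og w l P.
  split=> Ol.
    apply: (og_cancel (nE r w rO)); apply: (@og_Y_congr _ _ _ _ _ _ _ _ gr _ _ (s0 ^+ k * widen f)) => //.
    exact: (idealMl (og_ideal gr w _)).
  apply: (og_cancel (x := s0 ^+ k)); first by move=> /(primeX (primeE gr w)); apply: n0.
  apply: (@og_Y_congr _ _ _ _ _ _ _ _ gr _ _ (r * P)); last exact: (idealMl (og_ideal gr w _)).
  by rewrite -opprB; apply: (idealN (idealY Y)).
exists f, (D v), (D u); split; [|exact/fP|exact/fP|by move/fP].
by rewrite /D eqxx eq_sym (negPf uv) ltn_mul2l; lia.
Qed.
End Separating.
End Setup.

(** * Lifting arcs *)

Section Composition.
Variables (K L : fieldType) (iota : {rmorphism K -> L}) (N N' : nat).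
Local Notation sc := (subst_coef iota).

Definition compose (g : 'I_N -> {mpoly K[N']}) (f : {mpoly K[N]}) : {mpoly K[N']} :=
  mmap (@mpolyC N' K) g f.

Lemma sc_compose g f b k : sc (compose g f) b k = sc f (fun i l => sc (g i) b l) k.
Proof.
rewrite /compose; move: f k; apply: mpoly_ring_ind => [c|i|p q Hp Hq|p q Hp Hq] k.
- by rewrite mmapC !scC.
- by rewrite mmapX mmap1U scX.
- by rewrite mmapD !scD Hp Hq.
- by rewrite mmap_mul !scM; apply: eq_bigr => j _; rewrite Hp Hq.
Qed.
End Composition.

Lemma sc_ext (K L : fieldType) (iota : {rmorphism K -> L}) N (f : {mpoly K[N]}) b b' k :
  (forall i l, b i l = b' i l) -> subst_coef iota f b k = subst_coef iota f b' k.
Proof. by move=> H; apply: sc_agree => i l _. Qed.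

Section Series.
Variable L : fieldType.
Implicit Types (p q : nat -> L).

Definition smul p q k : L := \sum_(i < k.+1) p i * q (k - i)%N.

Lemma series_div p q : q 0%N != 0 -> exists c, forall k, p k = smul q c k.
Proof.
move=> q0; pose next k (c : nat -> L) l :=
  if l == k then (p k - \sum_(i < k) q i.+1 * c (k - i.+1)%N) / q 0%N else c l.
pose g := fix g k := if k is k'.+1 then next k' (g k') else fun _ => 0.
have gE k l : (l < k)%N -> g k l = g l.+1 l.
  elim: k => // k IH; rewrite ltnS leq_eqVlt => /orP[/eqP -> //|lk].
  by rewrite /= /next ltn_eqF // IH //= /next eqxx.
exists (fun k => g k.+1 k) => k; rewrite /smul big_ord_recl subn0 [g k.+1 k]/= /next eqxx.
rewrite mulrC divfK // -[LHS](subrK (\sum_(i < k) q i.+1 * g k (k - i.+1)%N)); congr (_ + _).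
apply: eq_bigr => i _; congr (_ * _); apply: gE; have := ltn_ord i; rewrite /bump /=; lia.
Qed.
End Series.

Section Scaling.
Variables (K : closedFieldType) (L : fieldType) (iota : {rmorphism K -> L}) (n m : nat).
Local Notation N := (n + m.+1)%N.
Local Notation R := {mpoly K[N]}.
Local Notation sc := (subst_coef iota).
Variables (lam : nat -> L) (b b' : 'I_N -> nat -> L).
Hypothesis Hx : forall i k, b (lshift m.+1 i) k = b' (lshift m.+1 i) k.
Hypothesis Hy : forall j k, b (rshift n j) k = smul lam (b' (rshift n j)) k.

(** The factor lam becomes the value of an extra variable, so that f(x, lam y) = lam^d f(x, y) is a
    polynomial identity before any series is substituted. *)
Let bl : 'I_(N.+1) -> nat -> L := fun i => if unlift ord0 i is Some i' then b' i' else lam.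
Let base (i : 'I_N) : {mpoly K[N.+1]} := 'X_(lift ord0 i).
Let scaled (i : 'I_N) : {mpoly K[N.+1]} :=
  match split i with inl _ => base i | inr _ => 'X_ord0 * base i end.

Let compose_scaled d (f : R) : yhomog d f -> compose scaled f = 'X_ord0 ^+ d * compose base f.
Proof.
move=> /allP Hf; rewrite /compose /mmap mulr_sumr; apply: eq_big_seq => mu /Hf /eqP Emu.
rewrite mulrCA; congr (_ * _); rewrite /mmap1 !big_split_ord /= mulrCA; congr (_ * _).
  by apply: eq_bigr => i _; rewrite /scaled; case: splitP => [//|j /= E]; have := ltn_ord i; lia.
rewrite -Emu -prodrXr -big_split; apply: eq_bigr => j _ /=; rewrite -exprMn; congr (_ ^+ _).
by rewrite /scaled; case: splitP => [i /= E|//]; have := ltn_ord i; lia.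
Qed.

Let sc_base f k : sc (compose base f) bl k = sc f b' k.
Proof. by rewrite sc_compose; apply: sc_ext => i l; rewrite scX /bl liftK. Qed.

Lemma sc_scale d (f : R) k : yhomog d f -> sc f b k = sc ('X_ord0 ^+ d * compose base f) bl k.
Proof.
move=> Hf; rewrite -(compose_scaled Hf) sc_compose; apply: sc_ext => i l.
have X0 l' : sc 'X_ord0 bl l' = lam l' by rewrite scX /bl unlift_none.
have XL i' l' : sc (base i') bl l' = b' i' l' by rewrite scX /bl liftK.
rewrite /scaled; case: splitP => j E.
  by rewrite XL; have -> : i = lshift m.+1 j by apply/val_inj.
have -> : i = rshift n j by apply/val_inj.
by rewrite scM Hy; apply: eq_bigr => t _; rewrite X0 XL.
Qed.

Lemma sc_scale_zero d (f : R) : yhomog d f -> (exists p, lam p != 0) ->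
  (forall k, sc f b k = 0) -> forall k, sc f b' k = 0.
Proof.
move=> Hf [p lp] fb; have [_ _ pr] := sc_ideal iota bl.
have [|Hl|Hb] := pr ('X_ord0 ^+ d) (compose base f); last by move=> k; rewrite -sc_base.
  by move=> k; rewrite -(sc_scale _ Hf).
have := primeX (sc_ideal iota bl) Hl; move/(_ p); rewrite scX /bl unlift_none => l0.
by rewrite l0 eqxx in lp.
Qed.

Lemma sc_scale_zero0 d (f : R) : yhomog d f -> lam 0%N != 0 -> sc f b 0%N = 0 -> sc f b' 0%N = 0.
Proof.
move=> Hf l0; rewrite (sc_scale _ Hf) scM big_ord1 subn0 sc_base => /eqP.
rewrite mulf_eq0 => /orP[|/eqP //].
have -> : sc ('X_ord0 ^+ d) bl 0%N = lam 0%N ^+ d.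
  elim: d {Hf} => [|d IH]; first by rewrite expr0 -mpolyC1 scC rmorph1.
  by rewrite !exprS scM big_ord1 subn0 IH scX /bl unlift_none.
by rewrite expf_eq0 (negPf l0) andbF.
Qed.
End Scaling.

Section Normalization.
Variables (K : closedFieldType) (L : fieldType) (iota : {rmorphism K -> L}) (n m : nat).
Local Notation N := (n + m.+1)%N.
Local Notation R := {mpoly K[N]}.
Local Notation sc := (subst_coef iota).

(** Dividing y by the unit series y_j(t) moves the lifting into the chart y_j = 1, where the results
    on affine arcs apply. *)
Lemma normalize_series (b : 'I_N -> nat -> L) j : b (rshift n j) 0%N != 0 ->
  exists b' : 'I_N -> nat -> L, [/\ forall i k, b' (lshift m.+1 i) k = b (lshift m.+1 i) k,
    forall Z : 'rV[K]_N -> Prop, cone Z -> (forall d (f : R), ideal_deg Z d f -> forall k, sc f b k = 0) ->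
      forall f : R, vanishes f (chart Z j) -> forall k, sc f b' k = 0
  & forall Z : 'rV[K]_N -> Prop, cone Z -> (forall d (f : R), ideal_deg Z d f -> sc f b 0%N = 0) ->
      forall f : R, vanishes f (chart Z j) -> sc f b' 0%N = 0].
Proof.
move=> bj.
have [c Hc] := choice _ (fun l => series_div (b (rshift n l)) bj).
pose b' (i : 'I_N) := match split i with inl a => b (lshift m.+1 a) | inr l => c l end.
have b'x i k : b' (lshift m.+1 i) k = b (lshift m.+1 i) k.
  rewrite /b'; case: splitP => [a /= E|l /= E]; last by have := ltn_ord i; lia.
  by have -> : a = i by apply/val_inj.
have b'y l k : b' (rshift n l) k = c l k.
  rewrite /b'; case: splitP => [a /= E|l' /= E]; first by have := ltn_ord a; lia.
  by have -> : l' = l by apply/val_inj/esym/(addnI E).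
have Hy l k : b (rshift n l) k = smul (b (rshift n j)) (b' (rshift n l)) k.
  by rewrite Hc; apply: eq_bigr => i _; rewrite b'y.
have Hx i k : b (lshift m.+1 i) k = b' (lshift m.+1 i) k by rewrite b'x.
have b'j k : sc ('X_(rshift n j) - 1) b' k = 0.
  have cj0 : c j 0%N = 1.
    have := Hc j 0%N; rewrite /smul big_ord1 subnn => /eqP; rewrite -{1}[b _ _]mulr1.
    by rewrite (inj_eq (mulfI bj)) => /eqP <-.
  rewrite scB scX b'y -mpolyC1 scC; elim/ltn_ind: k => -[_|k IH]; first by rewrite cj0 rmorph1 subrr.
  have := Hc j k.+1; rewrite /smul big_ord_recl subn0 big_ord_recr /= subnn cj0 mulr1.
  rewrite big1 ?add0r => [/eqP|i _].
    rewrite -{1}[b (rshift n j) k.+1]add0r (inj_eq (addIr _)) eq_sym mulf_eq0 (negPf bj) /= => /eqP ->.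
    by rewrite subr0.
  have ik := ltn_ord i; rewrite /bump /= add1n.
  have := IH (k.+1 - i.+1)%N; rewrite gtn_eqF; last lia.
  by rewrite subr0 => ->; rewrite ?mulr0 //; lia.
have [iP _ _] := sc_ideal iota b'.
(* If two polynomials agree on y_j = 1, a power of their difference is a multiple of y_j - 1, which
   the series kills. *)
have hz (f F : R) : (forall z, ycoord j z = 1 -> evalp F z = evalp f z) -> forall k, sc F b' k = sc f b' k.
  move=> EF k; apply/eqP; rewrite -subr_eq0 -scB; apply/eqP; move: k.
  pose J (g : R) := exists h, g = h * ('X_(rshift n j) - 1).
  have iJ : ideal J.
    split=> [|x y [h ->] [h' ->]|r x [h ->]]; first by exists 0; rewrite mul0r.
      by exists (h + h'); rewrite mulrDl.
    by exists (r * h); rewrite mulrA.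
  have [|p [h Eh]] := @nullstellensatz K N J (F - f) iJ; last first.
    apply: (primeX (sc_ideal iota b') (k := p)) => k; rewrite Eh.
    by have := idealMl iP h b'j; apply.
  move=> v Hv; pose z : 'rV[K]_N := \row_i v i.
  have Ev (g : R) : g.@[v] = evalp g z by apply: meval_eq => i; rewrite mxE.
  have zj : ycoord j z = 1.
    have := Hv ('X_(rshift n j) - 1) (ex_intro _ 1 (esym (mul1r _))).
    by rewrite Ev evalpB evalp1 evalp_yvar => /eqP; rewrite subr_eq0 => /eqP.
  by rewrite Ev evalpB EF ?subrr.
have homgZ (Z : 'rV[K]_N -> Prop) (f : R) : vanishes f (chart Z j) -> cone Z ->
   exists d (F : R), ideal_deg Z d F /\ forall k, sc F b' k = sc f b' k.
  move=> fZ coZ; have [d0 Hd0] := homogenize j f; have [F0 hF0 EF0] := Hd0 d0 (leqnn _).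
  exists (d0 + 1)%N, (F0 * 'X_(rshift n j)); split.
    split; first by apply: yhomogM => //; apply: yhomogy.
    move=> z Zz; rewrite evalpM evalp_yvar; case: (eqVneq (ycoord j z) 0) => [->|zj].
      by rewrite mulr0.
    by rewrite EF0 // fZ ?mulr0 ?mul0r //; apply: chart_normalize.
  apply: hz => z zj; rewrite evalpM evalp_yvar zj mulr1 EF0 ?zj ?oner_neq0 //.
  by rewrite expr1n mul1r normalize1.
exists b'; split=> // Z coZ HZ f fZ.
  move=> k; have [d [F [[hF FZ] EF]]] := homgZ Z f fZ coZ; rewrite -EF.
  apply: (sc_scale_zero Hx Hy hF) => //; first by exists 0%N.
  by apply: (HZ d).
have [d [F [[hF FZ] EF]]] := homgZ Z f fZ coZ; rewrite -EF.
by apply: (sc_scale_zero0 Hx Hy hF) => //; apply: (HZ d).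
Qed.
End Normalization.

Section Charts.
Variables (K : closedFieldType) (n m : nat).
Local Notation N := (n + m.+1)%N.
Local Notation R := {mpoly K[N]}.
Local Notation scK := (subst_coef (@idK K)).
Implicit Types (f g : R) (z : 'rV[K]_N).

Definition xpart (L : Type) (b : 'I_N -> nat -> L) : 'I_n -> nat -> L := fun i => b (lshift m.+1 i).

Lemma xjet_widen M M' (P : {mpoly K[n * M]}) : (M <= M')%N ->
  exists P' : {mpoly K[N * M']}, forall (L : fieldType) (iota : {rmorphism K -> L}) b,
    mmap iota (jet b (M := M')) P' = mmap iota (jet (xpart b) (M := M)) P.
Proof.
move=> MM; move: P; apply: mpoly_ring_ind => [c|l|f g [f' Hf] [g' Hg]|f g [f' Hf] [g' Hg]].
- by exists c%:MP => L iota b; rewrite !mmapC.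
- case/mxvec_indexP: l => i k; exists 'X_(mxvec_index (lshift m.+1 i) (widen_ord MM k)) => L iota b.
  by rewrite !mmapX !mmap1U !jetE.
- by exists (f' + g') => L iota b; rewrite !mmapD Hf Hg.
- by exists (f' * g') => L iota b; rewrite !mmap_mul Hf Hg.
Qed.

Lemma sc0_prime (L : fieldType) (iota : {rmorphism K -> L}) (b : 'I_N -> nat -> L) :
  prime_ideal (fun f : R => subst_coef iota f b 0%N = 0).
Proof.
split=> [|/eqP|f g]; first split.
- by rewrite -mpolyC0 scC rmorph0.
- by move=> f g Hf Hg; rewrite scD Hf Hg addr0.
- by move=> f g Hg; rewrite scM big_ord1 Hg mulr0.
- by rewrite -mpolyC1 scC rmorph1 oner_eq0.
by rewrite scM big_ord1 => /eqP; rewrite mulf_eq0 => /orP[]/eqP; [left|right].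
Qed.

Definition const_arc z : 'I_N -> nat -> K := fun i k => if k is 0 then z 0 i else 0.
Lemma start_const z : start (const_arc z) = z. Proof. by apply/rowP => i; rewrite mxE. Qed.
Lemma const_arc_in (Z : 'rV[K]_N -> Prop) z : Z z -> arc_in Z (const_arc z).
Proof.
move=> Zz f fZ [|k]; last by apply: sc_const => // i [].
by rewrite sc_eval -/(start (const_arc z)) start_const; apply: fZ.
Qed.

Lemma xjet_agree M (P : {mpoly K[n * M]}) (b b' : 'I_N -> nat -> K) :
  (forall i k, b' (lshift m.+1 i) k = b (lshift m.+1 i) k) ->
  mmap (@idK K) (jet (xpart b') (M := M)) P = mmap (@idK K) (jet (xpart b) (M := M)) P.
Proof. by move=> Hx; apply: jet_agree => i l _; apply: Hx. Qed.

Section Pair.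
Variables (Y W : 'rV[K]_N -> Prop).

Record lift (L : fieldType) (iota : {rmorphism K -> L}) (b : 'I_N -> nat -> L) : Prop := Lift {
  lift_y : exists j, b (rshift n j) 0%N != 0;
  lift_Y : forall d f, ideal_deg Y d f -> forall k, subst_coef iota f b k = 0;
  lift_E : forall d f, ideal_deg W d f -> subst_coef iota f b 0%N = 0
}.

Definition Karc (b : 'I_N -> nat -> K) : Prop :=
  exists j, arc_in (chart Y j) b /\ chart W j (start b).

Lemma Karc_lift b : Karc b -> lift (@idK K) b.
Proof.
move=> [j [bY [bE bj]]]; split=> [|d f [_ fY] k|d f [_ fE]].
- by exists j; move: bj; rewrite !mxE => ->; apply: oner_neq0.
- by apply: bY; apply: vanishes_chart.
- by rewrite sc_eval; apply: fE.
Qed.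

Hypotheses (cY : closed_for (@proj_closure K n m) Y) (cW : closed_for (@proj_closure K n m) W)
  (pW : prime_ideal (fun f : R => vanishes f W)) (WY : psub W Y) (smY : smooth_of_dim 2 Y).

Let coneY : cone Y. Proof. exact: proj_closed_cone cY. Qed.
Let coneW : cone W. Proof. exact: proj_closed_cone cW. Qed.

Lemma chart_primeW j z : chart W j z -> prime_ideal (fun f : R => vanishes f (chart W j)).
Proof. exact: (chart_prime coneW pW). Qed.
Lemma chart_sub j : psub (chart W j) (chart Y j).
Proof. by move=> z [Wz zj]; split=> //; apply: WY. Qed.
Lemma chart_smooth j z : chart W j z -> smooth_at (chart Y j) 2 z.
Proof. by move=> /chart_sub; apply: smY. Qed.
Lemma chart_closed j z : (forall f, vanishes f (chart W j) -> evalp f z = 0) -> chart W j z.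
Proof.
move=> Hz; have zj : ycoord j z = 1.
  have := Hz ('X_(rshift n j) - 1); rewrite evalpB evalp1 evalp_yvar => H1.
  apply/eqP; rewrite -subr_eq0; apply/eqP; apply: H1 => q [_].
  by rewrite evalpB evalp1 evalp_yvar ycoord_rsub => ->; rewrite subrr.
split; last by rewrite ycoord_rsub.
apply: (proj_closedP cW).
  by apply/eqP => z0; move: zj; rewrite -ycoord_rsub z0 mxE => /esym/eqP; rewrite oner_eq0.
by move=> d f _ fE; apply: Hz; apply: vanishes_chart.
Qed.

Lemma chart_generic j z f : chart W j z -> hom f -> ~ vanishes f W ->
  exists2 z', chart W j z' & evalp f z' != 0.
Proof.
move=> [Wz zj] [d hf] nf; have nyj : ~ vanishes ('X_(rshift n j) : R) W.
  by apply: (evalp_neq0_vanishes Wz); rewrite evalp_yvar -ycoord_rsub zj oner_neq0.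
have /not_vanishes[z1 Wz1] := primeMn pW nf nyj.
rewrite evalpM evalp_yvar mulf_eq0 negb_or => /andP[fz1 yz1].
exists (normalize j z1); first exact: (chart_normalize coneW).
by rewrite /normalize (evalp_yscale _ _ hf) mulf_neq0 // expf_neq0 // invr_eq0.
Qed.

Lemma Karc_of_series j (b : 'I_N -> nat -> K) : lift (@idK K) b -> b (rshift n j) 0%N != 0 ->
  exists b', [/\ arc_in (chart Y j) b', chart W j (start b')
    & forall i k, b' (lshift m.+1 i) k = b (lshift m.+1 i) k].
Proof.
move=> Hb bj; have [b' [Hx HY HE]] := normalize_series (@idK K) bj; exists b'; split=> //.
  by move=> f fY k; apply: (HY Y) fY k; [exact: coneY|exact: lift_Y Hb].
apply: chart_closed => f fE; rewrite -sc_eval; apply: (HE W) fE; first exact: coneW.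
exact: lift_E Hb.
Qed.

Lemma lift_descent (L : fieldType) (iota : {rmorphism K -> L}) b M (P : {mpoly K[n * M]}) :
  lift iota b -> mmap iota (jet (xpart b) (M := M)) P != 0 ->
  exists2 b', Karc b' & mmap (@idK K) (jet (xpart b') (M := M)) P != 0.
Proof.
move=> Hb Pb; have [j bj] := lift_y Hb; have [P' HP'] := xjet_widen P (leqnSn M).
have [b' [Hx HY HE]] := normalize_series iota bj.
have [|||c [cYc cE Pc]] := @arc_descent K N (chart Y j) (chart W j) 2 M P' L iota b'
  (@chart_closed j) (@chart_sub j) (@chart_smooth j).
- by move=> f fY k; apply: (HY Y) fY k; [exact: coneY|exact: lift_Y Hb].
- move=> f fE; apply: (HE W) fE; [exact: coneW|exact: lift_E Hb].
- by rewrite HP' (jet_agree iota (b' := xpart b)) // => i l _; apply: Hx.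
by exists c; [exists j|rewrite -HP'].
Qed.

Lemma Karc_move M (P : {mpoly K[n * M]}) f b : Karc b -> mmap (@idK K) (jet (xpart b) (M := M)) P != 0 ->
  hom f -> ~ vanishes f W ->
  exists b', [/\ Karc b', mmap (@idK K) (jet (xpart b') (M := M)) P != 0 & evalp f (start b') != 0].
Proof.
move=> [j [bY bW]] Pb hf nf; have [P' HP'] := xjet_widen P (leqnn M).
have [z Wz fz] := chart_generic bW hf nf.
have [|b' [bY' bW' Pb' fb']] := arc_move (chart_primeW bW) (@chart_sub j) (@chart_smooth j) bY bW
  _ (evalp_neq0_vanishes Wz fz) (P := P'); first by rewrite HP'.
by exists b'; split=> //; [exists j|rewrite -HP'].
Qed.

(** The two arcs may start in different charts: the first is moved until its start lies in the chart
    of the second, and then renormalized there. *)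
Lemma Karc_irreducible M (P Q : {mpoly K[n * M]}) b1 b2 : Karc b1 -> Karc b2 ->
  mmap (@idK K) (jet (xpart b1) (M := M)) P != 0 -> mmap (@idK K) (jet (xpart b2) (M := M)) Q != 0 ->
  exists b, [/\ Karc b, mmap (@idK K) (jet (xpart b) (M := M)) P != 0
    & mmap (@idK K) (jet (xpart b) (M := M)) Q != 0].
Proof.
move=> K1 [j2 [Y2 E2]] Pb1 Qb2.
have [P' HP'] := xjet_widen P (leqnn M); have [Q' HQ'] := xjet_widen Q (leqnn M).
have ny2 : ~ vanishes ('X_(rshift n j2) : R) W.
  by case: E2 => Wz zj; apply: (evalp_neq0_vanishes Wz); rewrite evalp_yvar -ycoord_rsub zj oner_neq0.
have [b3 [K3 P3 y3]] := Karc_move K1 Pb1 (ex_intro _ 1%N (yhomogy K n j2)) ny2.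
have [|b4 [Y4 E4 x4]] := @Karc_of_series j2 b3 (Karc_lift K3).
  by move: y3; rewrite evalpXU mxE.
have [||b [bY bE Pb Qb]] := arcs_irreducible (chart_primeW E2) (@chart_sub j2) (@chart_smooth j2)
  Y4 E4 _ Y2 E2 _ (P := P') (Q := Q').
- by rewrite HP' (xjet_agree _ x4).
- by rewrite HQ'.
by exists b; rewrite -HP' -HQ'; split=> //; exists j2.
Qed.
End Pair.
End Charts.

Section Setup.
Variables (G : weighted_graph) (K : closedFieldType) (n m : nat) (X : 'rV[K]_n -> Prop)
  (O : 'rV[K]_n) (Y : 'rV[K]_(n + m.+1) -> Prop) (E : G -> 'rV[K]_(n + m.+1) -> Prop).
Hypotheses (nss : normal_surface_singularity X O) (gr : good_resolution_with_graph X O Y E).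
Local Notation N := (n + m.+1)%N.
Local Notation R := {mpoly K[N]}.
Local Notation og := (og gr).
Local Notation M := (M gr).
Local Notation MH := (MH gr).
Local Notation H j := (fun f : R => is_true (yhomog j f)).
Local Notation tau := (tau gr).
Implicit Types (f g : R) (u v w : G) (z : 'rV[K]_N) (D : G -> nat).
Local Notation scK := (subst_coef (@idK K)).

Section Lift.
Variables (L : fieldType) (iota : {rmorphism K -> L}) (w : G) (b : 'I_N -> nat -> L).
Hypothesis Hb : lift Y (E w) iota b.
Local Notation sc := (subst_coef iota).

Lemma lift_vanY f : vanishes f Y -> forall k, sc f b k = 0.
Proof.
move=> fY; have [iP _ _] := sc_ideal iota b; apply: (hcomp_out iP) => d.
apply: (lift_Y Hb) (d) _ _; split; [exact: hcompP|exact: (vanishes_hcomp _ (coneY gr))].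
Qed.

Lemma lift_vanE f : vanishes f (E w) -> sc f b 0%N = 0.
Proof.
move=> fE; have [iP _ _] := sc0_prime iota b; apply: (hcomp_out iP) => d.
apply: (lift_E Hb) (d) _ _; split; [exact: hcompP|exact: (vanishes_hcomp _ (coneE gr (w := w)))].
Qed.

Lemma lift_pow f l : vanishes f (E w) -> forall k, (k < l)%N -> sc (f ^+ l) b k = 0.
Proof.
move=> /lift_vanE f0; elim: l => // l IH k kl; rewrite exprS.
by apply: (@scM_low _ _ _ _ _ _ _ 1 l) => // -[].
Qed.

(** Local equations exist near K-points, while b may be defined over a larger field. The multipliers
    a for which a g vanishes to order l along b form an ideal without zeros at points with y
    nonzero; so it contains a power of some y_j that is a unit along b. *)
Lemma lift_og l g : hom g -> og w l g -> forall k, (k < l)%N -> sc g b k = 0.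
Proof.
move=> hg Og; pose J a := forall k, (k < l)%N -> sc (a * g) b k = 0.
have iJ : ideal J.
  split=> [k _|x y Hx Hy k kl|r x Hx k kl].
  - by rewrite mul0r -mpolyC0 scC rmorph0 if_same.
  - by rewrite mulrDl scD Hx // Hy // addr0.
  - by rewrite -mulrA scM big1 // => i _; rewrite Hx ?mulr0 //; lia.
have [|p Hp] := proj_nullstellensatz iJ.
  move=> z Hz; apply/eqP/negPn/negP => z0; case: (classic (E w z)) => [Ez|].
    have [t Ht] := ex_local_eq gr Ez.
    have [a [c [_ _ az Hac]]] := local_gen_og nss Ez Ht hg Og.
    case/negP: az; apply/eqP/Hz => k kl.
    rewrite -[a * g](subrK (c * t ^+ l)) scD lift_vanY // add0r.
    by apply: (@scM_low _ _ _ _ _ _ _ 0 l) => // ; apply: lift_pow; apply: leq_van Ht.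
  move=> /(proj_separate (clE gr w) z0)[d [f [_ fE fz]]].
  have /Hz/eqP : J (f ^+ l).
    by move=> k kl; apply: (@scM_low _ _ _ _ _ _ _ l 0); rewrite ?addn0 //; apply: lift_pow.
  by rewrite evalpX expf_eq0 (negPf fz) andbF.
have [j yj] := lift_y Hb; have yp : sc ('X_(rshift n j) ^+ p) b 0%N != 0.
  by apply/eqP => /(primeX (sc0_prime iota b)); rewrite scX => /eqP; apply/negP.
move=> k kl; apply: NNPP => gk.
have [|q gq minq] := @sc_min _ _ iota _ g b; first by move=> H0; apply: gk.
have ql : (q < l)%N by rewrite (leq_ltn_trans _ kl) // leqNgt; apply/negP => /minq.
have := Hp j q ql; rewrite (@scM_lead _ _ _ _ _ _ _ 0 q) // => /eqP.
by rewrite mulf_eq0 (negPf yp) (negPf gq).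
Qed.
End Lift.

(** On Y one has a g = c tau^k with c not vanishing on E_w. Irreducibility of the arcs gives one
    along which tau has order one and c is nonzero at the start. *)
Lemma ex_Karc_order w k g : hom g -> og w k g -> ~ og w k.+1 g -> exists2 b, Karc Y (E w) b & scK g b k != 0.
Proof.
move=> hg Og nOg; have [a0 [c0 [na0 Hac0]]] := Og.
have [a [c [ha [dc hc] na Hac]]] :=
  hom_cofactor gr (vanishes_ideal (E w)) hg (homX k (tau_hom gr w)) na0 Hac0.
have nc : ~ vanishes c (E w).
  move=> cE; apply: nOg; apply: (og_cancel na).
  apply: (@og_Y_congr _ _ _ _ _ _ _ _ gr _ _ (c * tau w ^+ k)).
    by rewrite -opprB; apply: (idealN (idealY Y)).
  rewrite -add1n; apply: ogM; first exact/(og1P gr).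
  by apply: og_vanX; apply: tau_E.
have [z0 Ez0 Hz0] := tauP gr w; have [j [b1 [b1Y b1E _ tb1]]] := leq_arc Hz0.
have nyj : ~ vanishes ('X_(rshift n j)) (E w).
  have [Es sj] := b1E; apply: (evalp_neq0_vanishes Es).
  by rewrite evalp_yvar -ycoord_rsub sj oner_neq0.
have /not_vanishes[z1 Ez1] := notEM gr nc nyj.
rewrite evalpM evalp_yvar mulf_eq0 negb_or => /andP[cz1 yz1].
have z1E := chart_normalize (coneE gr (w := w)) Ez1 yz1.
have EY := @E_Y _ _ _ _ _ _ _ _ gr w; have smY := res_smooth (gr_resolution gr).
have [P HP] := coef_poly_universal (tau w) (ltnSn 1).
have [Q HQ] := coef_poly_universal c (ltn0Sn 1).
have [|||b [bY bE Pb Qb]] := @arcs_irreducible K N (chart Y j) (chart (E w) j) 2 2 P Q b1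
  (const_arc (normalize j z1)) (chart_primeW (clE gr w) (primeE gr w) z1E) (chart_sub EY (j := j)) (@chart_smooth _ _ _ _ _ EY smY j)
  b1Y b1E _ (const_arc_in (chart_sub EY z1E)) _ _.
- by rewrite HP.
- by rewrite start_const.
- rewrite HQ sc_eval -/(start _) start_const /normalize (evalp_yscale _ _ hc) mulf_neq0 //.
  by rewrite expf_neq0 // invr_eq0.
exists b; first by exists j.
rewrite HP in Pb; rewrite HQ in Qb.
have Hb : Karc Y (E w) b by exists j.
have lb := Karc_lift Hb.
have gl := lift_og lb hg Og.
have t0 : scK (tau w) b 0%N = 0 by apply: (lift_vanE lb); apply: tau_E.
have tk l : scK (tau w ^+ l) b l = scK (tau w) b 1%N ^+ l.
  elim: l => [|l IH]; first by rewrite !expr0 -mpolyC1 scC eqxx rmorph1.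
  rewrite !exprS -[l.+1]add1n (@scM_lead _ _ _ _ _ _ _ 1 l) ?IH //; first by case.
  by apply: (lift_pow lb); apply: tau_E.
have : scK (a * g) b k != 0.
  rewrite -[a * g](subrK (c * tau w ^+ k)) scD (lift_vanY lb) // add0r.
  rewrite -{2}[k]add0n (@scM_lead _ _ _ _ _ _ _ 0 k) //.
    by rewrite tk mulf_neq0 // expf_neq0.
  by apply: (lift_pow lb); apply: tau_E.
rewrite -{1}[k]add0n (@scM_lead _ _ _ _ _ _ _ 0 k) //.
by apply: contraNneq => ->; rewrite mulr0.
Qed.
End Setup.

(** * K-valued arcs as points of N_E, and the obstruction to arrows *)

Section Setup.
Variables (G : weighted_graph) (K : closedFieldType) (n m : nat) (X : 'rV[K]_n -> Prop)
  (O : 'rV[K]_n) (Y : 'rV[K]_(n + m.+1) -> Prop) (E : G -> 'rV[K]_(n + m.+1) -> Prop).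
Hypotheses (nss : normal_surface_singularity X O) (gr : good_resolution_with_graph X O Y E).
Local Notation N := (n + m.+1)%N.
Local Notation R := {mpoly K[N]}.
Local Notation og := (og gr).
Local Notation M := (M gr).
Local Notation MH := (MH gr).
Local Notation H j := (fun f : R => is_true (yhomog j f)).
Local Notation tau := (tau gr).
Implicit Types (f g : R) (u v w : G) (z : 'rV[K]_N) (D : G -> nat).
Local Notation scK := (subst_coef (@idK K)).
Local Notation through w := (arcs_through X O Y (E w)).

Lemma sc_widen (L : fieldType) (iota : {rmorphism K -> L}) (f : {mpoly K[n]}) (b : 'I_N -> nat -> L) k :
  subst_coef iota (widen m f) b k = subst_coef iota f (xpart b) k.
Proof. by rewrite [widen m f]/(compose _ f) sc_compose; apply: sc_ext => i l; rewrite scX. Qed.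

Lemma widen_hom (f : {mpoly K[n]}) : yhomog 0 (widen m f).
Proof.
apply: (@mpoly_ring_ind K n (fun f : {mpoly K[n]} => is_true (yhomog 0 (widen m f)))) => [c|i|p q Hp Hq|p q Hp Hq]; rewrite /widen.
- by rewrite mmapC; apply: yhomogC.
- by rewrite mmapX mmap1U; apply: yhomogx.
- by rewrite mmapD; apply: yhomogD.
- by rewrite mmap_mul -[0%N]addn0; apply: yhomogM.
Qed.

Lemma widen_Y (f : {mpoly K[n]}) : vanishes f X -> vanishes (widen m f) Y.
Proof. by move=> fX z Yz; rewrite evalp_widen; apply: fX; apply: (res_over (gr_resolution gr)). Qed.

Lemma sc_xdiff (L : fieldType) (iota : {rmorphism K -> L}) (b : 'I_N -> nat -> L) t k :
  subst_coef iota (xdiff m O t) b k = b (lshift m.+1 t) k - (if k == 0%N then iota (O 0 t) else 0).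
Proof. by rewrite /xdiff scB scX scC. Qed.

Lemma lift_center (L : fieldType) (iota : {rmorphism K -> L}) w (b : 'I_N -> nat -> L) i :
  lift Y (E w) iota b -> b (lshift m.+1 i) 0%N = iota (O 0 i).
Proof.
move=> Hb; have := lift_vanE gr Hb (xdiff_E gr i (w := w)).
by rewrite sc_xdiff => /eqP; rewrite subr_eq0 => /eqP.
Qed.

Lemma ex_Karc_nonconst w : exists t k b, [/\ (0 < k)%N, Karc Y (E w) b & b (lshift m.+1 t) k != 0].
Proof.
have [t nt] := xdiff_notY nss gr; have [k Ok nOk] := exact_order nss gr w nt.
have [b Kb bk] := ex_Karc_order nss (ex_intro _ 0%N (xdiff_hom m O t)) Ok nOk.
exists t, k, b; have lb := Karc_lift Kb; case: k bk {Ok nOk} => [|k].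
  by rewrite (lift_vanE gr lb (xdiff_E gr t (w := w))) eqxx.
by rewrite sc_xdiff subr0.
Qed.

Definition Karc_arc (b : 'I_N -> nat -> K) : arc K n := Arc (@idK K) (xpart b).

Lemma Karc_through w b : Karc Y (E w) b -> (exists t k, (0 < k)%N /\ b (lshift m.+1 t) k != 0) ->
  through w (Karc_arc b).
Proof.
move=> Kb [t [k [k0 bk]]]; have lb := Karc_lift Kb; split.
- split=> [i|f fX l] /=; first exact: (lift_center i lb).
  by rewrite -sc_widen; apply: (lift_vanY gr lb); apply: widen_Y.
- by exists t, k.
exists b; split=> //=; first exact: lift_y lb.
  exact: lift_Y lb.
by move=> d f Hf; have := lift_E lb Hf; rewrite sc_mmap.
Qed.

Lemma through_lift w a : through w a -> exists b, lift Y (E w) (arc_emb a) b /\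
  forall i k, xpart b i k = arc_coef a i k.
Proof.
move=> [_ _ [b [Hx Hy HY HE]]]; exists b; split=> //; split=> // d f Hf.
by rewrite sc_mmap; apply: (HE d).
Qed.

Lemma eval_arc_jet M (P : {mpoly K[n * M]}) (a : arc K n) :
  eval_arc P a = mmap (arc_emb a) (jet (arc_coef a) (M := M)) P.
Proof. by []. Qed.

Lemma through_descent w a M (P : {mpoly K[n * M]}) : through w a -> eval_arc P a != 0 ->
  exists2 b, Karc Y (E w) b & eval_arc P (Karc_arc b) != 0.
Proof.
move=> /through_lift[b [Hb Hx]]; rewrite eval_arc_jet.
rewrite -(jet_agree (arc_emb a) (b := xpart b)) => [Pb|i l _]; last exact: Hx.
exact: (lift_descent (clY gr) (clE gr w) (@E_Y _ _ _ _ _ _ _ _ gr w) (res_smooth (gr_resolution gr)) Hb Pb).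
Qed.

Lemma eval_arc_widen M M' (P : {mpoly K[n * M]}) : (M <= M')%N -> exists P' : {mpoly K[n * M']},
  forall a, eval_arc P' a = eval_arc P a.
Proof. by move=> MM; have [P' HP'] := jet_widen P MM; exists P' => a; rewrite !eval_arc_jet HP'. Qed.

Lemma eval_arcM M (P Q : {mpoly K[n * M]}) a : eval_arc (P * Q) a = eval_arc P a * eval_arc Q a.
Proof. exact: mmap_mul. Qed.

(** A third open condition, a nonzero coefficient of positive degree, keeps the common arc from
    being the constant one, which [arcs_through] excludes. *)
Lemma Karc_common w M1 M2 (P : {mpoly K[n * M1]}) (Q : {mpoly K[n * M2]}) b1 b2 :
  Karc Y (E w) b1 -> Karc Y (E w) b2 ->
  eval_arc P (Karc_arc b1) != 0 -> eval_arc Q (Karc_arc b2) != 0 ->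
  exists b, [/\ Karc Y (E w) b, through w (Karc_arc b), eval_arc P (Karc_arc b) != 0
    & eval_arc Q (Karc_arc b) != 0].
Proof.
move=> K1 K2 Pb1 Qb2; have [t [k [b3 [k0 K3 b3k]]]] := ex_Karc_nonconst w.
pose M := maxn k.+1 (maxn M1 M2).
have [P' HP'] := eval_arc_widen P (leq_trans (leq_maxl M1 M2) (leq_maxr k.+1 _) : (M1 <= M)%N).
have [Q' HQ'] := eval_arc_widen Q (leq_trans (leq_maxr M1 M2) (leq_maxr k.+1 _) : (M2 <= M)%N).
pose T : {mpoly K[n * M]} := 'X_(mxvec_index t (Ordinal (leq_maxl k.+1 (maxn M1 M2)))).
have HT b : eval_arc T (Karc_arc b) = b (lshift m.+1 t) k.
  by rewrite eval_arc_jet mmapX mmap1U jetE.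
have [||b4 [K4 Pb4 Qb4]] := @Karc_irreducible K n m Y (E w) (clY gr) (clE gr w) (primeE gr w) (@E_Y _ _ _ _ _ _ _ _ gr w) (res_smooth (gr_resolution gr)) M P' Q' b1 b2 K1 K2.
- by rewrite -[X in X != 0]/(eval_arc P' (Karc_arc b1)) HP'.
- by rewrite -[X in X != 0]/(eval_arc Q' (Karc_arc b2)) HQ'.
have [||b [Kb PQb Tb]] := @Karc_irreducible K n m Y (E w) (clY gr) (clE gr w) (primeE gr w) (@E_Y _ _ _ _ _ _ _ _ gr w) (res_smooth (gr_resolution gr)) M (P' * Q') T b4 b3 K4 K3.
- by rewrite mmap_mul mulf_neq0.
- by rewrite -[X in X != 0]/(eval_arc T (Karc_arc b3)) HT.
exists b; rewrite -HP' -HQ'; move: PQb; rewrite mmap_mul mulf_eq0 negb_or => /andP[Pb Qb].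
split=> //; apply: Karc_through => //; exists t, k; split=> //.
by rewrite -HT.
Qed.

Lemma arrow_obstruction u v (f : {mpoly K[n]}) k l : (k < l)%N -> og u l (widen m f) ->
  og v k (widen m f) -> ~ og v k.+1 (widen m f) -> ~ psub (through v) (arc_closure (through u)).
Proof.
move=> kl Ou Ov nOv H; have hf : hom (widen m f) by exists 0%N; apply: widen_hom.
have [P HP] := coef_poly_universal f (ltnSn k).
have Pu a : through u a -> eval_arc P a = 0.
  move=> /through_lift[b [Hb Hx]]; rewrite eval_arc_jet HP.
  rewrite (sc_ext _ _ _ (b' := xpart b)) => [|i l']; last by rewrite Hx.
  by rewrite -sc_widen; apply: (lift_og nss Hb hf Ou).
have [b Kb bk] := ex_Karc_order nss hf Ov nOv.
have Pb : eval_arc P (Karc_arc b) != 0 by rewrite eval_arc_jet HP -sc_widen.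
have [b' [_ tb' Pb' _]] := Karc_common Kb Kb Pb Pb.
by case/eqP: Pb'; apply: (H _ tb').
Qed.
End Setup.

Section Setup.
Variables (G : weighted_graph) (K : closedFieldType) (n m : nat) (X : 'rV[K]_n -> Prop)
  (O : 'rV[K]_n) (Y : 'rV[K]_(n + m.+1) -> Prop) (E : G -> 'rV[K]_(n + m.+1) -> Prop).
Hypotheses (nss : normal_surface_singularity X O) (gr : good_resolution_with_graph X O Y E).
Local Notation N := (n + m.+1)%N.
Local Notation R := {mpoly K[N]}.
Local Notation og := (og gr).
Local Notation M := (M gr).
Local Notation MH := (MH gr).
Local Notation H j := (fun f : R => is_true (yhomog j f)).
Local Notation tau := (tau gr).
Implicit Types (f g : R) (u v w : G) (z : 'rV[K]_N) (D : G -> nat).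
Local Notation scK := (subst_coef (@idK K)).
Local Notation through w := (arcs_through X O Y (E w)).

Definition nonconst (a : arc K n) : Prop := exists i k, (0 < k)%N /\ arc_coef a i k != 0.

Lemma prime_prod (A : comNzRingType) (J : A -> Prop) (I : finType) (F : I -> A) : prime_ideal J ->
  (forall i, ~ J (F i)) -> ~ J (\prod_i F i).
Proof.
move=> pJ HF; apply: (big_ind (fun x => ~ J x)); [by case: pJ|by move=> x y; apply: (primeMn pJ)|by move=> i _; apply: HF].
Qed.

(** Otherwise each E_w has an equation that is nonzero at the start of b. Their product survives a
    specialization to a K-point of the exceptional divisor, and this point lies on some E_w. *)
Lemma arc_on_divisor (L : fieldType) (iota : {rmorphism K -> L}) (b : 'I_N -> nat -> L) :
  (exists j, b (rshift n j) 0%N != 0) ->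
  (forall d f, ideal_deg Y d f -> forall k, subst_coef iota f b k = 0) ->
  (forall i, b (lshift m.+1 i) 0%N = iota (O 0 i)) ->
  exists w, lift Y (E w) iota b.
Proof.
move=> Hy HY Hx; apply: NNPP => Hn; have pq := sc0_prime iota b.
have Hw w : exists f, vanishes f (E w) /\ subst_coef iota f b 0%N <> 0.
  apply: NNPP => Hw; apply: Hn; exists w; split=> // d f [_ fE].
  by apply: NNPP => fb; apply: Hw; exists f.
have [F HF] := choice _ Hw; have [j bj] := Hy.
have ng : ~ (subst_coef iota ('X_(rshift n j) * \prod_w F w) b 0%N = 0).
  apply: (primeMn pq); first by rewrite scX; apply/eqP.
  by apply: (prime_prod pq) => w; have [] := HF w.
have [v [Hv gv]] := nullstellensatz_prime pq ng; pose z : 'rV[K]_N := \row_i v i.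
have Ev (g : R) : g.@[v] = evalp g z by apply: meval_eq => i; rewrite mxE.
move: gv; rewrite Ev evalpM evalp_yvar mulf_eq0 negb_or => /andP[zj].
have Yz : Y z.
  apply: (proj_closedP (clY gr)) => [|d f hf fY].
    by apply/eqP => z0; move: zj; rewrite -ycoord_rsub z0 mxE eqxx.
  by rewrite -Ev; apply: Hv; apply: (HY d).
have Oz : lsubmx z = O.
  apply/rowP => i; have := Hv (xdiff m O i).
  by rewrite sc_xdiff Hx eqxx subrr => /(_ erefl) H0; move: H0; rewrite Ev /xdiff !evalpE [lsubmx _ _ _]mxE => /eqP; rewrite subr_eq0 => /eqP.
have [w Ew] := E_cover gr (conj Yz Oz).
by rewrite (bigD1 w) //= evalpM (proj1 (HF w) z Ew) mul0r eqxx.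
Qed.

(** The valuative criterion by hand: near a K-point x1 other than O to which the generic point of
    the arc specializes, Y is the graph of F; F is evaluated along the arc and the common factor t^c
    is divided out. *)
Lemma lift_exists a : is_arc X O a -> nonconst a -> exists w, through w a.
Proof.
move=> [a0 aX] [i0 [k0 [k00 ak0]]]; set L := arc_field a in ak0; set iota := arc_emb a in a0 aX *.
pose al := arc_coef a; have pp := sc_ideal iota al.
have nx : ~ (forall k, subst_coef iota ('X_i0 - (O 0 i0)%:MP) al k = 0).
  by move=> /(_ k0); rewrite scB scX scC gtn_eqF // subr0 => ak00; case/eqP: ak0.
have [v [Hv gv]] := nullstellensatz_prime pp nx; pose x1 : 'rV[K]_n := \row_i v i.
have Ev (g : {mpoly K[n]}) : g.@[v] = evalp g x1 by apply: meval_eq => i; rewrite mxE.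
have Xx1 : X x1.
  by apply/(nss_closed nss) => f fX; rewrite -Ev; apply: Hv; apply: aX.
have x1O : x1 <> O by move=> E1; move: gv; rewrite Ev !evalpE E1 subrr eqxx.
have [F Fx1 HF] := res_iso (gr_resolution gr) Xx1 x1O.
have [j Fj] : exists j, evalp (F j) x1 != 0.
  apply: NNPP => Hn; case/negP: Fx1; apply/eqP/rowP => j; rewrite !mxE.
  by apply/eqP/negPn/negP => nj; apply: Hn; exists j.
have nFj : ~ (forall k, subst_coef iota (F j) al k = 0) by move=> /Hv; rewrite Ev; apply/eqP.
pose b0 (i : 'I_N) := match split i with inl i' => al i' | inr l => subst_coef iota (F l) al end.
have sc_b0 f k : subst_coef iota f b0 k = subst_coef iota (sub_graph F f) al k.
  rewrite [sub_graph F f]/(compose _ f) sc_compose; apply: sc_ext => i l.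
  by rewrite /b0; case: (split i) => // i'; rewrite scX.
have b0Y f : vanishes f Y -> forall k, subst_coef iota f b0 k = 0.
  move=> fY; suff : forall k, subst_coef iota (sub_graph F f) al k = 0 by move=> H k; rewrite sc_b0.
  have [_ _ pM] := pp.
  case: (pM ('X_i0 - (O 0 i0)%:MP) (F j * sub_graph F f)) => [||/pM[] //] //.
  apply: aX => x Xx; rewrite !evalpM evalp_sub_graph.
  case: (eqVneq (evalp ('X_i0 - (O 0 i0)%:MP) x) 0) => [->|xi]; first by rewrite mul0r.
  case: (eqVneq (evalp (F j) x) 0) => [->|Fjx]; first by rewrite mul0r mulr0.
  have xO : x <> O by move=> E1; move: xi; rewrite !evalpE E1 subrr eqxx.
  have Fx : eval_tuple F x != 0.
    by apply/eqP => /rowP/(_ j); rewrite !mxE => E1; rewrite E1 eqxx in Fjx.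
  rewrite fY ?mulr0 //; apply/(HF x Xx xO Fx); exists 1; rewrite ?oner_neq0 ?scale1r //.
have [|c [[l cl] minc]] := @ex_min_nat (fun k => exists l, subst_coef iota (F l) al k != 0).
  apply: NNPP => Hn; apply: nFj => k; apply/eqP/negPn/negP => Hk; apply: Hn; exists k, j.
  exact: Hk.
pose b (i : 'I_N) := match split i with inl i' => al i'
  | inr l => fun k => subst_coef iota (F l) al (k + c)%N end.
have bx i k : b (lshift m.+1 i) k = al i k.
  rewrite /b; case: splitP => [i' /= E1|i' /= E1]; last by have := ltn_ord i; lia.
  by have -> : i' = i by apply/val_inj.
have by_ l' k : b (rshift n l') k = subst_coef iota (F l') al (k + c)%N.
  rewrite /b; case: splitP => [i' /= E1|i' /= E1]; first by have := ltn_ord i'; lia.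
  by have -> : i' = l' by apply/val_inj/esym/(addnI E1).
have b0y l' k : b0 (rshift n l') k = subst_coef iota (F l') al k.
  rewrite /b0; case: splitP => [i' /= E1|i' /= E1]; first by have := ltn_ord i'; lia.
  by have -> : i' = l' by apply/val_inj/esym/(addnI E1).
(* The series t^c: in these terms the y-part of b0 is t^c times that of b, as the scaling lemmas
   require. *)
pose lam k : L := (k == c)%:R.
have Hx i k : b0 (lshift m.+1 i) k = b (lshift m.+1 i) k.
  by rewrite bx /b0; case: splitP => [i' /= E1|i' /= E1];
    [have -> : i' = i by apply/val_inj|have := ltn_ord i; lia].
have Hy l' k : b0 (rshift n l') k = smul lam (b (rshift n l')) k.
  rewrite b0y /smul; case: (ltnP k c) => kc.
    rewrite big1 => [|i _]; last by rewrite /lam ltn_eqF ?mul0r //; have := ltn_ord i; lia.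
    by apply/eqP/negPn/negP => Hk; have := minc k (ex_intro _ l' Hk); rewrite leqNgt kc.
  rewrite (bigD1 (Ordinal (kc : (c < k.+1)%N))) //= /lam eqxx mul1r big1 => [|i ic].
    by rewrite addr0 by_ subnK.
  by rewrite (_ : (i == c :> nat) = false) ?mul0r //; apply/negbTE; apply: contraNneq ic => E1; apply/eqP/val_inj.
have bY d f : ideal_deg Y d f -> forall k, subst_coef iota f b k = 0.
  move=> [hf fY]; apply: (sc_scale_zero Hx Hy hf); last exact: b0Y.
  by exists c; rewrite /lam eqxx oner_neq0.
have [||w [_ _ HE]] := @arc_on_divisor _ iota b _ bY.
- by exists l; rewrite by_ add0n.
- by move=> i; rewrite bx; apply: a0.
exists w; split=> //; first by exists i0, k0.
exists b; split=> //; first by exists l; rewrite by_ add0n.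
by move=> d f Hf; rewrite -sc_mmap; apply: (HE d).
Qed.

Lemma sc_reparam (b : 'I_N -> nat -> K) (s : K) f k :
  subst_coef (@idK K) f (fun i l => s ^+ l * b i l) k = s ^+ k * subst_coef (@idK K) f b k.
Proof.
move: f k; apply: mpoly_ring_ind => [c|i|p q Hp Hq|p q Hp Hq] k.
- by rewrite !scC; case: eqP => [->|]; rewrite ?mulr0 // expr0 mul1r.
- by rewrite !scX.
- by rewrite !scD Hp Hq mulrDr.
- rewrite !scM mulr_sumr; apply: eq_bigr => j _; rewrite Hp Hq.
  have -> : s ^+ k = s ^+ j * s ^+ (k - j) by rewrite -exprD subnKC // -ltnS.
  by ring.
Qed.

Lemma Karc_reparam w b (s : K) : Karc Y (E w) b -> Karc Y (E w) (fun i l => s ^+ l * b i l).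
Proof.
move=> [j [bY bE]]; exists j; split; first by move=> f fY k; rewrite sc_reparam bY ?mulr0.
suff -> : start (fun i l => s ^+ l * b i l) = start b by [].
by apply/rowP => i; rewrite !mxE expr0 mul1r.
Qed.

(* The constant arc is the specialization at s = 0 of t |-> b(s t). *)
Lemma constant_arc_closure w a : is_arc X O a -> ~ nonconst a -> arc_closure (through w) a.
Proof.
move=> [a0 _] nc M P HP; have [t [k [b [k0 Kb bk]]]] := ex_Karc_nonconst nss gr w.
pose bs (s : K) : 'I_N -> nat -> K := fun i l => s ^+ l * b i l.
pose Ps : {poly K} := mmap (@polyC K) (fun l => mxvec (\matrix_(i < n, l' < M) (b (lshift m.+1 i) l' *: 'X^l')) 0 l) P.
have HPs s : Ps.[s] = eval_arc P (Karc_arc (bs s)).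
  rewrite eval_arc_jet /Ps; move: P {HP Ps}; apply: mpoly_ring_ind => [c|l|p q Hp Hq|p q Hp Hq].
  - by rewrite !mmapC hornerC.
  - case/mxvec_indexP: l => i l; rewrite !mmapX !mmap1U jetE mxvecE mxE.
    by rewrite hornerZ hornerXn mulrC.
  - by rewrite !mmapD hornerD Hp Hq.
  - by rewrite !mmap_mul hornerM Hp Hq.
have P0 : Ps = 0.
  apply/eqP/negPn/negP => nP; have /ex_nonroot[s] : Ps * 'X != 0 by rewrite mulf_neq0 ?polyX_eq0.
  rewrite hornerM hornerX mulf_eq0 negb_or HPs => /andP[Pn s0]; case/eqP: Pn; apply: (HP (Karc_arc (bs s))).
  apply: Karc_through => //; first exact: Karc_reparam.
  by exists t, k; split=> //; rewrite /bs mulf_neq0 // expf_neq0.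
have E0 : eval_arc P a = arc_emb a (eval_arc P (Karc_arc (bs 0))).
  have Hc i l : arc_coef a i l = arc_emb a (xpart (bs 0) i l).
    case: l => [|l]; rewrite /xpart /bs.
      rewrite a0 expr0 mul1r; congr (arc_emb a _).
      by have := lift_center gr i (Karc_lift Kb).
    rewrite expr0n mul0r rmorph0; apply/eqP/negPn/negP => Hl; apply: nc.
    by exists i, l.+1.
  rewrite !eval_arc_jet; move: P {HP Ps HPs P0}; apply: mpoly_ring_ind => [c|l|p q Hp Hq|p q Hp Hq].
  - by rewrite !mmapC.
  - by case/mxvec_indexP: l => i l; rewrite !mmapX !mmap1U !jetE Hc.
  - by rewrite !mmapD rmorphD Hp Hq.
  - by rewrite !mmap_mul rmorphM Hp Hq.
by rewrite E0 -HPs P0 horner0 rmorph0.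
Qed.
End Setup.

(** * Ultrapowers *)

Record ultrafilter (I : Type) := Ultrafilter {
  ultra :> (I -> Prop) -> Prop;
  ultraT : ultra (fun _ => True);
  ultraS : forall A B, psub A B -> ultra A -> ultra B;
  ultraI : forall A B, ultra A -> ultra B -> ultra (fun i => A i /\ B i);
  ultra0 : ~ ultra (fun _ => False);
  ultraC : forall A, ultra A \/ ultra (fun i => ~ A i)
}.

Lemma ex_ultrafilter (I J : Type) (S : J -> I -> Prop) : inhabited J -> (forall j, exists i, S j i) ->
  (forall j k, exists l, forall i, S l i -> S j i /\ S k i) ->
  exists U : ultrafilter I, forall j, U (S j).
Proof.
move=> [j0] Sne Sdir.
pose P (Phi : (I -> Prop) -> Prop) := [/\ forall A B, psub A B -> Phi A -> Phi B,
  forall A B, Phi A -> Phi B -> Phi (fun i => A i /\ B i), forall A, Phi A -> exists i, A i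
  & Phi (fun _ => True)].
pose A0 (A : I -> Prop) := exists j, psub (S j) A.
have P0 : P A0.
  split.
  - by move=> A B AB [j H]; exists j => i /H/AB.
  - move=> A B [j HA] [k HB]; have [l Hl] := Sdir j k; exists l => i /Hl[H1 H2].
    by split; [apply: HA|apply: HB].
  - by move=> A [j H]; have [i Si] := Sne j; exists i; apply: H.
  - by exists j0.
have [|U [[US UI Une UT] A0U maxU]] := @zorn_pred _ P _ A0 P0.
  move=> F FP totF [B FB]; split.
  - by move=> A C sAC [D FD DA]; exists D => //; have [DS _ _ _] := FP _ FD; apply: DS sAC DA.
  - move=> A C [D FD DA] [D' FD' DC].
    case: (totF _ _ FD FD') => DD; [exists D'|exists D] => //.
      by have [_ DI _ _] := FP _ FD'; apply: DI => //; apply: DD.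
    by have [_ DI _ _] := FP _ FD; apply: DI => //; apply: DD.
  - by move=> A [D FD DA]; have [_ _ Dne _] := FP _ FD; apply: Dne.
  - by exists B => //; have [_ _ _ BT] := FP _ FB.
have U0 : ~ U (fun _ => False) by move=> /Une[].
have UC A : U A \/ U (fun i => ~ A i).
  apply: NNPP => /not_or_and[nA nA'].
  pose V (C : I -> Prop) := exists2 B, U B & forall i, B i -> A i -> C i.
  apply: nA; apply: (maxU V); last by exists (fun _ => True).
    split.
    - by move=> C D CD [B UB H]; exists B => // i Bi Ai; apply: CD; apply: H.
    - move=> C D [B UB H] [B' UB' H']; exists (fun i => B i /\ B' i); first exact: UI.
      by move=> i [Bi B'i] Ai; split; [apply: H|apply: H'].
    - move=> C [B UB H]; apply: NNPP => nC; apply: nA'; apply: US UB => i Bi Ai.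
      by apply: nC; exists i; apply: H.
    - by exists (fun _ => True).
  by move=> C UC; exists C.
by exists (Ultrafilter UT US UI U0 UC) => j /=; apply: A0U; exists j.
Qed.

Section Ultrapower.
Variables (I : Type) (K : fieldType) (U : ultrafilter I).
Implicit Types (f g : I -> K).

Definition ueqv f g : Prop := U (fun i => f i = g i).
Definition urep f : I -> K := epsilon (inhabits (fun _ => 0)) (ueqv f).

Lemma ueqv_refl f : ueqv f f.
Proof. by apply: ultraS (ultraT U) => i _. Qed.
Lemma ueqv_sym f g : ueqv f g -> ueqv g f.
Proof. by apply: ultraS => i ->. Qed.
Lemma ueqv_trans f g h : ueqv f g -> ueqv g h -> ueqv f h.
Proof. by move=> H1 H2; apply: ultraS (ultraI H1 H2) => i [-> ->]. Qed.
Lemma urepP f : ueqv f (urep f).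
Proof. by apply: epsilon_spec; exists f; apply: ueqv_refl. Qed.
Lemma urep_eq f g : ueqv f g -> urep f = urep g.
Proof.
move=> fg; rewrite /urep; congr (epsilon _ _); apply: pred_ext => h.
by split; apply: ueqv_trans => //; apply: ueqv_sym.
Qed.

(** The quotient of the families by equality on the ultrafilter, realized by the families that a
    fixed choice of representatives leaves unchanged. *)
Definition upower := {f : I -> K | urep f = f}.
Definition uclass f : upower := exist _ (urep f) (esym (urep_eq (urepP f))).

Lemma uclassP f g : uclass f = uclass g <-> ueqv f g.
Proof.
split=> [/(congr1 sval) /= E|fg].
  by apply: ueqv_trans (urepP f) _; rewrite E; apply: ueqv_sym; apply: urepP.
apply: eq_sig_hprop => [h|/=]; first by move=> *; apply: proof_irrelevance.
exact: urep_eq.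
Qed.

Lemma uclass_surj x : exists f, x = uclass f.
Proof.
case: x => f Hf; exists f; apply: eq_sig_hprop => [h|//=].
by move=> *; apply: proof_irrelevance.
Qed.

Definition uop1 (op : K -> K) (x : upower) := uclass (fun i => op (sval x i)).
Definition uop2 (op : K -> K -> K) (x y : upower) := uclass (fun i => op (sval x i) (sval y i)).

Lemma uop1E op f : uop1 op (uclass f) = uclass (fun i => op (f i)).
Proof. by apply/uclassP; apply: ultraS (urepP f) => i /= <-. Qed.
Lemma uop2E op f g : uop2 op (uclass f) (uclass g) = uclass (fun i => op (f i) (g i)).
Proof. by apply/uclassP; apply: ultraS (ultraI (urepP f) (urepP g)) => i /= [<- <-]. Qed.

HB.instance Definition _ := boolp.gen_eqMixin upower.
HB.instance Definition _ := boolp.gen_choiceMixin upower.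

Lemma uaddA : associative (uop2 +%R).
Proof. by move=> x y z; have [f ->] := uclass_surj x; have [g ->] := uclass_surj y;
  have [h ->] := uclass_surj z; rewrite !uop2E; congr uclass; apply: functional_extensionality => i;
  apply: addrA. Qed.
Lemma uaddC : commutative (uop2 +%R).
Proof. by move=> x y; rewrite /uop2; congr uclass; apply: functional_extensionality => i; apply: addrC. Qed.
Lemma uadd0 : left_id (uclass (fun _ => 0)) (uop2 +%R).
Proof. by move=> x; have [f ->] := uclass_surj x; rewrite uop2E; congr uclass;
  apply: functional_extensionality => i; apply: add0r. Qed.
Lemma uaddN : left_inverse (uclass (fun _ => 0)) (uop1 -%R) (uop2 +%R).
Proof. by move=> x; have [f ->] := uclass_surj x; rewrite uop1E uop2E; congr uclass;
  apply: functional_extensionality => i; apply: addNr. Qed.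
HB.instance Definition _ := GRing.isZmodule.Build upower uaddA uaddC uadd0 uaddN.

Lemma umulA : associative (uop2 *%R).
Proof. by move=> x y z; have [f ->] := uclass_surj x; have [g ->] := uclass_surj y;
  have [h ->] := uclass_surj z; rewrite !uop2E; congr uclass; apply: functional_extensionality => i;
  apply: mulrA. Qed.
Lemma umulC : commutative (uop2 *%R).
Proof. by move=> x y; rewrite /uop2; congr uclass; apply: functional_extensionality => i; apply: mulrC. Qed.
Lemma umul1 : left_id (uclass (fun _ => 1)) (uop2 *%R).
Proof. by move=> x; have [f ->] := uclass_surj x; rewrite uop2E; congr uclass;
  apply: functional_extensionality => i; apply: mul1r. Qed.
Lemma umulD : left_distributive (uop2 *%R) (uop2 +%R).
Proof. by move=> x y z; have [f ->] := uclass_surj x; have [g ->] := uclass_surj y;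
  have [h ->] := uclass_surj z; rewrite !uop2E; congr uclass; apply: functional_extensionality => i;
  apply: mulrDl. Qed.
Lemma u1_neq0 : uclass (fun _ => 1) != 0 :> upower.
Proof.
by apply/eqP => /uclassP H; apply: (ultra0 (u := U)); apply: ultraS H => i /eqP; rewrite oner_eq0.
Qed.
HB.instance Definition _ := GRing.Zmodule_isComNzRing.Build upower umulA umulC umul1 umulD u1_neq0.

Lemma umulV (x : upower) : x != 0 -> uop1 (fun t => t^-1) x * x = 1.
Proof.
have [f ->] := uclass_surj x => /eqP f0; rewrite uop1E [LHS]uop2E; apply/uclassP.
case: (ultraC U (fun i => f i = 0)) => [H|]; first by case: f0; apply/uclassP.
by apply: ultraS => i /eqP fi; rewrite mulVf.
Qed.
Lemma uinv0 : uop1 (fun t => t^-1) (0 : upower) = 0.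
Proof. by rewrite [LHS]uop1E invr0. Qed.
HB.instance Definition _ := GRing.ComNzRing_isField.Build upower umulV uinv0.

Definition udiag (c : K) : upower := uclass (fun _ => c).
Lemma udiag_zmod : zmod_morphism udiag.
Proof.
move=> x y; have -> : - udiag y = udiag (- y) by rewrite /udiag [LHS]uop1E.
by rewrite [RHS]uop2E.
Qed.
Lemma udiag_monoid : monoid_morphism udiag.
Proof. by split=> // x y; rewrite [RHS]uop2E. Qed.
HB.instance Definition _ := GRing.isZmodMorphism.Build K upower udiag udiag_zmod.
HB.instance Definition _ := GRing.isMonoidMorphism.Build K upower udiag udiag_monoid.

(** The polynomial case of Los's theorem: evaluation in the ultrapower is done index by index. *)
Lemma uclass_mmap N (h : 'I_N -> I -> K) (P : {mpoly K[N]}) :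
  mmap udiag (fun l => uclass (h l)) P = uclass (fun i => mmap (@idfun K) (fun l => h l i) P).
Proof.
move: P; apply: mpoly_ring_ind => [c|l|p q Hp Hq|p q Hp Hq].
- by rewrite mmapC; congr uclass; apply: functional_extensionality => i; rewrite mmapC.
- by rewrite mmapX mmap1U; congr uclass; apply: functional_extensionality => i; rewrite mmapX mmap1U.
- rewrite mmapD Hp Hq [LHS]uop2E; congr uclass; apply: functional_extensionality => i.
  by rewrite mmapD.
- rewrite (rmorphM (mmap udiag _)) /= Hp Hq [LHS]uop2E; congr uclass; apply: functional_extensionality => i.
  by rewrite (rmorphM (mmap idfun _)).
Qed.
End Ultrapower.

(** * The space of arcs *)

Section Setup.
Variables (G : weighted_graph) (K : closedFieldType) (n m : nat) (X : 'rV[K]_n -> Prop)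
  (O : 'rV[K]_n) (Y : 'rV[K]_(n + m.+1) -> Prop) (E : G -> 'rV[K]_(n + m.+1) -> Prop).
Hypotheses (nss : normal_surface_singularity X O) (gr : good_resolution_with_graph X O Y E).
Local Notation N := (n + m.+1)%N.
Local Notation R := {mpoly K[N]}.
Local Notation og := (og gr).
Local Notation M := (M gr).
Local Notation MH := (MH gr).
Local Notation H j := (fun f : R => is_true (yhomog j f)).
Local Notation tau := (tau gr).
Implicit Types (f g : R) (u v w : G) (z : 'rV[K]_N) (D : G -> nat).
Local Notation scK := (subst_coef (@idK K)).
Local Notation through w := (arcs_through X O Y (E w)).
Local Notation cl := (@arc_closure K n).

Lemma eval_arc1 M (a : arc K n) : eval_arc (1 : {mpoly K[n * M]}) a = 1.
Proof. exact: (rmorph1 (mmap (arc_emb a) _)). Qed.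

Section ArcTopology.
Implicit Types (S A B : arc K n -> Prop).

Lemma sub_cl S : psub S (cl S). Proof. by move=> a Sa M P; apply. Qed.
Lemma cl_mono S A : psub S A -> psub (cl S) (cl A).
Proof. by move=> SA a clS M P HP; apply: clS => b /SA; apply: HP. Qed.
Lemma cl_idem S : closed_for cl (cl S).
Proof. by move=> a; split=> [Ha M P HP|]; [apply: Ha => b; apply|apply: sub_cl]. Qed.
Lemma cl_min S A : closed_for cl A -> psub S A -> psub (cl S) A.
Proof. by move=> cA SA a /(cl_mono SA) /cA. Qed.

Lemma not_cl A a : closed_for cl A -> ~ A a ->
  exists M (P : {mpoly K[n * M]}), (forall b, A b -> eval_arc P b = 0) /\ eval_arc P a != 0.
Proof.
move=> cA nA; apply: NNPP => Hn; apply: nA; apply/cA => M P HP.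
by apply/eqP/negPn/negP => Pa; apply: Hn; exists M, P.
Qed.

Lemma cl_union A B : closed_for cl A -> closed_for cl B -> closed_for cl (fun a => A a \/ B a).
Proof.
move=> cA cB a; split=> [Ha|]; last exact: sub_cl.
apply: NNPP => /not_or_and[/(not_cl cA)[M1 [P [HP Pa]]] /(not_cl cB)[M2 [Q [HQ Qa]]]].
have [P' HP'] := eval_arc_widen P (leq_maxl M1 M2); have [Q' HQ'] := eval_arc_widen Q (leq_maxr M1 M2).
have /eqP : eval_arc (P' * Q') a = 0.
  by apply: Ha => b [/HP|/HQ] E0; rewrite eval_arcM HP' HQ' E0 ?mul0r ?mulr0.
by rewrite eval_arcM HP' HQ' mulf_eq0 (negPf Pa) (negPf Qa).
Qed.

Lemma cl_irreducible S : irreducible_for cl S -> irreducible_for cl (cl S).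
Proof.
move=> [[a Sa] irr]; split; first by exists a; apply: sub_cl.
move=> A B cA cB H; case: (irr A B cA cB) => [b /sub_cl /H //|SA|SB]; [left|right]; exact: cl_min.
Qed.

Lemma irreducible_finite (Z : arc K n -> Prop) (F : G -> arc K n -> Prop) (s : seq G) :
  irreducible_for cl Z -> (forall w, closed_for cl (F w)) ->
  (forall a, Z a -> exists2 w, w \in s & F w a) -> exists w, psub Z (F w).
Proof.
move=> [[a0 Za0] irr] cF; elim: s => [/(_ a0 Za0)[]//|w s IH] Hs.
pose U (s' : seq G) a := exists2 w', w' \in s' & F w' a.
have cU s' : closed_for cl (U s').
  elim: s' => [|x s' IHs] a; last first.
    rewrite (_ : U (x :: s') = fun a => F x a \/ U s' a); first exact: cl_union.
    apply: pred_ext => b; split=> [[y]|[Fb|[y ys Fb]]]; [|by exists x; rewrite ?mem_head|].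
      by rewrite inE => /orP[/eqP -> Fb|ys Fb]; [left|right; exists y].
    by exists y => //; apply: mem_tail.
  split=> [Ha|[] //]; have /eqP : eval_arc (1 : {mpoly K[n * 0]}) a = 0 by apply: Ha => b [].
  by rewrite eval_arc1 oner_eq0.
case: (irr (F w) (U s) (cF w) (cU s)) => [a /Hs[y]|ZF|ZU]; [|by exists w|exact: IH].
by rewrite inE => /orP[/eqP -> Fa|ys Fa]; [left|right; exists y].
Qed.
End ArcTopology.

Lemma is_arc_closed S : psub S (is_arc X O) -> psub (cl S) (is_arc X O).
Proof.
move=> SX a Ha; split=> [i|f fX k].
  pose P : {mpoly K[n * 1]} := 'X_(mxvec_index i ord0) - (O 0 i)%:MP.
  have EP b : eval_arc P b = arc_coef b i 0%N - arc_emb b (O 0 i).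
    by rewrite eval_arc_jet mmapB mmapC mmapX mmap1U jetE.
  apply/eqP; rewrite -subr_eq0 -EP; apply/eqP; apply: Ha => b Sb.
  by rewrite EP; have [-> _] := SX b Sb; rewrite subrr.
have [P HP] := coef_poly_universal f (ltnSn k).
by rewrite -HP; apply: Ha => b Sb; rewrite eval_arc_jet HP; have [_] := SX b Sb; apply.
Qed.

Lemma through_arc w : psub (through w) (is_arc X O). Proof. by move=> a []. Qed.

Lemma ex_Karc w : exists2 b, Karc Y (E w) b & through w (Karc_arc b).
Proof.
have [t [k [b [k0 Kb bk]]]] := ex_Karc_nonconst nss gr w.
by exists b => //; apply: Karc_through => //; exists t, k.
Qed.

Lemma through_common w a1 a2 M1 M2 (P : {mpoly K[n * M1]}) (Q : {mpoly K[n * M2]}) :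
  through w a1 -> through w a2 -> eval_arc P a1 != 0 -> eval_arc Q a2 != 0 ->
  exists b, [/\ Karc Y (E w) b, through w (Karc_arc b), eval_arc P (Karc_arc b) != 0
    & eval_arc Q (Karc_arc b) != 0].
Proof.
move=> t1 t2 P1 Q2; have [b1 K1 Pb1] := through_descent gr t1 P1.
have [b2 K2 Qb2] := through_descent gr t2 Q2.
exact: (Karc_common nss gr K1 K2 Pb1 Qb2).
Qed.

Lemma through_irreducible w : irreducible_for cl (through w).
Proof.
split; first by have [b _ tb] := ex_Karc w; exists (Karc_arc b).
move=> A B cA cB H; apply: NNPP => /not_or_and[nA nB].
have [a1 [t1 /(not_cl cA)[M1 [P [HP Pa]]]]] : exists a, through w a /\ ~ A a.
  by apply: NNPP => Hn; apply: nA => a ta; apply: NNPP => nAa; apply: Hn; exists a.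
have [a2 [t2 /(not_cl cB)[M2 [Q [HQ Qa]]]]] : exists a, through w a /\ ~ B a.
  by apply: NNPP => Hn; apply: nB => a ta; apply: NNPP => nBa; apply: Hn; exists a.
have [b [_ tb Pb Qb]] := through_common t1 t2 Pa Qa.
case: (H _ tb) => [/HP E0|/HQ E0]; first by rewrite E0 eqxx in Pb.
by rewrite E0 eqxx in Qb.
Qed.

Lemma is_arc_cover a : is_arc X O a -> exists w, cl (through w) a.
Proof.
move=> Xa; case: (classic (nonconst a)) => [na|na].
  by have [w ta] := lift_exists nss gr Xa na; exists w; apply: sub_cl.
have /card_gt0P[w _] := vertex_nonempty G.
by exists w; apply: (constant_arc_closure nss gr).
Qed.

(** A generic arc has to be nonzero at every P that is nonzero somewhere on [through w]. Each such P
    is nonzero at some K-valued arc, finitely many P at a common one by irreducibility, so a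
    suitable ultraproduct of these arcs works for all P. *)
Lemma ex_generic w : exists a, generic_arc (cl (through w)) a.
Proof.
pose Ix := {MP : {M : nat & {mpoly K[n * M]}} |
  exists b : 'I_N -> nat -> K, through w (Karc_arc b) /\ eval_arc (projT2 MP) (Karc_arc b) != 0}.
have [b Hb] := choice (fun (i : Ix) (b : 'I_N -> nat -> K) => through w (Karc_arc b) /\
  eval_arc (projT2 (sval i)) (Karc_arc b) != 0) (fun i => proj2_sig i).
have mk M (P : {mpoly K[n * M]}) : (exists2 a, through w a & eval_arc P a != 0) ->
    exists i : Ix, sval i = existT _ M P.
  move=> [a ta Pa]; have [c [_ tc Pc _]] := through_common ta ta Pa Pa.
  by exists (exist _ (existT _ M P) (ex_intro _ c (conj tc Pc))).
pose S (i j : Ix) := eval_arc (projT2 (sval i)) (Karc_arc (b j)) != 0.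
have [|i|i j|U HU] := @ex_ultrafilter Ix Ix S.
- have [c _ tc] := ex_Karc w; have [|i _] := @mk 0%N 1; last by constructor.
  by exists (Karc_arc c) => //; rewrite eval_arc1 oner_neq0.
- by exists i; have [] := Hb i.
- have [[ti Pi] [tj Pj]] := (Hb i, Hb j).
  have [c [_ tc Pc Qc]] := through_common ti tj Pi Pj.
  set M1 := projT1 (sval i) in Pi Pc *; set M2 := projT1 (sval j) in Pj Qc *.
  have [P' HP'] := eval_arc_widen (projT2 (sval i)) (leq_maxl M1 M2).
  have [Q' HQ'] := eval_arc_widen (projT2 (sval j)) (leq_maxr M1 M2).
  have [|l El] := @mk _ (P' * Q').
    by exists (Karc_arc c) => //; rewrite eval_arcM HP' HQ' mulf_neq0.
  exists l => k; rewrite /S El /= eval_arcM HP' HQ' mulf_eq0 negb_or => /andP[]; split=> //.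
pose a := Arc (@udiag Ix K U : {rmorphism K -> upower K U}) (fun i k => @uclass Ix K U (fun j => xpart (b j) i k)).
have Ea M (P : {mpoly K[n * M]}) : eval_arc P a = @uclass Ix K U (fun j => eval_arc P (Karc_arc (b j))).
  rewrite eval_arc_jet -[RHS](@uclass_mmap Ix K U _ (fun l j => jet (xpart (b j)) (M := M) l) P).
  rewrite /mmap; apply: eq_bigr => mu _; congr (_ * _); rewrite /mmap1; apply: eq_bigr => l _; congr (_ ^+ _).
  case/mxvec_indexP: l => i k; rewrite jetE; congr uclass;
    apply: functional_extensionality => j; by rewrite jetE.
exists a; split=> [M P HP|c Hc M P HP].
  rewrite Ea; apply/uclassP; apply: ultraS (ultraT U) => j _.
  exact: (HP (Karc_arc (b j)) (proj1 (Hb j))).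
have Pa := HP _ erefl; apply: Hc => d td; apply/eqP/negPn/negP => Pd.
have [|i Ei] := mk M P; first by exists d.
move: Pa; rewrite Ea => /uclassP Pa; apply: (ultra0 (u := U)).
by apply: ultraS (ultraI Pa (HU i)) => j []; rewrite /S Ei /= => ->; rewrite eqxx.
Qed.
End Setup.

Section Setup.
Variables (G : weighted_graph) (K : closedFieldType) (n m : nat) (X : 'rV[K]_n -> Prop)
  (O : 'rV[K]_n) (Y : 'rV[K]_(n + m.+1) -> Prop) (E : G -> 'rV[K]_(n + m.+1) -> Prop).
Hypotheses (nss : normal_surface_singularity X O) (gr : good_resolution_with_graph X O Y E).
Local Notation N := (n + m.+1)%N.
Local Notation R := {mpoly K[N]}.
Local Notation og := (og gr).
Local Notation M := (M gr).
Local Notation MH := (MH gr).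
Local Notation H j := (fun f : R => is_true (yhomog j f)).
Local Notation tau := (tau gr).
Implicit Types (f g : R) (u v w : G) (z : 'rV[K]_N) (D : G -> nat).
Local Notation scK := (subst_coef (@idK K)).
Local Notation through w := (arcs_through X O Y (E w)).
Local Notation cl := (@arc_closure K n).
Hypothesis noarrow : forall u v, u != v -> ~ psub (through v) (cl (through u)).

Lemma through_sub u v : psub (through v) (cl (through u)) -> u = v.
Proof. by move=> H; apply/eqP/negPn/negP => uv; apply: (noarrow uv). Qed.

Lemma irreducible_in_through (Z : arc K n -> Prop) : irreducible_for cl Z -> psub Z (is_arc X O) ->
  exists w, psub Z (cl (through w)).
Proof.
move=> iZ ZX; apply: (irreducible_finite (s := enum G) iZ) => [w|a /ZX /(is_arc_cover nss gr)[w Ha]].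
  exact: cl_idem.
by exists w; rewrite ?mem_enum.
Qed.

Lemma through_component w : arc_component X O (cl (through w)).
Proof.
split; [exact: cl_idem|by apply: cl_irreducible; apply: through_irreducible| |].
  by apply: is_arc_closed; apply: through_arc.
move=> Z cZ iZ ZX wZ; have [w' ZW] := irreducible_in_through iZ ZX.
have <- // : w' = w by apply: through_sub => a /sub_cl /wZ /ZW.
Qed.

Lemma component_through C : arc_component X O C -> exists w, C = cl (through w).
Proof.
move=> [cC iC CX maxC]; have [w Cw] := irreducible_in_through iC CX; exists w.
apply: pred_ext => a; split; first exact: Cw.
have [cw iw wX _] := through_component w; exact: (maxC _ cw iw wX Cw).
Qed.

(** A generic arc is not constant, since some arc of N_(E_w) is not. Its lifting meets some E_w', so
    N_(E_w) is in the closure of N_(E_w'), and the absence of arrows gives w' = w. *)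
Lemma generic_through w a : generic_arc (cl (through w)) a -> through w a.
Proof.
move=> [Ca Ha]; have Xa : is_arc X O a by apply: is_arc_closed Ca; apply: through_arc.
have na : nonconst a.
  have [t [k [b [k0 Kb bk]]]] := ex_Karc_nonconst nss gr w.
  have tb : through w (Karc_arc b) by apply: Karc_through => //; exists t, k.
  pose T : {mpoly K[n * k.+1]} := 'X_(mxvec_index t ord_max).
  have ET c : eval_arc T c = arc_coef c t k by rewrite eval_arc_jet mmapX mmap1U jetE.
  exists t, k; split=> //; apply/eqP => ak; case/eqP: bk.
  have := Ha _ (sub_cl tb) _ T; rewrite ET; apply => c ->; by rewrite ET.
have [w' tw'] := lift_exists nss gr Xa na.
have <- // : w' = w; apply: through_sub => c tc.
by apply: (cl_mono (S := fun b => b = a)); [move=> _ ->|apply: Ha; apply: sub_cl].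
Qed.

Lemma generic_unique w w' a : generic_arc (cl (through w)) a -> through w' a -> w' = w.
Proof.
move=> [_ Ha] ta; apply: through_sub => c /sub_cl /Ha.
by apply: cl_mono => _ ->.
Qed.

Lemma nash_of_essential : (forall v, essential X O Y (E v)) -> nash_bijective X O Y E.
Proof.
move=> ess; have Hn w : nash X O Y E (cl (through w)) w.
  split; first exact: ess.
  by have [a Ha] := ex_generic nss gr w; exists a => //; apply: generic_through.
split=> [C /component_through[w ->]|v _].
  exists w; split=> // w' [_ [a Ha ta]]; exact/esym/(generic_unique Ha ta).
exists (cl (through v)); split=> //; first exact: through_component.
move=> C' /component_through[w ->] [_ [a Ha ta]].
by rewrite (generic_unique Ha ta).
Qed.
End Setup.

(** * Essential components *)

Section Setup.
Variables (G : weighted_graph) (K : closedFieldType) (n m : nat) (X : 'rV[K]_n -> Prop)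
  (O : 'rV[K]_n) (Y : 'rV[K]_(n + m.+1) -> Prop) (E : G -> 'rV[K]_(n + m.+1) -> Prop).
Hypotheses (nss : normal_surface_singularity X O) (gr : good_resolution_with_graph X O Y E).
Local Notation N := (n + m.+1)%N.
Local Notation R := {mpoly K[N]}.
Local Notation og := (og gr).
Local Notation M := (M gr).
Local Notation MH := (MH gr).
Local Notation H j := (fun f : R => is_true (yhomog j f)).
Local Notation tau := (tau gr).
Implicit Types (f g : R) (u v w : G) (z : 'rV[K]_N) (D : G -> nat).
Local Notation scK := (subst_coef (@idK K)).
Local Notation through w := (arcs_through X O Y (E w)).
Local Notation cl := (@arc_closure K n).
Hypothesis noarrow : forall u v, u != v -> ~ psub (through v) (cl (through u)).

Section Essential.
Variables (v : G) (m' : nat) (Y' : 'rV[K]_(n + m'.+1) -> Prop).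
Hypothesis res' : resolution X O Y'.
Local Notation N' := (n + m'.+1)%N.
Local Notation R' := {mpoly K[N']}.

Definition graph_map (F : 'I_m'.+1 -> R) (i : 'I_N') : R :=
  match split i with inl a => 'X_(lshift m.+1 a) | inr j => F j end.
Definition pullback F : R' -> R := compose (graph_map F).

Lemma evalp_pullback F (f : R') z :
  evalp (pullback F f) z = evalp f (row_mx (lsubmx z) (eval_tuple F z)).
Proof.
pose Q (f : R') := evalp (pullback F f) z = evalp f (row_mx (lsubmx z) (eval_tuple F z)).
apply: (@mpoly_ring_ind _ _ Q) => [c|i|p q Hp Hq|p q Hp Hq]; rewrite /Q /pullback /compose.
- by rewrite mmapC !evalpC.
- rewrite mmapX mmap1U evalpXU mxE /graph_map; case: splitP => j _; first by rewrite evalpXU mxE.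
  by rewrite mxE.
- by rewrite mmapD !evalpD -/(pullback F p) -/(pullback F q) Hp Hq.
- by rewrite mmap_mul !evalpM -/(pullback F p) -/(pullback F q) Hp Hq.
Qed.

Lemma xdiff_van z : lsubmx z <> O -> exists t, evalp (xdiff m O t) z != 0.
Proof.
move=> zO; apply: NNPP => Hn; apply: zO; apply/rowP => i; apply: NNPP => zi; apply: Hn; exists i.
by rewrite /xdiff !evalpE subr_eq0; apply/eqP => E1; apply: zi; rewrite mxE.
Qed.

Lemma rep_pullback F d (f : R') : represents_birational O Y Y' F -> ideal_deg Y' d f ->
  (exists j, ~ vanishes (F j) Y) -> vanishes (pullback F f) Y.
Proof.
move=> [_ HF] [_ fY'] [j nj]; have [_ _ pY] := primeY gr; have [t nt] := xdiff_notY nss gr.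
have : vanishes (xdiff m O t * (F j * pullback F f)) Y.
  move=> z Yz; rewrite !evalpM; case: (classic (lsubmx z = O)) => [Oz|zO].
    by rewrite /xdiff !evalpE -Oz mxE subrr mul0r.
  case: (eqVneq (eval_tuple F z) 0) => [/rowP/(_ j)|Fz]; first by rewrite !mxE => ->; rewrite mul0r mulr0.
  by rewrite evalp_pullback fY' ?mulr0 //; apply: HF.
by case/pY => // /pY[].
Qed.

Lemma eval_tuple_neq0 p (F : 'I_p.+1 -> R) z : eval_tuple F z != 0 -> exists j, evalp (F j) z != 0.
Proof.
move=> Fz; apply: NNPP => Hn; case/negP: Fz; apply/eqP/rowP => j; rewrite !mxE.
by apply/eqP/negPn/negP => nj; apply: Hn; exists j.
Qed.

Section Graph.
Variables (x1 : 'rV[K]_n) (F' : 'I_m'.+1 -> {mpoly K[n]}) (j1 : 'I_m'.+1).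
Hypotheses (Xx1 : X x1) (x1O : x1 <> O) (Fj1 : evalp (F' j1) x1 != 0).
Hypothesis HF' : forall x', X x' -> x' <> O -> eval_tuple F' x' != 0 ->
  forall y, Y' (row_mx x' y) <-> exists2 c : K, c != 0 & y = c *: eval_tuple F' x'.

Lemma tuple_neq0 x j : evalp (F' j) x != 0 -> eval_tuple F' x != 0.
Proof. by move=> Fj; apply/eqP => /rowP/(_ j); rewrite !mxE => F0; rewrite F0 eqxx in Fj. Qed.

Lemma widenF_notY : ~ vanishes (widen m (F' j1)) Y.
Proof.
have [F Fx HF] := res_iso (gr_resolution gr) Xx1 x1O.
have Yx : Y (row_mx x1 (eval_tuple F x1)).
  by apply/(HF x1 Xx1 x1O Fx); exists 1; rewrite ?oner_neq0 ?scale1r.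
by apply: (evalp_neq0_vanishes Yx); rewrite evalp_widen row_mxKl.
Qed.

Lemma density g : (forall z, Y z -> lsubmx z <> O -> eval_tuple F' (lsubmx z) != 0 -> evalp g z = 0) ->
  vanishes g Y.
Proof.
move=> Hg; have [_ _ pY] := primeY gr; have [t nt] := xdiff_notY nss gr.
have : vanishes (xdiff m O t * (widen m (F' j1) * g)) Y.
  move=> z Yz; rewrite !evalpM evalp_widen; case: (classic (lsubmx z = O)) => [Oz|zO].
    by rewrite /xdiff !evalpE -Oz mxE subrr mul0r.
  case: (eqVneq (evalp (F' j1) (lsubmx z)) 0) => [->|/tuple_neq0 Fz]; first by rewrite mul0r mulr0.
  by rewrite Hg // !mulr0.
by case/pY => // /pY[] // /widenF_notY.
Qed.

Lemma rep_cross F1 F2 : represents_birational O Y Y' F1 -> represents_birational O Y Y' F2 ->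
  forall j l, vanishes (F1 j * F2 l - F1 l * F2 j) Y.
Proof.
move=> [_ H1] [_ H2] j l; apply: density => z Yz zO Fz; rewrite evalpB !evalpM.
have Xz := res_over (gr_resolution gr) Yz.
have val F : (eval_tuple F z != 0 -> Y' (row_mx (lsubmx z) (eval_tuple F z))) ->
    exists c, forall j, evalp (F j) z = c * evalp (F' j) (lsubmx z).
  case: (eqVneq (eval_tuple F z) 0) => [/rowP F0 _|F0 /(_ isT) /(HF' Xz zO Fz)[c _ /rowP Ec]].
    by exists 0 => i; have := F0 i; rewrite !mxE mul0r.
  by exists c => i; have := Ec i; rewrite !mxE.
have [c1 Hc1] := val _ (H1 z Yz zO); have [c2 Hc2] := val _ (H2 z Yz zO).
by rewrite !Hc1 !Hc2; ring.
Qed.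

(** The coordinates F' of X --> Y' may all vanish on E_v. Dividing them by tau^c, with c their least
    order along E_v, gives a representation that is nonzero at the generic point of E_v; al clears
    denominators. *)
Lemma ex_rep : exists (Gr : 'I_m'.+1 -> R) (c : nat) (al : R) (j0 : 'I_m'.+1),
  [/\ represents_birational O Y Y' Gr, hom al /\ ~ vanishes al (E v),
      forall j, vanishes (al * widen m (F' j) - Gr j * tau v ^+ c) Y,
      forall j, og v c (widen m (F' j))
    & ~ og v c.+1 (widen m (F' j0)) /\ ~ vanishes (Gr j0) (E v)].
Proof.
have hF j : hom (widen m (F' j)) by exists 0%N; apply: widen_hom.
have [|c [[j0 nj0] minc]] := @ex_min_nat (fun k => exists j, ~ og v k.+1 (widen m (F' j))).
  by have [k _ nk] := exact_order nss gr v widenF_notY; exists k, j1.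
have Oc j : og v c (widen m (F' j)).
  case: c nj0 minc => [|c] _ minc; first exact: og0.
  by apply: NNPP => nO; have := minc c (ex_intro _ j nO); rewrite ltnn.
have [dt htau] := tau_hom gr v.
have Hj j : exists a b, [/\ hom a, hom b, ~ vanishes a (E v)
    & vanishes (a * widen m (F' j) - b * tau v ^+ c) Y].
  have [a [b [na Hab]]] := Oc j.
  exact: (hom_cofactor gr (vanishes_ideal (E v)) (hF j) (homX c (tau_hom gr v)) na Hab).
have [a Ha] := choice _ Hj; have [b Hb] := choice _ Ha.
have [z Ez] := E_nonempty gr v; have [l zl] := ex_ycoord (E_neq0 gr Ez).
have nyl : ~ vanishes ('X_(rshift n l) : R) (E v).
  by apply: (evalp_neq0_vanishes Ez); rewrite evalp_yvar.
pose yl : R := 'X_(rshift n l) ^+ (c * dt).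
pose al := yl * \prod_j a j.
have pE := primeE gr v.
have [[A hA] nal] : hom al /\ ~ vanishes al (E v).
  split.
    apply: homM; first by apply: homX; exists 1%N; apply: yhomogy.
    by apply: hom_prod => j _; have [] := Hb j.
  apply: (primeMn pE); first by move=> /(primeX pE).
  by apply: (prime_prod pE) => j; have [] := Hb j.
have [B HB] : hom (\prod_j a j) by apply: hom_prod => j _; have [] := Hb j.
have hA' : yhomog (c * dt + B) al.
  apply: yhomogM => //; rewrite -[(c * dt)%N]muln1; apply: yhomogMn; exact: yhomogy.
(* All quotients are brought to the denominator al, whose factor yl makes its degree at least that
   of tau^c; the component of degree B is then the homogeneous quotient. *)
pose G0 j := yl * (\prod_(i | i != j) a i) * b j.
pose Gr j := hcomp B (G0 j).
have htc : yhomog (c * dt) (tau v ^+ c) by apply: yhomogMn.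
have EG j : vanishes (al * widen m (F' j) - Gr j * tau v ^+ c) Y.
  have E0 : vanishes (al * widen m (F' j) - G0 j * tau v ^+ c) Y.
    have -> : al * widen m (F' j) - G0 j * tau v ^+ c =
        yl * (\prod_(i | i != j) a i) * (a j * widen m (F' j) - b j * tau v ^+ c).
      by rewrite /al (bigD1 j) //= /G0; ring.
    by apply: (idealMl (idealY Y)); have [] := Hb j.
  have hw : yhomog (c * dt + B) (al * widen m (F' j)).
    by rewrite -[(c * dt + B)%N]addn0; apply: yhomogM => //; apply: widen_hom.
  have := vanishes_hcomp (c * dt + B) (coneY gr) E0.
  by rewrite hcompB (hcomp_id hw) [G0 j * _]mulrC (hcompM _ _ htc) mulrC [tau v ^+ c * _]mulrC [widen _ _ * _]mulrC.
have nG : ~ vanishes (Gr j0) (E v).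
  move=> GE; apply: nj0; apply: (og_cancel nal).
  apply: (@og_Y_congr _ _ _ _ _ _ _ _ gr _ _ (Gr j0 * tau v ^+ c)).
    by rewrite -opprB; apply: (idealN (idealY Y)).
  rewrite -add1n; apply: ogM; first exact/(og1P gr).
  by apply: og_vanX; apply: tau_E.
have nalY : ~ vanishes al Y by move=> H1; apply: nal; apply: (vanY_E gr).
have [_ _ pY] := primeY gr.
exists Gr, c, al, j0; split=> //; last first.
  by split=> //; exists A.
split; first by exists B => j; apply: hcompP.
move=> z' Yz' zO Gz; apply: (proj_closedP (res_closed res')); first by rewrite row_mxKr.
move=> d f hf fY'; rewrite -evalp_pullback.
suff : vanishes (al * (tau v * pullback Gr f)) Y.
  by case/pY => // /pY[/(tau_notY nss)//|]; apply.
apply: density => y Yy yO Fy.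
rewrite (evalpM al) (evalpM (tau v)).
case: (eqVneq (evalp al y) 0) => [->|aly]; first by rewrite mul0r.
case: (eqVneq (evalp (tau v) y) 0) => [->|ty]; first by rewrite mul0r mulr0.
have -> : evalp (pullback Gr f) y = 0; last by rewrite !mulr0.
rewrite evalp_pullback; apply: fY'; apply/(HF' (res_over (gr_resolution gr) Yy) yO Fy).
exists (evalp al y / evalp (tau v) y ^+ c).
  by rewrite mulf_neq0 // invr_eq0 expf_neq0.
apply/rowP => j; rewrite !mxE; have := EG j y Yy; rewrite evalpB (evalpM al) (evalpM (Gr j)) (evalpX (tau v)) evalp_widen => /eqP.
rewrite subr_eq0 => /eqP Ej; apply: (mulIf (expf_neq0 c ty)); rewrite -Ej.
by rewrite mulrAC divfK // expf_neq0.
Qed.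
End Graph.
End Essential.
End Setup.

Section Setup.
Variables (G : weighted_graph) (K : closedFieldType) (n m : nat) (X : 'rV[K]_n -> Prop)
  (O : 'rV[K]_n) (Y : 'rV[K]_(n + m.+1) -> Prop) (E : G -> 'rV[K]_(n + m.+1) -> Prop).
Hypotheses (nss : normal_surface_singularity X O) (gr : good_resolution_with_graph X O Y E).
Local Notation N := (n + m.+1)%N.
Local Notation R := {mpoly K[N]}.
Local Notation og := (og gr).
Local Notation M := (M gr).
Local Notation MH := (MH gr).
Local Notation tau := (tau gr).
Implicit Types (u v : G) (z : 'rV[K]_N) (D : G -> nat).
Local Notation scK := (subst_coef (@idK K)).
Local Notation through w := (arcs_through X O Y (E w)).
Local Notation cl := (@arc_closure K n).
Hypothesis noarrow : forall u v, u != v -> ~ psub (through v) (cl (through u)).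

Section Essential.
Variables (v : G) (m' : nat) (Y' : 'rV[K]_(n + m'.+1) -> Prop).
Hypothesis res' : resolution X O Y'.
Local Notation N' := (n + m'.+1)%N.
Local Notation R' := {mpoly K[N']}.
Local Notation T := (birational_transform O Y Y' (E v)).
Local Notation rep F := (represents_birational O Y Y' F).

Variables (x1 : 'rV[K]_n) (F' : 'I_m'.+1 -> {mpoly K[n]}) (j1 : 'I_m'.+1).
Hypotheses (Xx1 : X x1) (x1O : x1 <> O) (Fj1 : evalp (F' j1) x1 != 0).
Hypothesis HF' : forall x', X x' -> x' <> O -> eval_tuple F' x' != 0 ->
  forall y, Y' (row_mx x' y) <-> exists2 c : K, c != 0 & y = c *: eval_tuple F' x'.
Variables (Gr : 'I_m'.+1 -> R) (c : nat) (al : R) (j0 : 'I_m'.+1).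
Hypotheses (repG : rep Gr) (hal : hom al) (nal : ~ vanishes al (E v)).
Hypothesis EG : forall j, vanishes (al * widen m (F' j) - Gr j * tau v ^+ c) Y.
Hypothesis Oc : forall j, og v c (widen m (F' j)).
Hypotheses (nO : ~ og v c.+1 (widen m (F' j0))) (nG : ~ vanishes (Gr j0) (E v)).

Let cY' := res_closed res'.
Let pE := primeE gr v.
Let EY := @E_Y _ _ _ _ _ _ _ _ gr v.
Let smY := res_smooth (gr_resolution gr).

Let transform_points (w : 'rV[K]_N') := exists (F : 'I_m'.+1 -> R) z,
  [/\ rep F, E v z, eval_tuple F z != 0 & w = row_mx (lsubmx z) (eval_tuple F z)].

(** By [rep_cross] all representations of the map are proportional on E_v, so the transform can be
    tested on Gr alone. *)
Lemma pullback_points d (f : R') : yhomog d f -> vanishes (pullback Gr f) (E v) ->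
  vanishes f transform_points.
Proof.
move=> hf fE _ [F [z [repF Ez Fz ->]]]; have [j Fj] := eval_tuple_neq0 Fz.
have cross := rep_cross nss gr Xx1 x1O Fj1 HF' repF repG.
have nFE : ~ vanishes (F j) (E v) := evalp_neq0_vanishes Ez Fj.
have nGj : ~ vanishes (Gr j) (E v).
  move=> GE; have : vanishes (F j * Gr j0) (E v).
    move=> y Ey; have := cross j j0 y (EY Ey); rewrite evalpB !evalpM (GE y Ey) mulr0 subr0 => ->.
    by [].
  by have [_ _ pM] := pE; case/pM.
suff /(_ z Ez) : vanishes (pullback F f) (E v) by rewrite evalp_pullback.
have : vanishes (Gr j ^+ d * pullback F f) (E v).
  move=> y Ey; rewrite evalpM evalpX evalp_pullback.
  have <- : evalp f (yscale (evalp (F j) y) (row_mx (lsubmx y) (eval_tuple Gr y))) =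
     evalp (Gr j) y ^+ d * evalp f (row_mx (lsubmx y) (eval_tuple F y)).
    rewrite -(evalp_yscale _ _ hf) /yscale !row_mxKl !row_mxKr; congr (evalp f (row_mx _ _)).
    apply/rowP => l; rewrite !mxE; have := cross j l y (EY Ey); rewrite evalpB !evalpM => /eqP.
    by rewrite subr_eq0 => /eqP ->; rewrite mulrC.
  rewrite (evalp_yscale _ _ hf) -evalp_pullback fE ?mulr0 //.
by have [_ _ pM] := pE; case/pM => // /(primeX pE).
Qed.

Lemma points_pullback d (f : R') : yhomog d f -> vanishes f transform_points ->
  vanishes (pullback Gr f) (E v).
Proof.
move=> hf fZ; have : vanishes (Gr j0 * pullback Gr f) (E v).
  move=> z Ez; rewrite evalpM; case: (eqVneq (evalp (Gr j0) z) 0) => [->|Gz]; first by rewrite mul0r.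
  rewrite evalp_pullback fZ ?mulr0 //; exists Gr, z; split=> //.
  by apply/eqP => /rowP/(_ j0); rewrite !mxE => G0; rewrite G0 eqxx in Gz.
by have [_ _ pM] := pE; case/pM.
Qed.

Lemma points_T : psub transform_points T.
Proof.
move=> w Hw; apply: sub_proj_closure => //.
by have [F [z [_ _ Fz ->]]] := Hw; rewrite row_mxKr.
Qed.

Lemma T_vanishes d (f : R') : yhomog d f -> vanishes f T <-> vanishes f transform_points.
Proof.
move=> hf; split=> H w; first by move=> /points_T; apply: H.
by move=> [_]; apply=> //; exact: hf.
Qed.

Lemma T_exceptional : psub T (exceptional O Y').
Proof.
move=> w [w0 Hw]; apply: (proj_closedP (exceptional_closed O cY') w0) => d f hf fX; apply: (Hw d) => //.
move=> _ [F [z [repF Ez Fz ->]]]; apply: fX; split; last by rewrite row_mxKl (E_O gr Ez).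
apply: (proj_closedP cY'); first by rewrite row_mxKr.
move=> e g hg gY'; rewrite -evalp_pullback; apply: (rep_pullback nss gr repF (conj hg gY')).
  by have [j Fj] := eval_tuple_neq0 Fz; exists j; apply: (evalp_neq0_vanishes (EY Ez)).
exact: EY.
Qed.

Lemma T_irreducible : irreducible_for (@proj_closure K n m') T.
Proof.
have ex (f g : R') d e : yhomog d f -> yhomog e g -> ~ vanishes f T -> ~ vanishes g T ->
    exists w, [/\ T w, evalp f w != 0 & evalp g w != 0].
  move=> hf hg nf ng; have Hf : ~ vanishes (pullback Gr f) (E v).
    by move=> H; apply: nf; apply/(T_vanishes hf); apply: (pullback_points hf).
  have Hg : ~ vanishes (pullback Gr g) (E v).
    by move=> H; apply: ng; apply/(T_vanishes hg); apply: (pullback_points hg).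
  have [z [Ez Gz fz gz]] := not_vanishes3 pE nG Hf Hg.
  rewrite !evalp_pullback in fz gz.
  exists (row_mx (lsubmx z) (eval_tuple Gr z)); split=> //; apply: points_T; exists Gr, z; split=> //.
  by apply/eqP => /rowP/(_ j0); rewrite !mxE => G0; rewrite G0 eqxx in Gz.
have T0 w : T w -> rsubmx w != 0 by case.
have n1 : ~ vanishes (1 : R') T.
  have h1 : yhomog 0 (1 : R') by rewrite -mpolyC1; apply: yhomogC.
  move=> /(T_vanishes h1)/(points_pullback h1); have [z Ez] := E_nonempty gr v.
  by move=> /(_ z Ez)/eqP; rewrite evalp_pullback evalp1 oner_eq0.
have h1 : yhomog 0 (1 : R') by rewrite -mpolyC1; apply: yhomogC.
split; first by have [w [Tw _ _]] := ex _ _ _ _ h1 h1 n1 n1; exists w.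
move=> A B cA cB TAB; apply: NNPP => /not_or_and[nA nB].
have sep C : closed_for (@proj_closure K n m') C -> ~ psub T C ->
    exists d (f : R'), [/\ yhomog d f, vanishes f C & ~ vanishes f T].
  move=> cC nC; have [w [Tw nCw]] : exists w, T w /\ ~ C w.
    by apply: NNPP => Hn; apply: nC => w Tw; apply: NNPP => nCw; apply: Hn; exists w.
  have [d [f [hf fC fw]]] := proj_separate cC (T0 _ Tw) nCw.
  by exists d, f; split=> //; apply: (evalp_neq0_vanishes Tw).
have [d [f [hf fA nf]]] := sep A cA nA; have [e [g [hg gB ng]]] := sep B cB nB.
have [w [Tw fw gw]] := ex f g d e hf hg nf ng.
by case: (TAB w Tw) => [/fA E0|/gB E0]; [rewrite E0 eqxx in fw|rewrite E0 eqxx in gw].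
Qed.

Section Maximal.
Variable W : 'rV[K]_N' -> Prop.
Hypotheses (cW : closed_for (@proj_closure K n m') W) (iW : irreducible_for (@proj_closure K n m') W)
  (WX : psub W (exceptional O Y')) (TW : psub T W).
Let pW := irreducible_prime cW iW.
Let WY : psub W Y'. Proof. by move=> w /WX[]. Qed.
Let smY' := res_smooth res'.

Let S a := exists2 b, Karc Y' W b & a = Karc_arc b.

Lemma S_arc : psub S (is_arc X O).
Proof.
move=> _ [b [j [bY bW]] ->]; have lb := Karc_lift (ex_intro _ j (conj bY bW)); split=> [i|f fX k] /=.
  have [Ws _] := bW; have [_ /rowP/(_ i)] := WX Ws.
  by rewrite !mxE.
rewrite -sc_widen; apply: (lift_Y lb (d := 0)); split; first exact: widen_hom.
by move=> z Yz; rewrite evalp_widen; apply: fX; apply: (res_over res').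
Qed.

Lemma S_irreducible : irreducible_for cl S.
Proof.
split.
  have [[w Ww] _] := iW; have [j wj] := ex_ycoord (proj_closed_neq0 cW Ww).
  have cw := chart_normalize (proj_closed_cone cW) Ww wj.
  exists (Karc_arc (const_arc (normalize j w))); exists (const_arc (normalize j w)) => //.
  exists j; split; last by rewrite start_const.
  by apply: const_arc_in; apply: (chart_sub WY).
move=> A B cA cB H; apply: NNPP => /not_or_and[nA nB].
have ex C : closed_for cl C -> ~ psub S C -> exists M (P : {mpoly K[n * M]}) b,
    [/\ Karc Y' W b, forall a, C a -> eval_arc P a = 0 & eval_arc P (Karc_arc b) != 0].
  move=> cC nC; have [b [Kb nCb]] : exists b, Karc Y' W b /\ ~ C (Karc_arc b).
    by apply: NNPP => Hn; apply: nC => _ [b Kb ->]; apply: NNPP => nCb; apply: Hn; exists b.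
  by have [M [P [HP Pb]]] := not_cl cC nCb; exists M, P, b.
have [M1 [P [b1 [K1 PA Pb]]]] := ex A cA nA; have [M2 [Q [b2 [K2 QB Qb]]]] := ex B cB nB.
have [P' HP'] := eval_arc_widen P (leq_maxl M1 M2); have [Q' HQ'] := eval_arc_widen Q (leq_maxr M1 M2).
have [||b [Kb Pb3 Qb3]] := Karc_irreducible cY' cW pW WY smY' K1 K2 (P := P') (Q := Q').
- by rewrite -[X in X != 0]/(eval_arc P' (Karc_arc b1)) HP'.
- by rewrite -[X in X != 0]/(eval_arc Q' (Karc_arc b2)) HQ'.
case: (H (Karc_arc b) (ex_intro2 _ _ b Kb erefl)) => [/PA E0|/QB E0].
  by case/eqP: Pb3; rewrite -[LHS]/(eval_arc P' (Karc_arc b)) HP'.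
by case/eqP: Qb3; rewrite -[LHS]/(eval_arc Q' (Karc_arc b)) HQ'.
Qed.

(** Gr carries an arc through E_v, started where its coordinate j0 is nonzero, to an arc on Y'
    through T and hence through W. A polynomial that is nonzero somewhere on N_(E_v) is nonzero at
    such an arc. *)
Lemma through_cl_S : psub (through v) (cl S).
Proof.
move=> a ta M P HP; apply/eqP/negPn/negP => Pa.
have [b Kb Pb] := through_descent gr ta Pa.
have [b' [Kb' Pb' Gb']] := Karc_move (clE gr v) pE EY smY Kb Pb
  (ex_intro _ (proj1_sig (constructive_indefinite_description _ (proj1 repG)))
    (proj2_sig (constructive_indefinite_description _ (proj1 repG)) j0)) nG.
have lb' := Karc_lift Kb'.
pose bl : 'I_N' -> nat -> K := fun i => subst_coef (@idK K) (graph_map Gr i) b'.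
have Ebl (f : R') k : subst_coef (@idK K) f bl k = subst_coef (@idK K) (pullback Gr f) b' k.
  by rewrite /pullback sc_compose.
have bly j k : bl (rshift n j) k = subst_coef (@idK K) (Gr j) b' k.
  rewrite /bl /graph_map; case: splitP => [i /= E1|i /= E1]; first by have := ltn_ord i; lia.
  by have -> : i = j by apply/val_inj/esym/(addnI E1).
have blx i k : bl (lshift m'.+1 i) k = b' (lshift m.+1 i) k.
  rewrite /bl /graph_map; case: splitP => [i' /= E1|i' /= E1]; last by have := ltn_ord i; lia.
  by rewrite scX; have -> : i' = i by apply/val_inj.
have bl0 : bl (rshift n j0) 0%N != 0 by rewrite bly sc_eval.
have lbl : lift Y' W (@idK K) bl.
  split=> [|d f Hf k|d f [hf fW]]; first by exists j0.
    rewrite Ebl (lift_vanY gr lb') //; apply: (rep_pullback nss gr repG Hf).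
    by exists j0 => GY; apply: nG; apply: (vanY_E gr).
  rewrite Ebl (lift_vanE gr lb') //; apply: (points_pullback hf) => w /points_T /TW; exact: fW.
have [b2 [Y2 E2 x2]] := Karc_of_series cY' cW lbl bl0.
have Sb : S (Karc_arc b2) by exists b2 => //; exists j0.
case/eqP: Pb'; rewrite -[RHS](HP _ Sb); apply: jet_agree => i l _.
exact: (esym (etrans (x2 i l) (blx i l))).
Qed.

Lemma S_through : psub S (cl (through v)).
Proof.
have [|w Hw] := irreducible_in_through nss gr (cl_irreducible S_irreducible).
  by apply: is_arc_closed; apply: S_arc.
have Ew : w = v by apply: (through_sub noarrow) => a /through_cl_S /Hw.
by move=> a /sub_cl /Hw; rewrite Ew.
Qed.

(** Otherwise some f vanishes on T but not on W. Along K-valued arcs through E_v the vector phi of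
    t^c-coefficients of F' is a multiple of Gr at the start, so f(O, phi) = 0; this closed condition
    passes to the arcs through W. If phi is nonzero for such an arc, the y-part of its start is a
    multiple of phi, so f vanishes at the start, although the start can be moved off f = 0. *)
Lemma W_T : psub W T.
Proof.
move=> w0 Ww0; apply: NNPP => nT.
have [d [f [hf fT fw0]]] := proj_separate (proj_closure_closed _ : closed_for (@proj_closure K n m') T)
  (proj_closed_neq0 cW Ww0) nT.
have nfW : ~ vanishes f W := evalp_neq0_vanishes Ww0 fw0.
have fE := points_pullback hf (proj1 (T_vanishes hf) fT).
have HC j i : (i < c.+1)%N -> exists C : {mpoly K[n * c.+1]}, forall (L : fieldType) (iota : {rmorphism K -> L}) b,
   mmap iota (jet b (M := c.+1)) C = subst_coef iota (F' j) b i by apply: coef_poly_universal.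
have low b j i : Karc Y' W b -> (i < c)%N -> subst_coef (@idK K) (F' j) (xpart b) i = 0.
  move=> Kb ic; have [C HCi] := HC j i (ltnW ic : (i < c.+1)%N).
  have := S_through (ex_intro2 _ _ b Kb erefl : S (Karc_arc b)) _.
  move=> /(_ _ C); rewrite eval_arc_jet HCi; apply=> a /(through_lift)[b' [lb' Hx]].
  rewrite eval_arc_jet HCi (sc_ext _ _ _ (b' := xpart b')) => [|i' l]; last by rewrite Hx.
  by rewrite -sc_widen; apply: (lift_og nss lb' (ex_intro _ 0%N (widen_hom _ _)) (Oc j)).
have [C HCc] := choice _ (fun j => HC j c (ltnSn c)).
pose Q : {mpoly K[n * c.+1]} := compose (fun i : 'I_N' => match split i with
  inl a => (O 0 a)%:MP | inr j => C j end) f.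
have EQ (x : 'I_n -> nat -> K) : mmap (@idK K) (jet x (M := c.+1)) Q =
    evalp f (row_mx O (\row_j subst_coef (@idK K) (F' j) x c)).
  pose Pq (g : R') := mmap (@idK K) (jet x (M := c.+1)) (compose (fun i : 'I_N' => match split i with
    inl a => (O 0 a)%:MP | inr j => C j end) g) = evalp g (row_mx O (\row_j subst_coef (@idK K) (F' j) x c)).
  apply: (@mpoly_ring_ind _ _ Pq) => [t|i|p q Hp Hq|p q Hp Hq]; rewrite /Pq /compose.
  - by rewrite !mmapC evalpC.
  - rewrite mmapX mmap1U evalpXU mxE; case: splitP => j _; first by rewrite mmapC.
    by rewrite HCc mxE.
  - by rewrite !mmapD evalpD -/(compose _ p) -/(compose _ q) Hp Hq.
  - by rewrite !mmap_mul evalpM -/(compose _ p) -/(compose _ q) Hp Hq.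
have QE b : Karc Y (E v) b -> mmap (@idK K) (jet (xpart b) (M := c.+1)) Q = 0.
  move=> Kb; apply/eqP/negPn/negP => Qb.
  have [b' [Kb' Qb' alb]] := Karc_move (clE gr v) pE EY smY Kb Qb hal nal.
  have lb' := Karc_lift Kb'; case/eqP: Qb'; rewrite EQ.
  have Fc j : subst_coef (@idK K) (F' j) (xpart b') c =
      (subst_coef (@idK K) (tau v ^+ c) b' c / evalp al (start b')) * evalp (Gr j) (start b').
    have := lift_vanY gr lb' (EG j) c; rewrite scB => /eqP; rewrite subr_eq0 => /eqP.
    rewrite -{1 3}[c]add0n (@scM_lead _ _ _ _ _ _ _ 0 c) // => [|k kc]; last first.
      by apply: (lift_og nss lb' (ex_intro _ 0%N (widen_hom _ _)) (Oc j)).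
    rewrite (@scM_lead _ _ _ _ _ _ _ 0 c) // => [|k kc]; last first.
      by apply: (lift_pow gr lb') => //; apply: tau_E.
    rewrite !sc_eval -/(start b') sc_widen => EF; apply: (mulfI alb); rewrite EF.
    by field.
  set kap := _ / evalp al (start b') in Fc.
  have Os : lsubmx (start b') = O by have [jj [_ [Es _]]] := Kb'; apply: (E_O gr Es).
  have -> : row_mx O (\row_j subst_coef (@idK K) (F' j) (xpart b') c) =
      yscale kap (row_mx (lsubmx (start b')) (eval_tuple Gr (start b'))).
    by rewrite /yscale row_mxKl row_mxKr Os; congr row_mx; apply/rowP => j; rewrite !mxE Fc.
  rewrite (evalp_yscale _ _ hf) -evalp_pullback fE ?mulr0 //.
  by have [jj [_ [Es _]]] := Kb'.
have QS b : Karc Y' W b -> mmap (@idK K) (jet (xpart b) (M := c.+1)) Q = 0.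
  move=> Kb; apply: (S_through (ex_intro2 _ _ b Kb erefl : S (Karc_arc b)) (P := Q)) => a ta.
  apply/eqP/negPn/negP => Qa; have [b' Kb' Qb'] := through_descent gr ta Qa.
  by case/eqP: Qb'; apply: QE.
(* phi is not identically zero on the arcs through W: its coordinate j0 is nonzero on some arc
   through E_v, and that arc is in the closure of S. *)
have [b1 K1 C1] : exists2 b, Karc Y' W b & mmap (@idK K) (jet (xpart b) (M := c.+1)) (C j0) != 0.
  apply: NNPP => Hn.
  have [b Kb bc] := ex_Karc_order nss (ex_intro _ 0%N (widen_hom m (F' j0))) (Oc j0) nO.
  have Cb : eval_arc (C j0) (Karc_arc b) != 0 by rewrite eval_arc_jet HCc -sc_widen.
  have [b' [_ tb' Cb' _]] := Karc_common nss gr Kb Kb Cb Cb.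
  case/eqP: Cb'; apply: (through_cl_S tb') => _ [b2 K2 ->].
  by apply/eqP/negPn/negP => Cb2; apply: Hn; exists b2.
have [b2 [K2 C2 fb2]] := Karc_move cW pW WY smY' K1 C1 (ex_intro _ d hf) nfW.
have lb2 := Karc_lift K2; rewrite HCc in C2.
pose y j := evalp ('X_(rshift n j) : R') (start b2).
pose phi j := subst_coef (@idK K) (F' j) (xpart b2) c.
have [_ _ pY'] := irreducible_prime cY' (res_irreducible res').
(* The equations y_j F'_l = y_l F'_j hold on Y'. Their coefficients of t^c along b2 give the
   relation, since the lower coefficients of F' vanish on S. *)
have rel j l : y j * phi l = y l * phi j.
  pose rl : R' := 'X_(rshift n j) * widen m' (F' l) - 'X_(rshift n l) * widen m' (F' j).
  have hrl : yhomog 1 rl.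
    by apply: (subspaceB (yhomog_subspace _ _ _ 1)); rewrite -[1%N]addn0; apply: yhomogM;
      rewrite ?addn0; try exact: yhomogy; exact: widen_hom.
  have rlY : vanishes rl Y'.
    have Yx : Y' (row_mx x1 (eval_tuple F' x1)).
      apply/(HF' Xx1 x1O (tuple_neq0 Fj1)); exists 1; rewrite ?oner_neq0 ?scale1r //.
    have [t xt] := @xdiff_van K n m' O (row_mx x1 (eval_tuple F' x1)) (eq_ind_r (fun q => q <> O) x1O (row_mxKl _ _)).
    have /pY'[xY|//] : vanishes (xdiff m' O t * rl) Y'.
      move=> z Yz.
      rewrite evalpM; case: (classic (lsubmx z = O)) => [Oz|zO].
        by rewrite /xdiff !evalpE -Oz mxE subrr mul0r.
      rewrite /rl [evalp (_ * _ - _) z]evalpB !evalpM !evalp_widen !evalp_yvar.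
      case: (eqVneq (eval_tuple F' (lsubmx z)) 0) => [/rowP F0|Fz].
        by have := F0 j; have := F0 l; rewrite !mxE => -> ->; rewrite !mulr0 subrr mulr0.
      have Xz := res_over res' Yz; have := HF' Xz zO Fz (rsubmx z); rewrite hsubmxK.
      move=> [/(_ Yz)[t' _ /rowP Ey] _]; rewrite -!ycoord_rsub !Ey !mxE.
      by ring.
    by case/eqP: xt; apply: xY.
  have := lift_Y lb2 (conj hrl rlY) c; rewrite scB => /eqP; rewrite subr_eq0 => /eqP.
  have lowc i k : (k < c)%N -> subst_coef (@idK K) (widen m' (F' i)) b2 k = 0.
    by move=> kc; rewrite sc_widen low.
  rewrite -{1 2}[c]add0n (@scM_lead _ _ _ _ _ _ _ 0 c) // => [|k]; last exact: lowc.
  rewrite (@scM_lead _ _ _ _ _ _ _ 0 c) // => [|k]; last exact: lowc.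
  by rewrite !sc_eval -/(start b2) !sc_widen.
have [jj [_ [Ws sj]]] := K2; have Os : lsubmx (start b2) = O by have [] := WX Ws.
have phi0 : phi j0 != 0 := C2.
have Ey : rsubmx (start b2) = (y j0 / phi j0) *: (\row_j phi j).
  apply/rowP => j; rewrite [RHS]mxE [in RHS]mxE ycoord_rsub.
  have := rel j j0; rewrite /y !evalp_yvar => E1.
  by apply: (mulIf phi0); rewrite E1; field.
case/eqP: fb2; have -> : start b2 = yscale (y j0 / phi j0) (row_mx O (\row_j phi j)).
  by rewrite /yscale row_mxKl row_mxKr -Ey -Os hsubmxK.
by rewrite (evalp_yscale _ _ hf) -EQ QS ?mulr0.
Qed.
End Maximal.
End Essential.

Lemma all_essential v : essential X O Y (E v).
Proof.
move=> m' Y' res'; have [x1 Xx1 x1O] := nss_nontrivial nss.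
have [F' Fx1 HF'] := res_iso res' Xx1 x1O.
have [j1 Fj1] : exists j, evalp (F' j) x1 != 0.
  apply: NNPP => Hn; case/negP: Fx1; apply/eqP/rowP => j; rewrite !mxE.
  by apply/eqP/negPn/negP => nj; apply: Hn; exists j.
have [Gr [c [al [j0 [repG [hal nal] EG Oc [nO nG]]]]]] := ex_rep nss gr v res' Xx1 x1O Fj1 HF'.
split.
- exact: proj_closure_closed.
- exact: (T_irreducible Xx1 x1O Fj1 HF' repG nG).
- exact: T_exceptional.
- by move=> W cW iW WX TW; apply: (W_T res' Xx1 x1O Fj1 HF' repG hal nal EG Oc nO nG cW iW WX TW).
Qed.
End Setup.

(** * The theorem *)

Lemma transitive_selfint (G : weighted_graph) : negative_definite G ->
  [transitive graph_aut G, on [set: G] | 'P] ->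
  exists e : G -> nat, forall u : G,
    selfint u = - (e u)%:Z /\ (\sum_(v : G) edges u v < e u)%N.
Proof.
move=> nd tr; pose dg (u : G) := (\sum_(v : G) edges u v)%N.
have inv u v : selfint u = selfint v /\ dg u = dg v.
  have [a aG ->] := atransP2 tr (in_setT v) (in_setT u).
  move: aG; rewrite inE => /andP[/forallP/(_ v)/andP[_ /eqP Es] /forallP/(_ v)/forallP Ee].
  split; first exact: Es.
  rewrite /dg (reindex_inj (perm_inj (s := a))) /=; apply: eq_bigr => x _.
  exact/eqP/Ee.
have /card_gt0P[u0 _] := vertex_nonempty G.
have key : selfint u0 + (dg u0)%:Z < 0.
  have x0 : [ffun _ : G => 1 : rat] != 0.
    by apply/eqP => /ffunP/(_ u0); rewrite !ffunE => /eqP; rewrite oner_eq0.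
  have := nd _ x0.
  rewrite (eq_bigr (fun _ => (selfint u0 + (dg u0)%:Z)%:~R : rat)) => [|u _].
    rewrite sumr_const -mulr_natr pmulr_llt0 ?ltr0n ?vertex_nonempty //.
    by rewrite ltrz0.
  have [<- <-] := inv u u0.
  rewrite (eq_bigr (fun v => (incidence u v)%:~R)) => [|v _]; last by rewrite !ffunE mul1r mulr1.
  rewrite -(raddf_sum (intr : int -> rat)) /=; congr (_%:~R).
  rewrite (bigD1 u) //= /incidence eqxx; congr (_ + _).
  have -> : dg u = (\sum_(v | v != u) edges u v)%N by rewrite /dg (bigD1 u) //= edges_loopless.
  rewrite (big_morph Posz PoszD (erefl (Posz 0))); apply: eq_bigr => v /negPf vu.
  by rewrite eq_sym vu.
exists (fun u => `|selfint u|%N) => u; have [-> Ed] := inv u u0.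
rewrite -/(dg u) Ed; move: key; lia.
Qed.

Theorem corollary36 (G : weighted_graph) :
  negative_definite G ->
  [transitive graph_aut G, on [set: G] | 'P] ->
  forall (K : closedFieldType), [pchar K] =i pred0 ->
  forall (n m : nat) (X : 'rV[K]_n -> Prop) (O : 'rV[K]_n)
    (Y : 'rV[K]_(n + m.+1) -> Prop) (E : G -> 'rV[K]_(n + m.+1) -> Prop),
    normal_surface_singularity X O ->
    good_resolution_with_graph X O Y E ->
    (forall u v : G, adjacency_arrow X O Y E u v -> trivial_arrow u v) /\
    nash_bijective X O Y E.
Proof.
move=> nd tr K _ n m X O Y E nss gr.
have [e He] := transitive_selfint nd tr.
have noarrow (u v : G) : u != v ->
    ~ psub (arcs_through X O Y (E v)) (arc_closure (arcs_through X O Y (E u))).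
  move=> uv; have [f [k [l [kl Ou Ov nOv]]]] :=
    separating_function nss gr (fun w => proj1 (He w)) (fun w => proj2 (He w)) uv.
  exact: (arrow_obstruction nss kl Ou Ov nOv).
split; first by move=> u v [uv] /(noarrow u v uv).
exact: (nash_of_essential nss gr noarrow (all_essential nss gr noarrow)).
Qed.
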